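(* Let $b,\tilde b:\mathbb{R}_+\times\mathbb{R}^d\to\mathbb{R}^d$ be locally Lipschitz. Suppose that there is a constant $M\in[0,\infty)$ with $|b(t,x)-\tilde b(t,x)|\le M$ for all $x\in\mathbb{R}^d$, $t\ge 0$, and that there is a Lipschitz function $\kappa:[0,\infty)\to\mathbb{R}$, constant and strictly negative outside of a bounded interval, such that $$\langle x-y,\,b(t,x)-b(t,y)\rangle\le\kappa(|x-y|)\,|x-y|^2\qquad\text{for all }x,y\in\mathbb{R}^d,\ t\ge 0 .$$ Let $x,y\in\mathbb{R}^d$. Then there is a coupling $(\tilde X_t,\tilde Y_t)$ of solutions to $$dX_t=b(t,X_t)\,dt+dB_t,\quad X_0=x,\qquad\qquad dY_t=\tilde b(t,Y_t)\,dt+d\tilde B_t,\quad Y_0=y,$$ such that $$P[\tilde X_t\ne\tilde Y_t]\ \le\ \frac1{\tilde\epsilon}\,\frac{\tilde c}{e^{\tilde ct}-1}\,|x-y|+\pi[(0,\infty)]\qquad\text{for any }t\ge0,$$ where the probability measure $\pi$ on $[0,\infty)$ and the constants $\tilde c,\tilde\epsilon$ are as defined in the context.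
   Context: $\mathbb{R}_+=[0,\infty)$; $|\cdot|$ and $\langle\cdot,\cdot\rangle$ are the Euclidean norm and inner product; $u^+=\max(u,0)$; $\delta_0$ is the Dirac measure at $0$; $\lambda_{(0,\infty)}$ is Lebesgue measure on $(0,\infty)$. $(B_t)$ and $(\tilde B_t)$ are $d$-dimensional Brownian motions. A coupling of solutions to the two SDEs is a pair of processes defined on a common probability space such that the first process solves the first SDE and the second process solves the second SDE, each with respect to some $d$-dimensional Brownian motion (the joint law of the driving Brownian motions is part of the construction). The measure $\pi$: for $M=0$, $\pi=\delta_0$; for $M>0$, $\pi$ is the probability measure on $[0,\infty)$ determined by $$\pi(dx)\propto\frac2M\,\delta_0(dx)+\exp\Big(\frac12\int_0^x(M+\kappa(y)y)\,dy\Big)\lambda_{(0,\infty)}(dx).$$ The constants $\tilde c,\tilde\epsilon$ (which depend only on $\kappa$): $$\tilde c=\Big(2\int_0^{\tilde R_1}\frac{\tilde\Phi(s)}{\tilde\varphi(s)}\,ds\Big)^{-1},\qquad \tilde\epsilon=\min\Big\{\Big(2\int_0^{\tilde R_1}\frac1{\tilde\varphi(s)}\,ds\Big)^{-1},\ \tilde c\,\tilde\Phi(\tilde R_1)\Big\},$$ with $\tilde\varphi(r)=\exp\big(-\frac12\int_0^r(\kappa(s)s)^+\,ds\big)$, $\tilde\Phi(r)=\int_0^r\tilde\varphi(s)\,ds$, $\tilde R_0=\inf\{R\ge0:\kappa(r)r\le0\text{ for any }r\ge R\}$ and $\tilde R_1=\inf\{R\ge\tilde R_0:\ R(R-\tilde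 R_0)\,\kappa(r)\le-4\text{ for any }r\ge R\}$. For $t=0$ the right-hand side of the bound is read as $+\infty$ if $x\neq y$ (the bound is then trivial) and as its $t>0$ value $\pi[(0,\infty)]$ if $x=y$. *)

(* Defs.v *)
From HB Require Import structures.
From mathcomp Require Import all_boot all_order all_algebra.
From mathcomp Require Import all_classical all_reals all_analysis.

Set Implicit Arguments.
Unset Strict Implicit.
Unset Printing Implicit Defensive.
Import Order.TTheory GRing.Theory Num.Theory.
Import numFieldNormedType.Exports.
Local Open Scope classical_set_scope.
Local Open Scope ring_scope.

(* Functions of time t >= 0 or of distance r >= 0 are functions on R whose
   values at negative arguments are never constrained nor used. *)

Section Euclidean.
Context {R : realType} {d : nat}.
Implicit Types u v : 'rV[R]_d.

Definition inner u v : R := \sum_(i < d) u ord0 i * v ord0 i.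

(* The canonical norm `|u| on 'rV[R]_d is the sup norm. *)
Definition enorm u : R := Num.sqrt (inner u u).

End Euclidean.

Section Drift.
Context {R : realType} {d : nat}.

(* Joint local Lipschitz continuity on [0, +oo) x R^d; the norm used on
   R^d is irrelevant here.  The library also imposes the condition near
   off-diagonal pairs of points, where local boundedness already implies it. *)
Definition locally_lipschitz_drift (b : R -> 'rV[R]_d -> 'rV[R]_d) : Prop :=
  [locally [lipschitz (fun p : R^o * 'rV[R]_d => b p.1 p.2) p
           | p in [set p : R^o * 'rV[R]_d | 0 <= p.1]]].

End Drift.

Section Processes.
Context {R : realType} {d : nat} {disp : measure_display}.
Context {Omega : measurableType disp}.
Implicit Types (P : probability Omega R) (F : R -> set (set Omega)).
Implicit Types (X B : R -> Omega -> 'rV[R]_d) (Z : Omega -> 'rV[R]_d).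

Definition sigma_of Z : set (set Omega) :=
  <<s \bigcup_(i in [set: 'I_d])
        g_sigma_algebra_preimage (fun w => Z w ord0 i) >>.

Definition indep_sigma P (G H : set (set Omega)) : Prop :=
  forall A C, G A -> H C -> P (A `&` C) = (P A * P C)%E.

(* The law of Z is N(0, s^2 Id), i.e. the d-fold product of N(0, s^2), for
   s > 0. *)
Definition gaussian_law P Z (s : R) : Prop :=
  forall C : 'I_d -> set R, (forall i, measurable (C i)) ->
    P [set w | forall i, C i (Z w ord0 i)] =
    (\big[*%E/1]_(i < d) normal_prob 0 s (C i))%E.

Definition is_filtration F : Prop :=
  (forall t, 0 <= t ->
     sigma_algebra setT (F t) /\ F t `<=` @measurable _ Omega) /\
  (forall s t, 0 <= s -> s <= t -> F s `<=` F t).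

Definition adapted F X : Prop := forall t, 0 <= t -> sigma_of (X t) `<=` F t.

Definition continuous_paths P X : Prop :=
  {ae P, forall w, {within `[0, +oo[%classic, continuous (fun t : R => X t w)}}.

(* d-dimensional Brownian motion relative to the filtration F.  The increment
   condition is only imposed for s < t, since normal_prob 0 0 is by convention
   not the Dirac measure. *)
Definition brownian_motion P F B : Prop :=
  [/\ adapted F B,
      {ae P, forall w, B 0 w = 0},
      continuous_paths P B,
      forall s t, 0 <= s -> s < t ->
        indep_sigma P (sigma_of (fun w => B t w - B s w)) (F s) &
      forall s t, 0 <= s -> s < t ->
        gaussian_law P (fun w => B t w - B s w) (Num.sqrt (t - s))].

(* X solves dX_t = b(t, X_t) dt + dB_t, X_0 = x, for some Brownian motion B;
   since the noise is additive, the stochastic integral of the identity matrix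
   against B is B itself. *)
Definition sde_solution P (b : R -> 'rV[R]_d -> 'rV[R]_d) (x : 'rV[R]_d) X :
    Prop :=
  exists F, exists B,
    [/\ is_filtration F,
        brownian_motion P F B,
        adapted F X,
        continuous_paths P X &
        {ae P, forall w, forall t, 0 <= t -> forall i : 'I_d,
           X t w ord0 i = x ord0 i
             + (\int[lebesgue_measure]_(s in `[0, t]) b s (X s w) ord0 i)
             + B t w ord0 i}].

End Processes.

Section Constants.
Context {R : realType}.
Variable kappa : R -> R.

Definition phit (r : R) : R :=
  expR (- (2^-1 * \int[lebesgue_measure]_(s in `[0, r])
                    Num.max (kappa s * s) 0)).

Definition Phit (r : R) : R := \int[lebesgue_measure]_(s in `[0, r]) phit s.

Definition R0t : R :=
  inf [set r0 : R | 0 <= r0 /\ forall r, r0 <= r -> kappa r * r <= 0].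

Definition R1t : R :=
  inf [set r1 : R | R0t <= r1 /\
                    forall r, r1 <= r -> r1 * (r1 - R0t) * kappa r <= - 4].

Definition ct : R :=
  (2 * \int[lebesgue_measure]_(s in `[0, R1t]) (Phit s / phit s))^-1.

Definition epst : R :=
  Num.min (2 * \int[lebesgue_measure]_(s in `[0, R1t]) (phit s)^-1)^-1
          (ct * Phit R1t).

Section Pi.
Variable M : R.

Definition pi_density (x : R) : R :=
  expR (2^-1 * \int[lebesgue_measure]_(y in `[0, x]) (M + kappa y * y)).

Definition pi_unnormalized (A : set R) : \bar R :=
  ((2 / M)%:E * \d_(0%R : R) A +
   \int[lebesgue_measure]_(x in A `&` `]0%R, +oo[) (pi_density x)%:E)%E.

(* A measure on [0, +oo), seen as a measure on R that does not charge
   (-oo, 0). *)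
Definition sticky_pi (A : set R) : \bar R :=
  if M == 0 then \d_(0 : R) A
  else (pi_unnormalized A * (fine (pi_unnormalized setT))^-1%:E)%E.

End Pi.
End Constants.

(* The division by e^0 - 1 = 0 at t = 0 is read as +oo when x <> y and, the
   prefactor being multiplied by |x - y| = 0, as 0 when x = y. *)
Definition coupling_bound {R : realType} {d : nat} (kappa : R -> R) (M : R)
    (x y : 'rV[R]_d) (t : R) : \bar R :=
  if (t == 0) && (x != y) then +oo%E
  else (((epst kappa)^-1 * (ct kappa / (expR (ct kappa * t) - 1))
          * enorm (x - y))%:E + sticky_pi kappa M `]0%R, +oo[)%E.

(* Main.v *)
(* Both equations are replaced by Euler schemes with steps h = s^2 -> 0, driven
   by Gaussian increments.  An auxiliary scheme Z follows the drift b from y; the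
   increments of the schemes X and Y are obtained from those of Z by the maximal
   reflection coupling of the current one-step laws.  The distances |X - Z| and
   |Y - Z| are then dominated by a random walk with drift kappa(r) r, resp.
   M + kappa(r) r, that is absorbed at 0, and P[X <> Y] is at most the sum of the
   two survival probabilities.  These are bounded by supersolutions f of the
   generators 2 f'' + (kappa(r) r) f' and 2 f'' + (M + kappa(r) r) f': the
   first decays at rate ct and yields the term with |x - y|, the second yields the
   mass that pi gives to (0, oo).

   Instead of extracting a weak limit, the schemes are taken along a nonprincipal
   ultrafilter and live on the Loeb space of the ultraproduct of their probability
   spaces.  There the standard parts of the schemes are continuous processes that
   solve the equations pathwise, because the noise is additive, and the standard
   part of the noise is a Brownian motion for the filtration generated by the
   internal events of the past.  No stochastic integration is needed. *)

From HB Require Import structures.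
Require Import Defs.
From mathcomp Require Import all_boot all_order all_algebra.
From mathcomp Require Import all_classical all_reals all_analysis.
From mathcomp Require Import measurable_realfun ring lra.

Set Implicit Arguments.
Unset Strict Implicit.
Unset Printing Implicit Defensive.
Import Order.TTheory GRing.Theory Num.Theory.
Import numFieldNormedType.Exports.
Local Open Scope classical_set_scope.
Local Open Scope ring_scope.

(** * Loeb measures *)

(** The distance between X and Y has the drift kappa(r) r and a push of size at most M that acts
    even at 0. Merged paths can therefore separate again, and the comparison process on [0, oo) is
    sticky at 0, with invariant law [pi]. Inserting Z separates the effects: |X - Z| has no push and
    is absorbed at 0, while |Y - Z| has the push but starts at 0, from where the probability of
    being positive only grows with time. Reflecting discrete increments would jump over 0 without
    merging; with the maximal reflection coupling the noise changes the distance exactly as absorbed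
    Brownian motion does.

    A supersolution satisfies Lf <= - c f + p - q(0) 1_{r>0}, where q = - 2 f''. For c = 0 and q(0)
    = 1, the time average of P[r > 0] is at most p. For p near 0 and q(0) = epsilon, summing over
    the steps gives epsilon (1 - e^{-ct})/c P[r_t > 0] <= e^{-ct} f(r_0), the origin of c/(e^{ct} -
    1).

    The drifts have no growth bound, so the schemes are truncated at levels tending to infinity and
    the step shrinks fast enough to beat the Lipschitz constants of the truncations. *)

(* A nonprincipal ultrafilter; sequences modulo [nU] serve as hyperreals. *)
Definition nU : set_system nat :=
  sval (cid (ultraFilterLemma (eventually_filter : ProperFilter \oo))).

#[export] Instance nU_ultra : UltraFilter nU.
Proof. by rewrite /nU; case: cid => G []. Qed.

Lemma nU_ge (n : nat) : nU [set m | (n <= m)%N].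
Proof.
rewrite /nU; case: cid => G /= [GU]; apply; exact: nbhs_infty_ge.
Qed.

(** * Standard parts of real sequences *)

Section Standard_part.
Context {R : realType}.
Implicit Types u v : nat -> R.

(** If [u] is not bounded along [nU] the limit does not exist and [lim] returns [point]. *)
Definition st u : R := lim (u @ nU).

(** The image of an ultrafilter is an ultrafilter, and ultrafilters on a compact segment
    converge. *)
Lemma st_cvg u (C : R) : nU [set n | `|u n| <= C] -> u @ nU --> st u.
Proof.
move=> uC; have := @segment_compact R (- C) C.
rewrite compact_ultra => /(_ (u @ nU)) [||l [_ ul]].
- split; first exact: fmap_proper_filter.
  move=> G GP uG; apply/seteqP; split => A; last exact: uG.
  move=> GA; have [//|uA] := in_ultra_setVsetC (u @^-1` A) nU_ultra.
  have /filter_ex[x []] : G (A `&` ~` A) by apply: filterI => //; exact: uG.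
  by [].
- by apply: filterS uC => n /=; rewrite in_itv/= ler_norml.
by apply/cvg_ex; exists l; exact: ul.
Qed.

Lemma st_eq u (l : R) : u @ nU --> l -> st u = l.
Proof. exact: cvg_lim. Qed.

Lemma nU_dec (A : set nat) : nU A \/ nU (~` A).
Proof. exact: in_ultra_setVsetC. Qed.

Lemma nU_notin (A : set nat) : ~ nU A -> nU (~` A).
Proof. by case: (nU_dec A). Qed.

Lemma nU_contra (A : set nat) : nU A -> nU (~` A) -> False.
Proof. by move=> a b; have [x []] := @filter_ex _ _ _ _ (filterI a b). Qed.

End Standard_part.

Definition loeb_display : measure_display. Proof. exact: (default_measure_display). Qed.

(** * Internal sets and the Loeb measure *)

Section Loeb.
Context {R : realType} {dd : nat -> measure_display}.
Context {T : forall n, measurableType (dd n)}.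
Variable P : forall n, probability (T n) R.

(* Representatives of the points of an ultraproduct.  The phantom argument [P]
   lets the instances below depend on the measures. *)
Definition hyper (P : forall n, probability (T n) R) : Type := forall n, T n.

HB.instance Definition _ := Pointed.on (hyper P).

Implicit Types A B : forall n, set (T n).

Definition internal A : set (hyper P) :=
  [set w | nU [set n | A n (w n)]].

Definition internal_measurable : set (set (hyper P)) :=
  [set E | exists2 A, (forall n, measurable (A n)) & E = internal A].

Lemma internalC A : internal (fun n => ~` A n) = ~` internal A.
Proof.
apply/seteqP; split=> w /=; first by move=> h1 h2; exact: (nU_contra h2 h1).
exact: nU_notin.
Qed.

Lemma internalI A B : internal (fun n => A n `&` B n) = internal A `&` internal B.
Proof.
apply/seteqP; split=> w /=; last by move=> [a b]; exact: filterI.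
by move=> h; split; apply: filterS h => n /= -[].
Qed.

Lemma internalU A B : internal (fun n => A n `|` B n) = internal A `|` internal B.
Proof.
rewrite -[RHS]setCK setCU -!internalC -internalI -internalC.
congr internal; apply: functional_extensionality_dep => n.
by rewrite -setCU setCK.
Qed.

Lemma internalS A B : nU [set n | A n `<=` B n] -> internal A `<=` internal B.
Proof. by move=> AB w /= h; apply: filterS (filterI h AB) => n /= [a]; apply. Qed.

(** Otherwise counterexamples chosen index by index form a point of the first internal set outside
    the second. *)
Lemma subset_internal A B : internal A `<=` internal B -> nU [set n | A n `<=` B n].
Proof.
move=> AB; apply: contrapT => /nU_notin h.
have hex : forall n, exists x : T n, ~ (A n `<=` B n) -> A n x /\ ~ B n x.
  move=> n; have [s|/existsNP[x /not_implyP ?]] := pselect (A n `<=` B n); last by exists x.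
  by exists point.
pose w n := sval (cid (hex n)).
have hw n : ~ (A n `<=` B n) -> A n (w n) /\ ~ B n (w n) := svalP (cid (hex n)).
have : internal B w.
  by apply: AB; apply: filterS h => n /= /hw[].
by move=> h2; have [n /= [/hw[_ nB]]] := @filter_ex _ _ _ _ (filterI h h2).
Qed.

Lemma internal_inj A B : internal A = internal B -> nU [set n | A n = B n].
Proof.
move=> AB; have h1 : nU [set n | A n `<=` B n] by apply: subset_internal; rewrite AB.
have h2 : nU [set n | B n `<=` A n] by apply: subset_internal; rewrite AB.
by apply: filterS (filterI h1 h2) => n /= [a b]; apply/seteqP.
Qed.

(** Countable saturation by a diagonal choice: at index n the point lies in every nonempty [C k n]
    with k <= n, which is possible because the sets decrease in k. A given k satisfies k <= n for
    almost all n. *)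
Lemma saturation (C : nat -> forall n, set (T n)) :
  (forall n, {homo C^~ n : k l / (k <= l)%N >-> l `<=` k}) ->
  (forall k, nU [set n | C k n !=set0]) ->
  exists w : hyper P, forall k, internal (C k) w.
Proof.
move=> Cdec Cne.
have key n m : exists x : T n, forall k, (k <= m)%N -> C k n !=set0 -> C k n x.
  elim: m => [|m [x IH]].
    have [[x Cx]|h] := pselect (C 0%N n !=set0); [exists x|exists point];
      by move=> k; rewrite leqn0 => /eqP ->.
  have [[y Cy]|h] := pselect (C m.+1 n !=set0).
    by exists y => k km _; exact: (Cdec n _ _ km).
  by exists x => k; rewrite leq_eqVlt => /orP[/eqP -> //|]; exact: IH.
pose w n := sval (cid (key n n)).
have hw n := svalP (cid (key n n)).
exists w => k; apply: filterS (filterI (nU_ge k) (Cne k)) => n /= [kn].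
exact: hw.
Qed.

Lemma internal_measurable0 : internal_measurable set0.
Proof.
exists (fun n => set0) => //; apply/seteqP; split => w //=.
by move/filter_ex => [].
Qed.

Lemma internal_measurableU : setU_closed internal_measurable.
Proof.
move=> _ _ [A mA ->] [B mB ->]; exists (fun n => A n `|` B n).
  by move=> n; exact: measurableU.
by rewrite internalU.
Qed.

Lemma internal_measurableC : setC_closed internal_measurable.
Proof.
move=> _ [A mA ->]; exists (fun n => ~` A n); last by rewrite internalC.
by move=> n; exact: measurableC.
Qed.

HB.instance Definition _ := isAlgebraOfSets.Build loeb_display (hyper P)
  internal_measurable0 internal_measurableU internal_measurableC.

Definition hprob A : R := st (fun n => fine (P n (A n))).

(** The choice of representative made by [xget] does not affect the value: by [internal_inj] two
    representatives agree at [nU]-almost every index. *)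
Definition loeb_content (E : set (hyper P)) : \bar R :=
  (hprob (xget (fun=> set0) [set A | (forall n, measurable (A n)) /\ E = internal A]))%:E.

Lemma hprob_cvg A : (forall n, measurable (A n)) ->
  (fun n => fine (P n (A n))) @ nU --> hprob A.
Proof.
move=> mA; apply: (@st_cvg _ _ 1); apply: filterE => n /=.
have PA := probability_le1 (P n) (mA n).
have PAf : P n (A n) \is a fin_num by exact: fin_num_measure.
by rewrite ger0_norm ?fine_ge0// -lee_fin fineK.
Qed.

Lemma loeb_contentE A : (forall n, measurable (A n)) ->
  loeb_content (internal A) = (hprob A)%:E.
Proof.
move=> mA; rewrite /loeb_content; case: xgetP => [B -> [mB AB]|/(_ A)]; last by case.
congr EFin; apply: st_eq.
have BA := internal_inj AB.
apply: cvg_trans (hprob_cvg mA).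
by apply: near_eq_cvg; apply: filterS BA => n /= <-.
Qed.

Lemma hprob_ge0 A : (forall n, measurable (A n)) -> 0 <= hprob A.
Proof.
move=> mA; apply: (@limr_ge _ nU); first by apply: cvgP; exact: hprob_cvg.
by apply: filterE => n; rewrite fine_ge0.
Qed.

Lemma loeb_content_ge0 E : (0 <= loeb_content E)%E.
Proof.
rewrite /loeb_content lee_fin; case: xgetP => [A -> [mA _]|_]; exact: hprob_ge0.
Qed.

Lemma loeb_content_additive : measure_function.semi_additive loeb_content.
Proof.
apply/additive2P.
  have -> : set0 = internal (fun n => set0).
    by apply/seteqP; split => w //= /filter_ex[].
  rewrite loeb_contentE//; congr EFin; apply: st_eq.
  under eq_fun do rewrite measure0 /=.
  exact: cvg_cst.
move=> _ _ [A mA ->] [B mB ->] AB0.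
rewrite -internalU !loeb_contentE//; last by move=> n; exact: measurableU.
rewrite -EFinD; congr EFin; apply: st_eq.
have h : nU [set n | fine (P n (A n `|` B n)) = fine (P n (A n)) + fine (P n (B n))].
  have : nU [set n | A n `&` B n `<=` set0].
    by apply: subset_internal; rewrite internalI AB0 => w.
  apply: filterS => n /=; rewrite subset0 => AB.
  rewrite measureU// fineD//; exact: fin_num_measure.
apply: cvg_trans (cvgD (hprob_cvg mA) (hprob_cvg mB)).
by apply: near_eq_cvg; apply: filterS h => n /= ->.
Qed.

HB.instance Definition _ := isContent.Build loeb_display (hyper P) R
  loeb_content loeb_content_ge0 loeb_content_additive.

(** By saturation, a countable cover of an internal set by internal sets has a finite subcover, so
    only finite subadditivity is used. This is the condition for the Caratheodory extension. *)
Lemma loeb_content_sigma_subadditive :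
  measurable_subset_sigma_subadditive loeb_content.
Proof.
move=> X F mF [B mB ->] BF.
have /choice[A hA] : forall i, exists A, (forall n, measurable (A n)) /\ F i = internal A.
  by move=> i; have [A] := mF i; exists A.
have FA i : F i = internal (A i) by case: (hA i).
have mA i : forall n, measurable (A i n) by case: (hA i).
have [k Bk] : exists k, nU [set n | B n `<=` \bigcup_(i < k) A i n].
  apply: contrapT => /forallNP h.
  have [||w hw] := @saturation (fun k n => B n `\` \bigcup_(i < k) A i n).
  - move=> n k l kl x [Bx nA]; split => // -[i ik Aix].
    by apply: nA; exists i => //=; exact: leq_trans kl.
  - move=> k; apply: filterS (nU_notin (h k)) => n /=.
    by move=> /existsNP[x /not_implyP[? ?]]; exists x.
  have Bw : internal B w by apply: filterS (hw 0%N) => n /= [].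
  have [i _] := BF _ Bw; rewrite FA => Aw.
  have := hw i.+1 => /(filterI Aw) /filter_ex[n [/= Awn [_]]].
  by apply; exists i => /=.
have Bk' : internal B `<=` \bigcup_(i < k) F i.
  move=> w /= Bw; apply: contrapT => nF.
  have : nU [set n | forall i, (i < k)%N -> ~ A i n (w n)].
    have : forall j, (j <= k)%N -> nU [set n | forall i, (i < j)%N -> ~ A i n (w n)].
      elim => [_|j IH jk]; first exact: filterE.
      have h1 : nU [set n | ~ A j n (w n)].
        by apply: nU_notin => h; apply: nF; exists j => //; rewrite FA.
      apply: filterS (filterI h1 (IH (ltnW jk))) => n /= [h2 h3] i.
      by rewrite ltnS leq_eqVlt => /orP[/eqP ->|/h3].
    exact.
  by move=> /(filterI (filterI Bk Bw)) /filter_ex[n [[/= h1 /h1 [i ik Ai]]]] /(_ i ik).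
apply: (@le_trans _ _ (\sum_(i < k) loeb_content (F i))%E).
  apply: content_subadditive => //; first by exists B.
  by rewrite -bigcup_mkord.
rewrite -(@big_mkord _ 0%E _ k xpredT (fun i => loeb_content (F i))).
by apply: nneseries_lim_ge => i _ _; exact: loeb_content_ge0.
Qed.

HB.instance Definition _ := Content_SigmaSubAdditive_isMeasure.Build loeb_display R
  (hyper P) loeb_content loeb_content_sigma_subadditive.

Definition loeb_space := g_sigma_algebraType (@measurable _ (hyper P)).

HB.instance Definition _ := Measurable.on loeb_space.

Definition loeb : set loeb_space -> \bar R := measure_extension loeb_content.

HB.instance Definition _ := Measure.on loeb.

Lemma measurable_internal A : (forall n, measurable (A n)) ->
  measurable (internal A : set loeb_space).
Proof. by move=> mA; apply: sub_sigma_algebra; exists A. Qed.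

Lemma loebE A : (forall n, measurable (A n)) -> loeb (internal A) = (hprob A)%:E.
Proof.
move=> mA; rewrite /loeb /measure_extension measurable_mu_extE; last by exists A.
exact: loeb_contentE.
Qed.

Lemma loeb_setT : loeb setT = 1%E.
Proof.
have -> : setT = internal (fun=> setT) by apply/seteqP; split => // w _; exact: filterT.
rewrite loebE//; congr EFin; apply: st_eq.
by under eq_fun do rewrite probability_setT /=; exact: cvg_cst.
Qed.

HB.instance Definition _ := Measure_isProbability.Build _ _ _ loeb loeb_setT.

End Loeb.
Arguments loeb {R dd T} P.

(** * Measurability of standard parts *)

Section Loeb_theory.
Context {R : realType} {dd : nat -> measure_display}.
Context {T : forall n, measurableType (dd n)}.
Variable P : forall n, probability (T n) R.
Implicit Types A B : forall n, set (T n).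

Lemma loeb_le A (c : R) : (forall n, measurable (A n)) ->
  nU [set n | (P n (A n) <= c%:E)%E] -> (loeb P (internal A) <= c%:E)%E.
Proof.
move=> mA h; rewrite loebE// lee_fin; apply: (@limr_le _ nU).
  by apply: cvgP; exact: hprob_cvg.
apply: filterS h => n /=; have Pf : P n (A n) \is a fin_num by exact: fin_num_measure.
by rewrite -{1}(fineK Pf) lee_fin.
Qed.

Lemma loeb_cvg A (c : R) : (forall n, measurable (A n)) ->
  (fun n => fine (P n (A n))) @ nU --> c -> loeb P (internal A) = c%:E.
Proof. by move=> mA h; rewrite loebE//; congr EFin; exact: st_eq. Qed.

Definition hst (f : forall n, T n -> R) (w : hyper P) : R :=
  st (fun n => f n (w n)).

Definition hbdd (f : forall n, T n -> R) : set (hyper P) :=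
  \bigcup_m internal (fun n => [set x | `|f n x| <= m%:R]).

Lemma hbdd_cvg f w : hbdd f w -> (fun n => f n (w n)) @ nU --> hst f w.
Proof. by move=> [m _ h]; exact: st_cvg h. Qed.

Lemma cvg_hbdd f w (l : R) : (fun n => f n (w n)) @ nU --> l -> hbdd f w.
Proof.
move=> fl; have [m lm] : exists m, `|l| + 1 <= m%:R :> R.
  by exists (Num.bound (`|l| + 1)); rewrite ltW// archi_boundP// addr_ge0.
exists m => //; move/cvgrPdist_lt : fl => /(_ 1 ltr01); apply: filterS => n /= h.
apply: le_trans lm; rewrite -[X in `|X|](subrK l) addrC (le_trans (ler_normD _ _))//.
by rewrite lerD2l ltW// distrC.
Qed.

Lemma nhbddP f w : ~ hbdd f w -> hst f w = point.
Proof.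
move=> h; apply: dvgP => /cvg_ex[l hl]; apply: h; exact: cvg_hbdd hl.
Qed.

(** Standard parts turn strict inequalities into weak ones; the margin 1/(k+1) keeps the inequality
    strict in the limit. *)
Lemma hst_ltE f (a : R) : [set w | hst f w < a] `&` hbdd f =
  (\bigcup_k internal (fun n => [set x | f n x < a - k.+1%:R^-1])) `&` hbdd f.
Proof.
apply/seteqP; split=> w /= [h hb]; split => //.
  have := hbdd_cvg hb; move/cvgrPdist_lt => /(_ ((a - hst f w) / 2)).
  have e0 : 0 < (a - hst f w) / 2 by rewrite divr_gt0// subr_gt0.
  move=> /(_ e0) hn.
  have [k] : exists k, k.+1%:R^-1 <= (a - hst f w) / 2.
    exists (Num.bound ((a - hst f w) / 2)^-1).
    rewrite invf_ple ?posrE// ltW// (lt_le_trans (archi_boundP _))// ?invr_ge0 ?ltW//.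
    by rewrite ltr_nat.
  move=> hk; exists k => //; apply: filterS hn => n /=.
  rewrite distrC => /ltr_normlW.
  move: hk; move: (k.+1%:R^-1) (hst f w) (f n (w n)) => x y z ? ?; lra.
case: h => k _ hk.
apply: (@le_lt_trans _ _ (a - k.+1%:R^-1)); last by rewrite ltrBlDr ltrDl invr_gt0.
apply: (@limr_le _ nU); first by apply: cvgP; exact: (hbdd_cvg hb).
by apply: filterS hk => n /= /ltW.
Qed.

(** The family [S] is left abstract so that it can consist of the events of the past; this is how
    standard parts become adapted processes. *)
Lemma measurable_hst (S : forall n, set (set (T n))) (f : forall n, T n -> R) :
  (forall n (a : R), S n [set x | f n x < a]) ->
  (forall n (a : R), S n [set x | `|f n x| <= a]) ->
  g_sigma_algebra_preimage (hst f) `<=`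
    <<s [set internal A | A in [set A | forall n, S n (A n)]] >>.
Proof.
move=> Sf Sf'; set G := (X in <<s X >>).
have mb : <<s G >> (hbdd f).
  apply: (@bigcup_measurable _ (g_sigma_algebraType G)) => k _.
  by apply: sub_sigma_algebra; eexists; last reflexivity.
suff : measurable_fun setT (hst f : g_sigma_algebraType G -> R).
  by move=> mf _ [B mB <-]; apply: mf => //; exact: (@measurableT _ (g_sigma_algebraType G)).
apply: (measurability _ (measurable_realfun.RGenInftyO.measurableE R)) => // _ [_ [a ->] <-].
rewrite setTI.
(* Off [hbdd f] the standard part has the constant value [point], so this region lies entirely
   inside or entirely outside the preimage. *)
have -> : hst f @^-1` `]-oo, a[ = (([set w | hst f w < a] `&` hbdd f) `|`
    (if (point : R) < a then ~` hbdd f else set0)).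
  apply/seteqP; split=> w /=; rewrite in_itv /=.
    have [hb|hb] := pselect (hbdd f w); first by left.
    by rewrite nhbddP// => pa; right; rewrite pa.
  by move=> [[]//|]; case: ifPn => //= pa hb; rewrite nhbddP.
apply: (@measurableU _ (g_sigma_algebraType G)).
  rewrite hst_ltE; apply: (@measurableI _ (g_sigma_algebraType G)) => //.
  apply: (@bigcup_measurable _ (g_sigma_algebraType G)) => k _.
  by apply: sub_sigma_algebra; eexists; last reflexivity.
case: ifP => _; last exact: (@measurable0 _ (g_sigma_algebraType G)).
exact: (@measurableC _ (g_sigma_algebraType G)).
Qed.

End Loeb_theory.

(** * Gaussian measures *)

Section Density.
Context d (T : measurableType d) (R : realType).
Local Open Scope ereal_scope.
Variables (mu nu : {measure set T -> \bar R}) (g : T -> R).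
Hypotheses (mg : measurable_fun setT g) (g0 : forall x, (0 <= g x)%R).
Hypothesis nuE : forall A, measurable A -> nu A = \int[mu]_(x in A) (g x)%:E.

Let indicE E : measurable E ->
  \int[nu]_x (\1_E x)%:E = \int[mu]_x ((\1_E x)%:E * (g x)%:E).
Proof.
move=> mE; rewrite integral_indic// setIT nuE// integral_mkcond.
apply: eq_integral => x _; rewrite patchE indicE; case: ifP => _;
  by rewrite ?mul1e ?mul0e.
Qed.

Import HBNNSimple.

Let nnsfunE (f : {nnsfun T >-> R}) :
  \int[nu]_x (f x)%:E = \int[mu]_x ((f x)%:E * (g x)%:E).
Proof.
under [LHS]eq_integral do rewrite fimfunE -fsumEFin//.
rewrite [LHS]ge0_integral_fsum//; last 2 first.
  - by move=> r; exact/measurable_EFinP/measurableT_comp.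
  - by move=> n x _; rewrite EFinM nnfun_muleindic_ge0.
under [RHS]eq_integral.
  move=> x _; rewrite fimfunE -fsumEFin// muleC ge0_mule_fsumr; last first.
    by move=> r; rewrite EFinM nnfun_muleindic_ge0.
  over.
rewrite [RHS]ge0_integral_fsum//; last 2 first.
  - move=> r; apply/measurable_EFinP; apply: measurable_funM => //.
    exact: measurable_funM.
  - move=> n x _; apply: mule_ge0; first by rewrite lee_fin.
    by rewrite EFinM nnfun_muleindic_ge0.
apply: eq_fsbigr => r rf.
have r0 : (0 <= r)%R by move: rf; rewrite inE => -[x _ <-].
under eq_integral do rewrite EFinM.
rewrite ge0_integralZl//; last first.
  by apply/measurable_EFinP.
under [RHS]eq_integral do rewrite EFinM muleCA [X in _ * X]muleC.
rewrite ge0_integralZl//; last 2 first.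
  - apply/measurable_EFinP; exact: measurable_funM.
  - by move=> x _; rewrite mule_ge0 ?lee_fin.
by rewrite indicE.
Qed.

Lemma ge0_integral_density (f : T -> \bar R) : measurable_fun setT f ->
  (forall x, 0 <= f x) -> \int[nu]_x f x = \int[mu]_x (f x * (g x)%:E).
Proof.
move=> mf f0; pose f_ := nnsfun_approx measurableT mf.
transitivity (lim (\int[nu]_x (f_ n x)%:E @[n --> \oo])).
  rewrite -monotone_convergence//=.
  - apply: eq_integral => ? /[!inE] xD; apply/esym/cvg_lim => //=.
    exact: cvg_nnsfun_approx.
  - by move=> n; exact/measurable_EFinP/measurable_funTS.
  - by move=> n ? _; rewrite lee_fin.
  - by move=> ? _ ? ? mn; rewrite lee_fin; exact/lefP/nd_nnsfun_approx.
under eq_fun do rewrite nnsfunE.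
rewrite -monotone_convergence//=.
- apply: eq_integral => x _; apply/cvg_lim => //=.
  apply: cvgeZr => //; exact: cvg_nnsfun_approx.
- by move=> n; apply/measurable_EFinP/measurable_funM.
- by move=> n ? _; rewrite mule_ge0 ?lee_fin.
- move=> x _ m n mn; rewrite lee_wpmul2r ?lee_fin//.
  exact/lefP/nd_nnsfun_approx.
Qed.

End Density.

(** * Invariance of Lebesgue measure under shifts and sign change *)

Section Translation.
Context {R : realType}.
Local Notation mu := (@lebesgue_measure R).
Local Open Scope ereal_scope.

Let mshift (a : R) : measurable_fun [set: measurableTypeR R]
  ((fun x => x + a)%R : measurableTypeR R -> measurableTypeR R).
Proof. exact: measurable_funD. Qed.

Let mopp : measurable_fun [set: measurableTypeR R]
  (-%R : measurableTypeR R -> measurableTypeR R).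
Proof. exact: measurable_funN. Qed.

Lemma lebesgue_measure_shift (a : R) (A : set R) : measurable A ->
  pushforward mu ((fun x => x + a)%R : measurableTypeR R -> measurableTypeR R) A = mu A.
Proof.
move=> mA; pose f := (fun x => x + a)%R : measurableTypeR R -> measurableTypeR R.
pose F : {mfun measurableTypeR R >-> measurableTypeR R} :=
  HB.pack f (isMeasurableFun.Build _ _ _ _ _ (mshift a)).
apply/esym/(@lebesgue_measure_unique _ (pushforward mu F)) => //= _ [[u v]] _ <-.
rewrite /pushforward /=.
have -> : f @^-1` `]u, v] = `](u - a)%R, (v - a)%R]%classic.
  by apply/seteqP; split=> x; rewrite /= !in_itv/= ltrBlDr lerBrDr.
rewrite !lebesgue_measure_itv/= !lte_fin ltrD2r; case: ifP => // _.
by rewrite -!EFinD; congr EFin; ring.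
Qed.

Lemma integral_shift (a : R) (f : R -> \bar R) : measurable_fun setT f ->
  (forall x, 0 <= f x) -> \int[mu]_x f (x + a)%R = \int[mu]_x f x.
Proof.
move=> mf f0.
transitivity (\int[pushforward mu ((fun x => x + a)%R : measurableTypeR R -> measurableTypeR R)]_x f x).
  by rewrite ge0_integral_pushforward.
by apply: eq_measure_integral => A mA _; exact: lebesgue_measure_shift.
Qed.

Lemma integral_opp (f : R -> \bar R) : measurable_fun setT f ->
  (forall x, 0 <= f x) -> \int[mu]_x f (- x)%R = \int[mu]_x f x.
Proof.
move=> mf f0.
transitivity (\int[pushforward mu (-%R : measurableTypeR R -> measurableTypeR R)]_x f x).
  by rewrite ge0_integral_pushforward.
by apply: eq_measure_integral => A mA _; exact: lebesgue_measureN.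
Qed.

End Translation.

(** * The one-dimensional Gaussian measure *)

Section Gauss1.
Context {R : realType}.
Local Notation mu := (@lebesgue_measure R).
Local Open Scope ereal_scope.

Definition gauss1 : probability (measurableTypeR R) R := normal_prob 0 1.

Lemma gauss1E (f : R -> \bar R) : measurable_fun setT f ->
  (forall x, 0 <= f x) ->
  \int[gauss1]_x f x = \int[mu]_x (f x * (normal_pdf 0 1 x)%:E).
Proof.
move=> mf f0; apply: ge0_integral_density => //.
- exact: measurable_normal_pdf.
- by move=> x; exact: normal_pdf_ge0.
Qed.

Lemma normal_pdf1E (x : R) :
  (normal_pdf 0 1 x = normal_peak 1 * expR (- (x ^+ 2 / 2)))%R.
Proof.
rewrite normal_pdfE ?oner_eq0// /normal_fun subr0 expr1n; congr (_ * expR _)%R.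
by rewrite mulNr.
Qed.

(* Lebesgue measure up to a constant. *)
Definition flat1 (f : R -> \bar R) : \bar R :=
  \int[gauss1]_x (f x * (expR (x ^+ 2 / 2))%:E).

Lemma flat1E (f : R -> \bar R) : measurable_fun setT f ->
  (forall x, 0 <= f x) -> flat1 f = \int[mu]_x (f x * (normal_peak 1)%:E).
Proof.
move=> mf f0; rewrite /flat1 gauss1E.
- apply: eq_integral => x _; rewrite normal_pdf1E -muleA -EFinM; congr (_ * EFin _).
  by rewrite mulrCA -expRD subrr expR0 mulr1.
- apply: emeasurable_funM => //; apply/measurable_EFinP.
  by apply: measurableT_comp => //; apply: measurable_funM => //; exact: measurable_funX.
- by move=> x; rewrite mule_ge0// lee_fin expR_ge0.
Qed.

Lemma flat1_shift (a : R) (f : R -> \bar R) : measurable_fun setT f ->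
  (forall x, 0 <= f x) -> flat1 (fun x => f (x + a)%R) = flat1 f.
Proof.
move=> mf f0; rewrite !flat1E//; last first.
  by apply: measurableT_comp => //; exact: measurable_funD.
rewrite (integral_shift a (f := fun x => f x * (normal_peak 1)%:E))//.
- by apply: emeasurable_funM.
- by move=> x; rewrite mule_ge0// lee_fin normal_peak_ge0.
Qed.

Lemma flat1_opp (f : R -> \bar R) : measurable_fun setT f ->
  (forall x, 0 <= f x) -> flat1 (fun x => f (- x)%R) = flat1 f.
Proof.
move=> mf f0; rewrite !flat1E//; last first.
  by apply: measurableT_comp => //; exact: measurable_funN.
rewrite (integral_opp (f := fun x => f x * (normal_peak 1)%:E))//.
- by apply: emeasurable_funM.
- by move=> x; rewrite mule_ge0// lee_fin normal_peak_ge0.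
Qed.

End Gauss1.

(** * Row vectors as a measurable space *)

Definition rV_display : measure_display. Proof. exact: default_measure_display. Qed.

Section Measurable_rV.
Context {R : realType} {n : nat}.

Let coord : 'I_n -> 'rV[R]_n -> measurableTypeR R := fun i v => v ord0 i.

Let rV_set0 : g_sigma_preimage coord set0.
Proof. exact: sigma_algebra0. Qed.

Let rV_setC A : g_sigma_preimage coord A -> g_sigma_preimage coord (~` A).
Proof. exact: sigma_algebraC. Qed.

Let rV_bigcup (F : _^nat) : (forall i, g_sigma_preimage coord (F i)) ->
  g_sigma_preimage coord (\bigcup_i (F i)).
Proof. exact: sigma_algebra_bigcup. Qed.

HB.instance Definition _ := @isMeasurable.Build rV_display
  'rV[R]_n (g_sigma_preimage coord) rV_set0 rV_setC rV_bigcup.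

End Measurable_rV.

Lemma measurable_coord (R : realType) n (i : 'I_n) :
  measurable_fun [set: 'rV[R]_n] (fun v : 'rV[R]_n => v ord0 i : measurableTypeR R).
Proof.
move=> _ Y mY; rewrite setTI; apply: sub_sigma_algebra => /=.
rewrite -bigcup_seq; exists i => /=; first by rewrite mem_index_enum.
by exists Y => //; rewrite setTI.
Qed.

Lemma measurable_rVP d (T : measurableType d) (R : realType) n (f : T -> 'rV[R]_n) :
  measurable_fun setT f <->
  forall i, measurable_fun setT (fun x => f x ord0 i : measurableTypeR R).
Proof.
split=> [mf i|mf]; first exact: (measurableT_comp (measurable_coord i)).
apply: (@measurability _ _ _ _ _ _ (\big[setU/set0]_(i < n)
  preimage_set_system setT (fun v : 'rV[R]_n => v ord0 i : measurableTypeR R) measurable)) => //.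
move=> _ [C + <-]; rewrite -bigcup_seq => -[i /= _] [Y mY <-].
by rewrite !setTI; have := mf i measurableT _ mY; rewrite setTI.
Qed.

Lemma measurable_rVD d (T : measurableType d) (R : realType) n (f g : T -> 'rV[R]_n) :
  measurable_fun setT f -> measurable_fun setT g ->
  measurable_fun setT (fun x => f x + g x).
Proof.
move=> /measurable_rVP mf /measurable_rVP mg; apply/measurable_rVP => i.
under eq_fun do rewrite mxE.
by apply: measurable_funD; [exact: mf|exact: mg].
Qed.

Lemma measurable_rVN d (T : measurableType d) (R : realType) n (f : T -> 'rV[R]_n) :
  measurable_fun setT f -> measurable_fun setT (fun x => - f x).
Proof.
move=> /measurable_rVP mf; apply/measurable_rVP => i.
under eq_fun do rewrite mxE.
by apply: measurableT_comp => //; exact: mf.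
Qed.

Lemma measurable_rVB d (T : measurableType d) (R : realType) n (f g : T -> 'rV[R]_n) :
  measurable_fun setT f -> measurable_fun setT g ->
  measurable_fun setT (fun x => f x - g x).
Proof. by move=> mf mg; apply: measurable_rVD => //; exact: measurable_rVN. Qed.

Lemma measurable_rVZ d (T : measurableType d) (R : realType) n (a : T -> R)
    (f : T -> 'rV[R]_n) :
  measurable_fun setT a -> measurable_fun setT f ->
  measurable_fun setT (fun x => a x *: f x).
Proof.
move=> ma /measurable_rVP mf; apply/measurable_rVP => i.
under eq_fun do rewrite mxE.
by apply: measurable_funM; [exact: ma|exact: mf].
Qed.

Lemma measurable_inner d (T : measurableType d) (R : realType) n (f g : T -> 'rV[R]_n) :
  measurable_fun setT f -> measurable_fun setT g ->
  measurable_fun setT (fun x => inner (f x) (g x)).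
Proof.
move=> /measurable_rVP mf /measurable_rVP mg; apply: measurable_sum => i.
by apply: measurable_funM; [exact: mf|exact: mg].
Qed.

Lemma measurable_enorm d (T : measurableType d) (R : realType) n (f : T -> 'rV[R]_n) :
  measurable_fun setT f -> measurable_fun setT (fun x => enorm (f x)).
Proof.
move=> mf; apply: (measurableT_comp (f := @Num.sqrt R)); last exact: measurable_inner.
apply: continuous_measurable_fun; exact: sqrt_continuous.
Qed.

(** * Euclidean geometry of row vectors *)

Section Inner.
Context {R : realType} {d : nat}.
Implicit Types u v w : 'rV[R]_d.

Lemma innerC u v : inner u v = inner v u.
Proof. by apply: eq_bigr => i _; rewrite mulrC. Qed.

Lemma innerDl u v w : inner (u + v) w = inner u w + inner v w.
Proof. by rewrite -big_split; apply: eq_bigr => i _; rewrite mxE mulrDl. Qed.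

Lemma innerDr u v w : inner w (u + v) = inner w u + inner w v.
Proof. by rewrite !(innerC w) innerDl. Qed.

Lemma innerZl (a : R) u v : inner (a *: u) v = a * inner u v.
Proof. by rewrite mulr_sumr; apply: eq_bigr => i _; rewrite mxE mulrA. Qed.

Lemma innerZr (a : R) u v : inner u (a *: v) = a * inner u v.
Proof. by rewrite innerC innerZl innerC. Qed.

Lemma innerNl u v : inner (- u) v = - inner u v.
Proof. by rewrite -scaleN1r innerZl mulN1r. Qed.

Lemma innerNr u v : inner u (- v) = - inner u v.
Proof. by rewrite innerC innerNl innerC. Qed.

Lemma innerBl u v w : inner (u - v) w = inner u w - inner v w.
Proof. by rewrite innerDl innerNl. Qed.

Lemma innerBr u v w : inner w (u - v) = inner w u - inner w v.
Proof. by rewrite innerDr innerNr. Qed.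

Lemma inner0l v : inner 0 v = 0.
Proof. by rewrite -(scale0r 0) innerZl mul0r. Qed.

Lemma inner0r v : inner v 0 = 0.
Proof. by rewrite innerC inner0l. Qed.

Lemma inner_ge0 u : 0 <= inner u u.
Proof. by apply: sumr_ge0 => i _; rewrite -expr2 sqr_ge0. Qed.

Lemma sqr_enorm u : enorm u ^+ 2 = inner u u.
Proof. by rewrite sqr_sqrtr ?inner_ge0. Qed.

Lemma enorm_ge0 u : 0 <= enorm u. Proof. exact: sqrtr_ge0. Qed.

Lemma inner_eq0 u : (inner u u == 0) = (u == 0).
Proof.
apply/eqP/eqP => [h|->]; last by rewrite inner0l.
apply/rowP => i; rewrite mxE; apply/eqP; rewrite -sqrf_eq0 expr2; apply/eqP.
apply: (psumr_eq0P (P := predT) _ h) => // j _; rewrite -expr2 sqr_ge0 //.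
Qed.

Lemma enorm_eq0 u : (enorm u == 0) = (u == 0).
Proof. by rewrite -sqrf_eq0 sqr_enorm inner_eq0. Qed.

Lemma enorm0 : enorm (0 : 'rV[R]_d) = 0.
Proof. by apply/eqP; rewrite enorm_eq0. Qed.

Lemma enorm_gt0 u : (0 < enorm u) = (u != 0).
Proof. by rewrite lt_neqAle enorm_ge0 andbT eq_sym enorm_eq0. Qed.

Lemma enormZ (a : R) u : enorm (a *: u) = `|a| * enorm u.
Proof. by rewrite /enorm innerZl innerZr mulrA -expr2 sqrtrM ?sqr_ge0// sqrtr_sqr. Qed.

Lemma enormN u : enorm (- u) = enorm u.
Proof. by rewrite /enorm innerNl innerNr opprK. Qed.

Lemma inner_le u v : inner u v <= enorm u * enorm v.
Proof.
have [->|u0] := eqVneq u 0; first by rewrite inner0l mulr_ge0// enorm_ge0.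
have [->|v0] := eqVneq v 0; first by rewrite inner0r mulr_ge0// enorm_ge0.
have nu : 0 < enorm u by rewrite enorm_gt0.
have nv : 0 < enorm v by rewrite enorm_gt0.
have := inner_ge0 (enorm v *: u - enorm u *: v).
rewrite innerBl !innerBr !innerZl !innerZr -!sqr_enorm (innerC v u) => h.
have {}h : 0 <= 2 * (enorm u * enorm v) * (enorm u * enorm v - inner u v).
  apply: le_trans h _; rewrite le_eqVlt; apply/orP; left; apply/eqP; ring.
rewrite -subr_ge0 -(pmulr_rge0 _ (x := 2 * (enorm u * enorm v)))//.
by rewrite !mulr_gt0.
Qed.

Lemma enormD u v : enorm (u + v) <= enorm u + enorm v.
Proof.
rewrite -(@ler_pXn2r _ 2%N)// ?nnegrE ?addr_ge0 ?enorm_ge0//.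
rewrite sqr_enorm innerDl !innerDr -!sqr_enorm (innerC v u).
by have := inner_le u v; rewrite sqrrD; lra.
Qed.

Lemma coord_le_enorm u (i : 'I_d) : `|u ord0 i| <= enorm u.
Proof.
rewrite -(@ler_pXn2r _ 2%N)// ?nnegrE ?enorm_ge0// sqr_enorm.
rewrite real_normK ?num_real// /inner (bigD1 i)//= -expr2 lerDl.
by apply: sumr_ge0 => j _; rewrite -expr2 sqr_ge0.
Qed.

Lemma enorm_le_sum u : enorm u <= \sum_(i < d) `|u ord0 i|.
Proof.
have {1}-> : u = \sum_(i < d) u ord0 i *: delta_mx ord0 i.
  by rewrite [LHS]row_sum_delta.
elim/big_ind2 : _ => [|x a y b xa yb|i _]; first by rewrite enorm0.
  by apply: le_trans (enormD _ _) _; exact: lerD.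
rewrite enormZ ler_piMr// /enorm /inner (bigD1 i)//= big1 ?addr0.
  by rewrite mxE !eqxx mulr1 sqrtr1.
by move=> j ji; rewrite mxE (negbTE ji) mulr0.
Qed.

End Inner.

Lemma integral_prob_cst d (T : measurableType d) (R : realType) (P : probability T R)
  (c : \bar R) : (\int[P]_x c = c)%E.
Proof. by rewrite integral_cst//= probability_setT mule1. Qed.

(** * The standard Gaussian measure on R^n and its symmetries *)

Section Gauss_rV.
Context {R : realType}.
Local Open Scope ereal_scope.

Fact rVcons_key : unit. Proof. exact: tt. Qed.

Definition rVcons n (p : measurableTypeR R * 'rV[R]_n) : 'rV[R]_n.+1 :=
  locked_with rVcons_key
    (\row_i if unlift ord0 i is Some j then p.2 ord0 j else p.1).

Lemma rVcons0 n (p : measurableTypeR R * 'rV[R]_n) : rVcons p ord0 ord0 = p.1.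
Proof.
by rewrite /rVcons unlock mxE unlift_none.
Qed.

Lemma rVconsS n (p : measurableTypeR R * 'rV[R]_n) (i : 'I_n) :
  rVcons p ord0 (lift ord0 i) = p.2 ord0 i.
Proof.
by rewrite /rVcons unlock mxE liftK.
Qed.

Lemma measurable_rVcons n : measurable_fun setT (@rVcons n).
Proof.
apply/measurable_rVP => i; have [j ->|->] := unliftP ord0 i.
  under eq_fun do rewrite rVconsS.
  by apply: (measurableT_comp (measurable_coord j)).
under eq_fun do rewrite rVcons0.
exact: measurable_fst.
Qed.

HB.instance Definition _ n := isMeasurableFun.Build _ _ _ _ (@rVcons n) (@measurable_rVcons n).

Definition rVhead n (v : 'rV[R]_n.+1) : measurableTypeR R := v ord0 ord0.
Definition rVtail n (v : 'rV[R]_n.+1) : 'rV[R]_n := \row_i v ord0 (lift ord0 i).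

Lemma rVconsK n (v : 'rV[R]_n.+1) : rVcons (rVhead v, rVtail v) = v.
Proof.
apply/rowP => i; have [j ->|->] := unliftP ord0 i.
  by rewrite rVconsS mxE.
by rewrite rVcons0.
Qed.

Lemma rVcons_inner n (p q : measurableTypeR R * 'rV[R]_n) :
  inner (rVcons p) (rVcons q) = (p.1 * q.1 + inner p.2 q.2)%R.
Proof.
rewrite /inner big_ord_recl !rVcons0; congr (_ + _)%R.
by apply: eq_bigr => i _; rewrite !rVconsS.
Qed.

Lemma rVconsD n (p q : measurableTypeR R * 'rV[R]_n) :
  rVcons (p.1 + q.1, p.2 + q.2)%R = (rVcons p + rVcons q)%R.
Proof.
apply/rowP => i; rewrite mxE; have [j ->|->] := unliftP ord0 i.
  by rewrite !rVconsS mxE.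
by rewrite !rVcons0.
Qed.

Lemma rVconsZ n (a : R) (p : measurableTypeR R * 'rV[R]_n) :
  rVcons (a * p.1, a *: p.2)%R = (a *: rVcons p)%R.
Proof.
apply/rowP => i; rewrite mxE; have [j ->|->] := unliftP ord0 i.
  by rewrite !rVconsS mxE.
by rewrite !rVcons0.
Qed.

Fixpoint gauss n : probability 'rV[R]_n R :=
  match n with
  | 0%N => \d_(0%R : 'rV[R]_0)
  | m.+1 => distribution (gauss1 \x gauss m) (@rVcons m)
  end.

Lemma integral_gaussS n (f : 'rV[R]_n.+1 -> \bar R) : measurable_fun setT f ->
  (forall x, 0 <= f x) ->
  \int[gauss n.+1]_v f v = \int[gauss1]_x \int[gauss n]_v f (rVcons (x, v)).
Proof.
move=> mf f0; rewrite /= ge0_integral_distribution// fubini_tonelli1//.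
- by apply: (measurableT_comp mf (@measurable_rVcons n)).
- by move=> x; exact: f0.
Qed.

Definition wt n (v : 'rV[R]_n) : R := expR (inner v v / 2).

Lemma wt_cons n x (v : 'rV[R]_n) : wt (rVcons (x, v)) = (expR (x ^+ 2 / 2) * wt v)%R.
Proof. by rewrite /wt rVcons_inner -expRD -mulrDl expr2. Qed.

Lemma wt_ge0 n (v : 'rV[R]_n) : (0 <= wt v)%R. Proof. exact: expR_ge0. Qed.

Lemma measurable_wt n : measurable_fun setT (@wt n).
Proof.
apply: measurableT_comp => //; apply: measurable_funM => //.
exact: measurable_inner.
Qed.

(** Lebesgue integration on R^n up to a constant: the weight [wt] cancels the Gaussian density.
    Translations and reflections are studied for [flat], and the Gaussian statements follow by
    putting the density back. *)
Definition flat n (f : 'rV[R]_n -> \bar R) : \bar R :=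
  \int[gauss n]_v (f v * (wt v)%:E).

Lemma flat_ge0 n (f : 'rV[R]_n -> \bar R) : (forall x, 0 <= f x) -> 0 <= flat f.
Proof. by move=> f0; apply: integral_ge0 => x _; rewrite mule_ge0// lee_fin wt_ge0. Qed.

Let mcons1 n (x : R) : measurable_fun setT (fun v : 'rV[R]_n => rVcons (x, v)).
Proof. apply: (measurableT_comp (@measurable_rVcons n)); exact: pair1_measurable. Qed.

Let mcons2 n (v : 'rV[R]_n) : measurable_fun setT (fun x : R => rVcons (x, v)).
Proof. apply: (measurableT_comp (@measurable_rVcons n)); exact: pair2_measurable. Qed.

Let mw1 : measurable_fun setT (fun x : R => (expR (x ^+ 2 / 2))%:E).
Proof.
apply/measurable_EFinP; apply: measurableT_comp => //.
by apply: measurable_funM => //; exact: measurable_funX.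
Qed.

Let mw n : measurable_fun setT (fun v : 'rV[R]_n => (wt v)%:E).
Proof. by apply/measurable_EFinP; exact: measurable_wt. Qed.

Lemma measurable_flat n d (T : measurableType d) (f : T -> 'rV[R]_n -> \bar R) :
  measurable_fun setT (fun p => f p.1 p.2) -> (forall x v, 0 <= f x v) ->
  measurable_fun setT (fun x => flat (f x)).
Proof.
move=> mf f0.
apply: (measurable_fun_fubini_tonelli_F (fun p => f p.1 p.2 * (wt p.2)%:E)).
  by apply: emeasurable_funM => //; exact: (measurableT_comp (@mw n) measurable_snd).
by move=> x; rewrite mule_ge0// lee_fin wt_ge0.
Qed.

Lemma flatS n (f : 'rV[R]_n.+1 -> \bar R) : measurable_fun setT f ->
  (forall x, 0 <= f x) ->
  flat f = flat1 (fun x => flat (fun v => f (rVcons (x, v)))).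
Proof.
move=> mf f0; rewrite /flat integral_gaussS//; last 2 first.
  by apply: emeasurable_funM => //; exact: mw.
  by move=> x; rewrite mule_ge0// lee_fin wt_ge0.
apply: eq_integral => x _; rewrite -ge0_integralZr; [|exact: measurableT| | |].
- by apply: eq_integral => v _; rewrite wt_cons EFinM muleA [in RHS]muleAC.
- apply: emeasurable_funM; last exact: mw.
  exact: (measurableT_comp mf (@mcons1 _ x)).
- by move=> v _; rewrite mule_ge0// lee_fin wt_ge0.
- by rewrite lee_fin expR_ge0.
Qed.

Lemma flat_swap n (f : R -> 'rV[R]_n -> \bar R) :
  measurable_fun setT (fun p : measurableTypeR R * 'rV[R]_n => f p.1 p.2) ->
  (forall x v, 0 <= f x v) ->
  flat1 (fun x => flat (f x)) = flat (fun v => flat1 (fun x => f x v)).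
Proof.
move=> mf f0; rewrite /flat /flat1.
transitivity (\int[gauss1]_x \int[gauss n]_v
    (f x v * (wt v)%:E * (expR (x ^+ 2 / 2))%:E)).
  apply: eq_integral => x _; rewrite -ge0_integralZr; [by []|exact: measurableT| | |].
  - apply: emeasurable_funM; last exact: mw.
    exact: (measurableT_comp mf (pair1_measurable x)).
  - by move=> v _; rewrite mule_ge0// lee_fin wt_ge0.
  - by rewrite lee_fin expR_ge0.
rewrite (fubini_tonelli (fun p : measurableTypeR R * 'rV[R]_n =>
  f p.1 p.2 * (wt p.2)%:E * (expR (p.1 ^+ 2 / 2))%:E)); last 2 first.
- apply: emeasurable_funM; last exact: (measurableT_comp mw1 measurable_fst).
  by apply: emeasurable_funM => //; exact: (measurableT_comp (@mw n) measurable_snd).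
- by move=> x; rewrite !mule_ge0// lee_fin ?wt_ge0 ?expR_ge0.
apply: eq_integral => v _; rewrite -ge0_integralZr; [|exact: measurableT| | |].
- by apply: eq_integral => x _; rewrite muleAC.
- apply: emeasurable_funM; last exact: mw1.
  exact: (measurableT_comp mf (pair2_measurable v)).
- by move=> x _; rewrite mule_ge0// lee_fin expR_ge0.
- by rewrite lee_fin wt_ge0.
Qed.

Lemma eq_flat n (f g : 'rV[R]_n -> \bar R) : f =1 g -> flat f = flat g.
Proof. by move=> fg; apply: eq_integral => x _; rewrite fg. Qed.

Lemma eq_flat1 (f g : R -> \bar R) : f =1 g -> flat1 f = flat1 g.
Proof. by move=> fg; apply: eq_integral => x _; rewrite fg. Qed.

Lemma flat_shift n (a : 'rV[R]_n) (f : 'rV[R]_n -> \bar R) : measurable_fun setT f ->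
  (forall x, 0 <= f x) -> flat (fun v => f (v + a)%R) = flat f.
Proof.
elim: n => [|n IH] in a f * => mf f0.
  by apply: eq_flat => v; congr f; rewrite !thinmx0.
have mfa b : measurable_fun setT (fun v : 'rV[R]_n.+1 => f (v + b)%R).
  by apply: measurableT_comp => //; exact: measurable_rVD.
rewrite (flatS (mfa a) (fun x => f0 _)) (flatS mf f0).
transitivity (flat1 (fun x => flat (fun v => f (rVcons (x + rVhead a, v)%R)))).
  apply: eq_flat1 => x.
  rewrite -(IH (rVtail a) (fun v => f (rVcons ((x + rVhead a)%R, v))))//.
    by apply: eq_flat => v; rewrite -{1}(rVconsK a) -rVconsD.
  exact: (measurableT_comp mf (@mcons1 _ _)).
rewrite (flat1_shift (rVhead a) (f := fun x => flat (fun v => f (rVcons (x, v)))))//.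
- apply: measurable_flat => //; exact: (measurableT_comp mf (@measurable_rVcons n)).
- by move=> x; exact: flat_ge0.
Qed.

Definition reflect n (e g : 'rV[R]_n) : 'rV[R]_n := (g - (2 * inner e g) *: e)%R.

Lemma inner_reflect n (e g : 'rV[R]_n) : inner e e = 1%R ->
  inner (reflect e g) (reflect e g) = inner g g.
Proof.
move=> e1; rewrite /reflect innerBl !innerBr !innerZl !innerZr e1 (innerC g e).
ring.
Qed.

Lemma measurable_reflect n (e : 'rV[R]_n) : measurable_fun setT (reflect e).
Proof.
apply: measurable_rVB => //; apply: measurable_rVZ => //.
apply: measurable_funM => //; exact: measurable_inner.
Qed.

(** Write e = (c, w). If c = 0 the reflection only acts on the tail and induction applies. Otherwise
    it is a product of three shears ([A], [B], [A]) and the sign change [S] of the first coordinate;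
    each of these preserves [flat] by Tonelli and the one-dimensional or inductive invariance. *)
Lemma flat_reflect n (e : 'rV[R]_n) (f : 'rV[R]_n -> \bar R) : measurable_fun setT f ->
  (forall x, 0 <= f x) -> inner e e = 1%R -> flat (fun v => f (reflect e v)) = flat f.
Proof.
elim: n => [|n IH] in e f * => mf f0 e1.
  by apply: eq_flat => v; congr f; rewrite !thinmx0.
have mfe : measurable_fun setT (fun v : 'rV[R]_n.+1 => f (reflect e v)).
  apply: measurableT_comp => //; exact: measurable_reflect.
pose c := rVhead e; pose w := rVtail e.
have eE : e = rVcons (c, w) by rewrite rVconsK.
have e1' : (c * c + inner w w = 1)%R by rewrite -e1 eE rVcons_inner.
have [c0|c0] := eqVneq (c : R) 0%R.
  rewrite (flatS mfe (fun x => f0 _)) (flatS mf f0); apply: eq_flat1 => x.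
  rewrite -(IH w (fun v => f (rVcons (x, v))))//.
  - apply: eq_flat => v; rewrite eE; congr f; rewrite /reflect rVcons_inner/=.
    rewrite c0 mul0r add0r; apply/rowP => i; rewrite !mxE.
    have [j ->|->] := unliftP ord0 i; rewrite ?rVcons0 ?rVconsS/= ?mxE//.
    by rewrite mulr0 subr0.
  - exact: (measurableT_comp mf (@mcons1 _ _)).
  - by rewrite c0 mul0r add0r in e1'.
pose A (f : 'rV[R]_n.+1 -> \bar R) (v : 'rV[R]_n.+1) :=
  f (rVcons ((rVhead v - inner w (rVtail v) / c)%R, rVtail v)).
pose B (f : 'rV[R]_n.+1 -> \bar R) (v : 'rV[R]_n.+1) :=
  f (rVcons (rVhead v, (rVtail v + (2 * c * rVhead v) *: w)%R)).
pose S (f : 'rV[R]_n.+1 -> \bar R) (v : 'rV[R]_n.+1) :=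
  f (rVcons ((- rVhead v)%R : measurableTypeR R, rVtail v)).
have mhead : measurable_fun setT (@rVhead n) by exact: measurable_coord.
have mtail : measurable_fun setT (@rVtail n).
  apply/measurable_rVP => i; under eq_fun do rewrite mxE.
  exact: measurable_coord.
have mcomp (g1 : 'rV[R]_n.+1 -> R) (g2 : 'rV[R]_n.+1 -> 'rV[R]_n) :
    measurable_fun setT g1 -> measurable_fun setT g2 -> forall f : 'rV[R]_n.+1 -> \bar R,
    measurable_fun setT f -> measurable_fun setT (fun v => f (rVcons (g1 v, g2 v))).
  move=> m1 m2 h mh; apply: (measurableT_comp mh).
  apply: (measurableT_comp (@measurable_rVcons n)).
  exact: measurable_fun_pair.
have mA f1 : measurable_fun setT f1 -> measurable_fun setT (A f1).
  apply: mcomp => //; apply: measurable_funB => //; apply: measurable_funM => //.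
  exact: measurable_inner.
have mB f1 : measurable_fun setT f1 -> measurable_fun setT (B f1).
  apply: mcomp => //; apply: measurable_rVD => //; apply: measurable_rVZ => //.
  exact: measurable_funM.
have mS f1 : measurable_fun setT f1 -> measurable_fun setT (S f1).
  by apply: mcomp => //; apply: measurableT_comp.
have headK x (v : 'rV[R]_n) : rVhead (rVcons (x, v)) = x by rewrite /rVhead rVcons0.
have tailK x (v : 'rV[R]_n) : rVtail (rVcons (x, v)) = v.
  by apply/rowP => i; rewrite mxE rVconsS.
have mslice f1 v : measurable_fun setT f1 ->
    measurable_fun setT (fun x : R => f1 (rVcons (x, v : 'rV[R]_n)) : \bar R).
  by move=> mf1; exact: (measurableT_comp mf1 (@mcons2 _ v)).
have mf2 f1 : measurable_fun setT f1 ->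
   measurable_fun setT (fun p : measurableTypeR R * 'rV[R]_n => f1 (rVcons (p.1, p.2)) : \bar R).
  move=> mf1; apply: (measurableT_comp mf1).
  apply: (eq_measurable_fun (@rVcons n)) => //.
have fA f1 : measurable_fun setT f1 -> (forall x, 0 <= f1 x) -> flat (A f1) = flat f1.
  move=> mf1 f10; rewrite (flatS (mA _ mf1) (fun x => f10 _)) (flatS mf1 f10).
  rewrite (flat_swap (f := fun x v => A f1 (rVcons (x, v))) (mf2 _ (mA _ mf1)) (fun x v => f10 _)).
  rewrite (flat_swap (f := fun x v => f1 (rVcons (x, v))) (mf2 _ mf1) (fun x v => f10 _)).
  apply: eq_flat => v; rewrite -(flat1_shift (- (inner w v / c)) (mslice _ v mf1) (fun v => f10 _)).
  by apply: eq_flat1 => x; rewrite /A headK tailK.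
have fB f1 : measurable_fun setT f1 -> (forall x, 0 <= f1 x) -> flat (B f1) = flat f1.
  move=> mf1 f10; rewrite (flatS (mB _ mf1) (fun x => f10 _)) (flatS mf1 f10).
  apply: eq_flat1 => x.
  rewrite -(flat_shift ((2 * c * x) *: w) (measurableT_comp mf1 (@mcons1 _ x)) (fun v => f10 _)).
  by apply: eq_flat => v; rewrite /B headK tailK.
have fS f1 : measurable_fun setT f1 -> (forall x, 0 <= f1 x) -> flat (S f1) = flat f1.
  move=> mf1 f10; rewrite (flatS (mS _ mf1) (fun x => f10 _)) (flatS mf1 f10).
  rewrite (flat_swap (f := fun x v => S f1 (rVcons (x, v))) (mf2 _ (mS _ mf1)) (fun x v => f10 _)).
  rewrite (flat_swap (f := fun x v => f1 (rVcons (x, v))) (mf2 _ mf1) (fun x v => f10 _)).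
  apply: eq_flat => v; rewrite -(flat1_opp (mslice _ v mf1) (fun v => f10 _)).
  by apply: eq_flat1 => x; rewrite /S headK tailK.
have -> : (fun v => f (reflect e v)) = S (A (B (A f))).
  apply/funext => v; rewrite /S /A /B !headK !tailK; congr f.
  rewrite -{1}(rVconsK v) eE /reflect rVcons_inner/=.
  set x := rVhead v; set g := rVtail v; set p := inner w g.
  have e2 : (inner w w = 1 - c * c)%R by rewrite -e1'; ring.
  apply/rowP => i; rewrite !mxE; have [j ->|->] := unliftP ord0 i.
    rewrite !rVconsS/= !mxE -/p; field; exact: c0.
  rewrite !rVcons0/= innerDr innerZr e2 -/p; field; exact: c0.
have nA f1 : (forall x, 0 <= f1 x) -> forall x, 0 <= A f1 x by move=> h x; exact: h.
have nB f1 : (forall x, 0 <= f1 x) -> forall x, 0 <= B f1 x by move=> h x; exact: h.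
rewrite (fS _ (mA _ (mB _ (mA _ mf))) (nA _ (nB _ (nA _ f0)))).
rewrite (fA _ (mB _ (mA _ mf)) (nB _ (nA _ f0))).
by rewrite (fB _ (mA _ mf) (nA _ f0)) (fA _ mf f0).
Qed.

Definition norm1 n (f : 'rV[R]_n -> \bar R) v : \bar R := f v * (expR (- (inner v v / 2)))%:E.

Lemma gauss_flat n (f : 'rV[R]_n -> \bar R) : \int[gauss n]_v f v = flat (norm1 f).
Proof.
apply: eq_integral => v _; rewrite /norm1 /wt -muleA -EFinM -expRD.
by rewrite addrC subrr expR0 mule1.
Qed.

Lemma measurable_norm1 n (f : 'rV[R]_n -> \bar R) : measurable_fun setT f ->
  measurable_fun setT (norm1 f).
Proof.
move=> mf; apply: emeasurable_funM => //; apply/measurable_EFinP.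
apply: measurableT_comp => //; apply: measurableT_comp => //.
by apply: measurable_funM => //; exact: measurable_inner.
Qed.

Lemma norm1_ge0 n (f : 'rV[R]_n -> \bar R) : (forall x, 0 <= f x) -> forall x, 0 <= norm1 f x.
Proof. by move=> f0 x; rewrite mule_ge0// lee_fin expR_ge0. Qed.

Lemma gauss_reflect n (e : 'rV[R]_n) (f : 'rV[R]_n -> \bar R) :
  measurable_fun setT f -> (forall x, 0 <= f x) -> inner e e = 1%R ->
  \int[gauss n]_v f (reflect e v) = \int[gauss n]_v f v.
Proof.
move=> mf f0 e1; rewrite !gauss_flat.
rewrite -(flat_reflect (measurable_norm1 mf) (norm1_ge0 f0) e1).
by apply: eq_flat => v; rewrite /norm1 inner_reflect.
Qed.

(** The Cameron-Martin formula, from the translation invariance of [flat]. *)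
Lemma gauss_shift n (a : 'rV[R]_n) (f : 'rV[R]_n -> \bar R) :
  measurable_fun setT f -> (forall x, 0 <= f x) ->
  \int[gauss n]_v f (v + a)%R =
  \int[gauss n]_v (f v * (expR (inner v a - inner a a / 2))%:E).
Proof.
move=> mf f0; rewrite !gauss_flat.
rewrite -(flat_shift a (f := norm1 (fun v => f v * (expR (inner v a - inner a a / 2))%:E))).
- apply: eq_flat => v; rewrite /norm1 -muleA -EFinM -expRD; congr (_ * (expR _)%:E).
  by rewrite !innerDl !innerDr (innerC a v); field.
- apply: measurable_norm1; apply: emeasurable_funM => //; apply/measurable_EFinP.
  apply: measurableT_comp => //; apply: measurable_funB => //.
  exact: measurable_inner.
- by apply: norm1_ge0 => v; rewrite mule_ge0// lee_fin expR_ge0.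
Qed.

Lemma gauss_head n (f : R -> \bar R) : measurable_fun setT f -> (forall x, 0 <= f x) ->
  \int[gauss n.+1]_v f (rVhead v) = \int[gauss1]_x f x.
Proof.
move=> mf f0; rewrite integral_gaussS//; last first.
  by apply: measurableT_comp => //; exact: measurable_coord.
apply: eq_integral => x _; under eq_integral do rewrite /rVhead rVcons0/=.
exact: integral_prob_cst.
Qed.

(** The Householder reflection along [d0 - e] exchanges e with the first basis vector [d0], so
    [inner e] has the law of the first coordinate. *)
Lemma gauss_inner n (e : 'rV[R]_n) (f : R -> \bar R) :
  measurable_fun setT f -> (forall x, 0 <= f x) -> inner e e = 1%R ->
  \int[gauss n]_v f (inner e v) = \int[gauss1]_x f x.
Proof.
case: n e => [e _ _|n e mf f0 e1].
  by rewrite /inner big_ord0 => /esym/eqP; rewrite oner_eq0.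
rewrite -(gauss_head n)//.
pose d0 : 'rV[R]_n.+1 := delta_mx ord0 ord0.
have d0E v : inner d0 v = rVhead v.
  rewrite /inner (bigD1 ord0)//= mxE !eqxx mul1r big1 ?addr0//.
  by move=> j j0; rewrite mxE (negbTE j0) mul0r.
have d01 : inner d0 d0 = 1%R by rewrite d0E /rVhead mxE !eqxx.
have [->|ed] := eqVneq e d0.
  by apply: eq_integral => v _; rewrite d0E.
set k := enorm (d0 - e).
have k0 : (k != 0)%R by rewrite enorm_eq0 subr_eq0 eq_sym.
pose r := (k^-1 *: (d0 - e))%R.
have kE : (k ^+ 2 = 2 - 2 * inner d0 e)%R.
  rewrite sqr_enorm innerBl !innerBr d01 e1 (innerC e); ring.
have r1 : inner r r = 1%R.
  rewrite /r innerZl innerZr -sqr_enorm -/k; field; exact: k0.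
rewrite -(gauss_reflect (e := r) (f := f \o @rVhead n))//.
  apply: eq_integral => v _; rewrite /= -d0E; congr f.
  rewrite /reflect /r innerBr innerZr innerZl innerZr !innerBl !innerBr d01.
  have -> : inner d0 e = (1 - k ^+ 2 / 2)%R by rewrite kE; field.
  field; exact: k0.
  by apply: measurableT_comp => //; exact: measurable_coord.
by move=> v; exact: f0.
Qed.

End Gauss_rV.

(** * Maximal reflection coupling *)

Section Coupling_map.
Context {R : realType}.
Local Open Scope ereal_scope.

Definition unif : probability (measurableTypeR R) R := uniform_prob (@ltr01 R).

Lemma unif_le (p : R) : (0 <= p)%R ->
  unif [set u | (u <= p)%R] = (Num.min 1 p)%:E.
Proof.
move=> p0; have -> : [set u | (u <= p)%R] = `]-oo, p]%classic.
  by apply/seteqP; split=> x /=; rewrite in_itv.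
have := @integral_uniform R 0 1 ltr01 (fun x => (\1_(`]-oo, p]%classic) x)%:E).
rewrite integral_indic// setIT => -> //.
rewrite subr0 invr1 mul1e integral_indic//.
have -> : `]-oo, p] `&` `[0%R, 1%R] = `[0%R, (Num.min 1 p)%R]%classic.
  by apply/seteqP; split=> x /=; rewrite !in_itv/= le_min; [move=> [-> /andP[-> ->]]|move=> /andP[-> /andP[-> ->]]].
  etransitivity; first exact: lebesgue_measure_itv.
  rewrite /= lte_fin lt_min ltr01/= oppr0 adde0.
  by case: ltgtP p0 => // <- _; rewrite minEge ler01.
by apply/measurable_EFinP; exact: measurable_indic.
Qed.

Lemma integral_unif_if (T : Type) (f : T -> \bar R) (p : R) (a b : T) :
  (forall x, 0 <= f x) -> (0 <= p)%R ->
  \int[unif]_u f (if (u <= p)%R then a else b) =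
  f a * (Num.min 1 p)%:E + f b * (1 - Num.min 1 p)%:E.
Proof.
move=> f0 p0.
have mle : measurable [set u : R | (u <= p)%R].
  have -> : [set u | (u <= p)%R] = `]-oo, p]%classic.
    by apply/seteqP; split=> x /=; rewrite in_itv.
  exact: measurable_itv.
rewrite -(setvU [set u : R | (u <= p)%R]) ge0_integral_setU//=.
- rewrite addeC; congr (_ + _).
    rewrite (eq_integral (cst (f a))); last first.
      by move=> x; rewrite inE/= => ->.
    by rewrite integral_cst//; congr (_ * _); exact: unif_le.
  rewrite (eq_integral (cst (f b))); last first.
    by move=> x; rewrite inE/= => /negP/negbTE ->.
  rewrite integral_cst//; last exact: measurableC.
  congr (_ * _); transitivity (1 - unif [set u | (u <= p)%R]).
    exact: probability_setC.
  by rewrite unif_le// -EFinB.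
- exact: measurableC.
- rewrite setvU; apply: (eq_measurable_fun (fun u : R => if (u <= p)%R then f a else f b)).
    by move=> u _; case: ifP.
  by apply: measurable_fun_ifT => //; exact: measurable_realfun.measurable_fun_ler.
- by apply/eqP; rewrite setICl.
Qed.

(* Maximal reflection coupling: for independent Gaussian [g] and uniform [u],
   [rmap v g u] is Gaussian and equals [g + v] with the largest probability. *)
Definition rmap n (v g : 'rV[R]_n) (u : R) : 'rV[R]_n :=
  if (u <= expR (- inner g v - inner v v / 2))%R then (g + v)%R
  else reflect ((enorm v)^-1 *: v)%R g.

Lemma rmap0 n (g : 'rV[R]_n) u : rmap 0%R g u = g.
Proof. by rewrite /rmap scaler0 /reflect scaler0 subr0 addr0 if_same. Qed.

(** The Metropolis acceptance probability for a log-likelihood ratio t; [mprobM] is its detailed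
    balance. *)
Definition mprob (t : R) : R := Num.min 1%R (expR t).

Lemma mprob_ge0 t : (0 <= mprob t)%R.
Proof. by rewrite /mprob le_min ler01 expR_ge0. Qed.

Lemma mprob_le1 t : (mprob t <= 1)%R.
Proof. by rewrite /mprob ge_min lexx. Qed.

Lemma measurable_mprob : measurable_fun setT mprob.
Proof. by apply: measurable_minr. Qed.

Lemma mprobM t : (mprob (- t) * expR t = mprob t)%R.
Proof.
rewrite /mprob mulrC minr_pMr ?expR_ge0// mulr1 expRN divff ?gt_eqF ?expR_gt0//.
by rewrite minC.
Qed.

(** The threshold in [rmap] is the ratio of the Gaussian densities at g + v and g. The accepted part
    contributes f with weight [m'] after a Cameron-Martin shift. Reflection changes the sign of
    [inner g v], so the rejected part contributes f with the complementary weight [1 - m']. *)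
Lemma rmap_law n (v : 'rV[R]_n) (f : 'rV[R]_n -> \bar R) :
  measurable_fun setT f -> (forall x, 0 <= f x) ->
  \int[gauss n]_g \int[unif]_u f (rmap v g u) = \int[gauss n]_g f g.
Proof.
move=> mf f0; have [->|v0] := eqVneq v 0%R.
  by apply: eq_integral => g _; under eq_integral do rewrite rmap0; exact: integral_prob_cst.
set e := ((enorm v)^-1 *: v)%R.
have nv : (enorm v != 0)%R by rewrite enorm_eq0.
have e1 : inner e e = 1%R by rewrite /e innerZl innerZr -sqr_enorm; field.
have ev g : inner (reflect e g) v = (- inner g v)%R.
  rewrite /reflect /e innerBl !innerZl (innerC v g) -sqr_enorm; field; exact: nv.
pose m g := mprob (- inner g v - inner v v / 2).
pose m' g := mprob (inner g v - inner v v / 2).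
have mm : measurable_fun setT m.
  apply: (measurableT_comp measurable_mprob); apply: measurable_funB => //.
  by apply: measurableT_comp => //; exact: measurable_inner.
have mm' : measurable_fun setT m'.
  apply: (measurableT_comp measurable_mprob); apply: measurable_funB => //.
  exact: measurable_inner.
have mfa : measurable_fun setT (fun g : 'rV[R]_n => f (g + v)%R).
  by apply: (measurableT_comp mf); exact: measurable_rVD.
have mfr : measurable_fun setT (fun g => f (reflect e g)).
  by apply: (measurableT_comp mf); exact: measurable_reflect.
have m0 g : (0 <= 1 - m g)%R by rewrite subr_ge0 mprob_le1.
have m0' g : (0 <= 1 - m' g)%R by rewrite subr_ge0 mprob_le1.
under eq_integral => g _ do rewrite /rmap integral_unif_if ?expR_ge0//.
rewrite ge0_integralD//; last 4 first.
- by move=> g _; rewrite mule_ge0// lee_fin mprob_ge0.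
- by apply: emeasurable_funM => //; exact/measurable_EFinP.
- by move=> g _; rewrite mule_ge0// lee_fin m0.
- by apply: emeasurable_funM => //; apply/measurable_EFinP; exact: measurable_funB.
have -> : \int[gauss n]_g (f (g + v)%R * (m g)%:E) = \int[gauss n]_g (f g * (m' g)%:E).
  have := @gauss_shift R n v (fun w : 'rV[R]_n => f w * (m (w - v)%R)%:E).
  have h1 : measurable_fun setT (fun w : 'rV[R]_n => f w * (m (w - v)%R)%:E).
    apply: emeasurable_funM => //; apply/measurable_EFinP.
    by apply: (measurableT_comp mm); exact: measurable_rVB.
  move=> /(_ h1) h2.
  rewrite (_ : \int[gauss n]_g (f (g + v)%R * (m g)%:E) =
     \int[gauss n]_g (f (g + v)%R * (m (g + v - v)%R)%:E)); last first.
    by apply: eq_integral => g _; rewrite addrK.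
  rewrite h2; last by move=> x; rewrite mule_ge0// lee_fin mprob_ge0.
  apply: eq_integral => g _; rewrite -muleA -EFinM; congr (_ * EFin _).
  by rewrite /m /m' -[RHS]mprobM innerBl; congr (mprob _ * _)%R; field.
have -> : \int[gauss n]_g (f (reflect e g) * (1 - m g)%:E) =
    \int[gauss n]_g (f g * (1 - m' g)%:E).
  have h1 : measurable_fun setT (fun w => f w * (1 - m' w)%:E).
    by apply: emeasurable_funM => //; apply/measurable_EFinP; exact: measurable_funB.
  have h2 w : 0 <= f w * (1 - m' w)%:E by rewrite mule_ge0// lee_fin.
  rewrite -(gauss_reflect h1 h2 e1).
  by apply: eq_integral => g _; rewrite /m' ev /m.
rewrite -ge0_integralD//.
- apply: eq_integral => g _; rewrite -ge0_muleDr ?lee_fin ?mprob_ge0//.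
  by rewrite -EFinD addrC subrK mule1.
- by move=> g _; rewrite mule_ge0// lee_fin mprob_ge0.
- by apply: emeasurable_funM => //; exact/measurable_EFinP.
- by move=> g _; rewrite mule_ge0// lee_fin m0'.
- by apply: emeasurable_funM => //; apply/measurable_EFinP; exact: measurable_funB.
Qed.

(* The kernel of Brownian motion absorbed at 0, run for the time (2s)^2. *)
Definition absorb (s : R) (F : R -> R) (r : R) : \bar R :=
  \int[gauss1]_x (F 0 * mprob (- (r / s) * x - (r / s) ^+ 2 / 2) +
    F `|r + 2 * s * x| * (1 - mprob (- (r / s) * x - (r / s) ^+ 2 / 2)))%:E.

(** Only the noise component x along the unit vector e = - D/r matters: acceptance makes the points
    meet, rejection changes the distance r to |r + 2sx|. For r + 2sx >= 0 the acceptance probability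
    exp(- r (r + 2sx)/(2s^2)) is that of a Brownian bridge from r to r + 2sx over the time (2s)^2
    hitting 0, so the absorbed kernel appears without error. *)
Lemma dist_law n (s : R) (D : 'rV[R]_n) (F : R -> R) : (0 < s)%R ->
  measurable_fun setT F -> (forall x, 0 <= F x)%R ->
  \int[gauss n]_g \int[unif]_u
     (F (enorm (D + s *: (rmap (- (s^-1 *: D)) g u - g))))%:E
  = absorb s F (enorm D).
Proof.
move=> s0 mF F0.
have sn : (s != 0)%R by rewrite gt_eqF.
have [->|D0] := eqVneq D 0%R.
  rewrite /absorb enorm0 mul0r !oppr0 expr0n/= mul0r oppr0.
  transitivity (F 0%R)%:E.
    rewrite -[RHS](integral_prob_cst (gauss n)); apply: eq_integral => g _.
    rewrite -[RHS](integral_prob_cst unif); apply: eq_integral => u _.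
    by rewrite scaler0 oppr0 rmap0 subrr scaler0 addr0 enorm0.
  rewrite -[LHS](integral_prob_cst gauss1); apply: eq_integral => x _.
  by rewrite mul0r addr0 /mprob expR0 minxx mulr1 subrr mulr0 addr0.
set r := enorm D; have r0 : (0 < r)%R by rewrite enorm_gt0.
have rn : (r != 0)%R by rewrite gt_eqF.
pose e : 'rV[R]_n := (- (r^-1 *: D))%R.
have e1 : inner e e = 1%R by rewrite /e innerNl innerNr opprK innerZl innerZr -sqr_enorm -/r; field.
have vE : (- (s^-1 *: D) = (r / s) *: e)%R.
  by rewrite /e scalerN scalerA mulrAC divff// mul1r.
have nE : (enorm (- (s^-1 *: D)) = r / s)%R.
  by rewrite enormN enormZ ger0_norm ?invr_ge0 1?ltW// mulrC.
have DE : (D = (- r) *: e)%R by rewrite /e scalerN scaleNr opprK scalerA divff// scale1r.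
clearbody e.
transitivity (\int[gauss n]_g (fun x => (F 0 * mprob (- (r / s) * x - (r / s) ^+ 2 / 2) +
    F `|r + 2 * s * x| * (1 - mprob (- (r / s) * x - (r / s) ^+ 2 / 2)))%:E) (inner e g)).
  apply: eq_integral => g _.
  set p := (- inner g (- (s^-1 *: D)) - inner (- (s^-1 *: D)) (- (s^-1 *: D)) / 2)%R.
  have -> : (- (r / s) * inner e g - (r / s) ^+ 2 / 2 = p)%R.
    by rewrite /p -sqr_enorm nE vE innerZr (innerC g) mulNr.
  rewrite /rmap -/p.
  have F0' w : 0 <= (F (enorm (D + s *: (w - g)%R)))%:E by rewrite lee_fin.
  rewrite (integral_unif_if _ _ F0' (expR_ge0 _)).
  rewrite -EFinM -EFinM -EFinD -/(mprob p); congr (_ * _ + _ * _)%:E.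
    by rewrite addrAC subrr sub0r scalerN scalerA divff// scale1r subrr enorm0.
  congr F; rewrite nE vE scalerA (_ : ((r / s)^-1 * (r / s) = 1)%R); last by field; rewrite sn.
  rewrite scale1r (_ : (D + s *: (reflect e g - g))%R = (- (r + 2 * s * inner e g)) *: e); last first.
    rewrite /reflect; apply/rowP => i; have := congr1 (fun w : 'rV_n => w ord0 i) DE.
    by rewrite !mxE => ->; ring.
  rewrite enormZ.
  rewrite (_ : enorm e = 1%R); last by rewrite /enorm e1 sqrtr1.
  by rewrite mulr1 normrN.
have me : measurable_fun setT (fun x : R => mprob (- (r / s) * x - (r / s) ^+ 2 / 2)).
  apply: (measurableT_comp measurable_mprob); apply: measurable_funB => //.
apply: (@gauss_inner R n e (fun x => (F 0 * mprob (- (r / s) * x - (r / s) ^+ 2 / 2) +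
    F `|r + 2 * s * x| * (1 - mprob (- (r / s) * x - (r / s) ^+ 2 / 2)))%:E)) => //.
- apply/measurable_EFinP; apply: measurable_funD; first exact: measurable_funM.
  apply: measurable_funM; last exact: measurable_funB.
  apply: (measurableT_comp mF); apply: measurableT_comp => //.
  by apply: measurable_funD => //; exact: measurable_funM.
- by move=> x; rewrite lee_fin addr_ge0// mulr_ge0// ?mprob_ge0// subr_ge0 mprob_le1.
Qed.

(** Holds pointwise in the Gaussian variable: a larger start gives a larger end point and a smaller
    chance of absorption, and absorption yields the smallest value F 0. This allows the true
    distance to be replaced by an upper bound after each drift step. *)
Lemma absorb_mono (s : R) (F : R -> R) (r1 r2 : R) : (0 < s)%R ->
  measurable_fun setT F -> (forall x, 0 <= F x)%R ->
  (forall x y, 0 <= x -> x <= y -> F x <= F y)%R ->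
  (0 <= r1)%R -> (r1 <= r2)%R -> absorb s F r1 <= absorb s F r2.
Proof.
move=> s0 mF F0 Fmono r10 r12.
have me r : measurable_fun setT (fun x : R => mprob (- (r / s) * x - (r / s) ^+ 2 / 2)).
  apply: (measurableT_comp measurable_mprob); apply: measurable_funB => //.
have mJ r : measurable_fun setT (fun x : R =>
    (F 0 * mprob (- (r / s) * x - (r / s) ^+ 2 / 2) +
    F `|r + 2 * s * x| * (1 - mprob (- (r / s) * x - (r / s) ^+ 2 / 2)))%:E).
  apply/measurable_EFinP; apply: measurable_funD.
    by apply: measurable_funM => //; exact: me.
  apply: measurable_funM; last by apply: measurable_funB => //; exact: me.
  apply: (measurableT_comp mF); apply: measurableT_comp => //.
  by apply: measurable_funD => //; exact: measurable_funM.
apply: ge0_le_integral => //.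
- by move=> x _; rewrite lee_fin addr_ge0// mulr_ge0// ?mprob_ge0// subr_ge0 mprob_le1.
- exact: mJ.
- exact: mJ.
- move=> x _; rewrite lee_fin.
  have tE r : (- (r / s) * x - (r / s) ^+ 2 / 2 = - (r * (r + 2 * s * x) / (2 * s ^+ 2)))%R.
    by field; rewrite gt_eqF.
  rewrite !tE.
  set m1 := mprob _; set m2 := mprob _.
  have m2_0 := mprob_ge0 (- (r2 * (r2 + 2 * s * x) / (2 * s ^+ 2))).
  have m2_1 := mprob_le1 (- (r2 * (r2 + 2 * s * x) / (2 * s ^+ 2))).
  rewrite -/m2 in m2_0 m2_1.
  have Fb y : (0 <= y)%R -> (F 0 <= F y)%R by move=> y0; exact: Fmono.
  have s20 : (0 < 2 * s ^+ 2)%R by rewrite mulr_gt0// exprn_gt0.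
  have [A1|A1] := leP (r1 + 2 * s * x)%R 0%R.
    have -> : m1 = 1%R.
      rewrite /m1 /mprob minEle; case: ifP => // /negbT; rewrite -ltNge -[X in (_ < X)%R]expR0 ltr_expR.
      by rewrite oppr_lt0 ltNge pmulr_lle0 ?invr_gt0// mulr_ge0_le0.
    rewrite mulr1 subrr mulr0 addr0.
    have := Fb _ (normr_ge0 (r2 + 2 * s * x)%R); move: m2_0 m2_1; clearbody m2.
    by move: (F _) (F 0%R) => a z; nra.
  have A2 : (0 < r2 + 2 * s * x)%R by apply: lt_le_trans A1 _; rewrite lerD2r.
  have m12 : (m2 <= m1)%R.
    rewrite /m1 /m2 /mprob le_min ge_min lexx/= ge_min ler_expR lerN2.
    rewrite ler_pM2r ?invr_gt0// ler_pM ?(ltW A1) ?orbT ?lerD2r//.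
  have m11 := mprob_le1 (- (r1 * (r1 + 2 * s * x) / (2 * s ^+ 2))); rewrite -/m1 in m11.
  rewrite !gtr0_norm//.
  have F12 : (F (r1 + 2 * s * x) <= F (r2 + 2 * s * x))%R by apply: Fmono; rewrite ?lerD2r// ltW.
  have F1 := Fb _ (ltW A1); have F2 := Fb _ (ltW A2).
  move: F12 F1 F2; move: (F _) (F _) (F 0%R) => a c z *.
  have : (0 <= (1 - m1) * (a - c) + (m1 - m2) * (a - z))%R.
    by apply: addr_ge0; apply: mulr_ge0; rewrite subr_ge0.
  lra.
Qed.

End Coupling_map.

(** * Moments and integrability for the Gaussian measure *)

Section Moments.
Context {R : realType}.
Local Notation mu := (@lebesgue_measure R).
Local Notation gauss1 := (@gauss1 R).

Let phi (x : R) : R := normal_peak 1 * expR (- (x ^+ 2 / 2)).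

Let c0 : 0 < normal_peak (1 : R). Proof. by rewrite normal_peak_gt0// oner_eq0. Qed.

Let phi_ge0 x : 0 <= phi x.
Proof. by rewrite mulr_ge0 ?expR_ge0// ltW. Qed.

Let dphi (x : R) : is_derive x (1 : R) phi (- x * phi x).
Proof.
have h : is_derive x (1 : R) (fun x : R => - (x ^+ 2 / 2)) (- x).
  by apply: is_derive_eq; rewrite /GRing.scale/= ?expr1; field.
have h2 := is_derive1_comp (is_derive_expR _) h.
have h3 := is_deriveZ (normal_peak 1) h2.
by apply: is_derive_eq; rewrite /phi /GRing.scale/=; ring.
Qed.

Let dxphi (x : R) : is_derive x (1 : R) (fun x : R => - x * phi x) (x ^+ 2 * phi x - phi x).
Proof.
have h := dphi x; apply: is_derive_eq; rewrite /GRing.scale/=; ring.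
Qed.

Let cphi : continuous phi.
Proof.
move=> x; apply: differentiable_continuous; apply/derivable1_diffP.
exact: (@ex_derive _ _ _ _ _ _ _ (dphi x)).
Qed.

Let mphi : measurable_fun setT phi.
Proof. exact: continuous_measurable_fun. Qed.

Let gauss1E' (f : R -> R) : measurable_fun setT f -> (forall x, 0 <= f x) ->
  (\int[gauss1]_x (f x)%:E = \int[mu]_x (f x * phi x)%:E)%E.
Proof.
move=> mf f0; rewrite gauss1E//; last by exact/measurable_EFinP.
by apply: eq_integral => x _; rewrite normal_pdf1E EFinM.
Qed.

(** The tilted density is a multiple of the density of N(0, 2). *)
Lemma gauss1_exp_lty : (\int[gauss1]_x (expR (x ^+ 2 / 4))%:E < +oo)%E.
Proof.
rewrite gauss1E'//; last first.
  apply: measurableT_comp => //; apply: measurable_funM => //.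
pose s : R := Num.sqrt 2.
have s2 : s ^+ 2 = 2 by rewrite sqr_sqrtr.
have s0 : s != 0 by rewrite gt_eqF// sqrtr_gt0.
have p0 := normal_peak_gt0 s0.
have -> : (\int[mu]_x (expR (x ^+ 2 / 4) * phi x)%:E =
    \int[mu]_x ((normal_peak 1 / normal_peak s)%:E * (normal_pdf 0 s x)%:E))%E.
  apply: eq_integral => x _; rewrite -EFinM; congr EFin; rewrite normal_pdfE// /normal_fun subr0 s2 /phi.
  by rewrite mulrCA -expRD mulrA divfK ?gt_eqF//; congr (_ * expR _); field.
rewrite ge0_integralZl//.
- by rewrite integral_normal_pdf mule1 ltry.
- by apply/measurable_EFinP; exact: measurable_normal_pdf.
- by move=> x _; rewrite lee_fin normal_pdf_ge0.
- by rewrite lee_fin divr_ge0// ltW.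
Qed.

Let cvg_phi : phi x @[x --> +oo] --> (0 : R).
Proof.
rewrite -[X in _ --> X](mulr0 (normal_peak 1)); apply: cvgMr.
apply: (@squeeze_cvgr _ _ _ _ (fun=> 0) (fun x : R => expR (- (x / 2)))).
- near=> x; rewrite expR_ge0/= ler_expR lerN2 ler_pM2r ?invr_gt0//.
  by rewrite expr2 ler_peMl//; near: x; apply: nbhs_pinfty_ge; rewrite num_real.
- exact: cvg_cst.
- apply: (cvg_comp _ _ _ (@cvgr_expR R)).
  by apply: gt0_cvgMly => //; rewrite invr_gt0.
Unshelve. all: by end_near. Qed.

(** Stein's identity E[x h(x)] = E[h'(x)] for h the truncation of x to [-r, r]. In [absorb_le] it
    turns the second-order term at the boundary into a survival probability. *)
Lemma gauss1_Stein (r : R) : 0 < r ->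
  (\int[gauss1]_x (`|x| * Num.min `|x| r)%:E = gauss1 [set x | (`|x| <= r)%R])%E.
Proof.
move=> r0.
have mset : measurable [set x : R | `|x| <= r].
  have -> : [set x : R | `|x| <= r] = `[- r, r]%classic.
    by apply/seteqP; split=> x /=; rewrite in_itv/= ler_norml.
  exact: measurable_itv.
rewrite gauss1E'; last 2 first.
- apply: measurable_funM; first exact: normr_measurable.
  by apply: measurable_minr => //; exact: normr_measurable.
- by move=> x; rewrite mulr_ge0// le_min normr_ge0 ltW.
have -> : (gauss1 [set x | (`|x| <= r)%R] = \int[mu]_(x in `[(- r)%R, r]) (phi x)%:E)%E.
  rewrite /gauss1/= /normal_prob.
  have -> : [set x : R | `|x| <= r] = `[- r, r]%classic.
    by apply/seteqP; split=> x /=; rewrite in_itv/= ler_norml.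
  by apply: eq_integral => x _; rewrite normal_pdf1E.
pose h x : R := if r < x then r * x * phi x else 0.
pose A x : R := if (- r <= x <= r) then x ^+ 2 * phi x else 0.
have h0 x : 0 <= h x.
  by rewrite /h; case: ifP => // rx; rewrite !mulr_ge0 ?phi_ge0// ltW// (lt_trans r0).
have A0 x : 0 <= A x by rewrite /A; case: ifP => // rx; rewrite mulr_ge0 ?sqr_ge0.
have mh : measurable_fun setT h.
  apply: measurable_fun_ifT => //; first exact: measurable_realfun.measurable_fun_ltr.
  by apply: measurable_funM => //; exact: measurable_funM.
have mA : measurable_fun setT A.
  apply: measurable_fun_ifT => //; last by apply: measurable_funM.
  by apply: measurable_and; exact: measurable_realfun.measurable_fun_ler.
have -> : (\int[mu]_x (`|x| * Num.min `|x| r * phi x)%:E =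
    \int[mu]_x ((A x)%:E + ((h x)%:E + (h (- x))%:E)))%E.
  apply: eq_integral => x _; rewrite -!EFinD; congr EFin; rewrite /A /h -ler_norml.
  have [xr|xr] := leP `|x| r.
    have /andP[x1 x2] : - r <= x <= r by rewrite -ler_norml.
    rewrite ltNge x2/= ltrNr ltNge x1/= !addr0.
    by rewrite -normrM -expr2 ger0_norm ?sqr_ge0.
  rewrite add0r; have [x0|x0] := leP 0 x.
    move: xr; rewrite ger0_norm// => xr; rewrite xr ltrNr ltNge.
    rewrite (_ : - r <= x) ?addr0; last by apply: le_trans x0; rewrite oppr_le0 ltW.
    ring.
  move: xr; rewrite ltr0_norm// => xr; rewrite xr ltNge.
  rewrite (_ : x <= r) ?add0r; last by apply/ltW/(lt_trans x0).
  by rewrite /phi sqrrN; ring.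
rewrite ge0_integralD//; last 4 first.
- by move=> x _; rewrite lee_fin.
- exact/measurable_EFinP.
- by move=> x _; rewrite adde_ge0 ?lee_fin.
- apply: emeasurable_funD; apply/measurable_EFinP => //.
  by apply: (measurableT_comp mh); exact: measurable_funN.
rewrite ge0_integralD//; last 4 first.
- by move=> x _; rewrite lee_fin.
- exact/measurable_EFinP.
- by move=> x _; rewrite lee_fin.
- apply/measurable_EFinP => //.
  by apply: (measurableT_comp mh); exact: measurable_funN.
rewrite (integral_opp (f := fun x => (h x)%:E)); last 2 first.
- exact/measurable_EFinP.
- by move=> x; rewrite lee_fin.
have -> : (\int[mu]_x (h x)%:E = (r * phi r)%:E)%E.
  transitivity (\int[mu]_(x in `]r, +oo[) (r * (x * phi x))%:E)%E.
    rewrite [RHS]integral_mkcond; apply: eq_integral => x _; rewrite patchE mem_setE in_itv/= andbT /h.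
    by case: ifP => //; rewrite mulrA.
  rewrite integral_itv_obnd_cbnd; last first.
    by apply/measurable_EFinP; do 2 apply: measurable_funM => //; apply: measurable_funS mphi.
  under eq_integral do rewrite EFinM.
  rewrite ge0_integralZl//; last 3 first.
  - by apply/measurable_EFinP; apply: measurable_funM => //; apply: measurable_funS mphi.
  - move=> x; rewrite /= in_itv/= andbT => rx.
    by rewrite lee_fin mulr_ge0// (le_trans (ltW r0)).
  - by rewrite lee_fin ltW.
  rewrite (@ge0_continuous_FTC2y _ _ (fun x => - phi x) r 0).
  - by rewrite -EFinB sub0r opprK -EFinM.
  - by move=> x rx; rewrite mulr_ge0// (le_trans (ltW r0)).
  - by apply: continuous_subspaceT => x; apply: cvgM => //; exact: cphi.
  - by rewrite -oppr0; apply: cvgN; exact: cvg_phi.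
  - by move=> x _; have h1 := is_deriveN (dphi x); exact: ex_derive.
  - by apply: cvgN; apply: cvg_at_right_filter; exact: cphi.
  - move=> x _; rewrite derive1E; have h1 := is_deriveN (dphi x).
    by rewrite derive_val mulNr opprK.
have -> : (\int[mu]_x (A x)%:E = \int[mu]_(x in `[(- r)%R, r]) (x ^+ 2 * phi x)%:E)%E.
  rewrite [RHS]integral_mkcond; apply: eq_integral => x _; rewrite patchE mem_setE in_itv/= /A.
  by case: ifP.
have ic (f : R -> R) : continuous f -> mu.-integrable `[- r, r] (EFin \o f).
  move=> cf; apply: continuous_compact_integrable; first exact: segment_compact.
  exact: continuous_subspaceT.
have i1 : mu.-integrable `[- r, r] (EFin \o (fun x => x ^+ 2 * phi x)).
  by apply: ic => x; apply: cvgM; [exact: exprn_continuous|exact: cphi].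
have i2 : mu.-integrable `[- r, r] (EFin \o phi) by exact: ic.
have : (\int[mu]_(x in `[(- r)%R, r]) (x ^+ 2 * phi x - phi x)%:E = (- r * phi r)%:E - (r * phi r)%:E)%E.
  rewrite (@continuous_FTC2 _ _ (fun x => - x * phi x) (- r) r).
  - by rewrite /phi opprK sqrrN.
  - by rewrite gtrN.
  - apply: continuous_subspaceT => x; apply: cvgB; last exact: cphi.
    by apply: cvgM; [exact: exprn_continuous|exact: cphi].
  - have c : continuous (fun x : R => - x * phi x).
      move=> x; apply: differentiable_continuous; apply/derivable1_diffP.
      exact: (@ex_derive _ _ _ _ _ _ _ (dxphi x)).
    split => [x _| |].
    + exact: (@ex_derive _ _ _ _ _ _ _ (dxphi x)).
    + by apply: cvg_at_right_filter; exact: c.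
    + by apply: cvg_at_left_filter; exact: c.
  - by move=> x _; rewrite derive1E; exact: (@derive_val _ _ _ _ _ _ _ (dxphi x)).
rewrite integralB_EFin//.
have := integrable_fin_num _ i1; have := integrable_fin_num _ i2.
rewrite /comp /= => /(_ _)/fineK <-// /(_ _)/fineK <-//.
rewrite -!EFinB -!EFinD => -[] h1; congr EFin; lra.
Qed.

(** The monotone limit of [gauss1_Stein] as the truncation level grows. *)
Lemma gauss1_second_moment : (\int[gauss1]_x (x ^+ 2)%:E = 1)%E.
Proof.
pose g n (x : R) : \bar R := (`|x| * Num.min `|x| n.+1%:R)%:E.
have mg n : measurable_fun setT (g n).
  apply/measurable_EFinP; apply: measurable_funM; first exact: normr_measurable.
  by apply: measurable_minr => //; exact: normr_measurable.
have := @cvg_monotone_convergence _ _ R gauss1 setT measurableT g mg.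
have g0 n x : [set: R] x -> (0 <= g n x)%E by move=> _; rewrite lee_fin mulr_ge0// le_min normr_ge0.
move=> /(_ g0) h.
have {h} := h _ => h.
have h1 : (\int[gauss1]_x g n x)%E @[n --> \oo] --> (\int[gauss1]_x limn (g^~ x))%E.
  apply: h => x _ m n mn; rewrite lee_fin ler_wpM2l//.
  by rewrite le_min ge_min lexx/= ge_min ler_nat ltnS mn orbT.
have h2 : (\int[gauss1]_x limn (g^~ x) = \int[gauss1]_x (x ^+ 2)%:E)%E.
  apply: eq_integral => x _; apply: cvg_lim => //.
  apply: cvg_near_cst; near=> n; rewrite /g (min_idPl _) -?normrM -?expr2 1?[`|x ^+ 2|]ger0_norm ?sqr_ge0//.
  apply: (@le_trans _ _ n%:R); last by rewrite ler_nat.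
  by near: n; exact: nbhs_infty_ger.
rewrite h2 in h1.
apply: (cvg_unique _ h1) => //.
have -> : (fun n => \int[gauss1]_x g n x)%E = (fun n => gauss1 [set x | `|x| <= n.+1%:R]).
  by apply/funext => n; rewrite gauss1_Stein.
rewrite -(probability_setT gauss1).
have <- : \bigcup_n [set x : R | `|x| <= n.+1%:R] = setT.
  apply/seteqP; split => // x _; exists (Num.bound `|x|) => //=.
  by rewrite ltW// (lt_le_trans (archi_boundP _))// ler_nat.
apply: nondecreasing_cvg_mu.
- move=> n; have -> : [set x : R | `|x| <= n.+1%:R] = `[- n.+1%:R, n.+1%:R]%classic.
    by apply/seteqP; split=> x /=; rewrite in_itv/= ler_norml.
  exact: measurable_itv.
- by apply: bigcup_measurable => n _; have -> : [set x : R | `|x| <= n.+1%:R] = `[- n.+1%:R, n.+1%:R]%classic;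
    [apply/seteqP; split=> x /=; rewrite in_itv/= ler_norml|exact: measurable_itv].
- move=> n m nm; apply/subsetPset => x /= h3; apply: le_trans h3 _.
  by rewrite ler_nat ltnS.
Unshelve. all: by end_near. Qed.

Lemma gauss1_integrable (C : R) (f : R -> R) : measurable_fun setT f ->
  (forall x, `|f x| <= C * (1 + x ^+ 4)) -> gauss1.-integrable setT (EFin \o f).
Proof.
move=> mf fC.
(* 65 = 1 + 64: with y = x^2/4, the bound (1 + y/2)^2 <= e^y gives x^4 = 16 y^2 <= 64 e^y. *)
apply: (@le_integrable _ _ _ gauss1 setT measurableT _ (fun x => (C * 65 * expR (x ^+ 2 / 4))%:E)).
- exact/measurable_EFinP.
- move=> x _; rewrite /= lee_fin (le_trans (fC x))//.
  have C0 : 0 <= C by have := fC 0; rewrite expr0n/= addr0 mulr1; exact: le_trans.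
  rewrite ger0_norm ?mulr_ge0// ?expR_ge0// -mulrA ler_wpM2l//.
  set y := x ^+ 2 / 4.
  have y0 : 0 <= y by rewrite divr_ge0// sqr_ge0.
  have -> : x ^+ 4 = 16 * y ^+ 2 by rewrite /y; field.
  have e1 : 1 + y <= expR y by exact: expR_ge1Dx.
  have e2 : 1 + y / 2 <= expR (y / 2) by exact: expR_ge1Dx.
  have e3 : expR y = expR (y / 2) ^+ 2 by rewrite expr2 -expRD -splitr.
  have : (1 + y / 2) ^+ 2 <= expR y by rewrite e3 lerXn2r ?nnegrE ?expR_ge0// addr_ge0// divr_ge0.
  nra.
- apply/integrableP; split.
    apply/measurable_EFinP; apply: measurable_funM => //; apply: measurableT_comp => //.
    by apply: measurable_funM.
  have C0 : 0 <= C by have := fC 0; rewrite expr0n/= addr0 mulr1; exact: le_trans.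
  rewrite (_ : (\int[_]_(x in _) _)%E = (\int[gauss1]_x ((C * 65)%:E * (expR (x ^+ 2 / 4))%:E))%E); last first.
    by apply: eq_integral => x _; rewrite /= ger0_norm ?mulr_ge0// ?expR_ge0// EFinM.
  rewrite ge0_integralZl//; last 2 first.
  - by apply/measurable_EFinP; apply: measurableT_comp => //; apply: measurable_funM.
  - by rewrite lee_fin mulr_ge0.
  apply: lte_mul_pinfty; rewrite ?lee_fin ?mulr_ge0//; exact: gauss1_exp_lty.
Qed.

End Moments.

(** * Absorbed random walks and supersolutions *)

Section Absorbed_step.
Context {R : realType}.
Local Notation mu := (@lebesgue_measure R).
Local Notation gauss1 := (@gauss1 R).

Lemma gauss1_opp (f : R -> \bar R) : measurable_fun setT f -> (forall x, 0 <= f x)%E ->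
  (\int[gauss1]_x f (- x)%R = \int[gauss1]_x f x)%E.
Proof.
move=> mf f0; rewrite !gauss1E//; last first.
  by apply: (measurableT_comp mf); exact: measurable_funN.
rewrite -(integral_opp (f := fun x => f x * (normal_pdf 0 1 x)%:E)%E).
- by apply: eq_integral => x _; rewrite !normal_pdf1E sqrrN.
- apply: emeasurable_funM => //; apply/measurable_EFinP; exact: measurable_normal_pdf.
- by move=> x; rewrite mule_ge0// lee_fin normal_pdf_ge0.
Qed.

Lemma gauss1_shift (a : R) (f : R -> \bar R) : measurable_fun setT f ->
  (forall x, 0 <= f x)%E ->
  (\int[gauss1]_x f (x + a)%R = \int[gauss1]_x (f x * (expR (a * x - a ^+ 2 / 2))%:E))%E.
Proof.
move=> mf f0; rewrite !gauss1E//; last 3 first.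
- apply: emeasurable_funM => //; apply/measurable_EFinP; apply: measurableT_comp => //.
  by apply: measurable_funB => //; exact: measurable_funM.
- by move=> x; rewrite mule_ge0// lee_fin expR_ge0.
- by apply: (measurableT_comp mf); exact: measurable_funD.
rewrite -(integral_shift a (f := fun x => f x * (expR (a * x - a ^+ 2 / 2))%:E * (normal_pdf 0 1 x)%:E)%E).
- apply: eq_integral => x _; rewrite -muleA -EFinM !normal_pdf1E; congr (_ * EFin _)%E.
  by rewrite mulrCA -expRD; congr (_ * expR _); field.
- apply: emeasurable_funM => //; last first.
    by apply/measurable_EFinP; exact: measurable_normal_pdf.
  apply: emeasurable_funM => //; apply/measurable_EFinP; apply: measurableT_comp => //.
  by apply: measurable_funB => //; exact: measurable_funM.
- by move=> x; rewrite !mule_ge0// lee_fin ?expR_ge0 ?normal_pdf_ge0.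
Qed.

Definition oddext (F : R -> R) z : R := if 0 <= z then F z else - F (- z).

(** The reflection principle: for F vanishing at 0, the absorbed kernel is the free Gaussian kernel
    applied to the odd extension of F. Averaging over x and - x makes odd-order Taylor terms cancel
    pointwise. *)
Lemma absorb_sym (s : R) (F : R -> R) (r C : R) : 0 < s -> 0 < r ->
  measurable_fun setT F -> (forall x, 0 <= F x) -> F 0 = 0 ->
  (forall x, F x <= C * (1 + x ^+ 4)) ->
  absorb s F r =
  (\int[gauss1]_x ((oddext F (r + 2 * s * x) + oddext F (r - 2 * s * x)) / 2))%:E /\
  gauss1.-integrable setT (EFin \o (fun x => (oddext F (r + 2 * s * x) + oddext F (r - 2 * s * x)) / 2)).
Proof.
move=> s0 r0 mF F0 F00 FC.
have C0 : 0 <= C by have := FC 0; rewrite F00 expr0n/= addr0 mulr1.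
pose z x : R := r + 2 * s * x.
pose G x := if 0 < z x then F (z x) else 0.
pose N x := if z x < 0 then F (- z x) else 0.
have mz : measurable_fun setT z by apply: measurable_funD => //; exact: measurable_funM.
have mG : measurable_fun setT G.
  apply: measurable_fun_ifT => //; first exact: measurable_realfun.measurable_fun_ltr.
  exact: (measurableT_comp mF).
have mN : measurable_fun setT N.
  apply: measurable_fun_ifT => //; first exact: measurable_realfun.measurable_fun_ltr.
  by apply: (measurableT_comp mF); exact: measurable_funN.
have G0 x : 0 <= G x by rewrite /G; case: ifP.
have N0 x : 0 <= N x by rewrite /N; case: ifP.
pose C' := C * (1 + 8 * r ^+ 4 + 128 * s ^+ 4).
have zb x : C * (1 + z x ^+ 4) <= C' * (1 + x ^+ 4).
  rewrite /C' -mulrA ler_wpM2l//.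
  have h : z x ^+ 4 <= 8 * (r ^+ 4 + (2 * s * x) ^+ 4).
    rewrite /z; move: (2 * s * x) => y.
    have h1 : (r + y) ^+ 2 <= 2 * (r ^+ 2 + y ^+ 2) by have := sqr_ge0 (r - y); nra.
    have -> : (r + y) ^+ 4 = ((r + y) ^+ 2) ^+ 2 by rewrite -exprM.
    have h2 : ((r + y) ^+ 2) ^+ 2 <= (2 * (r ^+ 2 + y ^+ 2)) ^+ 2.
      by rewrite lerXn2r ?nnegrE ?sqr_ge0// mulr_ge0// addr_ge0// sqr_ge0.
    apply: le_trans h2 _; have := sqr_ge0 (r ^+ 2 - y ^+ 2); nra.
  have h4 : (2 * s * x) ^+ 4 = 16 * (s ^+ 4 * x ^+ 4) by ring.
  rewrite h4 in h.
  have x4 : 0 <= x ^+ 4 by rewrite exprn_even_ge0.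
  have r4 : 0 <= r ^+ 4 by rewrite exprn_even_ge0.
  have s4 : 0 <= s ^+ 4 by rewrite exprn_even_ge0.
  have rx := mulr_ge0 r4 x4.
  rewrite mulrDl mulrDl mul1r !mulrDr !mulr1; rewrite -!mulrA; lra.
have C'0 : 0 <= C'.
  by rewrite mulr_ge0// !addr_ge0// mulr_ge0// exprn_even_ge0.
have Gb x : G x <= C' * (1 + x ^+ 4).
  rewrite /G; case: ifP => _; first exact: le_trans (FC _) (zb x).
  by rewrite mulr_ge0// addr_ge0// exprn_even_ge0.
have Nb x : N x <= C' * (1 + x ^+ 4).
  rewrite /N; case: ifP => _.
    by apply: le_trans (FC _) _; rewrite (_ : (- z x) ^+ 4 = z x ^+ 4); [exact: zb|ring].
  by rewrite mulr_ge0// addr_ge0// exprn_even_ge0.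
have int1 (H : R -> R) : measurable_fun setT H -> (forall x, 0 <= H x) ->
    (forall x, H x <= C' * (1 + x ^+ 4)) ->
    [/\ gauss1.-integrable setT (EFin \o H),
       gauss1.-integrable setT (EFin \o (fun x => H (- x))) &
       \int[gauss1]_x H (- x) = \int[gauss1]_x H x].
  move=> mH H0 Hb; have mH' : measurable_fun setT (fun x : R => H (- x)).
    by apply: (measurableT_comp mH); exact: measurable_funN.
  split.
  - by apply: (gauss1_integrable mH (C := C')) => x; rewrite ger0_norm.
  - apply: (gauss1_integrable mH' (C := C')) => x; rewrite ger0_norm//.
    by rewrite (le_trans (Hb _))// (_ : (- x) ^+ 4 = x ^+ 4)//; ring.
  - rewrite /Rintegral; congr fine.
    rewrite -[RHS](gauss1_opp (f := fun x => (H x)%:E))//.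
    exact/measurable_EFinP.
have [iG iG' GE] := int1 G mG G0 Gb.
have [iN iN' NE] := int1 N mN N0 Nb.
have oE x : (oddext F (r + 2 * s * x) + oddext F (r - 2 * s * x)) / 2 =
    2^-1 * ((G x + G (- x)) - (N x + N (- x))).
  have e y : oddext F (z y) = G y - N y.
    rewrite /oddext /G /N; case: (ltgtP 0 (z y)) => h; rewrite ?subr0 ?sub0r//.
    by rewrite -h F00.
  have -> : r - 2 * s * x = z (- x) by rewrite /z mulrN.
  by rewrite -/(z x) !e; field.
have i2 : gauss1.-integrable setT (EFin \o (fun x => (G x + G (- x)) - (N x + N (- x)))).
  exact: (integrableB measurableT (integrableD measurableT iG iG')
    (integrableD measurableT iN iN')).
split; last first.
  rewrite (_ : (fun x => _ / 2) = (fun x => 2^-1 * ((G x + G (- x)) - (N x + N (- x))))).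
    exact: (integrableZl measurableT _ i2).
  by apply/funext => x; rewrite oE.
under eq_Rintegral do rewrite oE.
rewrite RintegralZl// RintegralB//; last 2 first.
- exact: (integrableD measurableT iG iG').
- exact: (integrableD measurableT iN iN').
rewrite !RintegralD// GE NE.
rewrite (_ : 2^-1 * _ = \int[gauss1]_x G x - \int[gauss1]_x N x); last by field.
pose t x := - (r / s) * x - (r / s) ^+ 2 / 2.
have tE x : t x = - (r * z x / (2 * s ^+ 2)).
  by rewrite /t /z; field; rewrite gt_eqF.
pose J x := F 0 * mprob (t x) + F `|z x| * (1 - mprob (t x)).
have mt : measurable_fun setT t by apply: measurable_funB => //; exact: mulrl_measurable.
have mJ : measurable_fun setT J.
  apply: measurable_funD; apply: measurable_funM => //.
  - exact: (measurableT_comp measurable_mprob mt).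
  - by apply: (measurableT_comp mF); exact: measurableT_comp.
  - apply: measurable_funB => //; exact: (measurableT_comp measurable_mprob mt).
have J0 x : 0 <= J x.
  by rewrite addr_ge0// mulr_ge0// ?mprob_ge0// subr_ge0 mprob_le1.
have s2 : 0 < 2 * s ^+ 2 by rewrite mulr_gt0// exprn_gt0.
have JE x : J x + G x * expR (t x) = G x.
  rewrite /J /G F00 mul0r add0r; case: ltP => h.
    rewrite gtr0_norm// (_ : mprob _ = expR (t x)); first by ring.
    by rewrite /mprob (min_idPr _)// -[leRHS]expR0 ler_expR tE oppr_le0 divr_ge0 ?mulr_ge0// ltW.
  rewrite (_ : mprob _ = 1); first by ring.
  rewrite /mprob (min_idPl _)// -[leLHS]expR0 ler_expR tE oppr_ge0 pmulr_lle0 ?invr_gt0//.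
  by rewrite pmulr_rle0.
have mGt : measurable_fun setT (fun x => G x * expR (t x)).
  by apply: measurable_funM => //; exact: measurableT_comp.
have h1 : (absorb s F r + \int[gauss1]_x (G x * expR (t x))%:E = \int[gauss1]_x (G x)%:E)%E.
  rewrite /absorb -ge0_integralD//.
  - by apply: eq_integral => x _; rewrite -EFinD -/(t x) -/(z x) -/(J x) JE.
  - by move=> x _; rewrite lee_fin; exact: J0.
  - by apply/measurable_EFinP; exact: mJ.
  - by move=> x _; rewrite lee_fin mulr_ge0// expR_ge0.
  - exact/measurable_EFinP.
(* A Cameron-Martin shift by r/s followed by x -> - x sends [z] to [- z]: the mass lost by
   absorption equals the mass of the reflected path. *)
have h2 : (\int[gauss1]_x (G x * expR (t x))%:E = \int[gauss1]_x (N x)%:E)%E.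
  transitivity (\int[gauss1]_x (G (x - r / s))%:E)%E.
    have mGE : measurable_fun setT (fun x => (G x)%:E) by exact/measurable_EFinP.
    rewrite (gauss1_shift (- (r / s)) mGE); last by move=> x; rewrite lee_fin.
    by apply: eq_integral => x _; rewrite EFinM sqrrN.
  rewrite -(gauss1_opp (f := fun x => (G (x - r / s))%:E)).
  - apply: eq_integral => x _; congr EFin; rewrite /G /N.
    have -> : z (- x - r / s) = - z x by rewrite /z; field; rewrite gt_eqF.
    by rewrite oppr_gt0.
  - apply/measurable_EFinP; apply: (measurableT_comp mG); exact: measurable_funD.
  - by move=> x; rewrite lee_fin.
rewrite h2 in h1.
have fG := integrable_fin_num measurableT iG; have fN := integrable_fin_num measurableT iN.
rewrite EFinB /Rintegral !fineK// -h1 addeK//.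
Qed.

Lemma absorb0 (s : R) (F : R -> R) : 0 < s -> (forall x, 0 <= F x) -> F 0 = 0 ->
  absorb s F 0 = 0%E.
Proof.
move=> s0 F0 F00; rewrite /absorb.
under eq_integral do rewrite F00 mul0r add0r mul0r oppr0 mul0r expr0n/= mul0r subrr /mprob expR0 minxx subrr mulr0.
by rewrite integral0.
Qed.

Lemma Rintegral_gauss1_cst (c : R) : \int[gauss1]_x c = c.
Proof. by rewrite /Rintegral (integral_prob_cst gauss1). Qed.

Section Second_order.
Variables (f w q : R -> R) (L : R).
Hypotheses (L0 : 0 <= L) (f0 : f 0 = 0) (q0 : 0 <= q 0).
Hypothesis taylor : forall a z, 0 <= a -> 0 <= z ->
  f z <= f a + w a * (z - a) - q a * (z - a) ^+ 2 / 4 + L * `|z - a| ^+ 3.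
Hypothesis taylor0 : forall z, 0 <= z ->
  w 0 * z - q 0 * z ^+ 2 / 4 - L * z ^+ 3 <= f z.
Hypothesis qlip : forall a, 0 <= a -> `|q a - q 0| <= L * a.

(** For |y| <= r both points are nonnegative and f is expanded at r. For |y| > r the odd extension
    reverses the sign at one point, and f is expanded at 0 in the three points r + |y|, |y| - r and
    r. The term |y| min(|y|, r) covers both cases; for |y| > r this costs the nonnegative quantity
    q(0) r (|y| - r). *)
Lemma oddext_le (r y : R) : 0 <= r ->
  (oddext f (r + y) + oddext f (r - y)) / 2 <=
  f r - (q r - q 0) * y ^+ 2 / 4 - q 0 * (`|y| * Num.min `|y| r) / 4
  + 20 * L * `|y| ^+ 3.
Proof.
wlog y0 : y / 0 <= y => [h r0|r0].
  have [|/ltW y0] := leP 0 y; first by move=> ?; exact: h.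
  have := h (- y); rewrite oppr_ge0 opprK normrN sqrrN addrC => h'.
  exact: h'.
rewrite ger0_norm//.
have ql := qlip r0; rewrite ler_norml in ql; case/andP: ql => ql1 ql2.
have y3 : 0 <= y ^+ 3 by rewrite exprn_ge0.
have Ly3 := mulr_ge0 L0 y3.
have [yr|ry] := leP y r.
  have t1 := taylor r0 (addr_ge0 r0 y0).
  have ry0 : 0 <= r - y by rewrite subr_ge0.
  have t2 := taylor r0 ry0.
  rewrite /oddext (addr_ge0 r0 y0) ry0.
  move: t1 t2; rewrite [r + y - r]addrC addKr [r - y - r]addrC addKr normrN sqrrN ger0_norm// => t1 t2.
  rewrite -expr2; lra.
have nr : (0 <= r - y) = false by rewrite subr_ge0 leNgt ry.
rewrite /oddext (addr_ge0 r0 y0) nr opprB.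
have yr0 : 0 <= y - r by rewrite subr_ge0 ltW.
have t1 := taylor (lexx 0) (addr_ge0 r0 y0).
have t2 := taylor0 yr0; have t3 := taylor0 r0.
move: t1; rewrite f0 add0r !subr0 ger0_norm ?addr_ge0// => t1.
have c1 : (r + y) ^+ 3 <= 8 * y ^+ 3.
  have -> : 8 * y ^+ 3 = (2 * y) ^+ 3 by ring.
  by rewrite lerXn2r ?nnegrE ?addr_ge0 ?mulr_ge0//; lra.
have c2 : (y - r) ^+ 3 <= y ^+ 3 by rewrite lerXn2r ?nnegrE//; lra.
have c3 : r ^+ 3 <= y ^+ 3 by rewrite lerXn2r ?nnegrE// ltW.
have d1 := ler_wpM2l L0 c1; have d2 := ler_wpM2l L0 c2; have d3 := ler_wpM2l L0 c3.
have d4 : (q r - q 0) * y ^+ 2 <= L * y ^+ 3.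
  apply: (@le_trans _ _ (L * r * y ^+ 2)); first by rewrite ler_wpM2r ?sqr_ge0.
  by rewrite -mulrA ler_wpM2l// exprS ler_wpM2r ?sqr_ge0// ltW.
have d5 : 0 <= q 0 * (r * (y - r)) by rewrite !mulr_ge0.
move: t1 t2 t3 d1 d2 d3 d4 d5 Ly3.
rewrite ![L * (8 * _)]mulrCA.
set A := L * y ^+ 3; set B := L * (r + y) ^+ 3; set D := L * (y - r) ^+ 3; set E := L * r ^+ 3.
set K := (q r - q 0) * y ^+ 2.
have -> : (r + y) ^+ 2 = r ^+ 2 + 2 * (r * y) + y ^+ 2 by ring.
have -> : (y - r) ^+ 2 = r ^+ 2 - 2 * (r * y) + y ^+ 2 by ring.
rewrite (_ : r * (y - r) = r * y - r ^+ 2); last by ring.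
rewrite [y * r]mulrC -[20 * L * y ^+ 3]mulrA -/A.
clearbody A B D E K; lra.
Qed.

End Second_order.

Definition third_moment : R := \int[gauss1]_x (`|x| ^+ 3).

Definition pos01 (x : R) : R := if 0 < x then 1 else 0.

Lemma measurable_pos01 : measurable_fun setT pos01.
Proof.
apply: measurable_fun_ifT => //; exact: measurable_realfun.measurable_fun_ltr.
Qed.

Lemma pos01_ge0 x : 0 <= pos01 x. Proof. by rewrite /pos01; case: ifP. Qed.

Lemma pos01_le1 x : pos01 x <= 1. Proof. by rewrite /pos01; case: ifP. Qed.

Lemma oddext_pos01_le (K : realFieldType) (r y : K) : 0 < r ->
  ((if 0 <= r + y then (if 0 < r + y then (1 : K) else 0) else - (if 0 < - (r + y) then 1 else 0)) +
   (if 0 <= r - y then (if 0 < r - y then (1 : K) else 0) else - (if 0 < - (r - y) then 1 else 0))) / 2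
  <= (- r <= y <= r)%R%:R.
Proof.
move=> r0; case: (ltgtP 0 (r + y)); case: (ltgtP 0 (r - y)); rewrite ?oppr0 ?oppr_gt0 => h1 h2;
  case: (lerP (- r) y) => h3; case: (lerP y r) => h4 /=;
  rewrite ?h1 ?h2; lra.
Qed.

(** By the reflection principle survival requires 2s|x| <= r. The Stein term produces this same
    probability, which is why q(0) may be charged to the surviving mass only. *)
Lemma absorb_pos_le (s r : R) : 0 < s -> 0 < r ->
  (absorb s pos01 r <= gauss1 [set x | (`|x| <= r / (2 * s))%R])%E.
Proof.
move=> s0 r0.
have s2 : 0 < 2 * s by rewrite mulr_gt0.
have pb x : pos01 x <= 1 * (1 + x ^+ 4).
  by rewrite mul1r (le_trans (pos01_le1 _))// lerDl exprn_even_ge0.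
have p00 : pos01 0 = 0 by rewrite /pos01 ltxx.
have [-> i1] := absorb_sym s0 r0 measurable_pos01 pos01_ge0 p00 pb.
pose A := [set x : R | `|x| <= r / (2 * s)].
have mA : measurable A.
  have -> : A = `[- (r / (2 * s)), r / (2 * s)]%classic.
    by apply/seteqP; split=> x; rewrite /A/= in_itv/= ler_norml.
  exact: measurable_itv.
have -> : gauss1 A = (\int[gauss1]_x \1_A x)%:E.
  by rewrite /Rintegral integral_indic// setIT fineK// fin_num_measure.
rewrite lee_fin; apply: le_Rintegral => //.
  apply: (gauss1_integrable (C := 1)); first exact: measurable_indic.
  move=> x; rewrite mul1r; apply: (@le_trans _ _ 1); last by rewrite lerDl exprn_even_ge0.
  by rewrite indicE; case: (_ \in _); rewrite ?normr1 ?normr0.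
move=> x _; rewrite indicE.
have AE : (x \in A) = (`|2 * s * x| <= r).
  rewrite normrM (gtr0_norm s2) mulrC -ler_pdivlMr//.
  by apply/idP/idP; rewrite inE.
rewrite AE; move: (2 * s * x) => y; rewrite /oddext /pos01 ler_norml.
exact: oddext_pos01_le.
Qed.

Lemma third_moment_ge0 : 0 <= third_moment.
Proof. by apply: Rintegral_ge0 => x _; exact: exprn_ge0. Qed.

(* Discrete analogue of the generator inequality 2f'' <= -q: the part q(0) of
   the killing rate only acts until absorption. *)
Lemma absorb_le (f w q : R -> R) (L C s r : R) :
  0 <= L -> f 0 = 0 -> 0 <= q 0 ->
  (forall a z, 0 <= a -> 0 <= z ->
    f z <= f a + w a * (z - a) - q a * (z - a) ^+ 2 / 4 + L * `|z - a| ^+ 3) ->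
  (forall z, 0 <= z -> w 0 * z - q 0 * z ^+ 2 / 4 - L * z ^+ 3 <= f z) ->
  (forall a, 0 <= a -> `|q a - q 0| <= L * a) ->
  measurable_fun setT f -> (forall x, 0 <= f x) ->
  (forall x, f x <= C * (1 + x ^+ 4)) ->
  0 < s -> 0 <= r ->
  (absorb s f r + (s ^+ 2 * q 0)%:E * absorb s pos01 r <=
   (f r - s ^+ 2 * (q r - q 0) + 160 * L * third_moment * s ^+ 3)%:E)%E.
Proof.
move=> L0 f0 q0 taylor taylor0 qlip mf fge0 fC s0; rewrite le_eqVlt => /predU1P[<-|r0].
  rewrite !absorb0//; [|exact: pos01_ge0|by rewrite /pos01 ltxx].
  rewrite mule0 adde0 lee_fin f0 subrr mulr0 subr0 add0r.
  apply: mulr_ge0; last exact/exprn_ge0/ltW.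
  by apply: mulr_ge0; [exact: mulr_ge0|exact: third_moment_ge0].
have s2 : 0 < 2 * s by rewrite mulr_gt0.
pose P := fine (gauss1 [set x | `|x| <= r / (2 * s)]).
have mA : measurable [set x : R | `|x| <= r / (2 * s)].
  have -> : [set x : R | `|x| <= r / (2 * s)] = `[- (r / (2 * s)), r / (2 * s)]%classic.
    by apply/seteqP; split=> x /=; rewrite in_itv/= ler_norml.
  exact: measurable_itv.
have PE : gauss1 [set x | `|x| <= r / (2 * s)] = P%:E by rewrite /P fineK// fin_num_measure.
have rs0 : 0 < r / (2 * s) by rewrite divr_gt0.
have i2 : gauss1.-integrable setT (EFin \o (fun x : R => x ^+ 2)).
  apply: (gauss1_integrable (C := 1)) => // x.
  rewrite mul1r ger0_norm ?sqr_ge0// (_ : x ^+ 4 = (x ^+ 2) ^+ 2); last by rewrite -exprM.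
  by have := sqr_ge0 (x ^+ 2 - 1); have := sqr_ge0 (x ^+ 2); nra.
have i3 : gauss1.-integrable setT (EFin \o (fun x : R => `|x| ^+ 3)).
  apply: (gauss1_integrable (C := 1)) => [|x].
    by apply: measurable_funX; exact: normr_measurable.
  rewrite mul1r ger0_norm ?exprn_ge0// (_ : x ^+ 4 = `|x| ^+ 4); last first.
    by rewrite -[RHS]ger0_norm ?exprn_ge0// -normrX normr_id ger0_norm// exprn_even_ge0.
  have y0 := normr_ge0 x; move: `|x| y0 => y y0.
  have [y1|y1] := leP y 1.
    by apply: (@le_trans _ _ 1); [exact: exprn_ile1|rewrite lerDl exprn_ge0].
  apply: (@le_trans _ _ (y ^+ 4)); last by rewrite lerDr.
  by rewrite ler_weXn2l// ltW.
have im : gauss1.-integrable setT (EFin \o (fun x : R => `|x| * Num.min `|x| (r / (2 * s)))).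
  apply: (gauss1_integrable (C := 1)) => [|x].
    apply: measurable_funM; first exact: normr_measurable.
    by apply: measurable_minr => //; exact: normr_measurable.
  have m0 : 0 <= Num.min `|x| (r / (2 * s)) by rewrite le_min normr_ge0 ltW.
  rewrite mul1r ger0_norm ?mulr_ge0//; apply: (@le_trans _ _ (x ^+ 2)).
    by rewrite -[x ^+ 2]ger0_norm ?sqr_ge0// normrX expr2 ler_wpM2l// ge_min lexx.
  rewrite (_ : x ^+ 4 = (x ^+ 2) ^+ 2); last by rewrite -exprM.
  by have := sqr_ge0 (x ^+ 2 - 1); have := sqr_ge0 (x ^+ 2); nra.
have E2 : \int[gauss1]_x (x ^+ 2) = 1 by rewrite /Rintegral gauss1_second_moment.
have Em : \int[gauss1]_x (`|x| * Num.min `|x| (r / (2 * s))) = P.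
  by rewrite /Rintegral gauss1_Stein.
have ic (c : R) : gauss1.-integrable setT (EFin \o (fun x : R => c)).
  by apply: (gauss1_integrable (C := `|c|)) => // x; rewrite ler_peMr// lerDl exprn_even_ge0.
(* [oddext_le] at y = 2sx, integrated: y^2/4 becomes s^2 x^2, the truncated term integrates to [P],
   and 20 (2s)^3 = 160 s^3. *)
have fb : (absorb s f r <= (f r - s ^+ 2 * (q r - q 0) - s ^+ 2 * q 0 * P + 160 * L * third_moment * s ^+ 3)%:E)%E.
  have [-> i1] := absorb_sym s0 r0 mf fge0 f0 fC.
  rewrite lee_fin.
  have j2 := integrableZl measurableT (s ^+ 2 * (q r - q 0)) i2.
  have jm := integrableZl measurableT (s ^+ 2 * q 0) im.
  have j3 := integrableZl measurableT (160 * L * s ^+ 3) i3.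
  have ja := integrableB measurableT (ic (f r)) j2.
  have jb := integrableB measurableT ja jm.
  have jc := integrableD measurableT jb j3.
  apply: (@le_trans _ _ (\int[gauss1]_x (f r - s ^+ 2 * (q r - q 0) * x ^+ 2
      - s ^+ 2 * q 0 * (`|x| * Num.min `|x| (r / (2 * s))) + 160 * L * s ^+ 3 * `|x| ^+ 3))).
    apply: le_Rintegral => // x _.
    have := oddext_le L0 f0 q0 taylor taylor0 qlip (2 * s * x) (ltW r0).
    rewrite -[r + - _]/(r - 2 * s * x); move/le_trans; apply.
    rewrite normrM (gtr0_norm s2) -[X in Num.min _ X](@divfK _ (2 * s)) ?gt_eqF//.
    rewrite [_ / (2 * s) * _]mulrC -minr_pMr ?(ltW s2)//.
    move: `|x| (Num.min _ _) => y m.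
    by rewrite le_eqVlt; apply/orP; left; apply/eqP; field.
  rewrite RintegralD// RintegralB// RintegralB// !RintegralZl// E2 Em -/third_moment Rintegral_gauss1_cst.
  by rewrite le_eqVlt; apply/orP; left; apply/eqP; ring.
have pb := absorb_pos_le s0 r0; rewrite PE in pb.
have sq0 : 0 <= s ^+ 2 * q 0 by rewrite mulr_ge0// sqr_ge0.
apply: le_trans (leeD fb (lee_wpmul2l _ pb)) _; first by rewrite lee_fin.
by rewrite -EFinM -EFinD lee_fin; lra.
Qed.

End Absorbed_step.

(** * Primitives, Taylor bounds and the one-step estimate for supersolutions *)

Section Calculus.
Context {R : realType}.
Implicit Types (F u f w q : R -> R) (a b x y z : R).

Definition primitive_of F u := forall x, is_derive x (1 : R) F (u x).

Lemma primitive_of_continuous F u x : primitive_of F u -> {for x, continuous F}.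
Proof.
move=> Fu; apply: differentiable_continuous; apply/derivable1_diffP.
exact: (@ex_derive _ _ _ _ _ _ _ (Fu x)).
Qed.

Lemma primitive_of_within F u a b : primitive_of F u ->
  {within `[a, b], continuous F}.
Proof.
by move=> Fu; apply: continuous_subspaceT => x; exact: primitive_of_continuous Fu.
Qed.

Lemma primitive_mvt F u a b : primitive_of F u -> a <= b ->
  exists2 c, a <= c <= b & F b - F a = u c * (b - a).
Proof.
move=> Fu ab.
have [||c] := @MVT_segment R F u a b ab.
- by move=> x _; exact: Fu.
- exact: primitive_of_within Fu.
- by rewrite in_itv/= => cab e; exists c.
Qed.

Lemma primitive_le F u a b : primitive_of F u -> a <= b ->
  (forall x, a <= x -> x <= b -> 0 <= u x) -> F a <= F b.
Proof.
move=> Fu ab u0; have [c /andP[ac cb] e] := primitive_mvt Fu ab.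
by rewrite -subr_ge0 e mulr_ge0// ?subr_ge0//; exact: u0.
Qed.

Lemma primitive_lip F u a b (K : R) : primitive_of F u ->
  (forall x, Num.min a b <= x -> x <= Num.max a b -> `|u x| <= K) ->
  `|F a - F b| <= K * `|a - b|.
Proof.
move=> Fu; wlog ab : a b / a <= b => [h|] uK.
  have [|/ltW ba] := leP a b; first by move=> ?; exact: h.
  by rewrite distrC [`|a - b|]distrC; apply: h => // x; rewrite minC maxC; exact: uK.
have [c /andP[ac cb] e] := primitive_mvt Fu ab.
rewrite distrC [`|a - b|]distrC e normrM ler_wpM2r//; apply: uK.
  by rewrite (min_idPl ab).
by rewrite (max_idPr ab).
Qed.

Lemma primitive_exists u : continuous u ->
  exists F, [/\ primitive_of F u, F 0 = 0 &
    forall x, 0 <= x -> F x = \int[lebesgue_measure]_(s in `[0, x]) u s].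
Proof.
move=> cu.
have iu a b : lebesgue_measure.-integrable `[a, b] (EFin \o u).
  by apply: continuous_compact_integrable; [exact: segment_compact|exact: continuous_subspaceT].
(* Integrating from - N makes the result differentiable on both sides of 0. The difference [F N] of
   two such integrals does not depend on N as long as N >= 0 and - N <= x. *)
pose G N x := \int[lebesgue_measure]_(s in `[- N, x]) u s.
have GE N N' x : N <= N' -> - N <= x -> G N' x - G N' (- N) = G N x.
  move=> NN' Nx; rewrite /G (@Rintegral_itvB R u (BLeft (- N')) (BRight x) (- N) (iu _ _)).
  - apply: Rintegral_itv_obnd_cbnd; apply: integrableS (iu (- N) x); [exact: measurable_itv|exact: measurable_itv|].
    by apply: subset_itvr; rewrite bnd_simp.
  - by rewrite bnd_simp lerN2.
  - by rewrite bnd_simp.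
pose F N x := G N x - G N 0.
have FE N N' x : 0 <= N -> N <= N' -> - N <= x -> F N' x = F N x.
  move=> N0 NN' Nx; rewrite /F -(GE N N' x)// -(GE N N' 0) ?oppr_le0//; ring.
exists (fun x => F (`|x| + 1) x); split.
- move=> x.
  have dF : is_derive x (1 : R) (F (`|x| + 2)) (u x).
    have x11 : x < x + 1 by rewrite ltrDl.
    have Nx : - (`|x| + 2) < x by have := ler_norm (- x); rewrite normrN; lra.
    have [d1 d2] := @continuous_FTC1_closed R u (- (`|x| + 2)) x (x + 1) x11 (iu _ _) Nx (cu x).
    have hG : is_derive x (1 : R) (G (`|x| + 2)) (u x) by split; [exact: d1|rewrite -derive1E; exact: d2].
    by apply: is_derive_eq; rewrite subr0.
  apply: near_eq_is_derive dF.
  have := @near_in_itvoo R (x - 1) (x + 1) x; rewrite in_itv/= ltrBlDr ltrDl ltr01 => /(_ isT).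
  apply: filterS => y; rewrite in_itv/= => /andP[y1 y2].
  have y3 : `|y| <= `|x| + 1.
    by rewrite ler_norml; have := ler_norm x; have := ler_norm (- x); rewrite normrN; lra.
  by apply: FE; rewrite ?addr_ge0//; have := ler_norm (- y); rewrite normrN; lra.
- by rewrite /F subrr.
- move=> x x0; rewrite (FE 0) ?addr_ge0 ?oppr0// /F /G oppr0 set_itv1 Rintegral_set1 subr0//.
Qed.

(** The mean value theorem twice: for w minus its linearization at a, where q is Lipschitz, and then
    for f. *)
Lemma taylor2 f w q (L a z : R) :
  primitive_of f w -> primitive_of w (fun x => - q x / 2) ->
  (forall x y, 0 <= x -> 0 <= y -> `|q x - q y| <= L * `|x - y|) -> 0 <= L ->
  0 <= a -> 0 <= z ->
  `|f z - f a - w a * (z - a) + q a * (z - a) ^+ 2 / 4| <= L * `|z - a| ^+ 3.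
Proof.
move=> fw wq qL L0 a0 z0.
have b1 x : 0 <= Num.min a z -> Num.min a z <= x -> 0 <= x by exact: le_trans.
have m0 : 0 <= Num.min a z by rewrite le_min a0.
have bd x : Num.min a z <= x -> x <= Num.max a z -> `|x - a| <= `|z - a|.
  rewrite ge_min le_max => /orP h1 /orP h2; rewrite ler_norml.
  have [za|za] := leP z a.
    rewrite ler0_norm ?subr_le0//; case: h1 => h1; case: h2 => h2; apply/andP; split; lra.
  rewrite gtr0_norm ?subr_gt0//; case: h1 => h1; case: h2 => h2; apply/andP; split; lra.
pose h x := w x - w a + q a / 2 * (x - a).
have hq : primitive_of h (fun x => (q a - q x) / 2).
  by move=> x; have := wq x => ?; apply: is_derive_eq; rewrite /GRing.scale/=; field.
have hb x : Num.min a z <= x -> x <= Num.max a z -> `|h x| <= L / 2 * `|z - a| ^+ 2.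
  move=> x1 x2; have x0 := b1 _ m0 x1.
  have ha : h a = 0 by rewrite /h !subrr mulr0 addr0.
  rewrite -[h x]subr0 -ha expr2 mulrA.
  apply: (@le_trans _ _ (L / 2 * `|z - a| * `|x - a|)); last first.
    by rewrite ler_wpM2l// ?bd// mulr_ge0// divr_ge0.
  apply: primitive_lip hq _.
  move=> y y1 y2.
  have y1' : Num.min a z <= y by apply: le_trans y1; rewrite le_min x1 ge_min lexx.
  have y2' : y <= Num.max a z by apply: le_trans y2 _; rewrite ge_max x2 le_max lexx.
  have y0 := b1 _ m0 y1'.
  rewrite normrM [`|2^-1|]ger0_norm// mulrAC ler_pM2r//.
  apply: le_trans (qL a y a0 y0) _; rewrite ler_wpM2l// distrC; exact: bd.
pose g x := f x - f a - w a * (x - a) + q a / 4 * (x - a) ^+ 2.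
have gh : primitive_of g h.
  move=> x; have := fw x => ?; apply: is_derive_eq; rewrite /GRing.scale/= /h ?expr1; by field.
have -> : f z - f a - w a * (z - a) + q a * (z - a) ^+ 2 / 4 = g z - g a.
  by rewrite /g !subrr; field.
apply: (@le_trans _ _ (L / 2 * `|z - a| ^+ 2 * `|z - a|)).
  apply: primitive_lip gh _.
  by move=> y; rewrite minC maxC; exact: hb.
rewrite -mulrA -exprSr ler_wpM2r ?exprn_ge0//; lra.
Qed.

(* A supersolution [f] of the sticky generator: [w = f'], [q = - 2 f''], and
   [q 0] is the rate gained while the distance is positive. *)
Record supersolution (g : R -> R) (c p : R) (f w q : R -> R) (L : R) : Prop := {
  sup_f0 : f 0 = 0 ;
  sup_fw : primitive_of f w ;
  sup_wq : primitive_of w (fun x => - q x / 2) ;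
  sup_L0 : 0 <= L ;
  sup_lip : forall x y, 0 <= x -> 0 <= y -> `|q x - q y| <= L * `|x - y| ;
  sup_w0 : forall x, 0 <= x -> 0 <= w x ;
  sup_q0 : 0 <= q 0 ;
  sup_gen : forall r, 0 <= r -> g r * w r - (q r - q 0) <= - (c * f r) + p }.

Definition pos_part x := Num.max x 0.

Lemma pos_part_ge0 x : 0 <= pos_part x.
Proof. by rewrite /pos_part le_max lexx orbT. Qed.

Lemma pos_part_id x : 0 <= x -> pos_part x = x.
Proof. by move=> x0; rewrite /pos_part (max_idPl x0). Qed.

Section Supersolution.
Context {g : R -> R} {c p : R} {f w q : R -> R} {L : R}.
Hypothesis S : supersolution g c p f w q L.

Lemma sup_mono x y : 0 <= x -> x <= y -> f x <= f y.
Proof.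
move=> x0 xy; apply: primitive_le (sup_fw S) xy _.
by move=> z xz _; apply: (sup_w0 S); exact: le_trans xz.
Qed.

Lemma sup_ge0 x : 0 <= x -> 0 <= f x.
Proof. by move=> x0; rewrite -(sup_f0 S) sup_mono. Qed.

Lemma sup_q_le x : 0 <= x -> `|q x| <= q 0 + L * x.
Proof.
move=> x0; have := sup_lip S x0 (lexx 0); rewrite subr0 (ger0_norm x0) => h.
by have := sup_q0 S; move: h; rewrite !ler_norml => /andP[h1 h2] q0; apply/andP; split; lra.
Qed.

Lemma sup_w_le x : 0 <= x -> w x <= w 0 + (q 0 + L * x) * x.
Proof.
move=> x0.
rewrite -lerBlDl; apply: le_trans (ler_norm _) _.
rewrite (_ : _ * x = (q 0 + L * x) * `|x - 0|); last by rewrite subr0 ger0_norm.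
apply: primitive_lip (sup_wq S) _.
move=> y; rewrite (min_idPr x0) (max_idPl x0) => y0 yx.
rewrite mulNr normrN normrM [`|2^-1|]ger0_norm//.
have := sup_q_le y0; have := ler_wpM2l (sup_L0 S) yx; have := normr_ge0 (q y); lra.
Qed.

Lemma sup_f_le : exists C, forall x, 0 <= x -> f x <= C * (1 + x ^+ 4).
Proof.
have w0 := sup_w0 S (lexx 0); have q0 := sup_q0 S; have L0 := sup_L0 S.
exists (2 * (w 0 + q 0 + L)) => x x0.
have [y /andP[y0 yx]] := primitive_mvt (sup_fw S) x0.
rewrite (sup_f0 S) !subr0 => ->.
have wy := sup_w_le y0.
have : w 0 + (q 0 + L * y) * y <= w 0 + (q 0 + L * x) * x.
  by rewrite lerD2l; apply: ler_pM => //; [by rewrite addr_ge0// mulr_ge0|rewrite lerD2l ler_wpM2l].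
move=> h; have {}h := le_trans wy h.
apply: (le_trans (ler_wpM2r x0 h)).
have x4 : x ^+ 4 = (x ^+ 2) ^+ 2 by rewrite -exprM.
have a1 : x <= 2 * (1 + x ^+ 4).
  rewrite x4; have := sqr_ge0 (x ^+ 2 - 1); have := sqr_ge0 (x - 1); have := sqr_ge0 (x ^+ 2); nra.
have a2 : x ^+ 2 <= 2 * (1 + x ^+ 4).
  rewrite x4; have := sqr_ge0 (x ^+ 2 - 1); have := sqr_ge0 (x ^+ 2); nra.
have a3 : x ^+ 3 <= 2 * (1 + x ^+ 4).
  have -> : x ^+ 3 = x * x ^+ 2 by rewrite exprS.
  rewrite x4; have := sqr_ge0 (x ^+ 2 - x); have := sqr_ge0 (x ^+ 2 - 1); have := sqr_ge0 (x ^+ 2); nra.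
have := ler_wpM2l w0 a1; have := ler_wpM2l q0 a2; have := ler_wpM2l L0 a3.
by move: (x ^+ 4) => t; rewrite !exprS expr0 mulr1; nra.
Qed.

Lemma measurable_sup : measurable_fun setT (f \o pos_part).
Proof.
apply: continuous_measurable_fun => x; apply: continuous_comp.
  by apply: (@continuous_max _ R^o); [exact: cvg_id|exact: cvg_cst].
exact: primitive_of_continuous (sup_fw S).
Qed.

(** The drift part of the step is handled by Taylor expansion at r, the noise part by [absorb_le].
    Everything that grows with the truncation is bounded by powers of [beta], so the error is of
    order s^3 beta^3, small against the time step s^2 once s beta^3 is small. [G] depends neither on
    s nor on beta. *)
Lemma supersolution_step (B : R) : 0 <= B -> exists2 G, 0 <= G &
  forall s beta r e : R, 0 < s -> s <= 1 -> 1 <= beta -> 0 <= r -> r <= beta ->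
    0 <= e -> e <= s ^+ 4 * beta -> `|g r| <= B * beta ->
    0 <= r + s ^+ 2 * g r + e ->
  (absorb s (f \o pos_part) (r + s ^+ 2 * g r + e)
    + (s ^+ 2 * q 0)%:E * absorb s pos01 (r + s ^+ 2 * g r + e)
  <= ((1 - s ^+ 2 * c) * f r + s ^+ 2 * (p + G * (s * beta ^+ 3)))%:E)%E.
Proof.
move=> B0.
have w0 := sup_w0 S (lexx 0); have q0 := sup_q0 S; have L0 := sup_L0 S.
have m3 := @third_moment_ge0 R; set m := third_moment in m3.
pose B1 := B + 1.
(* The coefficients of the five errors [e1] to [e5] bounded below. *)
exists (w 0 + q 0 + L + (q 0 + L) * B1 ^+ 2 + L * B1 ^+ 3 + L * B1 + 160 * L * m).
  by rewrite !addr_ge0 ?mulr_ge0 ?exprn_ge0 ?addr_ge0.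
move=> s b r e s0 s1 b1 r0 rb e0 eb gb rho0.
have [C fC] := sup_f_le.
set rho := r + s ^+ 2 * g r + e in rho0 *.
have hs : 0 <= s ^+ 2 by exact: sqr_ge0.
have s3 : s ^+ 4 <= s ^+ 3 by rewrite [s ^+ 4]exprS ler_piMl// exprn_ge0// ltW.
have dr : `|rho - r| <= s ^+ 2 * (B1 * b).
  rewrite /rho (_ : _ - r = s ^+ 2 * g r + e); last by ring.
  apply: le_trans (ler_normD _ _) _; rewrite normrM (ger0_norm hs) (ger0_norm e0).
  rewrite /B1 mulrDl mul1r mulrDr; apply: lerD; first exact: ler_wpM2l.
  apply: le_trans eb _; rewrite ler_wpM2r ?(le_trans ler01 b1)//.
  by rewrite ler_wiXn2l// ltW.
have fp x : 0 <= x -> (f \o pos_part) x = f x by move=> x0; rewrite /= pos_part_id.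
apply: le_trans (@absorb_le _ (f \o pos_part) w q L C s rho L0 _ q0 _ _ _ measurable_sup _ _ s0 rho0) _.
- by rewrite fp// (sup_f0 S).
- move=> a z a0 z0; rewrite !fp//.
  have := taylor2 (sup_fw S) (sup_wq S) (sup_lip S) L0 a0 z0; rewrite ler_norml; lra.
- move=> z z0; rewrite fp//.
  have := taylor2 (sup_fw S) (sup_wq S) (sup_lip S) L0 (lexx 0) z0.
  by rewrite ler_norml (sup_f0 S) !subr0 (ger0_norm z0); lra.
- by move=> a a0; have := sup_lip S a0 (lexx 0); rewrite subr0 (ger0_norm a0).
- by move=> x; apply: sup_ge0; exact: pos_part_ge0.
- move=> x; have [x0|x0] := leP 0 x; first by rewrite fp// fC.
  rewrite /= /pos_part (max_idPr (ltW x0)); apply: le_trans (fC 0 (lexx 0)) _.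
  have : 0 <= C by have := fC 0 (lexx 0); rewrite (sup_f0 S) expr0n/= addr0 mulr1.
  move=> C0; rewrite ler_wpM2l// expr0n/= lerD2l exprn_even_ge0//.
rewrite lee_fin fp// -/m.
have ty := taylor2 (sup_fw S) (sup_wq S) (sup_lip S) L0 r0 rho0.
have ql := sup_lip S rho0 r0; have gen := sup_gen S r0.
have qr := sup_q_le r0; have wr := sup_w_le r0.
set dd := `|rho - r| in dr ty ql.
have dd0 : 0 <= dd by exact: normr_ge0.
have d2 : (rho - r) ^+ 2 = dd ^+ 2 by rewrite /dd -normrX ger0_norm// sqr_ge0.
rewrite d2 in ty.
have b0 : 0 <= b by lra.
have B10 : 0 <= B1 by rewrite /B1; lra.
have bb1 : b <= b ^+ 3 by rewrite exprS ler_peMr// exprn_ege1.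
have bb2 : b ^+ 2 <= b ^+ 3 by rewrite [b ^+ 3]exprS ler_peMl// exprn_ge0.
have bb0 : 1 <= b ^+ 3 by exact: exprn_ege1.
set E := s ^+ 3 * b ^+ 3.
have E0 : 0 <= E by rewrite mulr_ge0// exprn_ge0// ltW.
have s3p : 0 <= s ^+ 3 by rewrite exprn_ge0// ltW.
have s4p : 0 <= s ^+ 4 by rewrite exprn_ge0// ltW.
have s6 : s ^+ 6 <= s ^+ 3 by apply: ler_wiXn2l => //; exact: ltW.
have e1 : w r * e <= (w 0 + q 0 + L) * E.
  have : w r <= (w 0 + q 0 + L) * b ^+ 2.
    apply: le_trans wr _.
    have b21 : 1 <= b ^+ 2 by exact: exprn_ege1.
    have rr : r * r <= b ^+ 2 by rewrite expr2 ler_pM.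
    have rb2 : r <= b ^+ 2 by apply: le_trans rb _; rewrite expr2 ler_peMr.
    have := ler_wpM2l w0 b21; have := ler_wpM2l q0 rb2; have := ler_wpM2l L0 rr; lra.
  move=> h; apply: le_trans (ler_pM (sup_w0 S r0) e0 h eb) _.
  rewrite [leLHS](_ : _ = (w 0 + q 0 + L) * (s ^+ 4 * b ^+ 3)); last by ring.
  by rewrite ler_wpM2l ?addr_ge0// ler_wpM2r// (le_trans ler01).
have dd2 : dd ^+ 2 <= B1 ^+ 2 * (s ^+ 4 * b ^+ 2).
  apply: (@le_trans _ _ ((s ^+ 2 * (B1 * b)) ^+ 2)).
    by rewrite lerXn2r// nnegrE (le_trans dd0 dr).
  by rewrite le_eqVlt; apply/orP; left; apply/eqP; ring.
have e2 : - (q r * dd ^+ 2 / 4) <= (q 0 + L) * B1 ^+ 2 * E.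
  have h1 : - q r <= (q 0 + L) * b.
    have := ler_norm (- q r); rewrite normrN => h; apply: le_trans h _; apply: le_trans qr _.
    by rewrite mulrDl lerD// ?ler_wpM2l// ler_peMr.
  have h2 : - q r * dd ^+ 2 <= (q 0 + L) * b * (B1 ^+ 2 * (s ^+ 4 * b ^+ 2)).
    apply: (@le_trans _ _ ((q 0 + L) * b * dd ^+ 2)); first by rewrite ler_wpM2r// exprn_ge0.
    by rewrite ler_wpM2l// mulr_ge0// addr_ge0.
  have h3 : (q 0 + L) * b * (B1 ^+ 2 * (s ^+ 4 * b ^+ 2)) <= (q 0 + L) * B1 ^+ 2 * E.
    rewrite [leLHS](_ : _ = (q 0 + L) * B1 ^+ 2 * (s ^+ 4 * b ^+ 3)); last by ring.
    rewrite ler_wpM2l ?mulr_ge0 ?addr_ge0 ?exprn_ge0//.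
    by rewrite ler_wpM2r// (le_trans ler01).
  have h4 : 0 <= (q 0 + L) * B1 ^+ 2 * E by apply: mulr_ge0 E0; rewrite mulr_ge0 ?addr_ge0 ?exprn_ge0.
  lra.
have e3 : L * dd ^+ 3 <= L * B1 ^+ 3 * E.
  rewrite -mulrA ler_wpM2l//; apply: (@le_trans _ _ ((s ^+ 2 * (B1 * b)) ^+ 3)).
    by rewrite lerXn2r// nnegrE (le_trans dd0 dr).
  rewrite [leLHS](_ : _ = B1 ^+ 3 * (s ^+ 6 * b ^+ 3)); last by ring.
  by rewrite ler_wpM2l ?exprn_ge0// ler_wpM2r// (le_trans ler01).
have e4 : s ^+ 2 * (L * dd) <= L * B1 * E.
  have -> : s ^+ 2 * (L * dd) = L * (s ^+ 2 * dd) by ring.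
  rewrite -mulrA ler_wpM2l//; apply: (@le_trans _ _ (s ^+ 2 * (s ^+ 2 * (B1 * b)))).
    exact: ler_wpM2l.
  rewrite [leLHS](_ : _ = B1 * (s ^+ 4 * b)); last by ring.
  by rewrite ler_wpM2l// ler_pM.
have e5 : 160 * L * m * s ^+ 3 <= 160 * L * m * E.
  by rewrite ler_wpM2l ?mulr_ge0// /E ler_peMr.
have gen' := ler_wpM2l hs gen.
have ql' : - (s ^+ 2 * q rho) <= - (s ^+ 2 * q r) + s ^+ 2 * (L * dd).
  move: ql; rewrite ler_norml => /andP[ql _]; have := ler_wpM2l hs ql; lra.
have tw : w r * (rho - r) = s ^+ 2 * (g r * w r) + w r * e by rewrite /rho; ring.
move: ty; rewrite tw ler_norml => /andP[_ ty].
have -> : s ^+ 2 * (p + (w 0 + q 0 + L + (q 0 + L) * B1 ^+ 2 + L * B1 ^+ 3 + L * B1 + 160 * L * m) * (s * b ^+ 3))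
  = s ^+ 2 * p + ((w 0 + q 0 + L) * E + (q 0 + L) * B1 ^+ 2 * E + L * B1 ^+ 3 * E + L * B1 * E + 160 * L * m * E).
  by rewrite /E; ring.
move: e1 e2 e3 e4 e5 gen' ql' ty.
set z1 := w r * e; set z2 := q r * dd ^+ 2 / 4; set z3 := L * dd ^+ 3; set z4 := s ^+ 2 * (L * dd).
lra.
Qed.

End Supersolution.
End Calculus.

(** * Linearity and monotonicity of the absorbed kernel *)

Section Absorb_linear.
Context {R : realType}.
Implicit Types (F G : R -> R) (s r : R).

Lemma measurable_absorb s r F : measurable_fun setT F ->
  measurable_fun setT (fun x : R => (F 0 * mprob (- (r / s) * x - (r / s) ^+ 2 / 2) +
    F `|r + 2 * s * x| * (1 - mprob (- (r / s) * x - (r / s) ^+ 2 / 2)))%:E).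
Proof.
move=> mF.
have me : measurable_fun setT (fun x : R => mprob (- (r / s) * x - (r / s) ^+ 2 / 2)).
  by apply: (measurableT_comp measurable_mprob); apply: measurable_funB => //.
apply/measurable_EFinP; apply: measurable_funD; first exact: measurable_funM.
apply: measurable_funM; last exact: measurable_funB.
apply: (measurableT_comp mF); apply: measurableT_comp => //.
by apply: measurable_funD => //; exact: measurable_funM.
Qed.

Lemma absorb_integrand_ge0 s r F x : (forall x, 0 <= F x) ->
  0 <= F 0 * mprob (- (r / s) * x - (r / s) ^+ 2 / 2) +
    F `|r + 2 * s * x| * (1 - mprob (- (r / s) * x - (r / s) ^+ 2 / 2)).
Proof. by move=> F0; rewrite addr_ge0// mulr_ge0// ?mprob_ge0// subr_ge0 mprob_le1. Qed.

Lemma absorb_ge0 s r F : (forall x, 0 <= F x) -> (0 <= absorb s F r)%E.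
Proof. by move=> F0; apply: integral_ge0 => x _; rewrite lee_fin; exact: absorb_integrand_ge0. Qed.

Lemma absorbD s r F G : measurable_fun setT F -> measurable_fun setT G ->
  (forall x, 0 <= F x) -> (forall x, 0 <= G x) ->
  absorb s (fun x => F x + G x) r = (absorb s F r + absorb s G r)%E.
Proof.
move=> mF mG F0 G0; rewrite /absorb -ge0_integralD//.
- by apply: eq_integral => x _; rewrite -EFinD; congr (_%:E); ring.
- by move=> x _; rewrite lee_fin; exact: absorb_integrand_ge0.
- exact: measurable_absorb.
- by move=> x _; rewrite lee_fin; exact: absorb_integrand_ge0.
- exact: measurable_absorb.
Qed.

Lemma absorbZ s r F (a : R) : measurable_fun setT F -> (forall x, 0 <= F x) -> 0 <= a ->
  absorb s (fun x => a * F x) r = (a%:E * absorb s F r)%E.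
Proof.
move=> mF F0 a0; rewrite /absorb -ge0_integralZl ?lee_fin//.
- by apply: eq_integral => x _; rewrite -EFinM; congr (_%:E); ring.
- exact: measurable_absorb.
- by move=> x _; rewrite lee_fin; exact: absorb_integrand_ge0.
Qed.

Lemma absorb_cst s r (a : R) : absorb s (fun=> a) r = a%:E.
Proof.
rewrite /absorb -[RHS](integral_prob_cst gauss1); apply: eq_integral => x _.
by congr (_%:E); ring.
Qed.

Lemma absorb_le_fun s r F G : measurable_fun setT F -> measurable_fun setT G ->
  (forall x, 0 <= F x) -> (forall x, 0 <= G x) ->
  (forall x, 0 <= x -> F x <= G x) -> (absorb s F r <= absorb s G r)%E.
Proof.
move=> mF mG F0 G0 FG; apply: ge0_le_integral => //.
- by move=> x _; rewrite lee_fin; exact: absorb_integrand_ge0.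
- exact: measurable_absorb.
- exact: measurable_absorb.
- move=> x _; rewrite lee_fin; apply: lerD.
    by rewrite ler_wpM2r ?mprob_ge0// FG.
  by rewrite ler_wpM2r ?subr_ge0 ?mprob_le1// FG.
Qed.

End Absorb_linear.

(** * The dominating random walk and its survival probability *)

Section Absorbed_chain.
Context {R : realType}.
Variables (g : R -> R) (K s D A beta : R).
Hypotheses (gK : forall a b, 0 <= a -> 0 <= b -> `|g a - g b| <= K * `|a - b|)
  (g0 : 0 <= g 0) (s0 : 0 < s) (s1 : s <= 1) (sK : s ^+ 2 * K <= 1)
  (D0 : 0 <= D) (A0 : 0 <= A) (b1 : 1 <= beta) (Db : D <= beta) (ADb : A * D <= beta).

(* One drift step of the distance, cut off at [D]; the term [A] absorbs the
   quadratic error of the Euler scheme. *)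
Definition rho x := let m := Num.min (pos_part x) D in m + s ^+ 2 * g m + s ^+ 4 * (A * m).

Lemma capP x : 0 <= Num.min (pos_part x) D <= beta.
Proof. by rewrite le_min pos_part_ge0 D0 ge_min Db orbT. Qed.

(** The drift has slope at least - K, and s^2 K <= 1 prevents one step from reversing the order. *)
Lemma rho_mono : {homo rho : x y / x <= y}.
Proof.
move=> x y xy; rewrite /rho /=.
have : Num.min (pos_part x) D <= Num.min (pos_part y) D.
  by rewrite le_min !ge_min lexx orbT andbT /pos_part ge_max !le_max xy lexx !orbT.
have /andP[] := capP x; have /andP[] := capP y.
move: (Num.min _ _) (Num.min _ _) => m' m m0 _ m'0 _ mm.
have := gK m0 m'0; rewrite ler_norml (@ger0_norm _ (m - m')) ?subr_ge0// => /andP[h _].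
have h2 := ler_wpM2l (sqr_ge0 s) h.
have h3 : s ^+ 2 * K * (m - m') <= m - m' by rewrite ler_piMl// subr_ge0.
have : s ^+ 4 * (A * m') <= s ^+ 4 * (A * m) by apply: ler_wpM2l; [exact/exprn_ge0/ltW|exact: ler_wpM2l].
move: h2; rewrite mulrN !mulrA; lra.
Qed.

Lemma rho_ge0 x : 0 <= rho x.
Proof.
apply: (@le_trans _ _ (rho (Num.min x 0))); last by apply: rho_mono; rewrite ge_min lexx.
rewrite /rho /pos_part (_ : Num.max _ 0 = 0); last by rewrite (max_idPr _)// ge_min lexx orbT.
by rewrite (min_idPl D0) add0r !mulr0 addr0 mulr_ge0 ?sqr_ge0.
Qed.

(* The probability that two chains at distance [x] stay apart for [k] steps,
   when each step drifts by [rho] and then reflects. *)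
Fixpoint surv k x : R :=
  if k is k'.+1 then fine (absorb s (surv k') (rho x)) else pos01 x.

Lemma pos01_mono : {homo @pos01 R : x y / x <= y}.
Proof.
move=> x y xy; rewrite /pos01; case: ifPn => x0; last by case: ifP.
by rewrite (lt_le_trans x0 xy).
Qed.

Lemma absorb_01 (F : R -> R) r : measurable_fun setT F -> (forall x, 0 <= F x <= 1) ->
  exists2 a, absorb s F r = a%:E & 0 <= a <= 1.
Proof.
move=> mF F01.
have F0 x : 0 <= F x by case/andP: (F01 x).
have h0 : (0 <= absorb s F r)%E by exact: absorb_ge0.
have h1 : (absorb s F r <= 1%:E)%E.
  by rewrite -(absorb_cst s r 1); apply: absorb_le_fun => // x _; case/andP: (F01 x).
have fn : absorb s F r \is a fin_num by rewrite ge0_fin_numE// (le_lt_trans h1)// ltry.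
by exists (fine (absorb s F r)); rewrite ?fineK// -!lee_fin fineK// h0.
Qed.

Lemma survP k : [/\ measurable_fun setT (surv k), forall x, 0 <= surv k x <= 1 &
  {homo surv k : x y / x <= y}].
Proof.
elim: k => [|k [mk k01 kh]].
  split; [exact: measurable_pos01|by move=> x; rewrite pos01_ge0 pos01_le1|exact: pos01_mono].
have h : {homo surv k.+1 : x y / x <= y}.
  move=> x y xy /=; have [a ea _] := absorb_01 (rho x) mk k01.
  have [b eb _] := absorb_01 (rho y) mk k01.
  rewrite ea eb/= -lee_fin -ea -eb; apply: absorb_mono => //.
  - by move=> z; case/andP: (k01 z).
  - by move=> z t _; exact: kh.
  - exact: rho_ge0.
  - exact: rho_mono.
split => //; first by apply: nondecreasing_measurable.
by move=> x /=; have [a -> ?] := absorb_01 (rho x) mk k01.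
Qed.

Lemma measurable_surv k : measurable_fun setT (surv k). Proof. by case: (survP k). Qed.
Lemma surv_ge0 k x : 0 <= surv k x. Proof. by case: (survP k) => _ /(_ x) /andP[]. Qed.
Lemma surv_mono k : {homo surv k : x y / x <= y}. Proof. by case: (survP k). Qed.

Lemma survS k x : (surv k.+1 x)%:E = absorb s (surv k) (rho x).
Proof.
have [mk k01 kh] := survP k.
by have [a /= -> _] := absorb_01 (rho x) mk k01.
Qed.

(** Without a push at 0 the state 0 is a trap. *)
Lemma surv_le_pos01 k x : 0 <= x -> g 0 = 0 -> surv k x <= pos01 x.
Proof.
case: k => [//|k] x0 g00; rewrite /pos01; case: ltP => [_|x0'].
  by have [_ /(_ x) /andP[]] := survP k.+1.
have {x0 x0'} -> : x = 0 by apply/eqP; rewrite eq_le x0'.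
have r0 : rho 0 = 0 by rewrite /rho pos_part_id// (min_idPl D0) g00 !mulr0 !addr0.
elim: k => [|k IH]; rewrite -lee_fin survS r0.
  by rewrite absorb0//; [exact: pos01_ge0|rewrite /= /pos01 ltxx].
by rewrite absorb0//; [move=> ?; exact: surv_ge0|apply/eqP; rewrite eq_le IH surv_ge0].
Qed.

Section With_supersolution.
Context {c p : R} {f w q : R -> R} {L : R}.
Hypothesis S : supersolution g c p f w q L.
Variables (B G : R).
Hypotheses (gB : forall x, 0 <= x -> x <= beta -> `|g x| <= B * beta).
Hypothesis step : forall r e : R, 0 <= r -> r <= beta ->
    0 <= e -> e <= s ^+ 4 * beta -> `|g r| <= B * beta ->
    0 <= r + s ^+ 2 * g r + e ->
  (absorb s (f \o pos_part) (r + s ^+ 2 * g r + e)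
    + (s ^+ 2 * q 0)%:E * absorb s pos01 (r + s ^+ 2 * g r + e)
  <= ((1 - s ^+ 2 * c) * f r + s ^+ 2 * (p + G * (s * beta ^+ 3)))%:E)%E.
Let a := 1 - s ^+ 2 * c.
Hypotheses (a0 : 0 <= a) (p0 : 0 <= p) (G0 : 0 <= G).
Let p' := p + G * (s * beta ^+ 3).

Let p'0 : 0 <= p'.
Proof.
have b0 : 0 <= beta by exact: le_trans ler01 b1.
by apply: addr_ge0 => //; apply: mulr_ge0 => //; rewrite mulr_ge0 ?exprn_ge0// ltW.
Qed.

Let fp0 x : 0 <= (f \o pos_part) x.
Proof. by apply: (sup_ge0 S); exact: pos_part_ge0. Qed.

(** The supersolution inequality for one step of the chain, in the affine form used by both
    inductions below. *)
Lemma chain_step (t C x : R) : 0 <= t -> 0 <= C -> 0 <= x ->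
  (absorb s (fun y : R => (t * ((f \o pos_part) y + s ^+ 2 * q 0 * pos01 y) + C)%R) (rho x) <=
   (t * (a * f x + s ^+ 2 * p') + C)%:E)%E.
Proof.
move=> t0 C0 x0.
have sq0 : 0 <= s ^+ 2 * q 0 by rewrite mulr_ge0 ?sqr_ge0 ?(sup_q0 S).
have mf := measurable_sup S.
have mp : measurable_fun setT (fun x : R => s ^+ 2 * q 0 * pos01 x).
  by apply: measurable_funM => //; exact: measurable_pos01.
have mh : measurable_fun setT (fun x : R => (f \o pos_part) x + s ^+ 2 * q 0 * pos01 x).
  exact: measurable_funD.
have pp0 x' : 0 <= s ^+ 2 * q 0 * pos01 x' by rewrite mulr_ge0// pos01_ge0.
have hh0 x' : 0 <= (f \o pos_part) x' + s ^+ 2 * q 0 * pos01 x' by rewrite addr_ge0.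
rewrite absorbD//; last by move=> ?; exact: mulr_ge0.
  rewrite absorbZ// absorb_cst EFinD EFinM; apply: leeD => //.
  apply: lee_wpmul2l; rewrite ?lee_fin//.
  rewrite absorbD// absorbZ//; [|exact: measurable_pos01|exact: pos01_ge0].
  rewrite /rho /=; have /andP[m0 mb] := capP x.
  have mx : Num.min (pos_part x) D <= x by rewrite ge_min pos_part_id// lexx.
  have := rho_ge0 x; rewrite /rho/=.
  have mD : Num.min (pos_part x) D <= D by rewrite ge_min lexx orbT.
  move: (Num.min _ _) m0 mb mx mD => m m0 mb mx mD r0.
  apply: le_trans (step m0 mb _ _ (gB m0 mb) r0) _.
  - by apply: mulr_ge0; [exact/exprn_ge0/ltW|exact: mulr_ge0].
  - apply: ler_wpM2l; first exact/exprn_ge0/ltW.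
    by apply: le_trans ADb; exact: ler_wpM2l.
  - by rewrite lee_fin lerD2r ler_wpM2l// (sup_mono S).
by apply: measurable_funM.
Qed.

(** Each step multiplies f by at most a and in addition yields s^2 q(0) times the probability of
    still being away from 0. As 0 is a trap, every such probability is at least the final one, so
    the yields add up to a geometric sum times [surv k x]. *)
Lemma surv_decay k x : 0 <= x -> g 0 = 0 -> a <= 1 ->
  s ^+ 2 * q 0 * (\sum_(j < k) a ^+ j) * surv k x <= a ^+ k * f x + k%:R * (s ^+ 2 * p').
Proof.
move=> x0 g00 a1; elim: k x x0 => [|k IH] x x0.
  by rewrite big_ord0 mulr0 !mul0r addr0 expr0 mul1r (sup_ge0 S).
have q0 := sup_q0 S.
set th := s ^+ 2 * q 0 * _; have th0 : 0 <= th.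
  apply: mulr_ge0; first by rewrite mulr_ge0 ?sqr_ge0.
  by apply: sumr_ge0 => i _; exact: exprn_ge0.
have ak0 : 0 <= a ^+ k by exact: exprn_ge0.
have mk := measurable_surv k; have k0 := surv_ge0 k.
rewrite -lee_fin EFinM survS -absorbZ//.
have sp0 : 0 <= k%:R * (s ^+ 2 * p') by apply: mulr_ge0 => //; rewrite mulr_ge0 ?sqr_ge0.
apply: le_trans (absorb_le_fun _ _ _ _ _ _ _) (_ : (_ <= _)%E).
- exact: measurable_funM.
- shelve.
- by move=> y; exact: mulr_ge0.
- shelve.
- move=> y y0; rewrite /th big_ord_recr/= mulrDr mulrDl.
  have h1 := IH y y0; have h2 := surv_le_pos01 k y0 g00.
  have h3 : s ^+ 2 * q 0 * a ^+ k * surv k y <= s ^+ 2 * q 0 * a ^+ k * pos01 y.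
    by apply: ler_wpM2l => //; apply: mulr_ge0 => //; rewrite mulr_ge0 ?sqr_ge0.
  apply: le_trans (lerD h1 h3) _.
  rewrite [leLHS](_ : _ = a ^+ k * ((f \o pos_part) y + s ^+ 2 * q 0 * pos01 y) + k%:R * (s ^+ 2 * p')); first exact: lexx.
  by rewrite /= pos_part_id//; ring.
- apply: le_trans (chain_step _ _ _) _ => //.
  rewrite lee_fin [a ^+ k.+1]exprSr -natr1.
  have : a ^+ k * (s ^+ 2 * p') <= s ^+ 2 * p'.
    by apply: ler_piMl; [rewrite mulr_ge0 ?sqr_ge0|exact: exprn_ile1].
  lra.
Unshelve.
- apply: measurable_funD => //; apply: measurable_funM => //; apply: measurable_funD.
    exact: measurable_sup S.
  by apply: measurable_funM => //; exact: measurable_pos01.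
- move=> y; rewrite addr_ge0// mulr_ge0// addr_ge0 ?fp0//.
  by apply: mulr_ge0 (pos01_ge0 y); rewrite mulr_ge0 ?sqr_ge0.
Qed.

(** After its first step the chain from 0 is at a point >= 0, and [surv k] increases with the
    starting point. *)
Lemma surv0_mono k : surv k 0 <= surv k.+1 0.
Proof.
rewrite -lee_fin survS -(absorb_cst s (rho 0) (surv k 0)).
apply: absorb_le_fun => //.
- exact: measurable_surv.
- by move=> _; exact: surv_ge0.
- by move=> x; exact: surv_ge0.
- by move=> x x0; exact: surv_mono.
Qed.

(** Dynkin's formula: per step, the mean of f grows by at most s^2 p' and loses s^2 q(0) times the
    probability of being away from 0 after the step. *)
Lemma surv_sum_le n x : c = 0 -> 0 <= x ->
  s ^+ 2 * q 0 * (\sum_(j < n) surv j.+1 x) <= f x + n%:R * (s ^+ 2 * p').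
Proof.
move=> c0; have a1 : a = 1 by rewrite /a c0 mulr0 subr0.
have q0 := sup_q0 S.
have sq0 : 0 <= s ^+ 2 * q 0 by rewrite mulr_ge0 ?sqr_ge0.
elim: n x => [|n IH] x x0; first by rewrite big_ord0 mulr0 mul0r addr0 (sup_ge0 S).
have sp0 : 0 <= n%:R * (s ^+ 2 * p') by apply: mulr_ge0 => //; rewrite mulr_ge0 ?sqr_ge0.
have ms m : measurable_fun setT (fun y => \sum_(j < m) surv j y).
  by apply: measurable_sum => j; exact: measurable_surv.
have s_0 m y : 0 <= \sum_(j < m) surv j y by apply: sumr_ge0 => j _; exact: surv_ge0.
have E m : (\sum_(j < m) surv j.+1 x)%:E = absorb s (fun y => \sum_(j < m) surv j y) (rho x).
  elim: m => [|m IHm].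
    rewrite big_ord0 -(absorb_cst s (rho x) 0); congr (absorb s _ _).
    by apply/funext => y; rewrite big_ord0.
  rewrite big_ord_recr/= EFinD IHm (fineK _); last by rewrite -survS.
  rewrite -absorbD//; [|exact: measurable_surv|exact: surv_ge0].
  by congr (absorb s _ _); apply/funext => y; rewrite big_ord_recr.
rewrite -lee_fin EFinM E -absorbZ//.
apply: le_trans (absorb_le_fun _ _ _ _ _ _ _) (_ : (_ <= _)%E).
- exact: measurable_funM.
- shelve.
- by move=> y; exact: mulr_ge0.
- shelve.
- move=> y y0; rewrite big_ord_recl mulrDr.
  have h1 := IH y y0.
  apply: le_trans (lerD (lexx _) h1) _.
  rewrite [leLHS](_ : _ = 1 * ((f \o pos_part) y + s ^+ 2 * q 0 * pos01 y) + n%:R * (s ^+ 2 * p')); first exact: lexx.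
  by rewrite /= pos_part_id//; ring.
- apply: le_trans (chain_step _ _ _) _ => //.
  by rewrite lee_fin a1 !mul1r -natr1 mulrDl mul1r -addrA lerD2l addrC.
Unshelve.
- apply: measurable_funD => //; apply: measurable_funM => //; apply: measurable_funD.
    exact: measurable_sup S.
  by apply: measurable_funM => //; exact: measurable_pos01.
- by move=> y; rewrite addr_ge0// mulr_ge0// addr_ge0 ?fp0// mulr_ge0// pos01_ge0.
Qed.

(** By [surv_sum_le] the time average of the survival probability from 0 is at most p', since f(0) =
    0. The sequence increases in k, so no term can exceed p': all later terms would exceed it by the
    same amount. *)
Lemma surv0_le k : c = 0 -> q 0 = 1 -> surv k 0 <= p'.
Proof.
move=> c0 q1; rewrite leNgt; apply/negP => hk.
have s20 : 0 < s ^+ 2 by exact: exprn_gt0.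
have mono i j : (i <= j)%N -> surv i 0 <= surv j 0.
  by move=> /subnK <-; elim: (j - i)%N => [//|m IH]; exact: le_trans IH (surv0_mono _).
set e := surv k 0 - p'; have e0 : 0 < e by rewrite subr_gt0.
(* The excess e over n further steps outweighs the first k steps, whose terms are only bounded below
   by 0. *)
have /= := Num.Theory.archi_boundP (_ : 0 <= k%:R * surv k 0 / e).
set n := Num.bound _ => hn.
have {}hn : k%:R * surv k 0 < n%:R * e.
  by rewrite -ltr_pdivrMr// hn// divr_ge0 ?mulr_ge0 ?surv_ge0// ltW.
have := surv_sum_le (n + k) c0 (lexx 0); rewrite q1 mulr1 (sup_f0 S) add0r mulrCA ler_pM2l//.
apply/negP; rewrite -ltNge.
apply: (@lt_le_trans _ _ (n%:R * surv k 0)).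
  rewrite natrD mulrDl; have : k%:R * p' <= k%:R * surv k 0 by rewrite ler_wpM2l// ltW.
  by move: hn; rewrite /e mulrBr; lra.
rewrite addnC big_split_ord/=.
apply: le_trans (_ : \sum_(i < n) surv (rshift k i).+1 0 <= _).
  rewrite -[n in n%:R]card_ord mulr_natl -sumr_const; apply: ler_sum => i _.
  by apply: mono => /=; rewrite -addnS leq_addr.
by rewrite lerDr; apply: sumr_ge0 => i _; exact: (surv_ge0 i.+1).
Qed.

End With_supersolution.
End Absorbed_chain.

(** * The supersolutions behind the constants *)

Section Segment.
Context {R : realType}.
Implicit Types (F G u : R -> R) (a b x y L : R).

Definition lip_on a b L F := forall x y, a <= x -> x <= b -> a <= y -> y <= b ->
  `|F x - F y| <= L * `|x - y|.

Lemma continuous_bounded_segment u a b : a <= b -> continuous u ->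
  exists2 B, 0 <= B & forall x, a <= x -> x <= b -> `|u x| <= B.
Proof.
move=> ab cu; have cn : continuous (fun x => `|u x|).
  by move=> x; apply: continuous_comp; [exact: cu|exact: norm_continuous].
have [c _ hc] := EVT_max ab (continuous_subspaceT cn).
by exists `|u c| => // x ax xb; apply: hc; rewrite in_itv/= ax.
Qed.

Lemma lip_on_primitive F u a b : a <= b -> primitive_of F u -> continuous u ->
  exists2 L, 0 <= L & lip_on a b L F.
Proof.
move=> ab Fu cu; have [B B0 hB] := continuous_bounded_segment ab cu.
exists B => // x y ax xb ay yb; apply: primitive_lip Fu _ => z z1 z2; apply: hB.
  by apply: le_trans z1; rewrite le_min ax.
by apply: le_trans z2 _; rewrite ge_max xb.
Qed.

Lemma lip_onM F G a b L1 L2 : a <= b -> continuous F -> continuous G ->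
  0 <= L1 -> 0 <= L2 -> lip_on a b L1 F -> lip_on a b L2 G ->
  exists2 L, 0 <= L & lip_on a b L (fun x => F x * G x).
Proof.
move=> ab cF cG L10 L20 lF lG.
have [B B0 hB] := continuous_bounded_segment ab cF.
have [C C0 hC] := continuous_bounded_segment ab cG.
exists (B * L2 + C * L1); first by rewrite addr_ge0 ?mulr_ge0.
move=> x y ax xb ay yb.
rewrite (_ : _ - _ = F x * (G x - G y) + G y * (F x - F y)); last by ring.
apply: le_trans (ler_normD _ _) _; rewrite !normrM mulrDl -!mulrA.
by apply: lerD; apply: ler_pM; rewrite ?hB ?hC ?lF ?lG.
Qed.

Lemma primitive_of_cts F u : primitive_of F u -> continuous F.
Proof. by move=> Fu x; exact: primitive_of_continuous Fu. Qed.

Lemma continuous_pos_part : continuous (@pos_part R).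
Proof. by move=> x; apply: (@continuous_max _ R^o); [exact: cvg_id|exact: cvg_cst]. Qed.

End Segment.

(** * The drift kappa(r) r and the supersolution of the sticky diffusion *)

Section Kappa.
Context {R : realType}.
Variables (kappa : R -> R) (Kl k Rk : R).
Hypotheses (Kl0 : 0 <= Kl) (k0 : k < 0) (Rk0 : 0 <= Rk)
  (klip : forall a b, 0 <= a -> 0 <= b -> `|kappa a - kappa b| <= Kl * `|a - b|)
  (kk : forall r, Rk <= r -> kappa r = k).

Definition kr r := kappa (pos_part r) * pos_part r.

Lemma krE r : 0 <= r -> kr r = kappa r * r.
Proof. by move=> r0; rewrite /kr pos_part_id. Qed.

(** The product with the unbounded factor r remains Lipschitz because kappa is constant from [Rk]
    on. *)
Lemma kr_lip x y : 0 <= x -> 0 <= y -> `|kr x - kr y| <= (- k + 2 * Kl * Rk) * `|x - y|.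
Proof.
wlog xy : x y / x <= y => [h|] x0 y0.
  have [|/ltW yx] := leP x y; first by move=> ?; exact: h.
  by rewrite distrC [`|x - y|]distrC; exact: h.
have kb z : 0 <= z -> `|kappa z| <= - k + Kl * Rk.
  move=> z0; have [Rz|zR] := leP Rk z; first by rewrite kk// ltr0_norm// lerDl mulr_ge0.
  have := klip z0 Rk0; rewrite (kk (lexx _)) (ltr0_norm (x := z - Rk)) ?subr_lt0// => h.
  have -> : kappa z = (kappa z - k) + k by ring.
  apply: le_trans (ler_normD _ _) _; rewrite (ltr0_norm k0).
  have : Kl * - (z - Rk) <= Kl * Rk by apply: ler_wpM2l => //; lra.
  by lra.
rewrite !krE// (_ : _ - _ = kappa y * (x - y) + (kappa x - kappa y) * x); last by ring.
apply: le_trans (ler_normD _ _) _.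
rewrite !normrM (ger0_norm x0).
rewrite (_ : (_ + _ * Rk) * `|_| = (- k + Kl * Rk) * `|x - y| + Kl * `|x - y| * Rk); last by ring.
apply: lerD; first by rewrite ler_wpM2r// kb.
have [Rx|xR] := leP Rk x.
  by rewrite !kk// ?(le_trans Rx xy)// subrr normr0 mul0r !mulr_ge0.
by apply: ler_pM => //; [exact: klip|exact: ltW].
Qed.

Lemma kr_lipC : 0 <= - k + 2 * Kl * Rk.
Proof. by rewrite addr_ge0// ?mulr_ge0// oppr_ge0 ltW. Qed.

Lemma continuous_kr : continuous kr.
Proof.
have cl : continuous (fun x => kr (pos_part x)).
  move=> x; apply/cvgrPdist_le => e e0.
  have K1 : 0 < - k + 2 * Kl * Rk + 1 by have := kr_lipC; lra.
  have cp := continuous_pos_part (x := x).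
  move/cvgrPdist_le : cp => /(_ (e / (- k + 2 * Kl * Rk + 1))) /(_ (divr_gt0 e0 K1)).
  apply: filterS => y hy; apply: le_trans (kr_lip (pos_part_ge0 _) (pos_part_ge0 _)) _.
  rewrite -(@divfK _ (- k + 2 * Kl * Rk + 1) _ e) ?gt_eqF//.
  rewrite mulrC; apply: ler_pM => //; first exact: kr_lipC.
  by rewrite lerDl.
have -> // : kr = fun x => kr (pos_part x).
by apply/funext => x; rewrite /kr [pos_part (pos_part x)]pos_part_id ?pos_part_ge0.
Qed.

Section Sticky.
Variable (M : R).
Hypothesis M0 : 0 <= M.

Let u y := M + kr y.

Let cu : continuous u.
Proof. by move=> x; apply: continuousD; [exact: cvg_cst|exact: continuous_kr]. Qed.

(* [I] is the density and [J] the distribution function of the absolutely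
   continuous part of [pi_unnormalized]. *)
Lemma sticky_density_exists : exists I J : R -> R, exists Z : R,
  [/\ primitive_of I (fun x => I x * (M + kr x) / 2), primitive_of J I,
      forall x, 0 < I x /\ J x <= Z,
      (J 0 = 0 /\ 0 < Z) /\ (forall e S : R, 0 < e -> exists2 r, S <= r & I r <= e) &
      I 0 = 1 /\ (\int[lebesgue_measure]_(x in `]0%R, +oo[) (pi_density kappa M x)%:E = Z%:E)%E].
Proof.
have [U [dU U0 UE]] := primitive_exists cu.
pose I x := expR (U x / 2).
have dI : primitive_of I (fun x => I x * u x / 2).
  move=> x; have := dU x => ?; rewrite /I.
  have h : is_derive x (1 : R) (fun x => U x / 2) (u x / 2).
    by apply: is_derive_eq; rewrite /GRing.scale/=; ring.
  have := @is_derive1_comp R expR (fun x => U x / 2) x _ _ (is_derive_expR _) h.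
  by rewrite /comp => h2; apply: is_derive_eq; rewrite mulrA.
have cI : continuous I by exact: primitive_of_cts dI.
have I0 x : 0 < I x by exact: expR_gt0.
have [J [dJ J0 JE]] := primitive_exists cI.
have Jmono : {homo J : x y / x <= y}.
  by move=> x y xy; apply: primitive_le dJ xy _ => z _ _; exact: ltW.
pose R0 := Num.max Rk ((M + 1) / - k).
have uR r : R0 <= r -> u r <= - 1.
  rewrite /R0 ge_max => /andP[h1 h2].
  have r0 : 0 <= r by exact: le_trans h1.
  rewrite /u krE// kk//; move: h2; rewrite ler_pdivrMr ?oppr_gt0//; lra.
(* Beyond [R0] the drift u is at most -1, so J + 2 I has derivative I (1 + u) <= 0 there; this
   bounds J. *)
pose C := J R0 + 2 * I R0.
have JC x : J x <= C.
  have CJ : J R0 <= C by rewrite lerDl mulr_ge0// ltW.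
  have [xR|/ltW Rx] := leP x R0; first exact: le_trans (Jmono _ _ xR) CJ.
  have dD : primitive_of (fun x => - (J x + 2 * I x)) (fun x => - (I x + I x * u x)).
    move=> y; have := dJ y; have := dI y => h1 h2.
    by apply: is_derive_eq; rewrite /GRing.scale/=; field.
  have : - (J R0 + 2 * I R0) <= - (J x + 2 * I x).
    apply: primitive_le dD Rx _ => z /uR hz _; rewrite oppr_ge0; have := I0 z; nra.
  rewrite lerN2 -/C; apply: le_trans; rewrite lerDl mulr_ge0//; exact: ltW.
have ubJ : has_ubound (range J) by exists C => _ [x _ <-].
pose Z := sup (range J).
have JZ x : J x <= Z by apply: ub_le_sup => //; exists x.
have cJ := nondecreasing_cvgr Jmono ubJ.
exists I, J, Z; split => //.
- split.
  split=> //; apply: lt_le_trans (JZ 1).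
    have [c _] := primitive_mvt dJ (@ler01 R); rewrite J0 !subr0 => ->; rewrite mulr1; exact: I0.
  move=> e S e0.
  pose T := Num.max S 0.
  have S0 : 0 <= T by rewrite /T le_max lexx orbT.
  (* J stays below Z, so on an interval this long the mean value of its derivative I is at most
     e. *)
  have Te : T <= T + (`|Z - J T| / e + 1) by rewrite lerDl addr_ge0// divr_ge0// ltW.
  have [c /andP[c1 c2] hc] := primitive_mvt dJ Te.
  exists c; first by apply: le_trans c1; rewrite /T le_max lexx.
  rewrite leNgt; apply/negP => hI.
  have : I c * (`|Z - J T| / e + 1) <= `|Z - J T|.
    rewrite (_ : I c * _ = J (T + (`|Z - J T| / e + 1)) - J T); last by rewrite hc addrAC subrr add0r.
    by apply: le_trans (ler_norm _); rewrite lerD2r.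
  apply/negP; rewrite -ltNge; apply: (@lt_le_trans _ _ (e * (`|Z - J T| / e + 1))).
    by rewrite mulrDr mulr1 mulrC divfK ?gt_eqF// ltrDl.
  by apply: ler_wpM2r; [rewrite addr_ge0// divr_ge0// ltW|exact: ltW].
- split; first by rewrite /I U0 mul0r expR0.
  have := @ge0_continuous_FTC2y R I J 0 Z _ _ cJ _ _ _.
  rewrite J0 sube0 => <-.
  + rewrite -integral_itv_obnd_cbnd; last first.
      by apply/measurable_EFinP; apply: measurable_funTS; exact: continuous_measurable_fun.
    apply: eq_integral => x; rewrite inE/= in_itv/= andbT => x0.
    rewrite /pi_density /I; congr ((expR _)%:E); rewrite mulrC; congr (_ * _).
    rewrite UE ?ltW//; apply: eq_Rintegral => y.
    by rewrite inE/= in_itv/= /u => /andP[y0 _]; rewrite krE.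
  + by move=> x _; exact: ltW.
  + exact: continuous_subspaceT.
  + by move=> x _; exact: (@ex_derive _ _ _ _ _ _ _ (dJ x)).
  + by rewrite -[X in _ --> X]J0; apply: cvg_at_right_filter; exact: (primitive_of_cts dJ).
  + by move=> x _; rewrite derive1E; exact: derive_val.
Qed.

(** [w1] solves 2 w' + u w = p - 1, so the generator inequality is an equality up to [R1]. From
    there on q is frozen at q1(R1) <= 0: this makes q globally Lipschitz and w nondecreasing, and
    since u <= u(R1) <= 0 beyond [R1] the inequality persists. *)
Lemma supersolution_of_tail (p w0 R1 : R) (w1 q1 : R -> R) :
  w0 = w1 0 -> Rk <= R1 -> 0 <= R1 -> u R1 <= 0 -> q1 R1 <= 0 -> q1 0 = 1 ->
  primitive_of w1 (fun x => - q1 x / 2) -> continuous q1 ->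
  (forall x, q1 x = 1 - p + u x * w1 x) -> (forall x, 0 <= x -> 0 <= w1 x) ->
  exists f w q L, supersolution (fun r => M + kr r) 0 p f w q L /\ q 0 = 1.
Proof.
move=> w00 kR1 R10 uR1 qR1 q10 dw1 cq1 q1E w1_0.
pose q x := q1 (Num.min (pos_part x) R1).
have cmin : continuous (fun x : R => Num.min (pos_part x) R1).
  by move=> x; apply: (@continuous_min _ R^o); [exact: continuous_pos_part|exact: cvg_cst].
have cq : continuous q.
  by move=> x; apply: (@continuous_comp _ _ _ (fun x => Num.min (pos_part x) R1) q1); [exact: cmin|exact: cq1].
have [Q [dQ Q0 _]] := primitive_exists cq.
pose w x := w0 - Q x / 2.
have dw : primitive_of w (fun x => - q x / 2).
  by move=> x; have := dQ x => ?; apply: is_derive_eq; rewrite /GRing.scale/=; by field.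
have cw := primitive_of_cts dw.
have [f [df f0 _]] := primitive_exists cw.
have qlo x : 0 <= x -> x <= R1 -> q x = q1 x.
  by move=> x0 xR; rewrite /q pos_part_id// (min_idPl xR).
have qhi x : R1 <= x -> q x = q1 R1.
  by move=> Rx; rewrite /q pos_part_id ?(le_trans R10 Rx)// (min_idPr Rx).
have wlo x : 0 <= x -> x <= R1 -> w x = w1 x.
  move=> x0 xR; have dd : primitive_of (fun x => w x - w1 x) (fun x => (q1 x - q x) / 2).
    move=> y; have := dw y; have := dw1 y => ? ?.
    by apply: is_derive_eq; rewrite /GRing.scale/=; by field.
  have := @primitive_lip _ _ _ x 0 0 dd; rewrite mul0r => h.
  have : `|(w x - w1 x) - (w 0 - w1 0)| <= 0.
    apply: h => y; rewrite (min_idPr x0) (max_idPl x0) => y0 yx.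
    by rewrite qlo// ?(le_trans yx)// subrr mul0r normr0.
  rewrite normr_le0 subr_eq0 => /eqP e; apply/eqP; rewrite -subr_eq0 e.
  by rewrite /w Q0 mul0r subr0 w00 subrr.
have whi x : R1 <= x -> w1 R1 <= w x.
  move=> Rx; rewrite -(wlo R1 R10 (lexx _)).
  apply: primitive_le dw Rx _ => z z1 _; rewrite qhi// divr_ge0// oppr_ge0//.
have K0 := kr_lipC.
have cw1 := primitive_of_cts dw1.
have ul : lip_on 0 R1 (- k + 2 * Kl * Rk) u.
  move=> x y x0 _ y0 _; rewrite /u (_ : _ - _ = kr x - kr y); last by ring.
  exact: kr_lip.
have [Lw Lw0 wl] := lip_on_primitive R10 dw1 (fun x => continuousM (continuousN (cq1 x)) (cvg_cst _)).
have [L L0 hL] := lip_onM R10 cu cw1 K0 Lw0 ul wl.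
exists f, w, q, L; split; last by rewrite qlo.
split => //.
- move=> x y x0 y0; rewrite /q !pos_part_id// !q1E.
  rewrite (_ : _ - _ = u (Num.min x R1) * w1 (Num.min x R1) - u (Num.min y R1) * w1 (Num.min y R1)); last by ring.
  apply: le_trans (hL _ _ _ _ _ _) _; rewrite ?le_min ?x0 ?y0 ?ge_min ?lexx ?orbT//.
  apply: ler_wpM2l => //.
  by have [h1|h1] := leP x R1; have [h2|h2] := leP y R1; rewrite ler_norml;
    have := ler_norm (x - y); have := ler_norm (y - x); rewrite (distrC y x); lra.
- move=> x x0; have [xR|/ltW xR] := leP x R1; first by rewrite wlo// w1_0.
  by apply: le_trans (whi x xR); exact: w1_0.
- by rewrite qlo// q10 ler01.
- move=> r r0; rewrite mul0r oppr0 add0r (qlo 0)// q10.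
  have [rR|/ltW rR] := leP r R1.
    by rewrite qlo// wlo// q1E /u; lra.
  rewrite qhi// q1E.
  have ur : M + kr r <= u R1.
    rewrite /u !krE// ?(le_trans R10 rR)// !kk// ?(le_trans kR1 rR)// lerD2l.
    by rewrite ler_wnM2l// ltW.
  have wr := whi r rR; have w10 := w1_0 R1 R10.
  have h1 : (M + kr r) * w r <= u R1 * w r by rewrite ler_wpM2r// (le_trans w10).
  have h2 : u R1 * w r <= u R1 * w1 R1 by rewrite ler_wnM2l.
  lra.
Qed.

(** Variation of constants for 2 w' + u w = p - 1 with w(0) = w0; the condition p = M w0 is the one
    imposed at the sticky point. The solution is w1 = (w0 - (1 - p) J/2)/I, and the last hypothesis
    keeps its numerator away from 0. As I becomes arbitrarily small far out, there is r with w1(r)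
    >= 1 and u(r) <= -1, hence q1(r) <= - p <= 0, where the solution can be continued. *)
Lemma sticky_supersolution (w0 Z : R) (I J : R -> R) :
  primitive_of I (fun x => I x * (M + kr x) / 2) -> primitive_of J I -> I 0 = 1 -> J 0 = 0 ->
  (forall x, 0 < I x /\ J x <= Z) ->
  (forall e S : R, 0 < e -> exists2 r, S <= r & I r <= e) ->
  0 < w0 -> M * w0 <= 1 -> (1 - M * w0) * Z / 2 < w0 ->
  exists f w q L, supersolution (fun r => M + kr r) 0 (M * w0) f w q L /\ q 0 = 1.
Proof.
move=> dI dJ I01 J0 IJ Itail w0_0 Mw1 hw.
set p := M * w0 in Mw1 hw *.
have p0 : 0 <= p by rewrite mulr_ge0// ltW.
have In x : I x != 0 by rewrite gt_eqF//; case: (IJ x).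
pose w1 x := (w0 - (1 - p) / 2 * J x) * (I x)^-1.
pose q1 (x : R) : R := 1 - p + u x * w1 x.
have dw1 : primitive_of w1 (fun x => - q1 x / 2).
  move=> x; have hI := dI x; have hJ := dJ x.
  have hV := is_deriveV (In x) hI.
  apply: is_derive_eq; rewrite /GRing.scale/= /q1 /w1 /u.
  by field; exact: In.
have cq1 : continuous q1.
  move=> x; apply: (@continuousD _ R^o _ (fun=> 1 - p) (fun x => u x * w1 x)); first exact: cvg_cst.
  by apply: (@continuousM _ _ u w1); [exact: cu|exact: primitive_of_continuous dw1].
have w1lo x : (w0 - (1 - p) * Z / 2) / I x <= w1 x.
  have [I0 JZ] := IJ x; rewrite /w1 ler_pM2r ?invr_gt0// lerD2l lerN2.
  rewrite [leRHS](_ : _ = (1 - p) / 2 * Z); last by ring.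
  by rewrite ler_wpM2l// divr_ge0// subr_ge0.
have eta0 : 0 < w0 - (1 - p) * Z / 2 by rewrite subr_gt0.
have [r] := Itail (w0 - (1 - p) * Z / 2) (Num.max Rk ((M + 1) / - k)) eta0.
rewrite ge_max => /andP[rk rM] rI.
have r0 : 0 <= r by exact: le_trans rk.
have ur : u r <= - 1.
  by rewrite /u krE// kk//; move: rM; rewrite ler_pdivrMr ?oppr_gt0//; lra.
have w1r : 1 <= w1 r.
  by apply: le_trans (w1lo r); rewrite ler_pdivlMr ?mul1r//; case: (IJ r).
apply: (@supersolution_of_tail p w0 r w1 q1) => //.
- by rewrite /w1 J0 I01 invr1 mulr0 subr0 mulr1.
- by apply: le_trans ur _; rewrite oppr_le0.
- by rewrite /q1; nra.
- by rewrite /q1 /u krE// mulr0 addr0 /w1 J0 I01 invr1 mulr0 subr0 mulr1 -/p subrK.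
- move=> x x0; apply: le_trans (w1lo x); rewrite divr_ge0 ?ltW//; by case: (IJ x).
Qed.

(** For M > 0 and w0 = p/M, the condition (1 - p) Z/2 < w0 says p > Z/(2/M + Z), the mass that pi
    gives to (0, oo); the room e makes it strict, and the cap at 1 ensures M w0 <= 1. For M = 0 any
    w0 > Z/2 works, with p = 0. *)
Lemma sticky_pi_supersolution (e : R) : 0 < e -> exists p f w q L,
  [/\ 0 <= p, (p%:E <= sticky_pi kappa M `]0%R, +oo[%classic + e%:E)%E,
    supersolution (fun r => M + kr r) 0 p f w q L & q 0 = 1].
Proof.
move=> e0.
have [I [J [Z [dI dJ IJ [[J0 Z0] Itail] [I01 ZE]]]]] := sticky_density_exists.
have d0 : (\d_(0%R : R) (`]0%R, +oo[%classic : set R) = 0 :> \bar R)%E.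
  by rewrite diracE memNset//= in_itv/= ltxx.
have [M00|Mn0] := eqVneq M 0.
  pose w0 := Z + 1; have w00 : 0 < w0 by rewrite addr_gt0.
  have hw : (1 - M * w0) * Z / 2 < w0 by rewrite M00 /w0; lra.
  have [|f [w [q [L [S q1]]]]] := sticky_supersolution dI dJ I01 J0 IJ Itail w00 _ hw.
    by rewrite M00 mul0r.
  exists (M * w0), f, w, q, L; split => //; first by rewrite M00 mul0r.
  by rewrite /sticky_pi M00 eqxx mul0r d0 add0e lee_fin ltW.
have Mp : 0 < M by rewrite lt_neqAle eq_sym Mn0.
pose pi0 := Z / (2 / M + Z).
have dn : 0 < 2 / M + Z by rewrite addr_gt0// divr_gt0.
have pi1 : pi0 < 1 by rewrite ltr_pdivrMr// mul1r ltrDr divr_gt0.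
pose p := Num.min 1 (pi0 + e).
have p1 : p <= 1 by rewrite ge_min lexx.
have pp : pi0 < p by rewrite lt_min pi1 ltrDl.
have pi00 : 0 <= pi0 by rewrite divr_ge0 ?ltW.
pose w0 := p / M.
have Mw : M * w0 = p by rewrite /w0 mulrC divfK.
have w00 : 0 < w0 by rewrite divr_gt0// (le_lt_trans pi00 pp).
have hw : (1 - M * w0) * Z / 2 < w0.
  rewrite Mw /w0; move: pp; rewrite ltr_pdivrMr// => h.
  rewrite (_ : p / M = p * (2 / M) / 2); last by field.
  rewrite ltr_pM2r//; lra.
have [|f [w [q [L [S q1]]]]] := sticky_supersolution dI dJ I01 J0 IJ Itail w00 _ hw.
  by rewrite Mw.
exists p, f, w, q, L; split => //.
- by rewrite (le_trans pi00 (ltW pp)).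
- rewrite /sticky_pi (negbTE Mn0) /pi_unnormalized d0 mule0 add0e diracT mule1 setIid setTI ZE.
  rewrite /= -EFinM -EFinD lee_fin -/pi0 ge_min lexx orbT//.
- by rewrite -Mw.
Qed.

End Sticky.
End Kappa.

Lemma lip_max (R : realType) (a b c : R) : `|Num.max a c - Num.max b c| <= `|a - b|.
Proof.
by have [h1|h1] := leP a c; have [h2|h2] := leP b c; rewrite ler_norml;
  have := ler_norm (a - b); have := ler_norm (b - a); rewrite (distrC b); lra.
Qed.

Lemma lip_min (R : realType) (a b c : R) : `|Num.min a c - Num.min b c| <= `|a - b|.
Proof.
by have [h1|h1] := leP a c; have [h2|h2] := leP b c; rewrite ler_norml;
  have := ler_norm (a - b); have := ler_norm (b - a); rewrite (distrC b); lra.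
Qed.

(** * The constants ct and epst and the decaying supersolution *)

Section Decay.
Context {R : realType}.
Variables (kappa : R -> R) (Kl k Rk : R).
Hypotheses (Kl0 : 0 <= Kl) (k0 : k < 0) (Rk0 : 0 <= Rk)
  (klip : forall a b, 0 <= a -> 0 <= b -> `|kappa a - kappa b| <= Kl * `|a - b|)
  (kk : forall r, Rk <= r -> kappa r = k).

Local Notation kr := (kr kappa).
Local Notation R0 := (R0t kappa).
Local Notation R1 := (R1t kappa).

(** Serves to show that the infima defining [R0t] and [R1t] are attained. *)
Lemma closed_right (F : R -> R) (a c : R) : continuous F ->
  (forall e, 0 < e -> exists x, [/\ a <= x, x < a + e & F x <= c]) -> F a <= c.
Proof.
move=> cF h; rewrite leNgt; apply/negP => hc.
have e0 : 0 < (F a - c) by rewrite subr_gt0.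
have /cvgrPdist_lt/(_ _ e0)/nbhs_ballP[d /= d0 hd] := cF a.
have [x [ax xd Fx]] := h d d0.
have := hd x; rewrite /ball/= distrC ger0_norm ?subr_ge0// ltrBlDl => /(_ xd).
by have := ler_norm (F a - F x); lra.
Qed.

Lemma closed_right_open (F : R -> R) (a c : R) : continuous F ->
  (forall x, a < x -> F x <= c) -> F a <= c.
Proof.
move=> cF h; apply: closed_right cF _ => e e0; exists (a + e / 2).
have ? : 0 < e / 2 by rewrite divr_gt0.
by split; [lra|lra|apply: h; lra].
Qed.

Lemma R0t_prop : 0 <= R0 /\ forall r, R0 <= r -> kr r <= 0.
Proof.
pose S := [set r0 : R | 0 <= r0 /\ forall r, r0 <= r -> kappa r * r <= 0].
have S0 : S Rk.
  by split=> // r Rr; rewrite kk//; apply: mulr_le0_ge0; [exact: ltW|exact: le_trans Rr].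
have lb : lbound S 0 by move=> x [].
have inS : has_inf S by split; [exists Rk|exists 0].
have R00 : 0 <= R0 by apply: lb_le_inf => //; exists Rk.
have h r : R0 < r -> kr r <= 0.
  move=> Rr; have [x [x0 Sx] xr] := @inf_lt _ S _ (ex_intro _ _ S0) Rr.
  by rewrite krE ?(le_trans R00 (ltW Rr))// Sx// ltW.
split => // r; rewrite le_eqVlt => /predU1P[<-|]; last exact: h.
by apply: closed_right_open; [exact: (continuous_kr Kl0 k0 Rk0 klip kk)|exact: h].
Qed.

Lemma R1t_prop : [/\ 0 < R1, R0 < R1 & forall r, R1 <= r -> R1 * (R1 - R0) * kappa r <= - 4].
Proof.
have [R00 _] := R0t_prop.
pose S := [set r1 : R | R0 <= r1 /\ forall r, r1 <= r -> r1 * (r1 - R0) * kappa r <= - 4].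
have : 4 <= 4 / - k * - k by rewrite divfK// oppr_eq0 lt_eqF.
have : 0 < 4 / - k by rewrite divr_gt0// oppr_gt0.
move: (4 / - k) => A q0 q1.
(* [A] stands for 4/(- k). Since T >= 1 and T - R0 >= A, the product T (T - R0) k is at most -4, so
   the set is not empty. *)
pose T := R0 + Rk + 1 + A.
have S0 : S T.
  split; first by rewrite /T -!addrA lerDl !addr_ge0// ltW.
  move=> r Tr; rewrite kk; last by apply: le_trans Tr; rewrite /T; lra.
  have T1 : 1 <= T by rewrite /T addrAC lerDr !addr_ge0// ltW.
  have TA : A <= T - R0.
    by rewrite /T (_ : _ - R0 = Rk + 1 + A) ?lerDr ?addr_ge0//; ring.
  have : A <= T * (T - R0) by apply: (le_trans TA); rewrite ler_peMl// (le_trans (ltW q0) TA).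
  move: (T * _) => z; nra.
have inS : has_inf S by split; [exists T|exists R0 => x []].
have R01 : R0 <= R1 by apply: lb_le_inf; [exists T|move=> x []].
have h r : R1 < r -> R1 * (R1 - R0) * kappa r <= - 4.
  move=> Rr; apply: (@closed_right (fun x => x * (x - R0) * kappa r)).
    by move=> x; apply: cvgM; [apply: cvgM; [exact: cvg_id|apply: cvgB; [exact: cvg_id|exact: cvg_cst]]|exact: cvg_cst].
  move=> e e0; have [|y yS] := @inf_lt _ S (Num.min r (R1 + e)) (ex_intro _ _ S0).
    by rewrite lt_min Rr ltrDl.
  rewrite lt_min => /andP[yr ye]; exists y; split => //.
    by apply: ge_inf => //; exists R0 => z [].
  by case: yS => _; apply; exact: ltW.
have R10 : 0 <= R1 by exact: le_trans R01.
have ck : continuous (fun x => kappa (pos_part x)).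
  move=> x; apply/cvgrPdist_le => e e0.
  have K1 : 0 < Kl + 1 by rewrite ltr_wpDl.
  have cp := continuous_pos_part (x := x).
  move/cvgrPdist_le : cp => /(_ (e / (Kl + 1))) /(_ (divr_gt0 e0 K1)).
  apply: filterS => y hy; apply: le_trans (klip (pos_part_ge0 _) (pos_part_ge0 _)) _.
  rewrite -(@divfK _ (Kl + 1) _ e) ?gt_eqF// mulrC.
  by apply: ler_pM => //; rewrite lerDl.
have h' r : R1 <= r -> R1 * (R1 - R0) * kappa r <= - 4.
  rewrite le_eqVlt => /predU1P[<-|]; last exact: h.
  have := @closed_right_open (fun x => R1 * (R1 - R0) * kappa (pos_part x)) R1 (- 4).
  rewrite pos_part_id//; apply.
    by move=> x; apply: cvgM; [exact: cvg_cst|exact: ck].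
  by move=> x xR; rewrite pos_part_id ?h// (le_trans R10 (ltW xR)).
(* Since -4 < 0, neither factor of R1 (R1 - R0) can vanish, which gives the strict inequalities. *)
have := h' R1 (lexx _).
have [->|R1n] := eqVneq R1 0; first by rewrite !mul0r; lra.
have [->|R1m] := eqVneq R1 R0; first by rewrite subrr mulr0 mul0r; lra.
by move=> _; split=> //; rewrite lt_neqAle eq_sym ?R1n// R1m.
Qed.

Local Notation phi := (phit kappa).
Local Notation Phi := (Phit kappa).
Local Notation c := (ct kappa).
Local Notation ep := (epst kappa).

Let kp y := Num.max (kr y) 0.

Let ckr : continuous kr. Proof. exact: (continuous_kr Kl0 k0 Rk0 klip kk). Qed.

Let ckp : continuous kp.
Proof. by move=> x; apply: (@continuous_max _ R^o); [exact: ckr|exact: cvg_cst]. Qed.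

Let kp_ge0 y : 0 <= kp y. Proof. by rewrite /kp le_max lexx orbT. Qed.
Let kr_le_kp y : kr y <= kp y. Proof. by rewrite /kp le_max lexx. Qed.

(** Replaces the integrals in the constants by primitives on all of R, which can be differentiated
    at 0 as well. *)
Lemma phit_props : exists vphi vPhi A B : R -> R,
  [/\ [/\ primitive_of vphi (fun x => - (kp x * vphi x) / 2), primitive_of vPhi vphi,
          primitive_of A (fun x => vPhi x / vphi x) & primitive_of B (fun x => (vphi x)^-1)],
      [/\ vphi 0 = 1, vPhi 0 = 0, A 0 = 0 & B 0 = 0],
      (forall x, 0 < vphi x) /\ (forall x, 0 <= x -> Phi x = vPhi x),
      c = (2 * A R1)^-1 & ep = Num.min (2 * B R1)^-1 (c * vPhi R1)].
Proof.
have [R10 _ _] := R1t_prop.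
have [P [dP P0 PE]] := primitive_exists ckp.
pose vphi x := expR (- (2^-1 * P x)).
have dphi : primitive_of vphi (fun x => - (kp x * vphi x) / 2).
  move=> x; have := dP x => ?; rewrite /vphi.
  have h : is_derive x (1 : R) (fun x => - (2^-1 * P x)) (- (2^-1 * kp x)).
    by apply: is_derive_eq; rewrite /GRing.scale/=; ring.
  have := @is_derive1_comp R expR (fun x => - (2^-1 * P x)) x _ _ (is_derive_expR _) h.
  by rewrite /comp => h2; apply: is_derive_eq; by field.
have phi0 x : 0 < vphi x by exact: expR_gt0.
have phiE x : 0 <= x -> phi x = vphi x.
  move=> x0; rewrite /phit /vphi PE//; congr (expR (- (_ * _))).
  by apply: eq_Rintegral => y; rewrite inE/= in_itv/= => /andP[y0 _]; rewrite /kp krE.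
have cphi := primitive_of_cts dphi.
have [vPhi [dPhi Phi0 PhiE]] := primitive_exists cphi.
have PhE x : 0 <= x -> Phi x = vPhi x.
  move=> x0; rewrite /Phit PhiE//; apply: eq_Rintegral => y.
  by rewrite inE/= in_itv/= => /andP[y0 _]; rewrite phiE.
have cinv : continuous (fun x => (vphi x)^-1).
  by move=> x; apply: cvgV; [rewrite gt_eqF|exact: cphi].
have [B [dB B0 BE]] := primitive_exists cinv.
have cq : continuous (fun x => vPhi x / vphi x).
  by move=> x; apply: cvgM; [exact: (primitive_of_cts dPhi)|exact: cinv].
have [A [dA A0 AE]] := primitive_exists cq.
have cE : c = (2 * A R1)^-1.
  rewrite /ct (AE _ (ltW R10)); congr ((2 * _)^-1); apply: eq_Rintegral => y.
  by rewrite inE/= in_itv/= => /andP[y0 _]; rewrite phiE// PhE.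
exists vphi, vPhi, A, B; split => //.
  by split => //; rewrite /vphi P0 mulr0 oppr0 expR0.
have eB : \int[lebesgue_measure]_(s in `[0, R1]) (phi s)^-1 = B R1.
  rewrite (BE _ (ltW R10)); apply: eq_Rintegral => y.
  by rewrite inE/= in_itv/= => /andP[y0 _]; rewrite phiE.
by rewrite /epst eB (PhE _ (ltW R10)).
Qed.

(** The concave distance function of reflection coupling: f' = phi (1 - H/2) with H' = (c Phi +
    epsilon)/phi up to R1. The constants are such that c A(R1) = 1/2 and epsilon B(R1) <= 1/2, so H
    <= 1 and phi/2 <= f' <= phi. Up to R1 the summand c Phi + epsilon of q gives the decay. Beyond
    R1 it is switched off, and the drift alone suffices by the definition of R1 and epsilon <= c
    Phi(R1). A sharp switch would make q jump, so it is smoothed by the ramp [chi], at the cost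
    e. *)
Lemma decay_supersolution (e : R) : 0 < e -> exists f w q L,
  [/\ supersolution (fun r => 0 + kr r) c e f w q L, q 0 = ep,
      forall x, 0 <= x -> f x <= x, 0 < c & 0 < ep].
Proof.
move=> e0; have [R00 kr0] := R0t_prop; have [R10 R01 kR1] := R1t_prop.
have [ph [Ph [A [B [[dph dPh dA dB] [ph00 Ph0 A0 B0] [ph0 PhE] cE eE]]]]] := phit_props.
move: PhE cE eE R00 kr0 R10 R01 kR1.
move: (Phi) (c) (ep) (R1) (R0) => P_ cc ee r1 r0 PhE cE eE r00 kr0 r10 r01 kr1.
have cph := primitive_of_cts dph; have cPh := primitive_of_cts dPh.
have kp0 r : r0 <= r -> kp r = 0 by move=> rr; rewrite /kp (max_idPr (kr0 r rr)).
have ph_mono x y : x <= y -> ph y <= ph x.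
  move=> xy; rewrite -lerN2; apply: (@primitive_le _ (fun x => - ph x) (fun x => kp x * ph x / 2)) => //.
    by move=> z; have := dph z => ?; apply: is_derive_eq; by field.
  by move=> z _ _; rewrite divr_ge0// mulr_ge0// ltW.
have ph_cst r : r0 <= r -> ph r = ph r0.
  move=> rr; apply/eqP; rewrite -subr_eq0 -normr_eq0 eq_le normr_ge0 andbT.
  rewrite -(mul0r `|r - r0|); apply: primitive_lip dph _ => z.
  by rewrite (min_idPr rr) => zr _; rewrite kp0// mul0r oppr0 mul0r normr0.
have ph_le1 x : 0 <= x -> ph x <= 1 by move=> x0; rewrite -ph00; exact: ph_mono.
set p0 := ph r0 in ph_cst.
have p00 : 0 < p0 by exact: ph0.
have php0 x : p0 <= ph x.
  by have [xr|/ltW rx] := leP x r0; [exact: ph_mono|rewrite ph_cst].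
have Ph_lin x : 0 <= x -> p0 * x <= Ph x.
  move=> x0; rewrite -subr_ge0.
  have : Ph 0 - p0 * 0 <= Ph x - p0 * x.
    apply: (@primitive_le _ (fun x => Ph x - p0 * x) (fun x => ph x - p0)) x0 _.
      by move=> z; have := dPh z => ?; apply: is_derive_eq; rewrite /GRing.scale/=; ring.
    by move=> z _ _; rewrite subr_ge0.
  by rewrite Ph0 mulr0 subrr.
have Ph_ge0 x : 0 <= x -> 0 <= Ph x by move=> x0; apply: le_trans (Ph_lin x x0); rewrite mulr_ge0// ltW.
have Ph_mono x y : x <= y -> Ph x <= Ph y.
  by move=> xy; apply: primitive_le dPh xy _ => z _ _; exact: ltW.
have Ph_tail x : r1 <= x -> Ph x = Ph r1 + p0 * (x - r1).
  move=> xr; have [z /andP[z1 _] hz] := primitive_mvt dPh xr.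
  by rewrite -(ph_cst z) ?(le_trans (ltW r01))// -hz; ring.
have Ph1 : 0 < Ph r1 by apply: lt_le_trans (Ph_lin _ (ltW r10)); rewrite mulr_gt0.
have B1 : 0 < B r1.
  have [z _] := primitive_mvt dB (ltW r10); rewrite B0 !subr0 => ->.
  by rewrite mulr_gt0// invr_gt0.
(* On [r0, r1], where phi is the constant [p0], the derivative of 2 p0 A - (s - r0) Phi is Phi - (s
   - r0) p0 >= 0. With c A(r1) = 1/2 this yields c (r1 - r0) Phi(r1) <= p0. *)
have A_lo : (r1 - r0) * Ph r1 <= 2 * p0 * A r1.
  have dV : primitive_of (fun s => 2 * p0 * A s - (s - r0) * Ph s)
      (fun s => 2 * p0 * (Ph s / ph s) - (Ph s + (s - r0) * ph s)).
    move=> s; have := dA s; have := dPh s => ? ?.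
    by apply: is_derive_eq; rewrite /GRing.scale/=; ring.
  have : 2 * p0 * A r0 - (r0 - r0) * Ph r0 <= 2 * p0 * A r1 - (r1 - r0) * Ph r1.
    apply: primitive_le dV (ltW r01) _ => s s0 _.
    rewrite ph_cst// (_ : 2 * p0 * (Ph s / p0) = 2 * Ph s); last by field; rewrite gt_eqF.
    have := Ph_lin s (le_trans r00 s0); have : 0 <= p0 * r0 by rewrite mulr_ge0// ltW.
    lra.
  rewrite subrr mul0r subr0; have : 0 <= A r0.
    rewrite -A0; apply: primitive_le dA r00 _ => z z0 _.
    by rewrite divr_ge0 ?Ph_ge0// ltW.
  move=> Ar0; have : 0 <= 2 * p0 * A r0 by rewrite !mulr_ge0// ltW.
  lra.
have A1 : 0 < A r1.
  have : 0 < 2 * p0 * A r1 by apply: lt_le_trans A_lo; rewrite mulr_gt0// subr_gt0.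
  by rewrite pmulr_rgt0// mulr_gt0.
have c0 : 0 < cc by rewrite cE invr_gt0 mulr_gt0.
have ee0 : 0 < ee by rewrite eE lt_min invr_gt0 !mulr_gt0.
have cA : cc * A r1 = 2^-1 by rewrite cE; field; rewrite gt_eqF.
have eB : ee * B r1 <= 2^-1.
  apply: (@le_trans _ _ ((2 * B r1)^-1 * B r1)); last by rewrite invfM -mulrA mulVf ?mulr1// gt_eqF.
  by rewrite ler_wpM2r// ?(ltW B1)// eE ge_min lexx.
have eP : ee <= cc * Ph r1 by rewrite eE ge_min lexx orbT.
have cP : cc * (r1 - r0) * Ph r1 <= p0.
  have : cc * ((r1 - r0) * Ph r1) <= cc * (2 * p0 * A r1) by rewrite ler_wpM2l// ltW.
  have -> : cc * (2 * p0 * A r1) = 2 * p0 * (cc * A r1) by ring.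
  by rewrite cA mulrA => h; apply: le_trans h _; lra.
(* The defect of the generator inequality where [m] is switched off, with w and f replaced by their
   bounds phi/2 and Phi. *)
pose N r := (kr r - kp r) * ph r / 2 + ee + cc * Ph r.
have cN : continuous N.
  move=> x; apply: cvgD; last by apply: cvgM; [exact: cvg_cst|exact: cPh].
  apply: cvgD; last exact: cvg_cst.
  apply: cvgM; last exact: cvg_cst.
  by apply: cvgM; [apply: cvgB; [exact: ckr|exact: ckp]|exact: cph].
(* After multiplication by r1 (r1 - r0), the kappa term is at most - 2 r p0 by the definition of r1,
   and the two other terms are at most r p0 each. *)
have N1 r : r1 <= r -> N r <= 0.
  move=> rr; have r_0 : r0 <= r by exact: le_trans (ltW r01) rr.
  rewrite /N kp0// subr0 ph_cst// krE ?(le_trans r00 r_0)//.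
  have D0 : 0 < r1 - r0 by rewrite subr_gt0.
  rewrite -(pmulr_rle0 _ (mulr_gt0 r10 D0)).
  have h1 := kr1 r rr.
  have Pr : r1 * Ph r <= r * Ph r1.
    rewrite Ph_tail//; have := Ph_lin r1 (ltW r10) => h.
    have : p0 * r1 * (r - r1) <= Ph r1 * (r - r1) by rewrite ler_wpM2r// subr_ge0.
    lra.
  have rp : 0 <= r * p0 by apply: mulr_ge0; apply: ltW => //; exact: lt_le_trans rr.
  have h2 : r1 * (r1 - r0) * kappa r * (r * p0) <= - 4 * (r * p0) by rewrite ler_wpM2r.
  have cD : 0 <= cc * (r1 - r0) by rewrite mulr_ge0// ltW.
  have h3 := ler_wpM2l cD Pr.
  have h4 : r * (cc * (r1 - r0) * Ph r1) <= r * p0.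
    by rewrite ler_wpM2l// ltW// (lt_le_trans r10 rr).
  have h5 : r1 * (r1 - r0) * ee <= r * (cc * (r1 - r0) * Ph r1).
    apply: (@le_trans _ _ (r1 * (r1 - r0) * (cc * Ph r1))).
      by rewrite ler_wpM2l// mulr_ge0// ltW.
    rewrite [leLHS](_ : _ = r1 * (cc * (r1 - r0) * Ph r1)); last by ring.
    by rewrite ler_wpM2r// mulr_ge0// ltW.
  lra.
have [d d0 [dr1 dN]] : exists2 d, 0 < d & d < r1 /\ forall r, r1 - d <= r -> N r <= e.
  have /cvgrPdist_lt/(_ _ e0)/nbhs_ballP[d /= d0 hd] := cN r1.
  exists (Num.min (d / 2) (r1 / 2)); first by rewrite lt_min !divr_gt0.
  split; first by rewrite gt_min; apply/orP; right; lra.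
  move=> r; rewrite lerBlDr -lerBlDl le_min => /andP[rd _].
  have [h|h] := leP r1 r; first by apply: le_trans (N1 r h) _; exact: ltW.
  have /hd : ball r1 d r by rewrite /ball/= gtr0_norm ?subr_gt0//; lra.
  by have := N1 r1 (lexx _); have := ler_norm (N r - N r1); rewrite distrC; lra.
(* A Lipschitz ramp from 1 to 0 over [r1 - d, r1], the interval on which continuity still gives [N]
   <= e. *)
pose chi x := Num.min (pos_part ((r1 - x) / d)) 1.
have chi01 x : 0 <= chi x <= 1 by rewrite le_min pos_part_ge0 ler01 ge_min lexx orbT.
have chi1 x : x <= r1 - d -> chi x = 1.
  move=> xd; have h : 1 <= (r1 - x) / d by rewrite ler_pdivlMr// mul1r; lra.
  by rewrite /chi pos_part_id ?(min_idPr h)// (le_trans ler01 h).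
have chi0 x : r1 <= x -> chi x = 0.
  move=> rx; rewrite /chi /pos_part (max_idPr _) ?(min_idPl ler01)//.
  by rewrite mulr_le0_ge0// ?subr_le0// invr_ge0 ltW.
have chi_lip a z : lip_on a z d^-1 chi.
  move=> x y _ _ _ _; rewrite /chi.
  have : `|pos_part ((r1 - x) / d) - pos_part ((r1 - y) / d)| <= d^-1 * `|x - y|.
    have -> : d^-1 * `|x - y| = `|(r1 - x) / d - (r1 - y) / d|.
      by rewrite -mulrBl normrM (gtr0_norm (x := d^-1)) ?invr_gt0// mulrC distrC; congr (`|_| * _); ring.
    exact: lip_max.
  by apply: le_trans; exact: lip_min.
have cchi : continuous chi.
  have cmin1 : continuous (fun y : R => Num.min y 1).
    by move=> x; apply: (@continuous_min _ R^o); [exact: cvg_id|exact: cvg_cst].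
  move=> x; apply: (@continuous_comp _ _ _ (fun x => pos_part ((r1 - x) / d)) (fun y : R => Num.min y 1)); last exact: cmin1.
  apply: (@continuous_comp _ _ _ (fun x => (r1 - x) / d) pos_part); last exact: continuous_pos_part.
  by apply: cvgM; [apply: cvgB; [exact: cvg_cst|exact: cvg_id]|exact: cvg_cst].
pose m x := cc * Ph x + ee.
have cm : continuous m.
  by move=> x; apply: cvgD; [apply: cvgM; [exact: cvg_cst|exact: cPh]|exact: cvg_cst].
have m0 x : 0 <= x -> 0 <= m x by move=> x0; rewrite addr_ge0 ?(ltW ee0)// mulr_ge0 ?Ph_ge0// ltW.
have ch : continuous (fun x => m x * chi x / ph x).
  move=> x; apply: cvgM; first by apply: cvgM; [exact: cm|exact: cchi].
  by apply: cvgV; [rewrite gt_eqF|exact: cph].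
have [H [dH H0 _]] := primitive_exists ch.
have H_mono x y : 0 <= x -> x <= y -> H x <= H y.
  move=> x0 xy; apply: primitive_le dH xy _ => z z0 _.
  by rewrite divr_ge0 ?(ltW (ph0 _))// mulr_ge0 ?m0 ?(le_trans x0 z0)//; case/andP: (chi01 z).
have H_le1 x : 0 <= x -> H x <= 1.
  have Hlo y : 0 <= y -> H y <= cc * A y + ee * B y.
    move=> y0; rewrite -subr_ge0.
    have : cc * A 0 + ee * B 0 - H 0 <= cc * A y + ee * B y - H y.
      apply: (@primitive_le _ (fun y => cc * A y + ee * B y - H y) (fun y => m y * (1 - chi y) / ph y)) y0 _.
        move=> z; have := dA z; have := dB z; have := dH z => ? ? ?.
        by apply: is_derive_eq; rewrite /GRing.scale/= /m; ring.
      move=> z z0 _; rewrite divr_ge0 ?(ltW (ph0 _))// mulr_ge0 ?m0// subr_ge0.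
      by case/andP: (chi01 z).
    by rewrite A0 B0 H0 !mulr0 addr0 subrr.
  have H1 : H r1 <= 1 by apply: le_trans (Hlo _ (ltW r10)) _; rewrite cA; lra.
  move=> x0; have [xr|/ltW rx] := leP x r1; first exact: le_trans (H_mono _ _ x0 xr) H1.
  apply: le_trans H1; rewrite -lerN2.
  apply: (@primitive_le _ (fun x => - H x) (fun x => - (m x * chi x / ph x))) => //.
    by move=> z; have := dH z => ?; apply: is_derive_eq.
  by move=> z rz _; rewrite chi0// mulr0 mul0r oppr0.
pose w x := ph x * (1 - H x / 2).
pose q x := kp x * w x + m x * chi x.
have dw : primitive_of w (fun x => - q x / 2).
  move=> x; have := dph x; have := dH x => ? ?.
  apply: is_derive_eq; rewrite /GRing.scale/= /q /w.
  by field; rewrite gt_eqF.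
have cw := primitive_of_cts dw.
have [f [df f0 _]] := primitive_exists cw.
have wlo x : 0 <= x -> ph x / 2 <= w x.
  by move=> x0; rewrite /w ler_pM2l//; have := H_le1 x x0; lra.
have whi x : 0 <= x -> w x <= ph x.
  move=> x0; rewrite /w ler_piMr ?(ltW (ph0 _))//; have := H_mono 0 x (lexx _) x0; rewrite H0; lra.
have w_0 x : 0 <= x -> 0 <= w x by move=> x0; apply: le_trans (wlo x x0); rewrite divr_ge0 ?(ltW (ph0 _)).
have f_Ph x : 0 <= x -> f x <= Ph x.
  move=> x0; rewrite -subr_ge0; have : Ph 0 - f 0 <= Ph x - f x.
    apply: (@primitive_le _ (fun x => Ph x - f x) (fun x => ph x - w x)) x0 _.
      by move=> z; have := dPh z; have := df z => ? ?; apply: is_derive_eq.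
    by move=> z z0 _; rewrite subr_ge0 whi.
  by rewrite Ph0 f0 subrr.
have cq : continuous q.
  move=> x; apply: cvgD; first by apply: cvgM; [exact: ckp|exact: cw].
  by apply: cvgM; [exact: cm|exact: cchi].
have qhi x : r1 <= x -> q x = 0.
  by move=> rx; rewrite /q chi0// mulr0 addr0 kp0 ?mul0r// (le_trans (ltW r01)).
have q00 : q 0 = ee.
  rewrite /q /kp krE// mulr0 maxxx mul0r add0r /m Ph0 mulr0 add0r chi1 ?mulr1//.
  by rewrite subr_ge0 ltW.
have r10' := ltW r10.
have kpl : lip_on 0 r1 (- k + 2 * Kl * Rk) kp.
  move=> x y x0 _ y0 _; apply: le_trans (kr_lip Kl0 k0 Rk0 klip kk x0 y0).
  exact: lip_max.
have K0 := kr_lipC Kl0 k0 Rk0.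
have cqh : continuous (fun x => - q x / 2).
  by move=> x; apply: cvgM; [apply: cvgN; exact: cq|exact: cvg_cst].
have [Lw Lw0 wl] := lip_on_primitive r10' dw cqh.
have dm : primitive_of m (fun x => cc * ph x).
  by move=> x; have := dPh x => ?; apply: is_derive_eq; rewrite /GRing.scale/=; ring.
have ccph : continuous (fun x => cc * ph x).
  by move=> x; apply: cvgM; [exact: cvg_cst|exact: cph].
have [Lm Lm0 ml] := lip_on_primitive r10' dm ccph.
have [L1 L10 l1] := lip_onM r10' ckp cw K0 Lw0 kpl wl.
have d10 : 0 <= d^-1 by rewrite invr_ge0 ltW.
have [L2 L20 l2] := lip_onM r10' cm cchi Lm0 d10 ml (chi_lip 0 r1).
have qE x : q x = q (Num.min x r1).
  have [//|/ltW h] := leP x r1; by rewrite !qhi.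
exists f, w, q, (L1 + L2); split => //; last first.
  by move=> x x0; have [z /andP[z0 _]] := primitive_mvt df x0;
    rewrite f0 !subr0 => ->; rewrite ler_piMl// (le_trans (whi z z0))// ph_le1.
split => //.
- exact: addr_ge0.
- move=> x y x0 y0; rewrite (qE x) (qE y).
  have x1 : 0 <= Num.min x r1 by rewrite le_min x0.
  have y1 : 0 <= Num.min y r1 by rewrite le_min y0.
  have x2 : Num.min x r1 <= r1 by rewrite ge_min lexx orbT.
  have y2 : Num.min y r1 <= r1 by rewrite ge_min lexx orbT.
  have hm : `|Num.min x r1 - Num.min y r1| <= `|x - y|.
    exact: lip_min.
  apply: (@le_trans _ _ ((L1 + L2) * `|Num.min x r1 - Num.min y r1|)); last first.
    by rewrite ler_wpM2l// addr_ge0.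
  move: (Num.min x r1) (Num.min y r1) x1 x2 y1 y2 {hm} => x' y' x1 x2 y1 y2.
  rewrite /q (_ : _ - _ = (kp x' * w x' - kp y' * w y') + (m x' * chi x' - m y' * chi y')); last by ring.
  by apply: le_trans (ler_normD _ _) _; rewrite [leRHS]mulrDl; apply: lerD; [exact: l1|exact: l2].
- by rewrite q00 ltW.
- move=> r r_0; rewrite add0r q00 /q.
  have /andP[x0 x1] := chi01 r.
  have k_0 : kr r - kp r <= 0 by rewrite subr_le0.
  have h1 : (kr r - kp r) * w r <= (kr r - kp r) * (ph r / 2).
    by apply: ler_wnM2l => //; exact: wlo.
  have h2 : (kr r - kp r) * (ph r / 2) <= (1 - chi r) * ((kr r - kp r) * (ph r / 2)).
    rewrite -subr_ge0 (_ : _ - _ = - (chi r * ((kr r - kp r) * (ph r / 2)))); last by ring.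
    rewrite oppr_ge0 mulr_ge0_le0// mulr_le0_ge0// divr_ge0// ltW//.
  have h3 : cc * f r <= cc * Ph r by rewrite ler_wpM2l ?f_Ph// ltW.
  (* By [h2] and [h3], the two sides of the generator inequality without e differ by at most (1 -
     chi) N. *)
  have h4 : (1 - chi r) * N r <= e.
    have [rd|/ltW rd] := leP r (r1 - d); first by rewrite chi1// subrr mul0r ltW.
    have [n0|/ltW n0] := leP (N r) 0.
      by apply: (@le_trans _ _ 0); [rewrite mulr_ge0_le0// subr_ge0|exact: ltW].
    by apply: le_trans (dN r rd); rewrite ler_piMl//; lra.
  move: h4; rewrite /N /m; lra.
Qed.

End Decay.

(** * Chains driven by independent noise *)

Section Power.
Context {R : realType} {d : measure_display} {S : measurableType d}.
Variable mu : probability S R.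

Definition tcons n (p : S * n.-tuple S) : n.+1.-tuple S := [the n.+1.-tuple S of p.1 :: p.2].

Lemma measurable_tcons n : measurable_fun setT (@tcons n).
Proof. exact: (@measurable_cons _ _ _ _ fst n snd). Qed.

HB.instance Definition _ n := isMeasurableFun.Build _ _ _ _ (@tcons n) (@measurable_tcons n).

Fixpoint pw n : probability (n.-tuple S) R :=
  match n with
  | 0%N => \d_([tuple] : 0.-tuple S)
  | m.+1 => distribution (mu \x pw m)%E (@tcons m)
  end.

Lemma measurable_tcons_section n (E : set (n.+1.-tuple S)) (x : S) : measurable E ->
  measurable [set w : n.-tuple S | E (tcons (x, w))].
Proof.
move=> mE; have := measurable_xsection x (measurable_tcons measurableT mE).
rewrite setTI (_ : xsection _ x = [set w | E (tcons (x, w))])//.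
by apply/seteqP; split=> w; rewrite /xsection/= inE.
Qed.

Lemma pwS n (E : set (n.+1.-tuple S)) : measurable E ->
  pw n.+1 E = (\int[mu]_x pw n [set w | E (tcons (x, w))])%E.
Proof.
move=> mE; rewrite /= /pushforward /product_measure1; apply: eq_integral => x _ /=.
by congr (pw n _); apply/seteqP; split=> w; rewrite /xsection/= inE.
Qed.

Lemma measurable_pw_section n (E : set (n.+1.-tuple S)) : measurable E ->
  measurable_fun setT (fun x => pw n [set w | E (tcons (x, w))]).
Proof.
move=> mE; have mE' := measurable_tcons measurableT mE; rewrite setTI in mE'.
have := measurable_fun_xsection (pw n) mE'.
congr (measurable_fun _ _); apply/funext => x /=.
by congr (pw n _); apply/seteqP; split=> w; rewrite /xsection/= inE.
Qed.

Lemma pwS_le n (E : set (n.+1.-tuple S)) (F : S -> \bar R) : measurable E ->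
  measurable_fun setT F -> (forall x, pw n [set w | E (tcons (x, w))] <= F x)%E ->
  (pw n.+1 E <= \int[mu]_x F x)%E.
Proof.
move=> mE mF h; rewrite pwS//; apply: ge0_le_integral => //.
exact: measurable_pw_section.
Qed.

Lemma pwS_le_cst n (E : set (n.+1.-tuple S)) (c : \bar R) : measurable E ->
  (forall x, pw n [set w | E (tcons (x, w))] <= c)%E -> (pw n.+1 E <= c)%E.
Proof.
move=> mE h; apply: le_trans (pwS_le mE (measurable_cst c) h) _.
by rewrite integral_prob_cst.
Qed.

Definition past n k (E : set (n.-tuple S)) :=
  measurable E /\ forall w w' : n.-tuple S, take k w = take k w' -> E w -> E w'.

Lemma past_section n k (E : set (n.+1.-tuple S)) x : past k.+1 E ->
  past k [set w : n.-tuple S | E (tcons (x, w))].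
Proof.
move=> [mE h]; split; first exact: measurable_tcons_section.
by move=> w w' ww /=; apply: h => /=; rewrite ww.
Qed.

Lemma past_sub n k l (E : set (n.-tuple S)) : (k <= l)%N -> past k E -> past l E.
Proof.
move=> kl [mE h]; split => // w w' ww; apply: h.
by rewrite -(take_takel _ kl) ww take_takel.
Qed.

Variables (dT : measure_display) (St : measurableType dT).
Variable step : nat -> St -> S -> St.
Hypothesis mstep : forall i, measurable_fun setT (fun p : St * S => step i p.1 p.2).

Fixpoint traj i x (l : seq S) : St :=
  if l is a :: l' then traj i.+1 (step i x a) l' else x.

Lemma traj_cat i x l1 l2 : traj i x (l1 ++ l2) = traj (i + size l1) (traj i x l1) l2.
Proof. by elim: l1 i x => [|a l IH] i x /=; [rewrite addn0|rewrite IH addSnnS]. Qed.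

Lemma measurable_traj n k i :
  measurable_fun setT (fun p : St * n.-tuple S => traj i p.1 (take k p.2)).
Proof.
elim: n k i => [|n IH] k i.
  rewrite (_ : (fun _ => _) = fst) //; apply/funext => -[x w] /=.
  by rewrite [w]tuple0 /=; case: k.
case: k => [|k].
  rewrite (_ : (fun _ => _) = fst) //; apply/funext => -[x w] /=.
  by rewrite take0.
rewrite (_ : (fun _ => _) = (fun p : St * n.-tuple S => traj i.+1 p.1 (take k p.2)) \o
   (fun p : St * n.+1.-tuple S => (step i p.1 (thead p.2), [tuple of behead p.2]))).
  apply: measurableT_comp; first exact: IH.
  apply/measurable_fun_pairP; split.
    rewrite (_ : _ \o _ = (fun q : St * S => step i q.1 q.2) \o (fun p : St * n.+1.-tuple S => (p.1, thead p.2)))//.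
    apply: measurableT_comp; first exact: mstep.
    apply/measurable_fun_pairP; split; first exact: measurable_fst.
    by apply: (measurableT_comp (measurable_tnth ord0)) measurable_snd.
  by apply: (measurableT_comp (@measurable_behead _ _ _)).
by apply/funext => -[x w] /=; case/tupleP: w => a w; rewrite theadE.
Qed.

Lemma measurable_traj_cst n k i x :
  measurable_fun setT (fun w : n.-tuple S => traj i x (take k w)).
Proof.
rewrite (_ : (fun w => _) = (fun p : St * n.-tuple S => traj i p.1 (take k p.2)) \o (pair x))//.
by apply: measurableT_comp; [exact: measurable_traj|exact: pair1_measurable].
Qed.

Variables (q : nat) (eta : nat -> St -> S -> 'rV[R]_q).
Hypothesis meta : forall i, measurable_fun setT (fun p : St * S => eta i p.1 p.2).
Hypothesis eta_law : forall i x (f : 'rV[R]_q -> \bar R), measurable_fun setT f ->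
  (forall g, 0 <= f g)%E -> (\int[mu]_a f (eta i x a) = \int[gauss q]_g f g)%E.

(** The increment [eta] may depend on the state, but by [eta_law] its law is the same Gaussian from
    every state, so these sums form a Gaussian random walk. *)
Fixpoint nsum i x (l : seq S) : 'rV[R]_q :=
  if l is a :: l' then eta i x a + nsum i.+1 (step i x a) l' else 0.

Lemma nsum_cat i x l1 l2 :
  nsum i x (l1 ++ l2) = nsum i x l1 + nsum (i + size l1) (traj i x l1) l2.
Proof.
by elim: l1 i x => [|a l IH] i x /=; [rewrite addn0 add0r|rewrite IH addSnnS addrA].
Qed.

Lemma measurable_nsum n k i :
  measurable_fun setT (fun p : St * n.-tuple S => nsum i p.1 (take k p.2)).
Proof.
elim: n k i => [|n IH] k i.
  rewrite (_ : (fun _ => _) = cst 0) //; apply/funext => -[x w] /=.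
  by rewrite [w]tuple0 /=; case: k.
case: k => [|k].
  rewrite (_ : (fun _ => _) = cst 0) //; apply/funext => -[x w] /=.
  by rewrite take0.
have m1 : measurable_fun setT (fun p : St * n.+1.-tuple S => (p.1, thead p.2)).
  apply/measurable_fun_pairP; split; first exact: measurable_fst.
  by apply: (measurableT_comp (measurable_tnth ord0)) measurable_snd.
rewrite (_ : (fun _ => _) = (fun p : St * n.+1.-tuple S =>
   ((fun q : St * S => eta i q.1 q.2) \o (fun p : St * n.+1.-tuple S => (p.1, thead p.2))) p +
   ((fun p : St * n.-tuple S => nsum i.+1 p.1 (take k p.2)) \o
     (fun p : St * n.+1.-tuple S => (step i p.1 (thead p.2), [tuple of behead p.2]))) p)).
  apply: measurable_rVD; first by apply: measurableT_comp.
  apply: measurableT_comp; first exact: IH.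
  apply/measurable_fun_pairP; split.
    rewrite (_ : _ \o _ = (fun q : St * S => step i q.1 q.2) \o (fun p : St * n.+1.-tuple S => (p.1, thead p.2)))//.
    by apply: measurableT_comp.
  by apply: (measurableT_comp (@measurable_behead _ _ _)).
by apply/funext => -[x w] /=; case/tupleP: w => a w; rewrite theadE.
Qed.

Lemma measurable_nsum_cst n k i x :
  measurable_fun setT (fun w : n.-tuple S => nsum i x (take k w)).
Proof.
rewrite (_ : (fun w => _) = (fun p : St * n.-tuple S => nsum i p.1 (take k p.2)) \o (pair x))//.
by apply: measurableT_comp; [exact: measurable_nsum|exact: pair1_measurable].
Qed.

End Power.

(** * Stability of Gaussian measures under convolution *)

Section Gauss_convolution.
Context {R : realType}.
Local Open Scope ereal_scope.

Let swap d1 d2 (T1 : measurableType d1) (T2 : measurableType d2)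
  (P1 : probability T1 R) (P2 : probability T2 R) (f : T1 * T2 -> \bar R) :
  measurable_fun setT f -> (forall p, 0 <= f p) ->
  \int[P1]_x \int[P2]_y f (x, y) = \int[P2]_y \int[P1]_x f (x, y).
Proof. by move=> mf f0; rewrite -[LHS]fubini_tonelli1// -[RHS]fubini_tonelli2. Qed.

Let mfub d1 d2 (T1 : measurableType d1) (T2 : measurableType d2)
  (P2 : probability T2 R) (f : T1 * T2 -> \bar R) :
  measurable_fun setT f -> (forall p, 0 <= f p) ->
  measurable_fun setT (fun x => \int[P2]_y f (x, y)).
Proof. by move=> mf f0; exact: measurable_fun_fubini_tonelli_F. Qed.

(** a x + b y is the inner product with the unit vector (a, b), so this is [gauss_inner] in the
    plane. *)
Lemma gauss1_conv (a b : R) (f : R -> \bar R) : measurable_fun setT f -> (forall x, 0 <= f x) ->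
  (a ^+ 2 + b ^+ 2 = 1)%R ->
  \int[gauss1]_x \int[gauss1]_y f (a * x + b * y)%R = \int[gauss1]_x f x.
Proof.
move=> mf f0 ab.
pose e : 'rV[R]_2 := rVcons (a, rVcons (b, 0%R)).
have e1 : inner e e = 1%R.
  by rewrite /e !rVcons_inner/= /inner big_ord0 addr0 -!expr2.
rewrite -(gauss_inner mf f0 e1).
have mi n (v : 'rV[R]_n) : measurable_fun setT (fun g : 'rV[R]_n => f (inner v g)).
  apply: (measurableT_comp mf); exact: measurable_inner.
rewrite integral_gaussS//.
apply: eq_integral => x _; rewrite integral_gaussS//; last first.
  apply: (measurableT_comp (mi _ _)); apply: (measurableT_comp (@measurable_rVcons _ _)).
  exact: pair1_measurable.
apply: eq_integral => y _; rewrite (_ : (fun _ => _) = cst (f (a * x + b * y)%R)); last first.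
  by apply/funext => v; rewrite /e !rVcons_inner/= {1}/inner big_ord0 addr0.
by rewrite integral_prob_cst.
Qed.

Lemma gauss_conv n (a b : R) (f : 'rV[R]_n -> \bar R) : measurable_fun setT f ->
  (forall x, 0 <= f x) -> (a ^+ 2 + b ^+ 2 = 1)%R ->
  \int[gauss n]_x \int[gauss n]_y f (a *: x + b *: y)%R = \int[gauss n]_x f x.
Proof.
move=> + + ab; elim: n f => [|n IH] f mf f0.
  have E (v : 'rV[R]_0) : v = 0%R by rewrite thinmx0.
  transitivity (f 0%R); last first.
    by rewrite -[LHS](integral_prob_cst (gauss 0)); apply: eq_integral => v _; rewrite [v in RHS]E.
  rewrite -[RHS](integral_prob_cst (gauss 0)); apply: eq_integral => v _.
  rewrite -[RHS](integral_prob_cst (gauss 0)); apply: eq_integral => v' _.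
  by rewrite [X in f X]E.
pose F (p : R * 'rV[R]_n) := f (rVcons p).
have mF : measurable_fun setT F by apply: measurableT_comp mf _; exact: measurable_rVcons.
have F0 p : 0 <= F p by exact: f0.
have mlin d (T : measurableType d) m (u v : T -> 'rV[R]_m) : measurable_fun setT u -> measurable_fun setT v ->
    measurable_fun setT (fun z => a *: u z + b *: v z)%R.
  by move=> mu mv; apply: measurable_rVD; exact: measurable_rVZ.
have mG : measurable_fun setT (fun v : 'rV[R]_n.+1 => \int[gauss n.+1]_v' f (a *: v + b *: v')%R).
  apply: (@mfub _ _ _ _ (gauss n.+1) (fun p : 'rV[R]_n.+1 * 'rV[R]_n.+1 => f (a *: p.1 + b *: p.2)%R)) => //.
  by apply: (measurableT_comp mf); apply: mlin.
rewrite (integral_gaussS mG); last by move=> v; exact: integral_ge0.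
rewrite (integral_gaussS mf f0).
have mFu : measurable_fun setT (fun t => \int[gauss n]_u F (t, u)).
  exact: (@mfub _ _ _ _ (gauss n) F).
rewrite -(gauss1_conv mFu _ ab); last by move=> x; exact: integral_ge0.
apply: eq_integral => x _.
transitivity (\int[gauss n]_u \int[gauss1]_x' \int[gauss n]_u' F (a * x + b * x', a *: u + b *: u')%R).
  apply: eq_integral => u _; rewrite integral_gaussS; last by move=> v; exact: f0.
    2: by apply: (measurableT_comp mf); apply: mlin.
  apply: eq_integral => x' _; apply: eq_integral => u' _.
  by congr (f _); rewrite /F -!rVconsZ -rVconsD.
have maff (y : R) : measurable_fun setT (fun x' : R => (a * y + b * x')%R).
  by apply: measurable_funD => //; exact: measurable_funM.
rewrite (@swap _ _ _ _ (gauss n) gauss1 (fun p => \int[gauss n]_u' F (a * x + b * p.2, a *: p.1 + b *: u')%R)).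
- apply: eq_integral => x' _; apply: (IH (fun u => F ((a * x + b * x')%R, u))) => //.
  by apply: (measurableT_comp mF); exact: pair1_measurable.
- apply: (@mfub _ _ _ _ (gauss n)
    (fun p : ('rV[R]_n * R) * 'rV[R]_n => F (a * x + b * p.1.2, a *: p.1.1 + b *: p.2)%R)) => //.
  apply: (measurableT_comp mF); apply/measurable_fun_pairP; split.
    apply: (measurableT_comp (maff x)).
    by apply: (measurableT_comp measurable_snd).
  by apply: mlin => //; apply: (measurableT_comp measurable_fst).
- by move=> p; exact: integral_ge0.
Qed.

End Gauss_convolution.

Lemma prob_bigsetU_le d (T : measurableType d) (R : realType) (P : probability T R)
    n (A : 'I_n -> set T) (c : R) : (forall i, measurable (A i)) ->
  (forall i, (P (A i) <= c%:E)%E) -> (P (\big[setU/set0]_i A i) <= (n%:R * c)%:E)%E.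
Proof.
elim: n A => [|n IH] A mA h; first by rewrite big_ord0 measure0 mul0r.
rewrite big_ord_recr/= -natr1 mulrDl mul1r EFinD.
have mU : measurable (\big[setU/set0]_(i < n) A (widen_ord (leqnSn n) i)).
  by apply: bigsetU_measurable => i _; exact: mA.
apply: le_trans (measureU2 P mU (mA ord_max)) _.
by apply: leeD; [exact: IH|exact: h].
Qed.

(** * Symmetry, tails and product form of Gaussian measures *)

Section Gauss_facts.
Context {R : realType}.

Lemma gauss_prob n (A : set 'rV[R]_n) : measurable A ->
  gauss n A = (\int[gauss n]_g (\1_A g)%:E)%E.
Proof. by move=> mA; rewrite integral_indic// setIT. Qed.

Lemma measurable_affine n (a : 'rV[R]_n) (c : R) (C : set 'rV[R]_n) : measurable C ->
  measurable [set g : 'rV[R]_n | C (a + c *: g)].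
Proof.
move=> mC; have := @measurable_rVD _ _ R n (fun=> a) (fun g : 'rV[R]_n => c *: g) (measurable_cst _).
move=> /(_ (measurable_rVZ (measurable_cst _) (@measurable_id _ _ setT)) measurableT _ mC).
by rewrite setTI.
Qed.

(** The case a = -1, b = 0 of the convolution formula. *)
Lemma gauss_opp n (c : R) (C : set 'rV[R]_n) : measurable C ->
  gauss n [set g | C (- c *: g)] = gauss n [set g | C (c *: g)].
Proof.
move=> mC; have mc (b : R) : measurable [set g : 'rV[R]_n | C (b *: g)].
  by have := measurable_affine 0 b mC; under eq_set do rewrite add0r.
rewrite !gauss_prob//.
have i1 : (-1 : R) ^+ 2 + 0 ^+ 2 = 1 by rewrite sqrrN expr1n expr0n addr0.
rewrite -[RHS](gauss_conv _ _ i1)//; last by apply/measurable_EFinP; exact: measurable_indic.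
apply: eq_integral => g _.
rewrite -[LHS](integral_prob_cst (gauss n)); apply: eq_integral => g' _.
congr (_%:E); rewrite scale0r addr0 scaleN1r /= !indicE; congr (_ : bool)%:R.
by apply/idP/idP; rewrite !inE/= scalerN scaleNr.
Qed.

Lemma gauss_step n (a : 'rV[R]_n) k (C : set 'rV[R]_n) : measurable C ->
  (\int[gauss n]_v gauss n [set g | C (a + v + Num.sqrt k%:R *: g)%R])%E =
  gauss n [set g | C (a + Num.sqrt k.+1%:R *: g)%R].
Proof.
move=> mC.
have k0 : 0 < Num.sqrt k.+1%:R :> R by rewrite sqrtr_gt0.
have kn : Num.sqrt k.+1%:R != 0 :> R by rewrite gt_eqF.
pose b : R := (Num.sqrt k.+1%:R)^-1; pose b' : R := Num.sqrt k%:R / Num.sqrt k.+1%:R.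
have bb : b ^+ 2 + b' ^+ 2 = 1.
  rewrite /b /b' expr_div_n exprVn !sqr_sqrtr ?ler0n// -[X in X + _]mul1r -mulrDl.
  by rewrite -natr1 addrC divff// natr1 pnatr_eq0.
rewrite [RHS]gauss_prob; last exact: measurable_affine.
rewrite -[RHS](gauss_conv _ _ bb)//; last first.
  by apply/measurable_EFinP; apply: measurable_indic; exact: measurable_affine.
apply: eq_integral => v _; rewrite gauss_prob; last exact: measurable_affine.
apply: eq_integral => g _; congr (_%:E); rewrite !indicE; congr (_ : bool)%:R.
have e : a + v + Num.sqrt k%:R *: g = a + Num.sqrt k.+1%:R *: (b *: v + b' *: g).
  by rewrite scalerDr !scalerA /b /b' divff// scale1r mulrCA divff// mulr1 addrA.
by apply/idP/idP; rewrite !inE/= e.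
Qed.

Lemma gauss_coord n (i : 'I_n) (C : set R) : measurable C ->
  gauss n [set g | C (g ord0 i)] = gauss1 C.
Proof.
move=> mC; pose e : 'rV[R]_n := delta_mx ord0 i.
have eE v : inner e v = v ord0 i.
  rewrite /inner (bigD1 i)//= mxE !eqxx mul1r big1 ?addr0// => j ji.
  by rewrite mxE (negbTE ji) andbF mul0r.
have mg : measurable [set g : 'rV[R]_n | C (g ord0 i)].
  by have := measurable_coord i measurableT mC; rewrite setTI.
rewrite gauss_prob//.
have := @gauss_inner R n e (fun x => (\1_C x)%:E) _ _ _.
have -> : (\int[gauss1]_x (\1_C x)%:E)%E = gauss1 C by rewrite integral_indic// setIT.
move=> <-//.
- by apply: eq_integral => v _; rewrite eE !indicE; congr ((_ : bool)%:R%:E); apply/idP/idP; rewrite !inE.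
- by apply/measurable_EFinP.
- by rewrite eE mxE !eqxx.
Qed.

Lemma gauss1_tail (a : R) : 0 < a ->
  (gauss1 [set x : R | (a < `|x|)%R] <= ((\int[gauss1]_x (x ^+ 4)) / a ^+ 4)%:E)%E.
Proof.
move=> a0; set A := [set _ | _].
have mA : measurable A.
  have := @normr_measurable R setT measurableT _ (measurable_itv `]a, +oo[).
  by rewrite setTI (_ : _ @^-1` _ = A)//; apply/seteqP; split=> x; rewrite /A/= in_itv/= andbT.
have i4 : gauss1.-integrable setT (EFin \o (fun x : R => x ^+ 4)).
  by apply: (gauss1_integrable (C := 1)) => // x; rewrite mul1r ger0_norm ?exprn_even_ge0// lerDr.
have -> : gauss1 A = (\int[gauss1]_x (\1_A x))%:E.
  by rewrite /Rintegral integral_indic// setIT fineK// fin_num_measure.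
rewrite mulrC -RintegralZl// lee_fin; apply: le_Rintegral => //.
- apply: (gauss1_integrable (C := 1)); first exact: measurable_indic.
  move=> x; rewrite mul1r; apply: (@le_trans _ _ 1); last by rewrite lerDl exprn_even_ge0.
  by rewrite indicE; case: (_ \in _); rewrite ?normr1 ?normr0.
- by have := integrableZl measurableT (a ^- 4) i4.
- move=> x _; rewrite indicE; have [xA|xA] := boolP (x \in A); last first.
    by apply: mulr_ge0; [rewrite invr_ge0 exprn_even_ge0|exact: exprn_even_ge0].
  rewrite mulrC ler_pdivlMr ?exprn_gt0// mul1r -[leRHS]ger0_norm ?exprn_even_ge0// normrX.
  have ax : a <= `|x| by move: xA; rewrite inE/= => /ltW.
  by rewrite lerXn2r// nnegrE (le_trans (ltW a0)).
Qed.

(** Markov's inequality for fourth moments. With c the square root of a time span, the bound is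
    quadratic in that time, so it remains small when summed over the blocks of a partition. *)
Lemma gauss_tail n : exists2 K : R, 0 <= K & forall c e : R, 0 <= c -> 0 < e ->
  (gauss n [set g | (e < enorm (c *: g))%R] <= (K * c ^+ 4 / e ^+ 4)%:E)%E.
Proof.
pose m4 : R := \int[gauss1]_x (x ^+ 4).
have m40 : 0 <= m4 by apply: Rintegral_ge0 => x _; exact: exprn_even_ge0.
exists (n%:R * (m4 * n.+1%:R ^+ 4)); first by rewrite !mulr_ge0 ?exprn_ge0.
move=> c e; rewrite le_eqVlt => /predU1P[<- e0|c0 e0].
  rewrite (_ : [set _ | _] = set0) ?measure0 ?lee_fin.
    by rewrite expr0n/= mulr0 mul0r.
  by apply/seteqP; split=> g //=; rewrite scale0r enorm0 ltNge ltW.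
pose a := e / (c * n.+1%:R).
have a0 : 0 < a by rewrite divr_gt0// mulr_gt0.
pose A (i : 'I_n) := [set g : 'rV[R]_n | a < `|g ord0 i|].
have mA1 : measurable [set x : R | (a < `|x|)%R].
  have := @normr_measurable R setT measurableT _ (measurable_itv `]a, +oo[).
  by rewrite setTI (_ : _ @^-1` _ = [set x | a < `|x|])//; apply/seteqP; split=> x; rewrite /=/= in_itv/= andbT.
have mA i : measurable (A i).
  by have := measurable_coord i measurableT mA1; rewrite setTI.
apply: (@le_trans _ _ (gauss n (\big[setU/set0]_i A i))).
  apply: le_measure; rewrite ?inE.
  - have : measurable_fun setT (fun g : 'rV[R]_n => enorm (c *: g)).
      by apply: measurable_enorm; exact: measurable_rVZ.
    move=> /(_ measurableT _ (measurable_itv `]e, +oo[)); rewrite setTI.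
    by congr measurable; apply/seteqP; split=> x; rewrite /= in_itv/= andbT.
  - exact: bigsetU_measurable.
  move=> g /=; rewrite enormZ (gtr0_norm c0) => h.
  rewrite -bigcup_seq /bigcup/=.
  apply: contrapT => hn; move: h; apply/negP; rewrite -leNgt.
  have hi i : `|g ord0 i| <= a.
    rewrite leNgt; apply/negP => hi; apply: hn; exists i => //=; by rewrite mem_index_enum.
  apply: (@le_trans _ _ (c * (n%:R * a))).
    rewrite ler_wpM2l// ?(ltW c0)//; apply: le_trans (enorm_le_sum g) _.
    rewrite mulr_natl -[n in leRHS]card_ord -sumr_const; apply: ler_sum => i _; exact: hi.
  rewrite /a (_ : c * _ = e * (n%:R / n.+1%:R)); last first.
    by field; rewrite (gt_eqF c0) nat1r pnatr_eq0.
  by rewrite ler_piMr ?(ltW e0)// ler_pdivrMr// mul1r ler_nat.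
have -> : n%:R * (m4 * n.+1%:R ^+ 4) * c ^+ 4 / e ^+ 4 = n%:R * (m4 / a ^+ 4).
  by rewrite /a; field; rewrite (gt_eqF c0) (gt_eqF e0) nat1r pnatr_eq0.
apply: prob_bigsetU_le => // i; have := gauss_coord i mA1; rewrite /A => ->.
exact: gauss1_tail.
Qed.

(** 2a is the sum of a + cg and a - cg, so one of the two has norm above e, and both have the same
    law. *)
Lemma gauss_sym_half n (a : 'rV[R]_n) (c e : R) : 0 <= e -> e < enorm a ->
  (1 <= gauss n [set g | (e < enorm (a + c *: g))%R] + gauss n [set g | (e < enorm (a + c *: g))%R])%E.
Proof.
move=> e0 ea; pose C := [set g : 'rV[R]_n | e < enorm (a + g)].
have mC : measurable C.
  have : measurable_fun setT (fun g : 'rV[R]_n => enorm (a + g)).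
    by apply: measurable_enorm; exact: measurable_rVD.
  move=> /(_ measurableT _ (measurable_itv `]e, +oo[)); rewrite setTI.
  by congr measurable; apply/seteqP; split=> x; rewrite /C/= in_itv/= andbT.
have mc (b : R) : measurable [set g : 'rV[R]_n | C (b *: g)].
  by have := measurable_affine 0 b mC; under eq_set do rewrite add0r.
rewrite (_ : [set g | _] = [set g | C (c *: g)])//.
rewrite -{1}(gauss_opp c mC) -(@probability_setT _ _ _ (gauss n)).
apply: le_trans (measureU2 (gauss n) (mc _) (mc _)).
apply: le_measure; rewrite ?inE//; first exact: measurableU.
move=> g _ /=; rewrite /C/=.
apply: contrapT => /not_orP[/negP h1 /negP h2]; move: ea; apply/negP; rewrite -leNgt.
move: h1 h2; rewrite -!leNgt => h1 h2.
have : enorm (2 *: a) <= 2 * e.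
  rewrite (_ : 2 *: a = (a + - c *: g) + (a + c *: g)); last first.
    by rewrite scaleNr addrACA addNr addr0 -mulr2n scaler_nat.
  by apply: le_trans (enormD _ _) _; lra.
by rewrite enormZ ger0_norm// ler_pM2l.
Qed.

Lemma gauss_prod n (C : 'I_n -> set R) : (forall i, measurable (C i)) ->
  gauss n [set g | forall i, C i (g ord0 i)] = (\big[*%E/1]_(i < n) gauss1 (C i))%E.
Proof.
have mD m (D : 'I_m -> set R) : (forall i, measurable (D i)) ->
    measurable [set g : 'rV[R]_m | forall i, D i (g ord0 i)].
  move=> mD; rewrite (_ : [set _ | _] = \bigcap_i [set g : 'rV[R]_m | D i (g ord0 i)]).
    apply: fin_bigcap_measurable => //= i _.
    by have := measurable_coord i measurableT (mD i); rewrite setTI.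
  by apply/seteqP; split=> g /= h i => [_|]; exact: h.
elim: n C => [|n IH] C mC.
  rewrite big_ord0 (_ : [set _ | _] = setT) ?probability_setT//.
  by apply/seteqP; split=> g //= _ [].
pose D (i : 'I_n) := C (lift ord0 i).
have mD' : measurable [set g : 'rV[R]_n | forall i, D i (g ord0 i)] by apply: mD => i; exact: mC.
rewrite big_ord_recl -(IH D)//; last by move=> i; exact: mC.
rewrite gauss_prob; last exact: mD.
rewrite integral_gaussS//; last first.
  by apply/measurable_EFinP; apply: measurable_indic; exact: mD.
transitivity (\int[gauss1]_x ((\1_(C ord0) x)%:E * gauss n [set g : 'rV[R]_n | forall i, D i (g ord0 i)]))%E.
  apply: eq_integral => x _; rewrite (gauss_prob mD').
  rewrite -ge0_integralZl//; last first.
    by apply/measurable_EFinP; exact: measurable_indic.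
  apply: eq_integral => v _; rewrite -EFinM; congr (_%:E).
  rewrite !indicE -natrM mulnb; congr ((_ : bool)%:R).
  apply/idP/andP => [|[]]; rewrite !inE/= => h.
    split; first by have := h ord0; rewrite rVcons0.
    by move=> i; have := h (lift ord0 i); rewrite rVconsS.
  by move=> h' i; have [j ->|->] := unliftP ord0 i; [rewrite rVconsS; exact: (h' j)|rewrite rVcons0].
under eq_integral do rewrite muleC.
rewrite ge0_integralZl//; last by apply/measurable_EFinP; apply: measurable_indic; exact: mC.
rewrite muleC; congr (_ * _)%E; rewrite integral_indic; [by rewrite setIT|exact: measurableT|exact: mC].
Qed.

End Gauss_facts.

(** * Laws, independence and maxima of the driving random walk *)

Section Noise.
Context {R : realType} {d : measure_display} {S : measurableType d}.
Variable mu : probability S R.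
Variables (dT : measure_display) (St : measurableType dT).
Variable step : nat -> St -> S -> St.
Hypothesis mstep : forall i, measurable_fun setT (fun p : St * S => step i p.1 p.2).
Variables (q : nat) (eta : nat -> St -> S -> 'rV[R]_q).
Hypothesis meta : forall i, measurable_fun setT (fun p : St * S => eta i p.1 p.2).
Hypothesis eta_law : forall i x (f : 'rV[R]_q -> \bar R), measurable_fun setT f ->
  (forall g, 0 <= f g)%E -> (\int[mu]_a f (eta i x a) = \int[gauss q]_g f g)%E.

Local Notation nsum := (nsum step eta).
Local Notation pw := (pw mu).

Lemma eta_step k i x (a : 'rV[R]_q) (C : set 'rV[R]_q) : measurable C ->
  (\int[mu]_s gauss q [set g | C (a + eta i x s + Num.sqrt k%:R *: g)%R])%E =
  gauss q [set g | C (a + Num.sqrt k.+1%:R *: g)%R].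
Proof.
move=> mC; rewrite -gauss_step//.
rewrite -(eta_law i x (f := fun v => gauss q [set g | C (a + v + Num.sqrt k%:R *: g)%R]))//.
pose E := [set p : 'rV[R]_q * 'rV[R]_q | C (a + p.1 + Num.sqrt k%:R *: p.2)].
have mE : measurable E.
  have mf : measurable_fun setT (fun p : 'rV[R]_q * 'rV[R]_q => a + p.1 + Num.sqrt k%:R *: p.2).
    by apply: measurable_rVD; [exact: measurable_rVD|exact: measurable_rVZ].
  by have := mf measurableT _ mC; rewrite setTI.
have := measurable_fun_xsection (gauss q) mE.
congr (measurable_fun _ _); apply/funext => v /=.
by congr (gauss q _); apply/seteqP; split=> g; rewrite /xsection/E/= inE.
Qed.

Lemma eta_step_measurable k i x (a : 'rV[R]_q) (C : set 'rV[R]_q) : measurable C ->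
  measurable_fun setT (fun s => gauss q [set g | C (a + eta i x s + Num.sqrt k%:R *: g)%R]).
Proof.
move=> mC; pose E := [set p : S * 'rV[R]_q | C (a + eta i x p.1 + Num.sqrt k%:R *: p.2)].
have mE : measurable E.
  have mf : measurable_fun setT (fun p : S * 'rV[R]_q => a + eta i x p.1 + Num.sqrt k%:R *: p.2).
    apply: measurable_rVD; last exact: measurable_rVZ.
    apply: measurable_rVD => //.
    rewrite (_ : (fun _ => _) = (fun p : St * S => eta i p.1 p.2) \o (fun p : S * 'rV[R]_q => (x, p.1)))//.
    apply: measurableT_comp; first exact: meta.
    by apply/measurable_fun_pairP; split; [exact: measurable_cst|exact: measurable_fst].
  by have := mf measurableT _ mC; rewrite setTI.
have := measurable_fun_xsection (gauss q) mE.
congr (measurable_fun _ _); apply/funext => v /=.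
by congr (gauss q _); apply/seteqP; split=> g; rewrite /xsection/E/= inE.
Qed.

Lemma measurable_nsum_set n k i x a (C : set 'rV[R]_q) : measurable C ->
  measurable [set w : n.-tuple S | C (a + nsum i x (take k w))].
Proof.
move=> mC; have := measurable_rVD (measurable_cst a) (measurable_nsum_cst mstep meta (n := n) k i x).
by move=> /(_ measurableT _ mC); rewrite setTI.
Qed.

Let nsum_tcons n i x s j k (w : n.-tuple S) :
  nsum i x (take (k.+1 + j) (tcons (s, w))) - nsum i x (take k.+1 (tcons (s, w))) =
  nsum i.+1 (step i x s) (take (k + j) w) - nsum i.+1 (step i x s) (take k w).
Proof. by rewrite /= opprD addrACA subrr add0r. Qed.

Let nsum_law0 n i x a (C : set 'rV[R]_q) :
  pw n [set w | C (a + nsum i x (take 0 w))] = gauss q [set g | C (a + Num.sqrt 0%:R *: g)].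
Proof.
have -> : pw n [set w | C (a + nsum i x (take 0 w))] = pw n [set w | C a].
  by congr (pw n _); apply/seteqP; split=> w /=; rewrite take0 addr0.
have -> : gauss q [set g | C (a + Num.sqrt 0%:R *: g)] = gauss q [set g | C a].
  by congr (gauss q _); apply/seteqP; split=> w /=; rewrite sqrtr0 scale0r addr0.
have [Ca|Ca] := pselect (C a).
  have -> : [set w : n.-tuple S | C a] = setT by apply/seteqP; split.
  have -> : [set g : 'rV[R]_q | C a] = setT by apply/seteqP; split.
  by rewrite !probability_setT.
have -> : [set w : n.-tuple S | C a] = set0 by apply/seteqP; split.
have -> : [set g : 'rV[R]_q | C a] = set0 by apply/seteqP; split.
by rewrite !measure0.
Qed.

Lemma nsum_law n k i x a (C : set 'rV[R]_q) : (k <= n)%N -> measurable C ->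
  pw n [set w | C (a + nsum i x (take k w))] = gauss q [set g | C (a + Num.sqrt k%:R *: g)].
Proof.
elim: n k i x a => [|n IH] k i x a.
  rewrite leqn0 => /eqP -> mC.
  exact: nsum_law0.
case: k => [_|k kn] mC; first exact: nsum_law0.
rewrite pwS; last exact: measurable_nsum_set.
rewrite -(eta_step k i x a mC); apply: eq_integral => s _.
rewrite -(IH k i.+1 (step i x s))//.
by congr (pw n _); apply/seteqP; split=> w /=; rewrite addrA.
Qed.

(** Induction on the length k of the past, integrating out its first step. For k = 0 the event is
    empty or everything, and [nsum_law] applies. *)
Lemma nsum_past n k m i x (E : set (n.-tuple S)) (C : set 'rV[R]_q) : (k + m <= n)%N ->
  past k E -> measurable C ->
  pw n (E `&` [set w | C (nsum i x (take (k + m) w) - nsum i x (take k w))]) =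
  (pw n E * gauss q [set g | C (Num.sqrt m%:R *: g)])%E.
Proof.
elim: k n i x E => [|k IH] n i x E kn [mE pE] mC.
  have [w0|E0] := pselect (exists w, E w); last first.
    rewrite (_ : E = set0); last by apply/seteqP; split=> // w Ew; case: E0; exists w.
    by rewrite set0I !measure0 mul0e.
  rewrite (_ : E = setT); last by apply/seteqP; split=> // w _; case: w0 => w'; apply: pE; rewrite !take0.
  rewrite setTI probability_setT mul1e.
  have -> : gauss q [set g | C (Num.sqrt m%:R *: g)] = gauss q [set g | C (0 + Num.sqrt m%:R *: g)].
    by congr (gauss q _); apply/seteqP; split=> g /=; rewrite add0r.
  by rewrite -(@nsum_law n m i x 0 C kn mC); congr (pw n _);
    apply/seteqP; split=> w /=; rewrite take0/= subr0 add0r.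
case: n E kn mE pE => [//|n] E kn mE pE.
have mN : measurable [set w : n.+1.-tuple S | C (nsum i x (take (k.+1 + m) w) - nsum i x (take k.+1 w))].
  have := @measurable_rVB _ _ R _ _ _ (measurable_nsum_cst mstep meta (n := n.+1) (k.+1 + m) i x)
    (measurable_nsum_cst mstep meta (n := n.+1) k.+1 i x).
  by move=> /(_ measurableT _ mC); rewrite setTI.
rewrite pwS; last exact: measurableI.
rewrite pwS//.
rewrite -ge0_integralZr//; last exact: measurable_pw_section.
apply: eq_integral => s _; rewrite -(IH n i.+1 (step i x s))//; last first.
  exact: past_section.
congr (pw n _); apply/seteqP; split=> w [Ew]; rewrite /mkset ?nsum_tcons => h; split => //.
by rewrite /mkset nsum_tcons.
Qed.

Lemma measurable_nsum_max n k m i x a (e : R) :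
  measurable [set w : n.-tuple S | exists2 j, (j <= m)%N &
    e < enorm (a + nsum i x (take (k + j) w) - nsum i x (take k w))].
Proof.
rewrite (_ : [set _ | _] = \bigcup_(j in `I_m.+1)
  [set w : n.-tuple S | e < enorm (a + nsum i x (take (k + j) w) - nsum i x (take k w))]); last first.
  by apply/seteqP; split=> w /= [j jm h]; exists j.
apply: bigcup_measurable => j _.
have : measurable_fun setT (fun w : n.-tuple S => enorm (a + nsum i x (take (k + j) w) - nsum i x (take k w))).
  apply: measurable_enorm; apply: measurable_rVB; last exact: measurable_nsum_cst.
  by apply: measurable_rVD => //; exact: measurable_nsum_cst.
move=> /(_ measurableT _ (measurable_itv `]e, +oo[)); rewrite setTI.
by congr measurable; apply/seteqP; split=> w; rewrite /= in_itv/= andbT.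
Qed.

Lemma measurable_enorm_gt (e : R) : measurable [set g : 'rV[R]_q | e < enorm g].
Proof.
have := @measurable_enorm _ _ R q id (@measurable_id _ _ setT) measurableT _ (measurable_itv `]e, +oo[).
by rewrite setTI; congr measurable; apply/seteqP; split=> w; rewrite /= in_itv/= andbT.
Qed.

(* Levy's maximal inequality: after the first exceedance the walk is at least
   as likely as not to end outside, by symmetry of the remaining increments. *)
Lemma nsum_max0 n m i x a (e : R) : 0 <= e -> (m <= n)%N ->
  (pw n [set w | exists2 j, (j <= m)%N & (e < enorm (a + nsum i x (take j w)))%R] <=
   gauss q [set g | (e < enorm (a + Num.sqrt m%:R *: g))%R] +
   gauss q [set g | (e < enorm (a + Num.sqrt m%:R *: g))%R])%E.
Proof.
move=> e0.
have mM n' m' i' x' a' : measurable [set w : n'.-tuple S | exists2 j, (j <= m')%N & (e < enorm (a' + nsum i' x' (take j w)))%R].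
  have := @measurable_nsum_max n' 0 m' i' x' a' e; congr measurable.
  by apply/seteqP; split=> w [j jm] /= h; exists j => //; move: h; rewrite take0 subr0.
elim: m n i x a => [|m IH] n i x a mn.
  have [ea|ea] := ltP e (enorm a).
    by apply: le_trans (probability_le1 _ (mM _ _ _ _ _)) _; exact: gauss_sym_half.
  rewrite [X in pw n X](_ : _ = set0).
    by rewrite measure0 adde_ge0.
  have : [set w : n.-tuple S | exists2 j, (j <= 0)%N & e < enorm (a + nsum i x (take j w))] = set0.
    apply/seteqP; split=> w //= [j];  rewrite leqn0 => /eqP->; rewrite take0/= addr0.
    by apply/negP; rewrite -leNgt.
  exact.
have [ea|ea] := ltP e (enorm a).
  by apply: le_trans (probability_le1 _ (mM _ _ _ _ _)) _; exact: gauss_sym_half.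
case: n mn => [//|n] mn.
have mC := measurable_enorm_gt e.
have ms := eta_step_measurable m i x a mC.
rewrite -(eta_step m i x a mC) -ge0_integralD//.
apply: pwS_le; [exact: mM|exact: emeasurable_funD|].
move=> s; apply: le_trans (IH n i.+1 (step i x s) (a + eta i x s) mn).
apply: le_measure; rewrite ?inE//.
  have := mM n.+1 m.+1 i x a; exact: measurable_tcons_section.
  exact: mM.
move=> w [[|j] jm] /=; first by rewrite addr0 ltNge ea.
by rewrite addrA => h; exists j.
Qed.

Lemma nsum_max n k m i x (e : R) : 0 <= e -> (k + m <= n)%N ->
  (pw n [set w | exists2 j, (j <= m)%N & (e < enorm (nsum i x (take (k + j) w) - nsum i x (take k w)))%R] <=
   gauss q [set g | (e < enorm (Num.sqrt m%:R *: g))%R] +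
   gauss q [set g | (e < enorm (Num.sqrt m%:R *: g))%R])%E.
Proof.
move=> e0; elim: k n i x => [|k IH] n i x kn.
  have := @nsum_max0 n m i x 0 e e0 kn.
  have -> : gauss q [set g | e < enorm (0 + Num.sqrt m%:R *: g)] = gauss q [set g | (e < enorm (Num.sqrt m%:R *: g))%R].
    by congr (gauss q _); apply/seteqP; split=> g /=; rewrite add0r.
  apply: le_trans; rewrite le_eqVlt; apply/orP; left; apply/eqP; congr (pw n _).
  by apply/seteqP; split=> w [j jm] /= h; exists j => //; move: h; rewrite take0/= subr0 add0r.
case: n kn => [//|n] kn; apply: pwS_le_cst.
  have := @measurable_nsum_max n.+1 k.+1 m i x 0 e; congr measurable.
  by apply/seteqP; split=> w [j jm] /= h; exists j => //; move: h; rewrite add0r.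
move=> s; apply: le_trans (IH n i.+1 (step i x s) kn).
rewrite le_eqVlt; apply/orP; left; apply/eqP; congr (pw n _).
by apply/seteqP; split=> w [j jm]; rewrite ?nsum_tcons => h; exists j => //; rewrite nsum_tcons.
Qed.

End Noise.

(** * Domination of the distance between two coupled chains *)

Section Coupled_chain.
Context {R : realType} {q : nat}.
Local Notation E := 'rV[R]_q.

Lemma measurable_inv_enorm d (T : measurableType d) (v : T -> E) :
  measurable_fun setT v -> measurable_fun setT (fun x => (enorm (v x))^-1).
Proof.
move=> mv; have mn : measurable_fun setT (fun x => enorm (v x)) by exact: measurable_enorm.
rewrite (_ : (fun _ => _) = fun x => if 0 < enorm (v x) then expR (- ln (enorm (v x))) else 0).
  apply: measurable_fun_ifT => //; first exact: measurable_realfun.measurable_fun_ltr.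
  apply: measurableT_comp => //; apply: measurableT_comp => //.
  by apply: (measurableT_comp (@measurable_ln R)).
apply/funext => x; case: ltP => [h|h]; first by rewrite expRN lnK.
have -> : enorm (v x) = 0 by apply/eqP; rewrite eq_le h enorm_ge0.
by rewrite invr0.
Qed.

Lemma measurable_rmap d (T : measurableType d) (v g : T -> E) (u : T -> R) :
  measurable_fun setT v -> measurable_fun setT g -> measurable_fun setT u ->
  measurable_fun setT (fun x => rmap (v x) (g x) (u x)).
Proof.
move=> mv mg mu; apply: measurable_fun_ifT.
- apply: measurable_realfun.measurable_fun_ler => //; apply: measurableT_comp => //.
  apply: measurable_funB; last by apply: measurable_funM => //; exact: measurable_inner.
  by apply: measurableT_comp => //; exact: measurable_inner.
- exact: measurable_rVD.
- have me : measurable_fun setT (fun x => (enorm (v x))^-1 *: v x).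
    by apply: measurable_rVZ => //; exact: measurable_inv_enorm.
  apply: measurable_rVB => //; apply: measurable_rVZ => //.
  by apply: measurable_funM => //; exact: measurable_inner.
Qed.

(** A Gaussian vector shared by all components of the scheme, and two independent uniform variables,
    one for each coupling with the auxiliary component. *)
Definition noise : Type := (E * (measurableTypeR R * measurableTypeR R))%type.
HB.instance Definition _ := Measurable.on noise.

Definition unif2 : probability (measurableTypeR R * measurableTypeR R)%type R :=
  (unif \x unif)%E.

Definition noise_law : probability noise R := (gauss q \x unif2)%E.

Lemma noise_int1 (f : E * R -> \bar R) : measurable_fun setT f -> (forall p, 0 <= f p)%E ->
  (\int[noise_law]_a f (a.1, a.2.1) = \int[gauss q]_g \int[unif]_u f (g, u))%E.
Proof.
move=> mf f0.
have mF : measurable_fun setT (fun a : noise => f (a.1, a.2.1)).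
  apply: (measurableT_comp mf); apply/measurable_fun_pairP; split; first exact: measurable_fst.
  by apply: (measurableT_comp measurable_fst) measurable_snd.
have ms (g : E) : measurable_fun setT (fun u : R => f (g, u)).
  by apply: (measurableT_comp mf); exact: pair1_measurable.
transitivity (\int[gauss q]_g \int[unif2]_u f (g, u.1))%E.
  exact: (@fubini_tonelli1 _ _ _ _ _ (gauss q) unif2).
apply: eq_integral => g _.
transitivity (\int[unif]_u \int[unif]_u' f (g, u))%E.
  apply: (@fubini_tonelli1 _ _ _ _ _ unif unif (fun u => f (g, u.1))) => //.
  by apply: (measurableT_comp (ms g)).
by apply: eq_integral => u _; rewrite integral_prob_cst.
Qed.

Lemma noise_int2 (f : E * R -> \bar R) : measurable_fun setT f -> (forall p, 0 <= f p)%E ->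
  (\int[noise_law]_a f (a.1, a.2.2) = \int[gauss q]_g \int[unif]_u f (g, u))%E.
Proof.
move=> mf f0.
have mF : measurable_fun setT (fun a : noise => f (a.1, a.2.2)).
  apply: (measurableT_comp mf); apply/measurable_fun_pairP; split; first exact: measurable_fst.
  by apply: (measurableT_comp measurable_snd) measurable_snd.
have ms (g : E) : measurable_fun setT (fun u : R => f (g, u)).
  by apply: (measurableT_comp mf); exact: pair1_measurable.
transitivity (\int[gauss q]_g \int[unif2]_u f (g, u.2))%E.
  exact: (@fubini_tonelli1 _ _ _ _ _ (gauss q) unif2).
apply: eq_integral => g _.
transitivity (\int[unif]_u' \int[unif]_u f (g, u))%E.
  apply: (@fubini_tonelli1 _ _ _ _ _ unif unif (fun u => f (g, u.2))) => //.
  by apply: (measurableT_comp (ms g)).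
by rewrite integral_prob_cst.
Qed.

(* [z] is driven by the Gaussian noise itself and [p] by its image under [rmap]. *)
Section Pair.
Variables (s K D A beta : R) (g : R -> R).
Hypotheses (gK : forall a b, 0 <= a -> 0 <= b -> `|g a - g b| <= K * `|a - b|)
  (g0 : 0 <= g 0) (s0 : 0 < s) (s1 : s <= 1) (sK : s ^+ 2 * K <= 1)
  (D0 : 0 <= D) (A0 : 0 <= A) (b1 : 1 <= beta) (Db : D <= beta) (ADb : A * D <= beta).
Variables (dT : measure_display) (St : measurableType dT).
Variable step : nat -> St -> noise -> St.
Hypothesis mstep : forall i, measurable_fun setT (fun p : St * noise => step i p.1 p.2).
Variables (p z : St -> E) (p' z' : nat -> St -> E) (u : noise -> R).
Hypotheses (mp : measurable_fun setT p) (mz : measurable_fun setT z).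
Hypothesis u_law : forall f : E * R -> \bar R, measurable_fun setT f -> (forall p, 0 <= f p)%E ->
  (\int[noise_law]_a f (a.1, u a) = \int[gauss q]_g \int[unif]_u f (g, u))%E.
Hypothesis pz_step : forall i x a,
  p (step i x a) - z (step i x a) = (p' i x - z' i x)
    + s *: (rmap (- (s^-1 *: (p' i x - z' i x))) a.1 (u a) - a.1).
Variable box : set E.
Hypothesis mbox : measurable box.
Hypothesis pz_drift : forall i x, box (p x) -> box (z x) ->
  enorm (p' i x - z' i x) <= rho g s D A (enorm (p x - z x)).

(** The box condition runs over j < k because the drift estimate is applied at the start of each of
    the k steps. *)
Definition apart n k i x := [set w : n.-tuple noise |
  0 < enorm (p (traj step i x (take k w)) - z (traj step i x (take k w))) /\
  forall j, (j < k)%N -> box (p (traj step i x (take j w))) /\ box (z (traj step i x (take j w)))].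

Lemma measurable_apart n k i x : measurable (@apart n k i x).
Proof.
have mt j := measurable_traj_cst mstep (n := n) j i x.
rewrite (_ : apart _ _ _ = [set w : n.-tuple noise | 0 < enorm (p (traj step i x (take k w)) - z (traj step i x (take k w)))]
  `&` \bigcap_(j in `I_k) ([set w : n.-tuple noise | box (p (traj step i x (take j w)))] `&`
     [set w : n.-tuple noise | box (z (traj step i x (take j w)))])); last first.
  by apply/seteqP; split=> w /= [h1 h2]; split => // j; exact: h2.
apply: measurableI.
  have m1 : measurable_fun setT (fun w : n.-tuple noise =>
      enorm (p (traj step i x (take k w)) - z (traj step i x (take k w)))).
    by apply: measurable_enorm; apply: measurable_rVB; [apply: (measurableT_comp mp)|apply: (measurableT_comp mz)].
  have := m1 measurableT _ (measurable_itv `]0, +oo[); rewrite setTI.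
  by congr measurable; apply/seteqP; split=> w; rewrite /= in_itv/= andbT.
apply: bigcap_measurableType => j _; apply: measurableI.
  by have /= := measurableT_comp mp (mt j); move=> /(_ measurableT _ mbox); rewrite setTI.
by have /= := measurableT_comp mz (mt j); move=> /(_ measurableT _ mbox); rewrite setTI.
Qed.

(** Induction on the first step: by [dist_law] the new distance follows the absorbed kernel from the
    distance after the drift; [pz_drift] and [absorb_mono] replace the latter by [rho]. If the start
    is outside the box the event is empty. *)
Lemma apart_le n k i x : (k <= n)%N ->
  (pw noise_law n (@apart n k i x) <= (surv g s D A k (enorm (p x - z x)))%:E)%E.
Proof.
elim: k n i x => [|k IH] n i x kn.
  rewrite /= /pos01; case: ltP => h; first by apply: probability_le1; exact: measurable_apart.
  rewrite [X in pw _ _ X](_ : _ = set0) ?measure0//.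
  by apply/seteqP; split=> w //= []; rewrite take0/= ltNge h.
case: n kn => [//|n] kn.
have [[bp bz]|nb] := pselect (box (p x) /\ box (z x)); last first.
  rewrite [X in pw _ _ X](_ : _ = set0) ?measure0 ?lee_fin; last first.
    by apply/seteqP; split=> w //= [_ /(_ 0%N isT)]; rewrite take0.
  exact: (surv_ge0 gK g0 s0 sK D0 A0 Db).
have [ms sv01 smono] := survP gK g0 s0 sK D0 A0 Db k.+1.
have [ms' sv01' smono'] := survP gK g0 s0 sK D0 A0 Db k.
pose H (a : E * R) := (surv g s D A k (enorm ((p' i x - z' i x)
    + s *: (rmap (- (s^-1 *: (p' i x - z' i x))) a.1 a.2 - a.1))))%:E.
have mH : measurable_fun setT H.
  apply/measurable_EFinP; apply: (measurableT_comp ms'); apply: measurable_enorm.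
  apply: measurable_rVD => //; apply: measurable_rVZ => //; apply: measurable_rVB => //.
  exact: measurable_rmap.
have mHa : measurable_fun setT (fun a : noise =>
    (surv g s D A k (enorm (p (step i x a) - z (step i x a))))%:E).
  apply/measurable_EFinP; apply: (measurableT_comp ms'); apply: measurable_enorm.
  have m1 : measurable_fun setT (step i x).
    rewrite (_ : step i x = (fun p : St * noise => step i p.1 p.2) \o (pair x))//.
    by apply: measurableT_comp; [exact: mstep|exact: pair1_measurable].
  by apply: measurable_rVB; [apply: (measurableT_comp mp)|apply: (measurableT_comp mz)].
have mA n' k' i' x' : measurable (@apart n' k' i' x') by exact: measurable_apart.
apply: le_trans (pwS_le (mA n.+1 k.+1 i x) mHa _) _.
  move=> a; apply: le_trans (IH n i.+1 (step i x a) kn).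
  apply: le_measure; rewrite ?inE; [|exact: mA|].
    exact: measurable_tcons_section (mA n.+1 k.+1 i x).
  by move=> w /= [h1 h2]; split => // j jk; have := h2 j.+1 jk.
rewrite (survS gK g0 s0 sK D0 A0 Db).
have -> : (\int[noise_law]_a (surv g s D A k (enorm (p (step i x a) - z (step i x a))))%:E =
    \int[noise_law]_a H (a.1, u a))%E.
  by apply: eq_integral => a _; rewrite /H pz_step.
have sv0 y : 0 <= surv g s D A k y by case/andP: (sv01' y).
rewrite u_law//; last by move=> a; rewrite lee_fin.
rewrite /H/= dist_law//.
apply: absorb_mono => //; [|exact: enorm_ge0|exact: pz_drift].
by move=> y t _; exact: smono'.
Qed.

End Pair.

End Coupled_chain.

(** * Euler schemes and their standard parts *)

Section Drift_facts.
Context {R : realType} {q : nat}.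
Local Notation E := 'rV[R]_q.

Definition compact_box (T : R) : set (R^o * E) :=
  [set p : R^o * E | 0 <= p.1 <= T /\ forall i : 'I_q, `|p.2 ord0 i| <= T].

Lemma compact_compact_box T : compact (compact_box T).
Proof.
have -> : compact_box T = (`[0, T]%classic : set R^o) `*` [set v : E | forall i, (`[- T, T]%classic : set R^o) (v ord0 i)].
  apply/seteqP; split=> -[t v]; rewrite /compact_box/=in_itv/= => -[h1 h2]; split => // i;
    by have := h2 i; rewrite ?in_itv/= ler_norml.
apply: compact_setX; first exact: segment_compact.
by apply: (@rV_compact _ _ (fun=> `[- T, T]%classic : set R^o)) => _; exact: segment_compact.
Qed.

(** The Lipschitz condition is local in pairs of points, so compactness of the product of the box
    with itself gives one constant for all pairs. *)
Lemma drift_lip (b : R -> E -> E) (T : R) : locally_lipschitz_drift b ->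
  exists2 L, 0 <= L & forall p r : R^o * E, compact_box T p -> compact_box T r ->
    `|b p.1 p.2 - b r.1 r.2| <= L * `|p - r|.
Proof.
move=> bl; have cK := @compact_compact_box T.
have /compact_near_coveringP cKK := compact_setX cK cK.
pose P (k : R) (pr : (R^o * E) * (R^o * E)) := compact_box T pr.1 -> compact_box T pr.2 ->
  `|b pr.1.1 pr.1.2 - b pr.2.1 pr.2.2| <= k * `|pr.1 - pr.2|.
have hP : \forall k \near +oo, (compact_box T `*` compact_box T) `<=` P k.
  apply: cKK => -[p r] [Kp Kr].
  have p0 : [set p : R^o * E | 0 <= p.1] p by case: Kp => /andP[].
  have r0 : [set p : R^o * E | 0 <= p.1] r by case: Kr => /andP[].
  have := bl (p, r) (conj p0 r0).
  move=> /pinfty_ex_gt0[k k0 hk].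
  exists ([set y : (R^o * E) * (R^o * E) | 0 <= y.1.1 /\ 0 <= y.2.1 ->
      `|b y.1.1 y.1.2 - b y.2.1 y.2.2| <= k * `|y.1 - y.2|], [set k' | k <= k']).
    split; first exact: hk.
    by apply: nbhs_pinfty_ge; exact: gtr0_real.
  move=> [y k'] /= [hy kk'] [/andP[y1 _] _] [/andP[y2 _] _].
  by apply: le_trans (hy (conj y1 y2)) _; rewrite ler_wpM2r.
have [k k0 hk] := pinfty_ex_gt0 hP.
exists k; first exact: ltW.
by move=> p r Kp Kr; exact: (hk (p, r)).
Qed.

Lemma normv_le (v : E) (c : R) : 0 <= c -> (forall i, `|v ord0 i| <= c) -> `|v| <= c.
Proof.
move=> c0 h; rewrite [leLHS]mx_normrE; apply/bigmax_leP; split => // -[i j] _ /=.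
by rewrite ord1.
Qed.

Lemma coord_le_normv (v : E) i : `|v ord0 i| <= `|v|.
Proof.
rewrite [leRHS]mx_normrE.
exact: (@le_bigmax _ _ _ 0 (fun i : 'I_1 * 'I_q => `|v i.1 i.2|) (ord0, i)).
Qed.

Lemma normv_le_enorm (v : E) : `|v| <= enorm v.
Proof. by apply: normv_le => [|i]; [exact: enorm_ge0|exact: coord_le_enorm]. Qed.

Lemma enorm_le_normv (v : E) : enorm v <= q%:R * `|v|.
Proof.
apply: le_trans (enorm_le_sum v) _.
have -> : q%:R * `|v| = \sum_(i < q) `|v| by rewrite sumr_const card_ord mulr_natl.
by apply: ler_sum => i _; exact: coord_le_normv.
Qed.

Lemma drift_enorm (b : R -> E -> E) (T : R) : locally_lipschitz_drift b -> 0 <= T ->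
  exists2 L, 0 <= L &
  (forall (t t' : R) (x x' : E), 0 <= t <= T -> 0 <= t' <= T ->
    (forall i, `|x ord0 i| <= T) -> (forall i, `|x' ord0 i| <= T) ->
    enorm (b t x - b t' x') <= L * (`|t - t'| + enorm (x - x'))) /\
  (forall (t : R) (x : E), 0 <= t <= T -> (forall i, `|x ord0 i| <= T) -> enorm (b t x) <= L).
Proof.
move=> bl T0; have [L L0 hL] := drift_lip T bl.
have h (t t' : R) (x x' : E) : 0 <= t <= T -> 0 <= t' <= T ->
    (forall i, `|x ord0 i| <= T) -> (forall i, `|x' ord0 i| <= T) ->
    enorm (b t x - b t' x') <= q%:R * L * (`|t - t'| + enorm (x - x')).
  move=> ht ht' hx hx'; apply: le_trans (enorm_le_normv _) _.
  rewrite -mulrA ler_wpM2l//; apply: le_trans (hL (t, x) (t', x') (conj ht hx) (conj ht' hx')) _.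
  rewrite ler_wpM2l// prod_normE/= ge_max lerDl enorm_ge0/=.
  by apply: le_trans (normv_le_enorm _) _; rewrite lerDr.
exists (q%:R * L + (enorm (b 0 0) + q%:R * L * (T + q%:R * T))).
  by rewrite addr_ge0 ?mulr_ge0// addr_ge0 ?enorm_ge0// !mulr_ge0// addr_ge0// mulr_ge0.
split.
  move=> t t' x x' ht ht' hx hx'; apply: le_trans (h _ _ _ _ ht ht' hx hx') _.
  rewrite ler_wpM2r ?addr_ge0 ?enorm_ge0// lerDl.
  by rewrite addr_ge0 ?enorm_ge0// !mulr_ge0// addr_ge0// mulr_ge0.
move=> t x ht hx.
have z0 : forall i, `|(0 : E) ord0 i| <= T by move=> i; rewrite mxE normr0.
have t00 : 0 <= (0 : R) <= T by rewrite lexx.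
have := h t 0 x 0 ht t00 hx z0; rewrite !subr0 => h1.
have -> : b t x = (b t x - b 0 0) + b 0 0 by rewrite subrK.
apply: le_trans (enormD _ _) _; rewrite addrC.
apply: (@le_trans _ _ (enorm (b 0 0) + q%:R * L * (T + q%:R * T))); last by rewrite lerDr mulr_ge0.
rewrite lerD2l; apply: le_trans h1 _; rewrite ler_wpM2l ?mulr_ge0//; apply: lerD.
  by case/andP: ht => t0 tT; rewrite ger0_norm.
by apply: le_trans (enorm_le_normv _) _; rewrite ler_wpM2l//; exact: normv_le.
Qed.

Lemma enorm_mono (u v : E) : (forall i, `|u ord0 i| <= `|v ord0 i|) -> enorm u <= enorm v.
Proof.
move=> h; rewrite -(@ler_pXn2r _ 2)// ?nnegrE ?enorm_ge0// !sqr_enorm.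
apply: ler_sum => i _; rewrite -!expr2 -[leLHS]real_normK ?num_real//.
by rewrite -[leRHS]real_normK ?num_real// lerXn2r ?nnegrE.
Qed.

Definition clamp (T : R) (x : E) : E := \row_i Num.max (- T) (Num.min (x ord0 i) T).

Lemma clamp_id T (x : E) : (forall i, `|x ord0 i| <= T) -> clamp T x = x.
Proof.
move=> h; apply/rowP => i; rewrite mxE; have := h i; rewrite ler_norml => /andP[h1 h2].
by rewrite (min_idPl h2) (max_idPr h1).
Qed.

Lemma clamp_le T x i : 0 <= T -> `|clamp T x ord0 i| <= T.
Proof.
by move=> T0; rewrite mxE ler_norml le_max lexx/= ge_max ge_min lexx orbT andbT; lra.
Qed.

Lemma clamp_lip T x y : enorm (clamp T x - clamp T y) <= enorm (x - y).
Proof.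
apply: enorm_mono => i; rewrite !mxE; move: (x ord0 i) (y ord0 i) => a c.
have h1 : `|Num.min a T - Num.min c T| <= `|a - c|.
  by have [h1|h1] := leP a T; have [h2|h2] := leP c T; rewrite ler_norml;
    have := ler_norm (a - c); have := ler_norm (c - a); rewrite (distrC c); lra.
apply: le_trans h1; move: (Num.min a T) (Num.min c T) => {}a {}c.
by have [h1|h1] := leP (- T) a; have [h2|h2] := leP (- T) c; rewrite ler_norml;
    have := ler_norm (a - c); have := ler_norm (c - a); rewrite (distrC c); lra.
Qed.

(** Evaluates [b] at a truncated argument: unlike multiplication by a cutoff, this preserves the
    monotonicity condition inside the box and is bounded and Lipschitz in x everywhere. *)
Definition cut_drift (T : R) (b : R -> E -> E) (t : R) (x : E) := b (Num.min t T) (clamp T x).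

Lemma cut_driftP (b : R -> E -> E) (T : R) : locally_lipschitz_drift b -> 0 <= T ->
  exists2 L, 0 <= L &
  (forall t x y, 0 <= t -> enorm (cut_drift T b t x - cut_drift T b t y) <= L * enorm (x - y)) /\
  (forall t x, 0 <= t -> enorm (cut_drift T b t x) <= L).
Proof.
move=> bl T0; have [L L0 [h1 h2]] := drift_enorm bl T0.
have hT t : 0 <= t -> 0 <= Num.min t T <= T by move=> t0; rewrite le_min t0 T0 ge_min lexx orbT.
exists L => //; split=> [t x y t0|t x t0].
  rewrite /cut_drift; apply: le_trans (h1 _ _ _ _ (hT t t0) (hT t t0) _ _) _.
  - by move=> i; exact: clamp_le.
  - by move=> i; exact: clamp_le.
  by rewrite subrr normr0 add0r ler_wpM2l// clamp_lip.
by apply: h2; [exact: hT|move=> i; exact: clamp_le].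
Qed.

Lemma rational_approx (x : E) (e : R) : 0 < e -> exists z : 'rV[rat]_q,
  enorm (x - map_mx ratr z) < e.
Proof.
move=> e0; have e1 : 0 < e / q.+1%:R by rewrite divr_gt0.
have hz (i : 'I_q) : exists r : rat, `|x ord0 i - ratr r| < e / q.+1%:R.
  have xx : x ord0 i - e / q.+1%:R < x ord0 i + e / q.+1%:R.
    by move: (e / _) e1 => a a0; lra.
  have [r] := rat_in_itvoo xx.
  rewrite in_itv/= => /andP[r1 r2]; exists r; move: (e / _) r1 r2 => a r1 r2; rewrite ltr_norml; lra.
have [f hf] := choice hz.
exists (\row_i f i); apply: le_lt_trans (enorm_le_sum _) _.
apply: (@le_lt_trans _ _ (q%:R * (e / q.+1%:R))).
  have -> : q%:R * (e / q.+1%:R) = \sum_(i < q) (e / q.+1%:R) by rewrite sumr_const card_ord mulr_natl.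
  by apply: ler_sum => i _; rewrite !mxE; exact: ltW.
by rewrite mulrCA gtr_pMr// ltr_pdivrMr// mul1r ltr_nat.
Qed.

(** F x < a holds if and only if F z + L |x - z| < a for some rational z, so sublevel sets are
    countable unions of measurable ones. *)
Lemma measurable_lip1 (F : E -> R) (L : R) :
  (forall x y, `|F x - F y| <= L * enorm (x - y)) -> measurable_fun setT F.
Proof.
wlog L0 : L / 0 < L => [h hF|hF].
  apply: (h (`|L| + 1)); first by rewrite ltr_pwDr.
  move=> x y; apply: le_trans (hF x y) _; rewrite ler_wpM2r ?enorm_ge0//.
  by have := ler_norm L; lra.
apply: (measurability _ (measurable_realfun.RGenInftyO.measurableE R)) => // _ [_ [a ->] <-].
rewrite setTI (_ : _ @^-1` _ = \bigcup_(z in [set: 'rV[rat]_q])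
    [set x : E | F (map_mx ratr z) + L * enorm (x - map_mx ratr z) < a]).
  apply: countable_bigcupT_measurable => // z.
  have : measurable_fun setT (fun x : E => F (map_mx ratr z) + L * enorm (x - map_mx ratr z)).
    apply: measurable_funD => //; apply: measurable_funM => //; apply: measurable_enorm.
    exact: measurable_rVB.
  move=> /(_ measurableT _ (measurable_itv `]-oo, a[)); rewrite setTI.
  by congr measurable; apply/seteqP; split=> y; rewrite /= in_itv.
apply/seteqP; split=> x; rewrite /= in_itv/=.
  move=> Fa; have e0 : 0 < (a - F x) / (2 * L) by rewrite divr_gt0 ?subr_gt0// mulr_gt0.
  have [z hz] := rational_approx x e0; exists z => //=.
  have := hF (map_mx ratr z) x; rewrite (_ : enorm (_ - x) = enorm (x - map_mx ratr z)); last first.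
    by rewrite -enormN opprB.
  move: hz; rewrite ltr_pdivlMr ?mulr_gt0// ler_norml; lra.
move=> [z _]; have := hF x (map_mx ratr z); rewrite ler_norml /=; lra.
Qed.

Lemma measurable_lip (F : E -> E) (L : R) :
  (forall x y, enorm (F x - F y) <= L * enorm (x - y)) -> measurable_fun setT F.
Proof.
move=> hF; apply/measurable_rVP => i; apply: (@measurable_lip1 _ L) => x y.
by apply: le_trans (hF x y); have := coord_le_enorm (F x - F y) i; rewrite !mxE.
Qed.

Lemma sqr_enormDZ (h : R) (u v : E) :
  enorm (u + h *: v) ^+ 2 = enorm u ^+ 2 + 2 * (h * inner u v) + h ^+ 2 * enorm v ^+ 2.
Proof.
rewrite !sqr_enorm innerDl !innerDr !innerZl !innerZr (innerC v u); ring.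
Qed.

(** The term h M comes from the triangle inequality. For the rest put A = h kap(r) r and B = h^2 L^2
    r; comparing squares leaves r B + (A + B)^2 >= 0, which explains the correction B. The bound h K
    <= 1 makes r + A nonnegative, as needed to take square roots. *)
Lemma drift_rho (b : E -> E) (bt : E -> E) (kap : R -> R) (K L h M : R) (a z : E) :
  0 <= h -> 0 <= M -> 0 <= K -> h * K <= 1 ->
  (forall r r', 0 <= r -> 0 <= r' -> `|kap r * r - kap r' * r'| <= K * `|r - r'|) ->
  inner (a - z) (b a - b z) <= kap (enorm (a - z)) * enorm (a - z) ^+ 2 ->
  enorm (b a - b z) <= L * enorm (a - z) -> enorm (bt a - b a) <= M ->
  enorm (a + h *: bt a - (z + h *: b z)) <=
    enorm (a - z) + h * (M + kap (enorm (a - z)) * enorm (a - z)) + h ^+ 2 * (L ^+ 2 * enorm (a - z)).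
Proof.
move=> h0 M0 K0 hK kK mono lip bM.
set r := enorm (a - z) in mono lip *; have r0 : 0 <= r by exact: enorm_ge0.
have kr : - (K * r) <= kap r * r.
  by have := kK r 0 r0 (lexx _); rewrite mulr0 !subr0 (ger0_norm r0) ler_norml => /andP[].
have -> : a + h *: bt a - (z + h *: b z) = (a - z + h *: (b a - b z)) + h *: (bt a - b a).
  by apply/rowP => i; rewrite !mxE; ring.
apply: le_trans (enormD _ _) _.
have -> : r + h * (M + kap r * r) + h ^+ 2 * (L ^+ 2 * r) =
   (r + h * (kap r * r) + h ^+ 2 * (L ^+ 2 * r)) + h * M by ring.
apply: lerD; last by rewrite enormZ (ger0_norm h0) ler_wpM2l.
have hkr : 0 <= r + h * (kap r * r).
  have := ler_wpM2l h0 kr; have := ler_wpM2r r0 hK; lra.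
have rhs0 : 0 <= r + h * (kap r * r) + h ^+ 2 * (L ^+ 2 * r).
  by rewrite addr_ge0// mulr_ge0 ?sqr_ge0// mulr_ge0 ?sqr_ge0.
rewrite -(@ler_pXn2r _ 2)// ?nnegrE ?enorm_ge0// sqr_enormDZ -/r.
have lip2 : enorm (b a - b z) ^+ 2 <= L ^+ 2 * r ^+ 2.
  rewrite -exprMn lerXn2r ?nnegrE ?enorm_ge0//; exact: le_trans (enorm_ge0 _) lip.
have h1 := ler_wpM2l h0 mono; have h2 := ler_wpM2l (sqr_ge0 h) lip2.
have := mulr_ge0 hkr (mulr_ge0 (sqr_ge0 h) (mulr_ge0 (sqr_ge0 L) r0)).
have := sqr_ge0 (h * (kap r * r)).
have := sqr_ge0 (h ^+ 2 * (L ^+ 2 * r)).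
have := mulr_ge0 (sqr_ge0 h) (mulr_ge0 (sqr_ge0 L) (sqr_ge0 r)).
have := mulr_ge0 r0 (mulr_ge0 (sqr_ge0 h) (mulr_ge0 (sqr_ge0 L) r0)).
move: h1 h2; move: (inner _ _) (enorm _ ^+ 2) => I N; nra.
Qed.

End Drift_facts.

Lemma nU_ex2 (A B : set nat) : nU A -> nU B -> exists n, A n /\ B n.
Proof. by move=> a b; have [n] := @filter_ex _ _ _ _ (filterI a b); exists n. Qed.

Lemma derive0 (R : realType) (f : R -> R) (x : R) :
  (forall e, 0 < e -> exists2 d, 0 < d & forall t, `|t - x| <= d -> `|f t - f x| <= e * `|t - x|) ->
  is_derive x (1 : R) f 0.
Proof.
move=> hf.
have h : k^-1 *: (f (k *: 1 + x) - f x) @[k --> 0^'] --> (0 : R).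
  apply/cvgrPdist_le => e e0; have [d d0 hd] := hf e e0.
  near=> k.
  have kd : `|k| <= d by near: k; exact: dnbhs0_le.
  have k0 : k != 0 by near: k; exact: nbhs_dnbhs_neq.
  rewrite sub0r normrN normrZ normfV.
  have := hd (k *: 1 + x); rewrite addrK [k *: 1]mulr1 => /(_ kd) h.
  by rewrite mulrC ler_pdivrMr// normr_gt0.
by apply: DeriveDef; [apply/cvg_ex; exists 0|apply: cvg_lim].
Unshelve. all: by end_near. Qed.

Lemma increment_approx (R : realFieldType) (e et et1 v x1 x2 x3 x4 y1 y2 y3 y4 w1 w2 r1 r2 : R) :
  0 <= e -> et = et1 * (4 + 2 * `|v| + 2 * e) ->
  `|x1 - y1| <= et1 -> `|x2 - y2| <= et1 -> `|x3 - y3| <= et1 -> `|x4 - y4| <= et1 ->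
  `|x2 - x4 - (x1 - x3) - (w2 - w1) * v| <= e * (w2 - w1) ->
  `|w1 - r1| <= et1 -> `|w2 - r2| <= et1 ->
  `|y2 - y4 - (y1 - y3) - (r2 - r1) * v| <= e * (r2 - r1) + et.
Proof.
move=> e0 -> b1 b2 b3 b4 bi a5 a6.
have p1 : `|(w1 - r1) * v| <= et1 * `|v| by rewrite normrM ler_wpM2r.
have p2 : `|(w2 - r2) * v| <= et1 * `|v| by rewrite normrM ler_wpM2r.
have p3 : e * (w2 - w1) <= e * (r2 - r1) + e * (2 * et1).
  rewrite -mulrDr ler_wpM2l//.
  by move: a5 a6; rewrite !ler_norml => /andP[? ?] /andP[? ?]; lra.
move: p1 p2 (le_trans bi p3) b1 b2 b3 b4 => {bi a5 a6 p3}; rewrite !ler_norml.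
by move=> /andP[? ?] /andP[? ?] /andP[? ?] /andP[? ?] /andP[? ?] /andP[? ?] /andP[? ?]; apply/andP; split; lra.
Qed.

Lemma near_idx (R : realFieldType) (w s r1 r2 m h d : R) : r1 - h <= w -> w <= r2 ->
  s <= r1 + m -> r2 <= s + m -> m <= d / 2 -> h <= d / 2 -> `|w - s| <= d.
Proof. by move=> *; rewrite ler_norml; apply/andP; split; lra. Qed.

Lemma near_idx2 (R : realFieldType) (w s r1 r2 m h d k : R) : r1 - h <= w -> w <= r2 ->
  s <= r1 + m -> r2 <= s + m -> m <= d / 2 -> h <= d / 4 -> `|k - s| <= d / 4 -> `|w - k| <= d.
Proof. by move=> ? ? ? ? ? ?; rewrite !ler_norml => /andP[? ?]; apply/andP; split; lra. Qed.

Lemma between_dist (R : realFieldType) (r1 r2 r3 s d : R) : r1 <= r3 -> r3 <= r2 ->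
  `|r1 - s| <= d -> `|r2 - s| <= d -> `|r3 - s| <= d.
Proof. by move=> ? ?; rewrite !ler_norml => /andP[? ?] /andP[? ?]; apply/andP; split; lra. Qed.

(** * Grid times and standard parts of discrete paths *)

Section Time_index.
Context {R : realType}.

Definition kidx (h t : R) : nat := Num.truncn (t / h).

Lemma kidxP (h t : R) : 0 < h -> 0 <= t -> h * (kidx h t)%:R <= t < h * (kidx h t)%:R + h.
Proof.
move=> h0 t0; have /andP[t1 t2] := truncn_itv (divr_ge0 t0 (ltW h0)).
move: t1 t2; rewrite ler_pdivlMr// ltr_pdivrMr// -natr1 mulrDl mul1r !(mulrC _ h) => -> ->.
by [].
Qed.

Lemma kidx_mono (h s t : R) : 0 < h -> s <= t -> (kidx h s <= kidx h t)%N.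
Proof. by move=> h0 st; apply: le_truncn; rewrite ler_pM2r ?invr_gt0. Qed.

Lemma kidx0 (h : R) : kidx h 0 = 0%N.
Proof. by rewrite /kidx mul0r truncn0. Qed.

End Time_index.

Section Standard_path.
Context {R : realType} {q : nat}.
Local Notation E := 'rV[R]_q.
Variable h : nat -> R.
Hypotheses (h0 : forall n, 0 < h n) (hs : forall e, 0 < e -> nU [set n | h n <= e]).
Variable Y : nat -> nat -> E.

Definition spath (t : R) : E := \row_i st (fun n => Y n (kidx (h n) t) ord0 i).

Definition Sbounded := forall T : R, exists C, nU [set n | forall k : nat, h n * k%:R <= T -> enorm (Y n k) <= C].

(** S-continuity of the internal path: the modulus d is a standard real, the same for [nU]-almost
    every index. *)
Definition Scontinuous := forall T e : R, 0 < e -> exists2 d, 0 < d &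
  nU [set n | forall j k : nat, h n * j%:R <= T -> h n * k%:R <= T ->
    `|h n * j%:R - h n * k%:R| <= d -> enorm (Y n j - Y n k) <= e].

Hypotheses (Yb : Sbounded).

Lemma kidx_cvg (t e : R) : 0 <= t -> 0 < e -> nU [set n | `|h n * (kidx (h n) t)%:R - t| <= e].
Proof.
move=> t0 e0; apply: filterS (hs e0) => n /= hn.
have /andP[h1 h2] := kidxP (h0 n) t0.
by rewrite ler_norml; apply/andP; split; lra.
Qed.

Lemma spath_cvg (t e : R) : 0 <= t -> 0 < e ->
  nU [set n | enorm (Y n (kidx (h n) t) - spath t) <= e].
Proof.
move=> t0 e0; have [C hC] := Yb t.
have e1 : 0 < e / q.+1%:R by rewrite divr_gt0.
have hi (i : 'I_q) : nU [set n | `|st (fun n => Y n (kidx (h n) t) ord0 i) - Y n (kidx (h n) t) ord0 i| < e / q.+1%:R].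
  have : nU [set n | `|Y n (kidx (h n) t) ord0 i| <= C].
    apply: filterS hC => n /= hn; apply: le_trans (coord_le_enorm _ _) _; apply: hn.
    by case/andP: (kidxP (h0 n) t0).
  by move=> /st_cvg/cvgrPdist_lt/(_ _ e1).
have hf : nU [set n | forall i : 'I_q, `|st (fun n => Y n (kidx (h n) t) ord0 i) - Y n (kidx (h n) t) ord0 i| < e / q.+1%:R].
  exact: (@filter_forall _ _ _ nU).
apply: filterS hf => n /= hn.
apply: le_trans (enorm_le_sum _) _.
apply: (@le_trans _ _ (q%:R * (e / q.+1%:R))).
  have -> : q%:R * (e / q.+1%:R) = \sum_(i < q) (e / q.+1%:R) by rewrite sumr_const card_ord mulr_natl.
  by apply: ler_sum => i _; rewrite !mxE distrC; exact: ltW.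
by rewrite mulrCA ger_pMr// ler_pdivrMr// mul1r ler_nat.
Qed.

Lemma spath_le (t C : R) : 0 <= t ->
  nU [set n | enorm (Y n (kidx (h n) t)) <= C] -> enorm (spath t) <= C.
Proof.
move=> t0 hC; apply/ler_addgt0Pr => e e0.
have [n [h1 h2]] := nU_ex2 hC (spath_cvg t0 e0).
rewrite (_ : spath t = Y n (kidx (h n) t) - (Y n (kidx (h n) t) - spath t)); last by rewrite subKr.
by apply: le_trans (enormD _ _) _; rewrite enormN lerD.
Qed.

Hypotheses (Yc : Scontinuous).

Lemma spath_continuous (T e : R) : 0 < e -> exists2 d, 0 < d &
  forall s t, 0 <= s <= T -> 0 <= t <= T -> `|s - t| <= d -> enorm (spath s - spath t) <= e.
Proof.
move=> e0; have e3 : 0 < e / 3 by rewrite divr_gt0.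
have [d d0 hd] := Yc T e3; exists (d / 2); first by rewrite divr_gt0.
move=> s t /andP[s0 sT] /andP[t0 tT] st.
have d4 : 0 < d / 4 by rewrite divr_gt0.
have [n [[[h1 h2] [h3 h4]] h5]] := nU_ex2 (filterI (filterI (spath_cvg s0 e3) (spath_cvg t0 e3))
  (filterI (kidx_cvg s0 d4) (kidx_cvg t0 d4))) hd.
have /andP[ks _] := kidxP (h0 n) s0; have /andP[kt _] := kidxP (h0 n) t0.
have := h5 (kidx (h n) s) (kidx (h n) t) (le_trans ks sT) (le_trans kt tT) _.
move: h1 h2 h3 h4 => /=; set a := Y n _; set c := Y n _; set u := h n * _; set v := h n * _ => h1 h2 h3 h4 h6.
have {}h6 : enorm (a - c) <= e / 3.
  by apply: h6; move: st h3 h4; rewrite !ler_norml => /andP[? ?] /andP[? ?] /andP[? ?]; apply/andP; split; lra.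
rewrite (_ : spath s - spath t = (a - c) - (a - spath s) + (c - spath t)); last first.
  by apply/rowP => i; rewrite !mxE; ring.
apply: le_trans (enormD _ _) _; apply: le_trans (lerD (enormD _ _) (lexx _)) _.
rewrite enormN; lra.
Qed.

Lemma spath_within : {within `[0, +oo[%classic, continuous spath}.
Proof.
have cp : continuous (fun t => spath (pos_part t)).
  move=> x; apply/cvgrPdist_le => e e0.
  have [d d0 hd] := spath_continuous (pos_part x + 1) e0.
  have := continuous_pos_part (x := x); move/cvgrPdist_le => hp.
  near=> t.
  have h1 : `|pos_part x - pos_part t| <= d by near: t; exact: hp.
  have h2 : `|pos_part x - pos_part t| <= 1 by near: t; exact: hp.
  apply: le_trans (normv_le_enorm _) _; apply: hd => //.
    by rewrite pos_part_ge0/= lerDl.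
  by rewrite pos_part_ge0/=; move: h2; rewrite ler_norml; lra.
apply/subspace_continuousP => t; rewrite /= in_itv/= andbT => t0.
have := cp t; rewrite /continuous_at/= pos_part_id// => ht.
have ht' : spath (pos_part s) @[s --> within `[0, +oo[%classic (nbhs t)] --> spath t.
  exact: cvg_within_filter ht.
have e : spath s @[s --> within `[0, +oo[%classic (nbhs t)] -->
    spath (pos_part s) @[s --> within `[0, +oo[%classic (nbhs t)].
  by apply: fmap_within_eq => s; rewrite inE/= in_itv/= andbT => s0; rewrite pos_part_id.
exact: cvg_trans e ht'.
Unshelve. all: by end_near. Qed.

End Standard_path.

(** * Pathwise analysis of an Euler scheme with given noise *)

Section Euler_path.
Context {R : realType} {q : nat}.
Local Notation E := 'rV[R]_q.
Variable h : nat -> R.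
Hypotheses (h0 : forall n, 0 < h n) (hs : forall e, 0 < e -> nU [set n | h n <= e]).
Variables (b c : R -> E -> E) (M K : R) (x : E).
Hypotheses (bl : locally_lipschitz_drift b) (cl : locally_lipschitz_drift c).
Hypotheses (bc : forall t z, 0 <= t -> enorm (b t z - c t z) <= M).
Hypotheses (K0 : 0 <= K) (mono : forall t u v, 0 <= t ->
  inner (u - v) (b t u - b t v) <= K * enorm (u - v) ^+ 2).
Variables (X B : nat -> nat -> E) (N : nat -> nat).
Hypotheses (X0 : forall n, X n 0 = x) (B0 : forall n, B n 0 = 0).
Hypothesis Xrec : forall n k, (k < N n)%N ->
  X n k.+1 = X n k + h n *: cut_drift n%:R c (h n * k%:R) (X n k) + (B n k.+1 - B n k).
Hypothesis hN : forall n, n%:R <= h n * (N n)%:R.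
Hypothesis hC : forall n t y, 0 <= t -> h n * enorm (cut_drift n%:R c t y) ^+ 2 <= 1.
Hypotheses (Bb : Sbounded h B) (Bc : Scontinuous h B).

(** Without the noise the increments are of order h, which permits energy estimates and
    differentiation. *)
Let Z n k := X n k - B n k.

Let lt_idx n T k : T < n%:R -> h n * k%:R <= T -> (k < N n)%N.
Proof.
move=> Tn kT; rewrite -(ltr_nat R) -(ltr_pM2l (h0 n)).
by apply: le_lt_trans kT _; exact: lt_le_trans (hN n).
Qed.

Let Zrec n k : (k < N n)%N -> Z n k.+1 = Z n k + h n *: cut_drift n%:R c (h n * k%:R) (X n k).
Proof. by move=> kN; rewrite /Z Xrec//; apply/rowP => i; rewrite !mxE; ring. Qed.

(** An energy estimate for |Z|^2 with a discrete Gronwall argument: the one-sided Lipschitz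
    condition replaces a growth bound, and the drift is evaluated along the bounded path B. The
    bound on X is carried in the same induction, because it is what keeps the truncation at level n
    inactive for large n. *)
Lemma Euler_bounded : Sbounded h X.
Proof.
move=> T'; pose T := Num.max T' 0; have T0 : 0 <= T by rewrite le_max lexx orbT.
suff [C hC'] : exists C, nU [set n | forall k : nat, h n * k%:R <= T -> enorm (X n k) <= C].
  exists C; apply: filterS hC' => n /= hn k kT; apply: hn; apply: le_trans kT _.
  by rewrite le_max lexx.
have [C0 hB0] := Bb T; pose CB := Num.max C0 0.
have CB0 : 0 <= CB by rewrite le_max lexx orbT.
have TC0 : 0 <= T + CB by rewrite addr_ge0.
have [L L0 [_ bL]] := drift_enorm bl TC0.
pose gam := (L + M) ^+ 2 + 1.
pose CV := expR (T * (2 * K + 1)) * (enorm x ^+ 2 + T * gam).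
have gam0 : 0 <= gam by rewrite addr_ge0 ?sqr_ge0.
have CV0 : 0 <= CV by rewrite mulr_ge0 ?expR_ge0// addr_ge0 ?sqr_ge0// mulr_ge0.
pose C := 1 + CV + CB.
exists C; have [n0 hn0] : exists n0 : nat, C + T < n0%:R.
  exists (Num.bound (C + T)); apply: archi_boundP; rewrite !addr_ge0//.
apply: filterS (filterI hB0 (nU_ge n0)) => n /= [hB nn0].
have nC : C + T < n%:R by apply: lt_le_trans hn0 _; rewrite ler_nat.
have hn := h0 n.
pose a := 1 + h n * (2 * K + 1).
have a1 : 1 <= a by rewrite lerDl mulr_ge0 ?(ltW hn)// addr_ge0 ?mulr_ge0.
have aexp k : h n * k%:R <= T -> a ^+ k <= expR (T * (2 * K + 1)).
  move=> kT; apply: (@le_trans _ _ (expR (h n * (2 * K + 1)) ^+ k)).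
    by rewrite lerXn2r ?nnegrE ?expR_ge0 ?(le_trans ler01 a1)// expR_ge1Dx.
  rewrite -expRM_natl ler_expR mulrA (mulrC _ (h n)) ler_wpM2r// addr_ge0 ?mulr_ge0//.
have key k : h n * k%:R <= T -> enorm (Z n k) ^+ 2 <= a ^+ k * (enorm x ^+ 2 + h n * k%:R * gam) /\ enorm (X n k) <= C.
  elim: k => [_|k IH kT].
    have e : enorm (Z n 0) ^+ 2 <= a ^+ 0 * (enorm x ^+ 2 + h n * 0%:R * gam).
      by rewrite /Z X0 B0 subr0 mulr0 mul0r addr0 expr0 mul1r.
    split => //; rewrite X0.
    have : enorm x ^+ 2 <= CV.
      rewrite /CV; apply: (@le_trans _ _ (1 * (enorm x ^+ 2 + T * gam))).
        by rewrite mul1r lerDl mulr_ge0.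
      by rewrite ler_wpM2r ?addr_ge0 ?sqr_ge0 ?mulr_ge0// -expR0 ler_expR mulr_ge0// addr_ge0 ?mulr_ge0.
    have := sqr_ge0 (enorm x - 1); have := enorm_ge0 x; rewrite /C; nra.
  have kT' : h n * k%:R <= T by apply: le_trans kT; rewrite ler_pM2l// ler_nat.
  have [IH1 IH2] := IH kT'.
  have t0 : 0 <= h n * k%:R by rewrite mulr_ge0// ltW.
  have kN : (k < N n)%N by apply: lt_idx kT'; apply: le_lt_trans nC; rewrite lerDr /C !addr_ge0.
  have coordn (y : E) (D : R) : enorm y <= D -> forall i, `|y ord0 i| <= D.
    by move=> yD i; apply: le_trans (coord_le_enorm _ _) yD.
  have cE : cut_drift n%:R c (h n * k%:R) (X n k) = c (h n * k%:R) (X n k).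
    rewrite /cut_drift clamp_id ?(min_idPl _)//.
      by apply: le_trans kT' _; apply: le_trans (ltW nC); rewrite lerDr /C !addr_ge0.
    by move=> i; apply: le_trans (coordn _ _ IH2 i) _; apply: le_trans (ltW nC); rewrite lerDl.
  set cc := cut_drift _ _ _ _ in cE.
  have hcc : h n ^+ 2 * enorm cc ^+ 2 <= h n.
    by have := hC n (X n k) t0; rewrite -/cc expr2 -mulrA => h1; rewrite ler_piMr// ltW.
  have in1 : inner (Z n k) cc <= K * enorm (Z n k) ^+ 2 + enorm (Z n k) * (L + M).
    (* Monotonicity bounds the first difference, as X - B = Z; b along B is at most L by
       compactness; the last difference is at most M. *)
    have -> : cc = (b (h n * k%:R) (X n k) - b (h n * k%:R) (B n k)) + (b (h n * k%:R) (B n k) -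
        (b (h n * k%:R) (X n k) - c (h n * k%:R) (X n k))).
      by rewrite cE; apply/rowP => i; rewrite !mxE; ring.
    rewrite innerDr lerD ?mono//; apply: le_trans (inner_le _ _) _.
    rewrite ler_wpM2l ?enorm_ge0//; apply: le_trans (enormD _ _) _; rewrite enormN lerD ?bc//.
    apply: bL; first by rewrite t0/= (le_trans kT')// lerDl.
    move=> i; apply: le_trans (coordn _ _ (hB k kT') i) _.
    by apply: (@le_trans _ _ CB); [rewrite le_max lexx|rewrite lerDr].
  have e : enorm (Z n k.+1) ^+ 2 <= a ^+ k.+1 * (enorm x ^+ 2 + h n * k.+1%:R * gam).
    rewrite Zrec// -/cc sqr_enormDZ.
    have s1 : 2 * (enorm (Z n k) * (L + M)) <= enorm (Z n k) ^+ 2 + (L + M) ^+ 2.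
      by have := sqr_ge0 (enorm (Z n k) - (L + M)); nra.
    have s2 : enorm (Z n k) ^+ 2 + 2 * (h n * inner (Z n k) cc) + h n ^+ 2 * enorm cc ^+ 2 <=
        a * enorm (Z n k) ^+ 2 + h n * gam.
      have := ler_wpM2l (ltW hn) in1; have := ler_wpM2l (ltW hn) s1; rewrite /a /gam.
      move: hcc; move: (inner _ _) (enorm (Z n k) ^+ 2) (enorm cc ^+ 2) => I1 I2 I3.
      lra.
    apply: le_trans s2 _; apply: le_trans (lerD (ler_wpM2l (le_trans ler01 a1) IH1) (lexx _)) _.
    rewrite mulrA -exprS -natr1.
    have : 1 * (h n * gam) <= a ^+ k.+1 * (h n * gam).
      by rewrite ler_wpM2r ?mulr_ge0 ?(ltW hn)// exprn_ege1.
    rewrite mul1r; lra.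
  split => //.
  have V : enorm (Z n k.+1) ^+ 2 <= CV.
    apply: le_trans e _; rewrite /CV; apply: ler_pM; last first.
    - by rewrite lerD2l ler_wpM2r.
    - exact: aexp.
    - by rewrite addr_ge0 ?sqr_ge0// mulr_ge0// mulr_ge0// ltW.
    - by rewrite exprn_ge0// (le_trans ler01).
  have -> : X n k.+1 = Z n k.+1 + B n k.+1 by rewrite /Z subrK.
  apply: le_trans (enormD _ _) _; rewrite /C; apply: lerD.
    by have := sqr_ge0 (enorm (Z n k.+1) - 1); have := enorm_ge0 (Z n k.+1); nra.
  by apply: le_trans (hB _ kT) _; rewrite le_max lexx.
by move=> k kT; case: (key k kT).
Qed.

Lemma Euler_inc n (v : E) (e : R) j k : 0 <= e -> (j <= k)%N -> (k <= N n)%N ->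
  (forall i, (j <= i)%N -> (i < k)%N -> enorm (cut_drift n%:R c (h n * i%:R) (X n i) - v) <= e) ->
  enorm (Z n k - Z n j - (h n * k%:R - h n * j%:R) *: v) <= e * (h n * k%:R - h n * j%:R).
Proof.
move=> e0 jk kN hv; have hn := h0 n.
elim: k jk kN hv => [|k IH].
  by rewrite leqn0 => /eqP-> _ _; rewrite !subrr scale0r subr0 enorm0 mulr0.
rewrite leq_eqVlt => /predU1P[->|jk] kN hv; first by rewrite !subrr scale0r subr0 enorm0 mulr0.
have {}IH := IH jk (ltnW kN) (fun i ji ik => hv i ji (ltnW ik)).
rewrite Zrec// -natr1.
rewrite (_ : _ - _ = (Z n k - Z n j - (h n * k%:R - h n * j%:R) *: v) +
   h n *: (cut_drift n%:R c (h n * k%:R) (X n k) - v)); last first.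
  by apply/rowP => i; rewrite !mxE; ring.
apply: le_trans (enormD _ _) _; rewrite enormZ (gtr0_norm hn).
have := ler_wpM2l (ltW hn) (hv k jk (ltnSn k)); lra.
Qed.

Let cut_id n T C : T + C <= n%:R -> 0 <= T -> 0 <= C -> forall k, h n * k%:R <= T ->
  enorm (X n k) <= C -> cut_drift n%:R c (h n * k%:R) (X n k) = c (h n * k%:R) (X n k).
Proof.
move=> TC T0 C0 k kT XC; rewrite /cut_drift clamp_id ?(min_idPl _)//.
  by apply: le_trans kT _; apply: le_trans TC; rewrite lerDl.
by move=> i; apply: le_trans (coord_le_enorm _ _) _; apply: le_trans XC _; apply: le_trans TC; rewrite lerDr.
Qed.

Let bounded_ge T : exists2 C, 0 <= C & nU [set n | [/\ forall k : nat, h n * k%:R <= T -> enorm (X n k) <= C,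
  Num.max T 0 + C <= n%:R & forall k : nat, h n * k%:R <= T -> (k < N n)%N]].
Proof.
have [C hC'] := Euler_bounded T; exists (Num.max C 0); first by rewrite le_max lexx orbT.
pose W := Num.max T 0 + Num.max C 0.
have [n0 hn0] : exists n0 : nat, W < n0%:R.
  by exists (Num.bound W); apply: archi_boundP; rewrite addr_ge0// le_max lexx orbT.
apply: filterS (filterI hC' (nU_ge n0)) => n /= [hX nn0].
have nW : W < n%:R by apply: lt_le_trans hn0 _; rewrite ler_nat.
split; [by move=> k /hX h1; apply: le_trans h1 _; rewrite le_max lexx|exact: ltW|].
move=> k; apply: lt_idx; apply: le_lt_trans nW.
by apply: (@le_trans _ _ (Num.max T 0)); [rewrite le_max lexx|rewrite lerDl le_max lexx orbT].
Qed.

Lemma Euler_continuous : Scontinuous h X.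
Proof.
move=> T e e0; have [C C0 hX] := bounded_ge T.
have T0 : 0 <= Num.max T 0 by rewrite le_max lexx orbT.
have TC0 : 0 <= Num.max T 0 + C by rewrite addr_ge0.
have [L L0 [_ cL]] := drift_enorm cl TC0.
have e2 : 0 < e / 2 by rewrite divr_gt0.
have [d d0 hd] := Bc T e2.
have L1 : 0 < L + 1 by rewrite ltr_wpDl.
exists (Num.min d (e / 2 / (L + 1))); first by rewrite lt_min d0 divr_gt0.
apply: filterS (filterI hX hd) => n /= [[hXn nC hkN] hB].
have key j k : (j <= k)%N -> h n * k%:R <= T -> `|h n * j%:R - h n * k%:R| <= Num.min d (e / 2 / (L + 1)) ->
    enorm (X n j - X n k) <= e.
  move=> jk kT; rewrite le_min => /andP[jd je].
  have hn := h0 n.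
  have hjk : h n * j%:R <= h n * k%:R by rewrite ler_pM2l// ler_nat.
  have jT : h n * j%:R <= T by exact: le_trans kT.
  have := @Euler_inc n 0 L j k L0 jk (ltnW (hkN k kT)) _.
  rewrite scaler0 subr0 => hZ.
  have {}hZ : enorm (Z n k - Z n j) <= L * (h n * k%:R - h n * j%:R).
    apply: hZ => i ji ik; rewrite subr0.
    have iT : h n * i%:R <= T by apply: le_trans kT; rewrite ler_pM2l// ler_nat ltnW.
    have iT0 : h n * i%:R <= Num.max T 0 by apply: le_trans iT _; rewrite le_max lexx.
    rewrite (cut_id nC T0 C0 iT0 (hXn i iT)); apply: cL.
      by rewrite mulr_ge0 ?(ltW hn)//=; apply: le_trans iT0 _; rewrite lerDl.
    move=> l; apply: le_trans (coord_le_enorm _ _) _; apply: le_trans (hXn i iT) _.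
    by rewrite lerDr.
  rewrite (_ : X n j - X n k = (B n j - B n k) - (Z n k - Z n j)); last first.
    by rewrite /Z; apply/rowP => i; rewrite !mxE; ring.
  apply: le_trans (enormD _ _) _; rewrite enormN.
  have := hB j k jT kT jd.
  move: je; rewrite distrC ger0_norm ?subr_ge0// ler_pdivlMr// => je.
  have : 0 <= h n * k%:R - h n * j%:R by rewrite subr_ge0.
  move: hZ; lra.
move=> j k jT kT jk; have [le|/ltnW le] := leqP j k; first exact: key.
by rewrite -enormN opprB; apply: key => //; rewrite distrC.
Qed.

(** The standard part of X - B is shown to have the derivative c(s, X_s), and is then identified
    with the primitive F of this continuous function by comparing derivatives. *)
Lemma Euler_integral (t : R) (i : 'I_q) : 0 <= t ->
  spath h X t ord0 i = x ord0 i + (\int[lebesgue_measure]_(s in `[0, t]) c s (spath h X s) ord0 i)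
    + spath h B t ord0 i.
Proof.
move=> t0; have Xb := Euler_bounded; have Xc := Euler_continuous.
pose u (s : R) : R := c (pos_part s) (spath h X (pos_part s)) ord0 i.
have bdd (T : R) : exists2 C, 0 <= C & forall s, 0 <= s <= T -> enorm (spath h X s) <= C.
  have [C C0 hX] := bounded_ge T; exists C => // s /andP[s0 sT].
  refine (@spath_le _ _ _ h0 X Xb s C s0 _); apply: filterS hX => n /= [hXn _ _]; apply: hXn.
  by case/andP: (kidxP (h0 n) s0) => h1 _; exact: le_trans sT.
have cmod (T e : R) : 0 < e -> exists2 d, 0 < d & forall (s r : R) (y : E), 0 <= s <= T -> 0 <= r <= T ->
    (forall l, `|y ord0 l| <= T) -> `|r - s| <= d -> enorm (y - spath h X s) <= d ->
    (forall l, `|spath h X s ord0 l| <= T) -> enorm (c r y - c s (spath h X s)) <= e.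
  move=> e0; have [T0|T0] := leP 0 T; last first.
    by exists 1 => // s r y /andP[s0 sT]; have := le_trans s0 sT; rewrite leNgt T0.
  have [L L0 [hL _]] := drift_enorm cl T0.
  have L1 : 0 < 2 * (L + 1) by rewrite mulr_gt0// ltr_wpDl.
  exists (e / (2 * (L + 1))); first by rewrite divr_gt0.
  move=> s r y hs' hr hy rs ys hXs; apply: le_trans (hL _ _ _ _ hr hs' hy hXs) _.
  apply: (@le_trans _ _ (L * (e / (2 * (L + 1)) + e / (2 * (L + 1))))).
    by rewrite ler_wpM2l// lerD.
  have -> : L * (e / (2 * (L + 1)) + e / (2 * (L + 1))) = e * (L / (L + 1)).
    by field; rewrite gt_eqF// ltr_wpDl.
  by rewrite ler_piMr ?(ltW e0)// ler_pdivrMr ?ltr_wpDl// mul1r lerDl.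
have cu : continuous u.
  move=> s; apply/cvgrPdist_le => e e0.
  pose T := pos_part s + 1.
  have [C C0 hC'] := bdd T; pose T2 := T + C.
  have T0 : 0 <= T by rewrite addr_ge0// pos_part_ge0.
  have [d d0 hd] := cmod T2 e e0.
  have [d' d'0 hd'] := spath_continuous h0 hs Xb Xc T d0.
  have := continuous_pos_part (x := s); move/cvgrPdist_le => hp.
  near=> r.
  have h1 : `|pos_part s - pos_part r| <= d by near: r; exact: hp.
  have h2 : `|pos_part s - pos_part r| <= d' by near: r; exact: hp.
  have h3 : `|pos_part s - pos_part r| <= 1 by near: r; exact: hp.
  have sT : 0 <= pos_part s <= T by rewrite pos_part_ge0/= lerDl.
  have rT : 0 <= pos_part r <= T by rewrite pos_part_ge0/=; move: h3; rewrite ler_norml /T; lra.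
  have wT z : 0 <= z <= T -> 0 <= z <= T2 by move=> /andP[-> zT]; rewrite /= (le_trans zT)// lerDl.
  have wX z : 0 <= z <= T -> forall l, `|spath h X z ord0 l| <= T2.
    move=> hz l; apply: le_trans (coord_le_enorm _ _) _; apply: le_trans (hC' z hz) _.
    by rewrite lerDr.
  have := hd (pos_part s) (pos_part r) (spath h X (pos_part r)) (wT _ sT) (wT _ rT) (wX _ rT) _ _ (wX _ sT).
  rewrite distrC => /(_ h1) /(_ (hd' _ _ rT sT _)); rewrite distrC => /(_ h2) hh.
  rewrite distrC; have := coord_le_enorm (c (pos_part r) (spath h X (pos_part r)) - c (pos_part s) (spath h X (pos_part s))) i.
  by rewrite !mxE => h4; apply: le_trans h4 hh.
have [F [dF F0 FE]] := primitive_exists cu.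
pose z (s : R) : R := spath h X s ord0 i - spath h B s ord0 i.
(* The absolute value extends the difference to an even function, so that its derivative at 0 is
   two-sided. *)
pose phi (s : R) : R := z (`|s|) - F (`|s|).
(* the increments of the Euler scheme minus its noise are local Riemann sums *)
have zloc (s e : R) : 0 <= s -> 0 < e -> exists2 d, 0 < d & forall r1 r2, 0 <= r1 -> r1 <= r2 ->
    s - d <= r1 -> r2 <= s + d -> `|z r2 - z r1 - (r2 - r1) * u s| <= e * (r2 - r1).
  move=> s0 e0; pose T := s + 2.
  have [C C0 hX] := bounded_ge T; pose T2 := T + C.
  have T0 : 0 <= T by rewrite /T; lra.
  have [d d0 hd] := cmod T2 e e0.
  have d2 : 0 < d / 2 by rewrite divr_gt0.
  have [d' d'0 hd'] := Xc T (d / 2) d2.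
  exists (Num.min (Num.min (d / 2) (d' / 2)) 1); first by rewrite !lt_min d2 (divr_gt0 d'0)//= ltr01.
  move=> r1 r2 r10 r12; rewrite lerBlDr => s1 s2.
  have mm : Num.min (Num.min (d / 2) (d' / 2)) 1 <= d / 2 by rewrite !ge_min lexx.
  have mm' : Num.min (Num.min (d / 2) (d' / 2)) 1 <= d' / 2 by rewrite !ge_min lexx !orbT.
  have mm1 : Num.min (Num.min (d / 2) (d' / 2)) 1 <= 1 by rewrite !ge_min lexx !orbT.
  move: (Num.min _ 1) mm mm' mm1 s1 s2 => m mm mm' mm1 s1 s2.
  have r20 : 0 <= r2 by exact: le_trans r12.
  pose v := c s (spath h X s).
  have uv : u s = v ord0 i by rewrite /u /v pos_part_id.
  apply/ler_addgt0Pr => et et0.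
  pose W := 4 + 2 * `|v ord0 i| + 2 * e.
  have W0 : 0 < W by rewrite /W; have := normr_ge0 (v ord0 i); lra.
  pose et1 := et / W; have et10 : 0 < et1 by rewrite divr_gt0.
  have d'4 : 0 < d' / 4 by rewrite divr_gt0.
  have [n [[[[a1 a2] [a3 a4]] [[a5 a6] a7]] [[[hXn nC hkN] hc] [[a8 a9] [a10 a11]]]]] := nU_ex2
    (filterI (filterI (filterI (spath_cvg h0 Xb r10 et10) (spath_cvg h0 Xb r20 et10))
      (filterI (spath_cvg h0 Bb r10 et10) (spath_cvg h0 Bb r20 et10)))
      (filterI (filterI (kidx_cvg h0 hs r10 et10) (kidx_cvg h0 hs r20 et10)) (spath_cvg h0 Xb s0 d2)))
    (filterI (filterI hX hd') (filterI (filterI (kidx_cvg h0 hs s0 d2) (hs d2))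
      (filterI (kidx_cvg h0 hs s0 d'4) (hs d'4)))).
  move: a1 a2 a3 a4 a5 a6 a7 a8 a9 a10 a11 => /= a1 a2 a3 a4 a5 a6 a7 a8 a9 a10 a11.
  have hn := h0 n.
  have /andP[k1a k1b] := kidxP hn r10; have /andP[k2a k2b] := kidxP hn r20.
  have /andP[ksa ksb] := kidxP hn s0.
  have k12 : (kidx (h n) r1 <= kidx (h n) r2)%N by exact: kidx_mono.
  set k1 := kidx (h n) r1 in k12 a1 a3 a5 k1a k1b; set k2 := kidx (h n) r2 in k12 a2 a4 a6 k2a k2b.
  set ks := kidx (h n) s in ksa ksb a7 a8 a10.
  have r2T : r2 <= T by apply: le_trans s2 _; rewrite lerD2l (le_trans mm1)// ler1n.
  have k2T : h n * k2%:R <= T by exact: le_trans r2T.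
  have nC2 : T + C <= n%:R by move: nC; rewrite (max_idPl T0).
  have sXT : forall l, `|spath h X s ord0 l| <= T2.
    move=> l; apply: le_trans (coord_le_enorm _ _) _; apply: (@le_trans _ _ C); last by rewrite lerDr.
    apply: (@spath_le _ _ _ h0 X Xb s C s0); apply: filterS hX => n' /= [hXn' _ _]; apply: hXn'.
    by case/andP: (kidxP (h0 n') s0) => h1 _; apply: le_trans h1 _; rewrite lerDl.
  have inc := @Euler_inc n v e k1 k2 (ltW e0) k12 (ltnW (hkN k2 k2T)) _.
  have {}inc : enorm (Z n k2 - Z n k1 - (h n * k2%:R - h n * k1%:R) *: v) <= e * (h n * k2%:R - h n * k1%:R).
    apply: inc => l k1l lk2.
    have lT : h n * l%:R <= T by apply: le_trans k2T; rewrite ler_pM2l// ler_nat ltnW.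
    have lr2 : h n * l%:R <= r2 by apply: le_trans k2a; rewrite ler_pM2l// ler_nat ltnW.
    have r1l : r1 - h n <= h n * l%:R.
      apply: (@le_trans _ _ (h n * k1%:R)); first by rewrite lerBlDr ltW.
      by rewrite ler_pM2l// ler_nat.
    rewrite (cut_id nC2 T0 C0 lT (hXn l lT)); apply: hd => //.
    - by rewrite s0/= /T2 /T -addrA lerDl addr_ge0.
    - by rewrite mulr_ge0 ?(ltW hn)//= (le_trans lT)// lerDl.
    - move=> l'; apply: le_trans (coord_le_enorm _ _) _; apply: le_trans (hXn l lT) _.
      by rewrite lerDr.
    - exact: near_idx r1l lr2 s1 s2 mm a9.
    - rewrite (_ : X n l - spath h X s = (X n l - X n ks) + (X n ks - spath h X s)); last by rewrite addrA subrK.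
      apply: le_trans (enormD _ _) _; rewrite [leRHS](splitr d); apply: lerD => //.
      apply: hc => //; first by apply: le_trans ksa _; rewrite lerDl.
      exact: near_idx2 r1l lr2 s1 s2 mm' a11 a10.
  have cc (w1 w2 : E) D : enorm (w1 - w2) <= D -> `|w1 ord0 i - w2 ord0 i| <= D.
    by move=> hD; have := coord_le_enorm (w1 - w2) i; rewrite !mxE => h1; exact: le_trans hD.
  have b1 := cc _ _ _ a1; have b2 := cc _ _ _ a2; have b3 := cc _ _ _ a3; have b4 := cc _ _ _ a4.
  have bi : `|(X n k2 ord0 i - B n k2 ord0 i) - (X n k1 ord0 i - B n k1 ord0 i) - (h n * k2%:R - h n * k1%:R) * v ord0 i|
      <= e * (h n * k2%:R - h n * k1%:R).
    by have := le_trans (coord_le_enorm _ i) inc; rewrite /Z !mxE.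
  rewrite uv /z.
  have eW : et = et1 * W by rewrite /et1 divfK// gt_eqF.
  exact: (increment_approx (ltW e0) eW b1 b2 b3 b4 bi a5 a6).
have dphi (s : R) : is_derive s (1 : R) phi 0.
  apply: derive0 => e e0; have e2 : 0 < e / 2 by rewrite divr_gt0.
  have [d1 d10 hd1] := zloc `|s| (e / 2) (normr_ge0 _) e2.
  have := cu `|s|; move/cvgrPdist_le => /(_ _ e2) /nbhs_ballP[d2 /= d20 hd2].
  exists (Num.min d1 (d2 / 2)); first by rewrite lt_min d10 divr_gt0.
  move=> r; rewrite le_min => /andP[rd1 rd2].
  have tri : `| `|r| - `|s| | <= `|r - s| by exact: ler_dist_dist.
  have key (r1 r2 : R) : 0 <= r1 -> r1 <= r2 -> `|r1 - `|s| | <= `|r - s| -> `|r2 - `|s| | <= `|r - s| ->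
      `|z r2 - F r2 - (z r1 - F r1)| <= e * (r2 - r1).
    move=> r10 r12 h1 h2.
    have hz := hd1 r1 r2 r10 r12 _ _.
    have {}hz : `|z r2 - z r1 - (r2 - r1) * u (`|s|)| <= e / 2 * (r2 - r1).
      by apply: hz; [rewrite lerBlDr -lerBlDl (le_trans (ler_norm _))// distrC (le_trans h1)|
        rewrite -lerBlDl (le_trans (ler_norm _))// (le_trans h2)].
    have hF : `|F r2 - F r1 - (r2 - r1) * u (`|s|)| <= e / 2 * (r2 - r1).
      have [r3 /andP[r13 r32] ->] := primitive_mvt dF r12.
      rewrite [_ * (_ - _)]mulrC -mulrBr normrM mulrC (ger0_norm (x := r2 - r1)) ?subr_ge0//.
      rewrite ler_wpM2r ?subr_ge0// distrC; apply: hd2; rewrite /ball/=.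
      apply: (@le_lt_trans _ _ (d2 / 2)); last by rewrite ltr_pdivrMr// ltr_pMr// ltr1n.
      by rewrite distrC; exact: between_dist r13 r32 (le_trans h1 rd2) (le_trans h2 rd2).
    rewrite (_ : z r2 - F r2 - (z r1 - F r1) = (z r2 - z r1 - (r2 - r1) * u (`|s|)) - (F r2 - F r1 - (r2 - r1) * u (`|s|))); last by ring.
    by apply: le_trans (ler_normB _ _) _; move: hz hF; lra.
  apply: (@le_trans _ _ (e * `| `|r| - `|s| |)); last by rewrite ler_wpM2l// ltW.
  rewrite /phi; have [rs|/ltW rs] := leP `|r| `|s|.
    by rewrite -normrN opprB (distrC `|r|) (ger0_norm (x := `|s| - `|r|)) ?subr_ge0//; apply: key; rewrite // subrr normr0.
  by rewrite (ger0_norm (x := `|r| - `|s|)) ?subr_ge0//; apply: key; rewrite // subrr normr0.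
have : phi t = phi 0.
  apply/eqP; rewrite -subr_eq0 -normr_le0.
  have := @primitive_lip _ phi (fun=> 0) t 0 0 dphi.
  by rewrite mul0r; apply => r _ _; rewrite normr0.
rewrite /phi normr0 ger0_norm// F0 subr0 /z.
have -> : spath h X 0 = x.
  by apply/rowP => j; rewrite mxE; apply: st_eq; under eq_fun do rewrite kidx0 X0; exact: cvg_cst.
have -> : spath h B 0 = 0.
  by apply/rowP => j; rewrite !mxE; apply: st_eq; under eq_fun do rewrite kidx0 B0 mxE; exact: cvg_cst.
rewrite (_ : (0 : E) ord0 i = 0) ?mxE// subr0 FE// => e.
have <- : \int[lebesgue_measure]_(s in `[0, t]) u s = \int[lebesgue_measure]_(s in `[0, t]) c s (spath h X s) ord0 i.
  apply: eq_Rintegral => s; rewrite inE/= in_itv/= => /andP[s0 _]; by rewrite /u pos_part_id.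
by rewrite -e; ring.
Unshelve. all: by end_near. Qed.

End Euler_path.

(** * Solutions on a Loeb space *)

(** Dynkin's lemma, for a sigma-algebra that may be smaller than the ambient one; it is applied to
    the filtration. *)
Lemma measure_eq_on d (T : measurableType d) (R : realType) (m1 m2 : {measure set T -> \bar R})
    (G : set (set T)) : G `<=` measurable -> setI_closed G ->
  (m1 setT < +oo)%E -> m1 setT = m2 setT -> (forall A, G A -> m1 A = m2 A) ->
  forall A, <<s G >> A -> m1 A = m2 A.
Proof.
move=> Gm GI f1 e12 eG.
suff h : <<s G >> `<=` [set A | measurable A /\ m1 A = m2 A] by move=> A /h[].
apply: lambda_system_subset => //; last by move=> A GA; split; [exact: Gm|exact: eG].
split => //.
- move=> A B BA [mA eA] [mB eB]; split; first exact: measurableD.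
  have fA : (m1 A < +oo)%E by apply: le_lt_trans f1; apply: le_measure; rewrite ?inE//.
  have gA : (m2 A < +oo)%E by rewrite -eA.
  rewrite !measureD//.
  by rewrite setIidr//; congr (_ - _)%E; [exact: eA|exact: eB].
- move=> F ndF hF; have mF i : measurable (F i) by case: (hF i).
  have mU : measurable (\bigcup_i F i) by exact: bigcupT_measurable.
  split => //.
  have c1 := nondecreasing_cvg_mu (mu := m1) mF mU ndF.
  have c2 := nondecreasing_cvg_mu (mu := m2) mF mU ndF.
  have e : m1 \o F = m2 \o F by apply/funext => i /=; case: (hF i).
  by move: c1; rewrite e => c1; exact: cvg_unique c1 c2.
Qed.

(** * Boxes as a generating class of events *)

Section Boxes.
Context {R : realType} {q : nat}.

Definition rVbox (a : 'I_q -> R) : set 'rV[R]_q := [set v | forall i, v ord0 i < a i].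

Lemma measurable_rVforall (C : 'I_q -> set R) : (forall i, measurable (C i)) ->
  measurable [set v : 'rV[R]_q | forall i, C i (v ord0 i)].
Proof.
move=> mC; rewrite (_ : [set _ | _] = \bigcap_(i in [set: 'I_q]) [set v : 'rV[R]_q | C i (v ord0 i)]).
  apply: fin_bigcap_measurable => // i _.
  by have := measurable_coord i measurableT (mC i); rewrite setTI.
by apply/seteqP; split=> v /= h i; [move=> _; exact: h|exact: h].
Qed.

Lemma measurable_rVbox a : measurable (rVbox a).
Proof.
have := @measurable_rVforall (fun i => `]-oo, a i[%classic) (fun i => measurable_itv _).
by rewrite (_ : [set _ | _] = rVbox a)//; apply/seteqP; split=> v /= h i; have := h i; rewrite /= in_itv.
Qed.

Lemma rVbox_generate (A : set 'rV[R]_q) : measurable A -> <<s [set rVbox a | a in setT] >> A.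
Proof.
set G := [set rVbox a | a in setT].
have mc (i : 'I_q) : measurable_fun setT (fun v : g_sigma_algebraType G => (v : 'rV[R]_q) ord0 i : measurableTypeR R).
  apply: (measurability _ (measurable_realfun.RGenInftyO.measurableE R)) => // _ [_ [a ->] <-].
  rewrite setTI (_ : _ @^-1` _ = \bigcup_(n : nat) rVbox (fun j => if j == i then a else n%:R)).
    apply: (@bigcup_measurable _ (g_sigma_algebraType G)) => k _.
    by apply: sub_sigma_algebra; eexists; last reflexivity.
  apply/seteqP; split=> v /=; rewrite in_itv/=.
    move=> va; exists (Num.bound (\sum_j `|v ord0 j|)) => //= j.
    case: eqVneq => [->//|_]; apply: (@le_lt_trans _ _ (\sum_j `|v ord0 j|)).
      by apply: le_trans (ler_norm _) _; rewrite (bigD1 j)//= lerDl sumr_ge0.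
    by apply: archi_boundP; exact: sumr_ge0.
  by move=> [n _ /(_ i)]; rewrite eqxx.
move=> mA; have := @measurable_rVP _ (g_sigma_algebraType G) R q id.
by case=> _ /(_ mc) /(_ (@measurableT _ (g_sigma_algebraType G)) A mA); rewrite setTI.
Qed.

Lemma rVbox_measure_eq (m1 m2 : {measure set 'rV[R]_q -> \bar R}) :
  (m1 setT < +oo)%E -> m1 setT = m2 setT -> (forall a, m1 (rVbox a) = m2 (rVbox a)) ->
  forall A, measurable A -> m1 A = m2 A.
Proof.
move=> f1 e12 eG A /rVbox_generate; apply: measure_eq_on => //.
- by move=> _ [a _ <-]; exact: measurable_rVbox.
- move=> _ _ [a _ <-] [a' _ <-]; exists (fun i => Num.min (a i) (a' i)) => //.
  apply/seteqP; split=> v /=.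
    by move=> h; split=> i; have := h i; rewrite lt_min => /andP[].
  by move=> [h h'] i; rewrite lt_min h h'.
- by move=> _ [a _ <-].
Qed.

End Boxes.

(** * Scaling of Gaussian laws *)

Section Scaling.
Context {R : realType}.
Local Notation mu := (@lebesgue_measure R).
Local Open Scope ereal_scope.

Lemma integral_scale (a : R) (f : R -> \bar R) : (0 < a)%R -> measurable_fun setT f ->
  (forall x, 0 <= f x) -> a%:E * \int[mu]_x f (a * x)%R = \int[mu]_x f x.
Proof.
move=> a0 mf f0.
have ms : measurable_fun [set: measurableTypeR R] ((fun x => a * x)%R : measurableTypeR R -> measurableTypeR R).
  by apply: measurable_funM.
pose F : {mfun measurableTypeR R >-> measurableTypeR R} :=
  HB.pack (fun x => a * x : measurableTypeR R)%R (isMeasurableFun.Build _ _ _ _ _ ms).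
have a0' : (0 <= a)%R by exact: ltW.
pose pm : {measure set (measurableTypeR R) -> \bar R} := pushforward mu F.
pose m : {measure set (measurableTypeR R) -> \bar R} := mscale (NngNum a0') (pm ms).
have em A : measurable A -> mu A = m A.
  apply: (@lebesgue_measure_unique _ m) => _ [[u v]] _ <-.
  rewrite /m /= /mscale/= /pm /= /pushforward /=.
  have -> : F @^-1` `]u, v] = `](u / a)%R, (v / a)%R]%classic.
    by apply/seteqP; split=> x; rewrite /= !in_itv/= ltr_pdivrMr// ler_pdivlMr// ![(x * a)%R]mulrC.
  rewrite !lebesgue_measure_itv/= !lte_fin ltr_pM2r ?invr_gt0//; case: ifP => // _; last by rewrite mule0.
  by rewrite -!EFinD -EFinM; congr EFin; field; rewrite gt_eqF.
transitivity (\int[m]_x f x).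
  rewrite ge0_integral_mscale//= ge0_integral_pushforward//.
by apply: eq_measure_integral => A mA _; symmetry; exact: em.
Qed.

Lemma normal_prob_scale (s : R) (C : set R) : (0 < s)%R -> measurable C ->
  gauss1 [set x | C (s * x)%R] = normal_prob 0 s C.
Proof.
move=> s0 mC.
have mC' : measurable [set x : R | C (s * x)%R].
  have ms : measurable_fun [set: measurableTypeR R] (fun x => s * x : measurableTypeR R)%R by apply: measurable_funM.
  by have := ms measurableT _ mC; rewrite setTI.
transitivity (\int[mu]_(x in [set x | C (s * x)%R]) (normal_pdf 0 1 x)%:E); first by [].
rewrite /normal_prob [LHS]integral_mkcond [RHS]integral_mkcond.
pose f (x : R) : \bar R := ((\1_C x)%:E * (normal_pdf 0 s x)%:E).
have mf : measurable_fun setT f.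
  apply: emeasurable_funM; apply/measurable_EFinP; first exact: measurable_indic.
  exact: measurable_normal_pdf.
have f0 x : 0 <= f x by rewrite mule_ge0// lee_fin ?normal_pdf_ge0.
transitivity (\int[mu]_x f x); last first.
  apply: eq_integral => x _; rewrite /f patchE indicE; case: ifP => _; by rewrite ?mul1e ?mul0e.
rewrite -(integral_scale s0 mf f0) -ge0_integralZl//; last 2 first.
- by apply: (measurableT_comp mf); apply: measurable_funM.
- by rewrite lee_fin ltW.
apply: eq_integral => x _; rewrite /f patchE indicE.
rewrite (_ : (x \in [set x | C (s * x)%R]) = ((s * x)%R \in C)); last by apply/idP/idP; rewrite !inE.
case: ifP => _; rewrite ?mul1e ?mul0e ?mule0//.
rewrite -EFinM; congr EFin; rewrite !normal_pdfE ?oner_eq0 ?gt_eqF// /normal_fun /normal_peak.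
have -> : (s ^+ 2 * pi *+ 2 = s ^+ 2 * (1 ^+ 2 * pi *+ 2))%R by ring.
rewrite (sqrtrM _ (sqr_ge0 s)) sqrtr_sqr gtr0_norm//.
have -> : (- (s * x - 0) ^+ 2 / (s ^+ 2 *+ 2) = - (x - 0) ^+ 2 / (1 ^+ 2 *+ 2))%R by field; rewrite gt_eqF.
by rewrite invfM !mulrA divff ?mul1r// gt_eqF.
Qed.

End Scaling.

Section Blocks.
Context {R : realType} {q : nat}.
Variable W : nat -> 'rV[R]_q.

Lemma le_kidx (h t : R) k : 0 < h -> h * k%:R <= t -> (k <= kidx h t)%N.
Proof.
move=> h0 kt; have t0 : 0 <= t by apply: le_trans kt; rewrite mulr_ge0// ltW.
have /andP[_ k1] := kidxP h0 t0.
rewrite -ltnS -(ltr_nat R) -natr1 -(ltr_pM2l h0) mulrDr mulr1; exact: le_lt_trans k1.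
Qed.

(* A large oscillation over a time [delta] shows up in one of the blocks of
   length [2 delta] that start at multiples of [delta]. *)
Lemma block_oscillation (h T delta e : R) j k : 0 < h -> h <= delta ->
  h * j%:R <= T -> h * k%:R <= T -> `|h * j%:R - h * k%:R| <= delta -> e < enorm (W j - W k) ->
  exists2 l, (l < (kidx h T %/ kidx h delta).+1)%N & exists2 i, (i <= 2 * kidx h delta)%N &
    e / 2 < enorm (W (l * kidx h delta + i) - W (l * kidx h delta)).
Proof.
move=> h0 hd; set m := kidx h delta.
have m0 : (0 < m)%N by apply: le_kidx => //; rewrite mulr1.
wlog jk : j k / (j <= k)%N => [H jT kT jkd ee|].
  have [jk|/ltnW kj] := leqP j k; first exact: (H j k).
  by apply: (H k j) => //; [rewrite distrC|rewrite -enormN opprB].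
move=> jT kT; rewrite distrC ger0_norm; last by rewrite subr_ge0 ler_pM2l// ler_nat.
rewrite -mulrBr -natrB// => jkd ee.
have {}jkd : (k - j <= m)%N by exact: le_kidx.
pose l := (j %/ m)%N; have lj : (l * m <= j)%N by exact: leq_trunc_div.
have jl : (j < l * m + m)%N by rewrite addnC -mulSn; exact: ltn_ceil.
exists l; first by rewrite ltnS leq_div2r// le_kidx.
have tri : enorm (W j - W k) <= enorm (W (l * m + (j - l * m)) - W (l * m)) + enorm (W (l * m + (k - l * m)) - W (l * m)).
  rewrite !subnKC//; last exact: leq_trans jk.
  rewrite (_ : W j - W k = (W j - W (l * m)) - (W k - W (l * m))); last by apply/rowP => i; rewrite !mxE; ring.
  by apply: le_trans (enormD _ _) _; rewrite enormN.
have [c|c] := ltP (e / 2) (enorm (W (l * m + (j - l * m)) - W (l * m))).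
  by exists (j - l * m)%N => //; rewrite leq_subLR; apply: leq_trans (ltnW jl) _; rewrite leq_add2l leq_pmull.
exists (k - l * m)%N; last by move: (lt_le_trans ee tri) c; lra.
rewrite leq_subLR; move: jkd; rewrite leq_subLR => /leq_trans; apply.
by rewrite (leq_trans (leq_add (ltnW jl) (leqnn m)))// -addnA leq_add2l addnn mul2n.
Qed.

End Blocks.

Lemma lt_sub_inv (R : realType) q (v a : 'I_q -> R) :
  (forall i, v i < a i) <-> exists k, forall i, v i < a i - k.+1%:R^-1.
Proof.
split=> [h|[k hk] i]; last by apply: lt_trans (hk i) _; rewrite ltrBlDr ltrDl invr_gt0.
have hi (i : 'I_q) : \forall k \near \oo, v i < a i - k.+1%:R^-1.
  have d0 : 0 < a i - v i by rewrite subr_gt0.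
  have := near_infty_natSinv_lt (PosNum d0); apply: filterS => k /= hk; rewrite ltrBrDl -ltrBrDr; exact: hk.
have hf : \forall k \near \oo, forall i : 'I_q, v i < a i - k.+1%:R^-1 by exact: (@filter_forall _ _ _ \oo).
by have [k hk] := @filter_ex _ _ _ _ hf; exists k.
Qed.

Lemma ae_measure_le d (T : measurableType d) (R : realType) (m : {measure set T -> \bar R}) (A B : set T) :
  measurable A -> measurable B -> {ae m, forall w, A w -> B w} -> (m A <= m B)%E.
Proof.
move=> mA mB [N [mN N0 hN]].
have u2 : (m (B `|` N) <= m B)%E by rewrite -[leRHS]adde0 -[in leRHS]N0; exact: measureU2.
apply: le_trans u2; apply: le_measure; rewrite ?inE//; first exact: measurableU.
move=> w Aw; have [Nw|Nw] := pselect (N w); [by right|left].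
by apply: contrapT => nB; apply: Nw; apply: hN => /= /(_ Aw).
Qed.

Lemma ae_measure_eq d (T : measurableType d) (R : realType) (m : {measure set T -> \bar R}) (A B : set T) :
  measurable A -> measurable B -> {ae m, forall w, A w <-> B w} -> m A = m B.
Proof.
move=> mA mB AB; apply/eqP; rewrite eq_le; apply/andP; split; apply: ae_measure_le => //;
  by apply: (@filterS _ _ (ae_filter_ringOfSetsType m)) AB => w [].
Qed.

(** * Brownian motion and solutions on the Loeb space *)

Section Driven.
Context {R : realType} {dS : measure_display} {S : measurableType dS}.
Variable mu : probability S R.
Context {dT : measure_display} {St : measurableType dT} {q : nat}.
Local Notation E := 'rV[R]_q.
Variables (N : nat -> nat) (h : nat -> R).
Variables (step : nat -> nat -> St -> S -> St) (eta : nat -> nat -> St -> S -> E) (x0 : St).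
Hypothesis mstep : forall n i, measurable_fun setT (fun p : St * S => step n i p.1 p.2).
Hypothesis meta : forall n i, measurable_fun setT (fun p : St * S => eta n i p.1 p.2).
Hypothesis eta_law : forall n i x (f : E -> \bar R), measurable_fun setT f ->
  (forall g, 0 <= f g)%E -> (\int[mu]_a f (eta n i x a) = \int[gauss q]_g f g)%E.
Hypotheses (h0 : forall n, 0 < h n) (hs : forall e, 0 < e -> nU [set n | h n <= e]).
Hypothesis hN : forall n, n%:R <= h n * (N n)%:R.

Local Notation P := (fun n => pw mu (N n)).
Local Notation lp := (loeb P).

Definition noise_path n k (w : (N n).-tuple S) : E :=
  Num.sqrt (h n) *: nsum (step n) (eta n) 0 x0 (take k w).

Local Notation W := noise_path.

Let sh0 n : 0 < Num.sqrt (h n). Proof. by rewrite sqrtr_gt0. Qed.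

Lemma measurable_noise_path n k : measurable_fun setT (@noise_path n k).
Proof.
apply: measurable_rVZ; first exact: measurable_cst.
exact: measurable_nsum_cst.
Qed.

Lemma noise_path_past n k m (A : set ((N n).-tuple S)) (C : set E) : (k + m <= N n)%N ->
  past k A -> measurable C ->
  pw mu (N n) (A `&` [set w | C (W (k + m) w - W k w)]) =
  (pw mu (N n) A * gauss q [set g | C (Num.sqrt (h n * m%:R) *: g)])%E.
Proof.
move=> km pA mC; pose C' := [set v | C (Num.sqrt (h n) *: v)].
have mC' : measurable C'.
  by have := measurable_affine 0 (Num.sqrt (h n)) mC; under eq_set do rewrite add0r.
have := nsum_past (@mstep n) (@meta n) (@eta_law n) 0 x0 km pA mC'.
rewrite (_ : [set w | C (W (k + m) w - W k w)] = [set w : (N n).-tuple S |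
  C' (nsum (step n) (eta n) 0 x0 (take (k + m) w) - nsum (step n) (eta n) 0 x0 (take k w))]); last first.
  by apply/seteqP; split=> w; rewrite /C'/W/= scalerBr.
move=> ->; congr (_ * gauss q _)%E.
by apply/seteqP; split=> g; rewrite /C'/= scalerA -sqrtrM ?(ltW (h0 n)).
Qed.

Let max_set n k m (e : R) := [set w : (N n).-tuple S | exists2 j, (j <= m)%N & e < enorm (W (k + j) w - W k w)].

Let max_setE n k m (e : R) : max_set k m e = [set w : (N n).-tuple S | exists2 j, (j <= m)%N &
  e / Num.sqrt (h n) < enorm (nsum (step n) (eta n) 0 x0 (take (k + j) w) - nsum (step n) (eta n) 0 x0 (take k w))].
Proof.
by apply/seteqP; split=> w /= [j jm hj]; exists j => //; move: hj;
  rewrite /W -scalerBr enormZ (gtr0_norm (sh0 n)) ltr_pdivrMr// mulrC.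
Qed.

Lemma measurable_noise_max n k m (e : R) : measurable (@max_set n k m e).
Proof.
rewrite max_setE.
have := measurable_nsum_max (@mstep n) (@meta n) (n := N n) k m 0 x0 0 (e / Num.sqrt (h n)).
by congr measurable; apply/seteqP; split=> w /= [j jm hj]; exists j => //; move: hj; rewrite add0r.
Qed.

Lemma noise_max : exists2 K : R, 0 <= K & forall n k m (e : R), 0 < e -> (k + m <= N n)%N ->
  (pw mu (N n) (@max_set n k m e) <= (K * (h n * m%:R) ^+ 2 / e ^+ 4)%:E)%E.
Proof.
have [K K0 hK] := @gauss_tail R q; exists (K + K); first by rewrite addr_ge0.
move=> n k m e e0 km; rewrite max_setE.
have e1 : 0 < e / Num.sqrt (h n) by rewrite divr_gt0.
apply: le_trans (nsum_max (@mstep n) (@meta n) (@eta_law n) 0 x0 (ltW e1) km) _.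
have := hK (Num.sqrt m%:R) _ (sqrtr_ge0 _) e1 => h1.
apply: le_trans (leeD h1 h1) _; rewrite -EFinD lee_fin -mulrDl -mulrDl.
rewrite (_ : Num.sqrt m%:R ^+ 4 = m%:R ^+ 2); last by rewrite (exprM _ 2 2) sqr_sqrtr.
rewrite expr_div_n (_ : Num.sqrt (h n) ^+ 4 = h n ^+ 2); last by rewrite (exprM _ 2 2) sqr_sqrtr// ltW.
by rewrite invfM invrK exprMn !mulrA; rewrite le_eqVlt; apply/orP; left; apply/eqP; ring.
Qed.

Let block n (T delta e : R) := [set w : (N n).-tuple S | exists2 l, (l < (kidx (h n) T %/ kidx (h n) delta).+1)%N &
  @max_set n (l * kidx (h n) delta) (2 * kidx (h n) delta) (e / 2) w].

Let blockE n T delta e : @block n T delta e =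
  \big[setU/set0]_(l < (kidx (h n) T %/ kidx (h n) delta).+1)
    @max_set n (l * kidx (h n) delta) (2 * kidx (h n) delta) (e / 2).
Proof.
by rewrite -(bigcup_mkord _ (fun l => @max_set n (l * kidx (h n) delta) (2 * kidx (h n) delta) (e / 2))).
Qed.

Let measurable_block n T delta e : measurable (@block n T delta e).
Proof. by rewrite blockE; apply: bigsetU_measurable => i _; exact: measurable_noise_max. Qed.

(** About T/delta blocks, each with probability of order delta^2/e^4, give a total of order delta.
    The factor 128 collects the block length 2 delta, the oscillation e/2, and the bound 2 (T + 1)
    for delta times the number of blocks. *)
Let block_le : exists2 K : R, 0 <= K & forall n (T delta e : R), 0 <= T -> 0 < delta -> delta <= 1 -> 0 < e ->
  h n <= delta / 2 -> T + 2 <= n%:R ->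
  (pw mu (N n) (@block n T delta e) <= (K * (T + 1) / e ^+ 4 * delta)%:E)%E.
Proof.
have [K K0 hK] := noise_max; exists (128 * K); first by rewrite mulr_ge0.
move=> n T delta e T0 d0 d1 e0 hd Tn; rewrite blockE.
have hn := h0 n; set m := kidx (h n) delta; set L := (_ %/ _).+1.
have /andP[md1 md2] := kidxP hn (ltW d0); have /andP[t1 t2] := kidxP hn T0.
rewrite -/m in md1 md2.
have m0 : (0 < m)%N by apply: le_kidx => //; rewrite mulr1; lra.
have Lm : h n * (L * m)%:R <= T + delta.
  rewrite /L mulSn natrD mulrDr addrC lerD//; apply: le_trans t1.
  by rewrite ler_pM2l// ler_nat leq_trunc_div.
have e2 : 0 < e / 2 by rewrite divr_gt0.
apply: le_trans.
  apply: (@prob_bigsetU_le _ _ _ _ _ _ (K * (h n * (2 * m)%:R) ^+ 2 / (e / 2) ^+ 4)).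
    by move=> i; exact: measurable_noise_max.
  move=> i; apply: hK => //; rewrite -(ler_nat R) -(ler_pM2l hn); apply: le_trans (hN n).
  apply: le_trans Tn; rewrite natrD mulrDr lerD//.
    apply: le_trans t1; rewrite ler_pM2l// ler_nat; apply: leq_trans (leq_trunc_div _ m).
    by rewrite leq_mul2r -ltnS ltn_ord orbT.
  by rewrite natrM mulrCA; move: md1; lra.
rewrite lee_fin.
have hm0 : 0 <= h n * m%:R by rewrite mulr_ge0// ltW.
have ie : 0 <= (e ^+ 4)^-1 by rewrite invr_ge0 exprn_ge0// ltW.
have Ld : L%:R * delta <= 2 * (T + 1).
  move: Lm; rewrite natrM mulrCA => Lm.
  have : L%:R * (delta / 2) <= L%:R * (h n * m%:R) by rewrite ler_wpM2l//; lra.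
  by lra.
rewrite (_ : L%:R * _ = (64 * K / e ^+ 4) * (L%:R * (h n * m%:R) * (h n * m%:R))); last first.
  by rewrite natrM; field; rewrite gt_eqF.
rewrite (_ : 128 * K * (T + 1) / e ^+ 4 * delta = (64 * K / e ^+ 4) * (2 * (T + 1) * delta)); last by field; rewrite gt_eqF.
rewrite ler_wpM2l//; first by rewrite mulr_ge0// mulr_ge0.
apply: ler_pM => //; first by rewrite mulr_ge0.
by apply: le_trans Ld; rewrite ler_wpM2l.
Qed.

(** The intersection of all these events has measure at most C/(i+1) for every i, hence 0. *)
Lemma loeb_small (A : nat -> forall n, set ((N n).-tuple S)) (C : R) : (forall i n, measurable (A i n)) ->
  (forall i, nU [set n | (pw mu (N n) (A i n) <= (C / i.+1%:R)%:E)%E]) ->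
  {ae lp, forall w, exists i, ~ internal (P := P) (A i) w}.
Proof.
move=> mA hA; exists (\bigcap_i internal (P := P) (A i)).
have mI : measurable (\bigcap_i internal (P := P) (A i) : set (loeb_space P)).
  by apply: (@bigcapT_measurable _ (loeb_space P)) => i; exact: (@measurable_internal _ _ _ P (A i) (mA i)).
split => //; last first.
  by move=> w /= /forallNP hw i _; apply: contrapT; exact: hw.
have le i : (lp (\bigcap_i internal (P := P) (A i)) <= (C / i.+1%:R)%:E)%E.
  apply: le_trans (loeb_le (P := P) (mA i) (hA i)); apply: le_measure.
  - by rewrite inE.
  - by apply/mem_set; exact: (@measurable_internal _ _ _ P (A i) (mA i)).
  - exact: bigcap_inf.
apply/eqP; rewrite eq_le measure_ge0 andbT; apply/lee_addgt0Pr => e e0; rewrite add0e.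
have [i hi] : exists i : nat, C / i.+1%:R <= e.
  exists (Num.bound (C / e)); rewrite ler_pdivrMr// mulrC -ler_pdivrMr//.
  have [c0|/ltW c0] := leP 0 (C / e); last by apply: le_trans c0 _.
  by apply: le_trans (ltW (archi_boundP c0)) _; rewrite ler_nat.
by apply: le_trans (le i) _; rewrite lee_fin.
Qed.

(** For a horizon T and a tolerance 1/(p+1), the oscillation events with modulus 1/(i+1) have
    probability O(1/(i+1)), so almost surely one of them fails. Countably many pairs T, p
    suffice. *)
Lemma ae_Scontinuous : {ae lp, forall w, Scontinuous h (fun n k => W k (w n))}.
Proof.
have [K K0 hK] := block_le.
have key (T p : nat) : {ae lp, forall w, exists i : nat,
    ~ internal (P := P) (fun n => @block n T%:R i.+1%:R^-1 p.+1%:R^-1) w}.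
  apply: (@loeb_small (fun i n => @block n T%:R i.+1%:R^-1 p.+1%:R^-1) (K * (T%:R + 1) / p.+1%:R^-1 ^+ 4)) => // i.
  have i0 : 0 < i.+1%:R^-1 :> R by rewrite invr_gt0.
  have i2 : 0 < i.+1%:R^-1 / 2 :> R by rewrite divr_gt0.
  apply: filterS (filterI (hs i2) (nU_ge (T + 2))) => n /= [hn Tn].
  apply: hK => //; first by rewrite invf_le1// ler1n.
  by rewrite -natrD ler_nat.
have key2 (T : nat) := ae_foralln (key T).
have := ae_foralln key2; apply: filterS => w /= hw T e e0.
pose T' := Num.bound (Num.max T 0).
have TT' : T <= T'%:R.
  apply: (@le_trans _ _ (Num.max T 0)); first by rewrite le_max lexx.
  by apply: ltW; apply: archi_boundP; rewrite le_max lexx orbT.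
pose p := Num.bound e^-1.
have pe : p.+1%:R^-1 <= e.
  rewrite invf_ple ?posrE//; apply: (@le_trans _ _ p%:R); last by rewrite ler_nat.
  by apply: ltW; apply: archi_boundP; rewrite invr_ge0 ltW.
have [i] := hw T' p => /nU_notin hi.
exists i.+1%:R^-1; first by rewrite invr_gt0.
have i0 : 0 < i.+1%:R^-1 :> R by rewrite invr_gt0.
apply: filterS (filterI hi (hs i0)) => n /= [nb hn] j k jT kT jk.
rewrite leNgt; apply/negP => ejk; apply: nb.
have := @block_oscillation R q (fun k => W k (w n)) (h n) T'%:R i.+1%:R^-1 p.+1%:R^-1 j k (h0 n) hn
  (le_trans jT TT') (le_trans kT TT') jk (le_lt_trans pe ejk).
by move=> [l lL [i' im hi']]; exists l => //; exists i'.
Qed.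

Lemma ae_Sbounded : {ae lp, forall w, Sbounded h (fun n k => W k (w n))}.
Proof.
have [K K0 hK] := noise_max.
have key (T : nat) : {ae lp, forall w, exists i : nat,
    ~ internal (P := P) (fun n => @max_set n 0 (kidx (h n) T%:R) i.+1%:R) w}.
  apply: (@loeb_small (fun i n => @max_set n 0 (kidx (h n) T%:R) i.+1%:R) (K * T%:R ^+ 2)) => i.
    by move=> n; exact: measurable_noise_max.
  apply: filterS (nU_ge T) => n /= Tn.
  have T0 : 0 <= T%:R :> R by [].
  have /andP[t1 t2] := kidxP (h0 n) T0.
  apply: le_trans (hK _ _ _ _ _ _) _ => //.
    rewrite add0n -(ler_nat R) -(ler_pM2l (h0 n)); apply: le_trans t1 _; apply: le_trans (hN n).
    by rewrite ler_nat.
  rewrite lee_fin; apply: ler_pM.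
  - by rewrite mulr_ge0 ?sqr_ge0.
  - by rewrite invr_ge0 exprn_ge0.
  - by rewrite ler_wpM2l// lerXn2r ?nnegrE// mulr_ge0// ltW.
  - by rewrite lef_pV2 ?posrE ?exprn_gt0// exprS ler_peMr// exprn_ege1// ler1n.
have := ae_foralln key; apply: filterS => w /= hw T.
pose T' := Num.bound (Num.max T 0).
have TT' : T <= T'%:R.
  apply: (@le_trans _ _ (Num.max T 0)); first by rewrite le_max lexx.
  by apply: ltW; apply: archi_boundP; rewrite le_max lexx orbT.
have [i] := hw T' => /nU_notin hi.
exists i.+1%:R; apply: filterS hi => n /= nb k kT.
rewrite leNgt; apply/negP => ek; apply: nb; exists k.
  by apply: le_kidx => //; exact: le_trans TT'.
by rewrite add0n /W take0/= scaler0 subr0.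
Qed.

Definition bm (t : R) (w : loeb_space P) : E := spath h (fun n k => W k (w n)) t.

(** The tuples also record the uniform variables, so this can be larger than the filtration of [bm];
    all components of the scheme have to be adapted to it. *)
Definition filt (t : R) : set (set (loeb_space P)) :=
  <<s [set internal (P := P) A | A in [set A | forall n, past (kidx (h n) t) (A n)]] >>.

Let lpE A : (forall n, measurable (A n)) -> lp (internal (P := P) A) = (hprob P A)%:E.
Proof. exact: loebE. Qed.

Lemma filtP : is_filtration filt.
Proof.
split=> [t t0|s t s0 st].
  split; first exact: smallest_sigma_algebra.
  apply: smallest_sub; first exact: (@sigma_algebra_measurable _ (loeb_space P)).
  by move=> _ [A /= pA <-]; apply: measurable_internal => n; case: (pA n).
apply: smallest_sub; first exact: smallest_sigma_algebra.
move=> _ [A /= pA <-]; apply: sub_sigma_algebra; exists A => // n.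
by apply: past_sub (pA n); exact: kidx_mono.
Qed.

Lemma filt_row t (f : forall n, (N n).-tuple S -> E) : (forall n, measurable_fun setT (f n)) ->
  (forall n (v v' : (N n).-tuple S), take (kidx (h n) t) v = take (kidx (h n) t) v' -> f n v = f n v') ->
  sigma_of (fun w : loeb_space P => \row_i hst (P := P) (fun n v => f n v ord0 i) w) `<=` filt t.
Proof.
move=> mf pf; apply: smallest_sub; first exact: smallest_sigma_algebra.
move=> C [i _]; under [X in g_sigma_algebra_preimage X]eq_fun do rewrite mxE.
have mi n : measurable_fun setT (fun v => f n v ord0 i : measurableTypeR R).
  by have /measurable_rVP := mf n.
have key n (B : set R) : measurable B -> past (kidx (h n) t) [set v : (N n).-tuple S | B (f n v ord0 i)].
  move=> mB; split; first by have := mi n measurableT _ mB; rewrite setTI.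
  by move=> v v' /pf /= ->.
apply: (@measurable_hst _ _ _ P (fun n => past (kidx (h n) t)) (fun n v => f n v ord0 i)).
- by move=> n a; have := key n _ (measurable_itv `]-oo, a[); under eq_set do rewrite /= in_itv/=.
- move=> n a; have := key n _ (measurable_itv `[- a, a]); congr past.
  by apply/seteqP; split=> v /=; rewrite in_itv/= ler_norml.
Qed.

Lemma bm_adapted : adapted filt bm.
Proof.
move=> t t0; apply: (@filt_row t (fun n v => W (kidx (h n) t) v)).
- by move=> n; exact: measurable_noise_path.
- by move=> n v v' e; rewrite /noise_path e.
Qed.

Lemma measurable_adapted X t : 0 <= t -> adapted filt X -> measurable_fun setT (X t : loeb_space P -> E).
Proof.
move=> t0 aX; have [/(_ t t0)[_ Fm] _] := filtP.
apply/measurable_rVP => i _ Y mY; rewrite setTI.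
apply: Fm; apply: (aX t t0); apply: sub_sigma_algebra; exists i => //.
by exists Y => //; rewrite setTI.
Qed.

Section Increment.
Variables s t : R.
Hypotheses (s0 : 0 <= s) (st : s < t).
Let t0 : 0 <= t. Proof. by apply: le_trans (ltW st). Qed.
Let dk n := (kidx (h n) t - kidx (h n) s)%N.
Let sg : R := Num.sqrt (t - s).
Let sg0 : 0 < sg. Proof. by rewrite sqrtr_gt0 subr_gt0. Qed.
(** The grid increment has variance h dk, which only tends to t - s. Rescaling gives it exactly the
    limit law at every index with dk > 0, so box probabilities need no passage to the limit. *)
Let V n (v : (N n).-tuple S) : E :=
  (sg / Num.sqrt (h n * (dk n)%:R)) *: (W (kidx (h n) s + dk n) v - W (kidx (h n) s) v).
Let Z w := bm t w - bm s w.

Let dkE n : (kidx (h n) s + dk n)%N = kidx (h n) t.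
Proof. by rewrite /dk subnKC// kidx_mono// ltW. Qed.

Let mV n : measurable_fun setT (@V n).
Proof.
apply: measurable_rVZ; first exact: measurable_cst.
by apply: measurable_rVB; exact: measurable_noise_path.
Qed.

Let dk_cvg : (fun n => h n * (dk n)%:R) @ nU --> t - s.
Proof.
apply/cvgrPdist_le => e e0; have e2 : 0 < e / 2 by rewrite divr_gt0.
apply: filterS (filterI (kidx_cvg h0 hs s0 e2) (kidx_cvg h0 hs t0 e2)) => n /= [h1 h2].
rewrite /dk natrB; last by rewrite kidx_mono// ltW.
rewrite mulrBr; move: h1 h2; rewrite !ler_norml => /andP[? ?] /andP[? ?]; apply/andP; split; lra.
Qed.

Let dk_gt0 : nU [set n | (0 < dk n)%N].
Proof.
have ts : 0 < t - s by rewrite subr_gt0.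
have := dk_cvg; move/cvgrPdist_lt => /(_ _ ts); apply: filterS => n /=.
by case: posnP => // ->; rewrite mulr0 subr0 gtr0_norm// ltxx.
Qed.

Let kt_le : nU [set n | (kidx (h n) t <= N n)%N].
Proof.
have [n0 hn0] : exists n0 : nat, t < n0%:R by exists (Num.bound t); exact: archi_boundP.
apply: filterS (nU_ge n0) => n /= nn0.
have /andP[t1 _] := kidxP (h0 n) t0.
rewrite -(ler_nat R) -(ler_pM2l (h0 n)); apply: le_trans t1 _; apply: le_trans (hN n).
by apply: le_trans (ltW hn0) _; rewrite ler_nat.
Qed.

Let V_cvg w i : Sbounded h (fun n k => W k (w n)) -> (fun n => V (w n) ord0 i) @ nU --> Z w ord0 i.
Proof.
move=> wb.
have c u : 0 <= u -> (fun n => W (kidx (h n) u) (w n) ord0 i) @ nU --> bm u w ord0 i.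
  move=> u0; apply/cvgrPdist_le => e e0; have := spath_cvg h0 wb u0 e0.
  apply: filterS => n /= hn; rewrite distrC; apply: le_trans hn.
  by have := coord_le_enorm (W (kidx (h n) u) (w n) - bm u w) i; rewrite !mxE.
have r1 : (fun n => sg / Num.sqrt (h n * (dk n)%:R)) @ nU --> (1 : R).
  have sgn : sg != 0 by rewrite gt_eqF.
  suff : (fun n => sg / Num.sqrt (h n * (dk n)%:R)) @ nU --> sg / sg by rewrite divff.
  apply: cvgM; first exact: cvg_cst.
  apply: cvgV => //.
  have sc : Num.sqrt x @[x --> t - s] --> Num.sqrt (t - s) by exact: sqrt_continuous.
  exact: cvg_comp dk_cvg sc.
have c0 : (fun n => sg / Num.sqrt (h n * (dk n)%:R) *
    (W (kidx (h n) t) (w n) ord0 i - W (kidx (h n) s) (w n) ord0 i)) @ nU --> Z w ord0 i.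
  suff -> : Z w ord0 i = 1 * (bm t w ord0 i - bm s w ord0 i).
    by apply: cvgM => //; apply: cvgB; exact: c.
  by rewrite mul1r /Z !mxE.
apply: cvg_trans c0; apply: near_eq_cvg; apply: filterE => n; by rewrite /V dkE !mxE.
Qed.

Let Vbox (A : forall n, set ((N n).-tuple S)) (a : 'I_q -> R) k n :=
  A n `&` [set v | forall i, V v ord0 i < a i - k.+1%:R^-1].

Let gbox (a : 'I_q -> R) k := [set g : E | forall i, (sg *: g) ord0 i < a i - k.+1%:R^-1].

Let mgbox a k : measurable (gbox a k).
Proof.
have := measurable_affine 0 sg (measurable_rVbox (fun i => a i - k.+1%:R^-1)).
by under eq_set do rewrite add0r.
Qed.

Let mVbox A a k n : measurable (A n) -> measurable (@Vbox A a k n).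
Proof.
move=> mA; apply: measurableI => //.
by have := @mV n measurableT _ (measurable_rVbox (fun i => a i - k.+1%:R^-1)); rewrite setTI.
Qed.

Let Vbox_law A a k : (forall n, past (kidx (h n) s) (A n)) ->
  lp (internal (P := P) (Vbox A a k)) = (lp (internal (P := P) A) * gauss q (gbox a k))%E.
Proof.
move=> pA; have mA n : measurable (A n) by case: (pA n).
have gf : gauss q (gbox a k) \is a fin_num by exact: fin_num_measure.
transitivity ((hprob P A)%:E * (fine (gauss q (gbox a k)))%:E)%E; last by rewrite fineK// lpE.
rewrite -EFinM; apply: loeb_cvg; first by move=> n; exact: mVbox.
have c0 : (fun n => fine (pw mu (N n) (A n)) * fine (gauss q (gbox a k))) @ nU -->
    hprob P A * fine (gauss q (gbox a k)).
  by apply: cvgM; [exact: hprob_cvg|exact: cvg_cst].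
apply: cvg_trans c0; apply: near_eq_cvg.
apply: filterS (filterI kt_le dk_gt0) => n /= [kN dn].
have hd : 0 < h n * (dk n)%:R by rewrite mulr_gt0// ltr0n.
pose C := [set v : E | forall i, ((sg / Num.sqrt (h n * (dk n)%:R)) *: v) ord0 i < a i - k.+1%:R^-1].
have mC : measurable C.
  have := measurable_affine 0 (sg / Num.sqrt (h n * (dk n)%:R)) (measurable_rVbox (fun i => a i - k.+1%:R^-1)).
  by under eq_set do rewrite add0r.
have kk : (kidx (h n) s + dk n <= N n)%N by rewrite dkE.
have := noise_path_past kk (pA n) mC.
rewrite (_ : [set g | C _] = gbox a k); last first.
  by apply/seteqP; split=> g; rewrite /C/gbox/= scalerA divfK// gt_eqF// sqrtr_gt0.
move=> e; transitivity (fine (pw mu (N n) (A n) * gauss q (gbox a k))%E); last by rewrite -e.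
have pf : pw mu (N n) (A n) \is a fin_num := fin_num_measure (pw mu (N n)) _ (mA n).
by rewrite (fineM pf gf).
Qed.

(** The box for the standard part is, almost surely, the increasing union over k of internal boxes
    shrunk by 1/(k+1); on each of these past and increment factorize by [Vbox_law]. *)
Lemma increment_box A a : (forall n, past (kidx (h n) s) (A n)) ->
  lp (internal (P := P) A `&` [set w | rVbox a (Z w)]) =
  (lp (internal (P := P) A) * gauss q [set g | rVbox a (sg *: g)])%E.
Proof.
move=> pA; have mA n : measurable (A n) by case: (pA n).
have mI : measurable (internal (P := P) A : set (loeb_space P)) by exact: measurable_internal.
have mZ : measurable_fun setT Z.
  by apply: measurable_rVB; apply: (measurable_adapted _ bm_adapted).
have mB : measurable [set w | rVbox a (Z w)].
  by have := mZ measurableT _ (measurable_rVbox a); rewrite setTI.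
pose U k : set (loeb_space P) := internal (P := P) (Vbox A a k).
have mU k : measurable (U k) by apply: measurable_internal => n; exact: mVbox.
have ndU : nondecreasing_seq U.
  move=> k l kl; rewrite subsetEset; apply: internalS; apply: filterE => n v [Av hv]; split => // i.
  by apply: lt_le_trans (hv i) _; rewrite lerD2l lerN2 lef_pV2 ?posrE// ler_nat.
have ndg : nondecreasing_seq (gbox a).
  move=> k l kl; rewrite subsetEset => g hg i.
  by apply: lt_le_trans (hg i) _; rewrite lerD2l lerN2 lef_pV2 ?posrE// ler_nat.
have Ug : \bigcup_k gbox a k = [set g | rVbox a (sg *: g)].
  apply/seteqP; split=> g /=; first by move=> [k _ hk]; apply/lt_sub_inv; exists k.
  by move=> /lt_sub_inv[k hk]; exists k.
have e : lp (internal (P := P) A `&` [set w | rVbox a (Z w)]) = lp (\bigcup_k U k).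
  have hae : {ae lp, forall w : loeb_space P, (internal (P := P) A `&` [set w | rVbox a (Z w)]) w <-> (\bigcup_k U k) w}; last first.
    by apply: ae_measure_eq hae; [exact: measurableI|exact: bigcupT_measurable].
  have := ae_Sbounded; apply: (@filterS _ _ (ae_filter_ringOfSetsType lp)) => w wb; split.
    move=> [Aw /lt_sub_inv[k hk]]; exists k => //.
    have c (i : 'I_q) : nU [set n | V (w n) ord0 i < a i - k.+1%:R^-1].
      exact: (cvgr_lt _ (V_cvg (i := i) wb) _ (hk i)).
    have c' : nU [set n | forall i : 'I_q, V (w n) ord0 i < a i - k.+1%:R^-1] by exact: (@filter_forall _ _ _ nU).
    by apply: filterS (filterI Aw c') => n /= [].
  move=> [k _ hk]; split; first by apply: filterS hk => n /= [].
  apply/lt_sub_inv; exists k.+1 => i.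
  apply: (@le_lt_trans _ _ (a i - k.+1%:R^-1)); last by rewrite ltrD2l ltrN2 ltf_pV2 ?posrE// ltr_nat.
  have hi := V_cvg (i := i) wb; rewrite -(cvg_lim _ hi)//; apply: (@limr_le _ nU); first by apply: cvgP; exact: hi.
  by apply: filterS hk => n /= [_ /(_ i) /ltW].
rewrite e.
have c1 : lp \o U @ \oo --> lp (\bigcup_k U k).
  by apply: nondecreasing_cvg_mu => //; exact: bigcupT_measurable.
have c2 : gauss q \o gbox a @ \oo --> gauss q [set g | rVbox a (sg *: g)].
  by rewrite -Ug; apply: nondecreasing_cvg_mu => //; exact: bigcupT_measurable.
have c3 : lp \o U @ \oo --> (lp (internal (P := P) A) * gauss q [set g | rVbox a (sg *: g)])%E.
  rewrite (_ : lp \o U = (fun k => lp (internal (P := P) A) * (gauss q \o gbox a) k)%E); last first.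
    by apply/funext => k /=; rewrite -Vbox_law.
  by apply: cvgeZl => //; exact: fin_num_measure.
exact: cvg_unique c1 c3.
Qed.

Let mZ : measurable_fun setT Z.
Proof. by apply: measurable_rVB; apply: (measurable_adapted _ bm_adapted). Qed.

Let mZC C : measurable C -> measurable [set w | C (Z w)].
Proof. by move=> mC; have := mZ measurableT mC; rewrite setTI. Qed.

Lemma increment_past A C : (forall n, past (kidx (h n) s) (A n)) -> measurable C ->
  lp (internal (P := P) A `&` [set w | C (Z w)]) =
  (lp (internal (P := P) A) * gauss q [set g | C (sg *: g)])%E.
Proof.
move=> pA mC; have mA n : measurable (A n) by case: (pA n).
have mI : measurable (internal (P := P) A : set (loeb_space P)) by exact: measurable_internal.
have fI : lp (internal (P := P) A) \is a fin_num by exact: fin_num_measure.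
have pI : 0 <= fine (lp (internal (P := P) A)) by rewrite fine_ge0.
have ms : measurable_fun setT (fun g : E => sg *: g).
  by apply: measurable_rVZ => //; exact: measurable_id.
pose m1' : {measure set (loeb_space P) -> \bar R} := mrestr lp mI.
pose m1 : {measure set E -> \bar R} := pushforward m1' Z.
pose m2' : {measure set E -> \bar R} := pushforward (gauss q) (fun g : E => sg *: g).
pose m2 : {measure set E -> \bar R} := mscale (NngNum pI) (m2' ms).
have e1 B : m1 mZ B = lp (internal (P := P) A `&` [set w | B (Z w)]) by rewrite setIC.
have e2 B : m2 B = (lp (internal (P := P) A) * gauss q [set g | B (sg *: g)])%E.
  by rewrite /m2/= /mscale/= fineK.
rewrite -e1 -e2; apply: rVbox_measure_eq => //.
- rewrite e1 (_ : [set w | _] = setT)// setIT ltey_eq; by rewrite fI.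
- rewrite e1 e2 (_ : [set w | _] = setT)// (_ : [set g | _] = setT)// setIT.
  by rewrite probability_setT mule1.
- by move=> a; rewrite e1 e2; exact: increment_box.
Qed.

Lemma increment_law C : measurable C -> lp [set w | C (Z w)] = gauss q [set g | C (sg *: g)].
Proof.
move=> mC; have := @increment_past (fun=> setT) C _ mC.
rewrite (_ : internal _ = setT); last by apply/seteqP; split=> // w _; exact: filterT.
by rewrite setTI probability_setT mul1e; apply => n; split.
Qed.

Lemma increment_gaussian : gaussian_law lp Z sg.
Proof.
move=> C mC; transitivity (gauss q [set g : E | forall i, C i ((sg *: g) ord0 i)]).
  exact: (increment_law (measurable_rVforall mC)).
rewrite (_ : [set g | _] = [set g : E | forall i, [set x | C i (sg * x)] (g ord0 i)]); last first.
  by apply/seteqP; split=> g /= hg i; have := hg i; rewrite mxE.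
rewrite (gauss_prod (C := fun i => [set x | C i (sg * x)])); last first.
  move=> i; have mi : measurable_fun setT (fun x : measurableTypeR R => sg * x : measurableTypeR R).
    by apply: measurable_funM.
  by have := mi measurableT _ (mC i); rewrite setTI.
by apply: eq_bigr => i _; exact: normal_prob_scale.
Qed.

(** Internal events of the past are closed under intersection and generate [filt s], so
    [increment_past] extends from them by uniqueness of measures. *)
Lemma increment_indep : indep_sigma lp (sigma_of Z) (filt s).
Proof.
have hZ : sigma_of Z `<=` preimage_set_system setT Z measurable.
  apply: smallest_sub; first exact: sigma_algebra_preimage (@sigma_algebra_measurable _ E).
  move=> _ [i _ [B mB <-]]; exists [set v : E | B (v ord0 i)].
    by have := measurable_coord i measurableT mB; rewrite setTI.
  by [].
move=> _ H /hZ[C mC <-] FH; rewrite setTI.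
have fC : lp (Z @^-1` C) \is a fin_num by exact: fin_num_measure (mZC mC).
have pC : 0 <= fine (lp (Z @^-1` C)) by rewrite fine_ge0.
pose m1 : {measure set (loeb_space P) -> \bar R} := mrestr lp (mZC mC).
pose m2 : {measure set (loeb_space P) -> \bar R} := mscale (NngNum pC) lp.
have e1 B : m1 B = lp (B `&` [set w | C (Z w)]) by [].
have e2 B : m2 B = (lp (Z @^-1` C) * lp B)%E by rewrite /m2/= /mscale/= fineK.
rewrite setIC -[LHS]e1 -[RHS]e2; apply: (measure_eq_on (m1 := m1) (m2 := m2) _ _ _ _ _ FH).
- by move=> _ [A pA <-]; apply: measurable_internal => n; case: (pA n).
- move=> _ _ [A pA <-] [B pB <-]; exists (fun n => A n `&` B n); last by rewrite internalI.
  move=> n; have [mA hA] := pA n; have [mB hB] := pB n; split; first exact: measurableI.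
  by move=> v v' e [Av Bv]; split; [exact: hA Av|exact: hB Bv].
- by rewrite e1 setTI ltey_eq fC.
- by rewrite e1 e2 setTI probability_setT mule1.
- move=> _ [A pA <-]; rewrite e1 e2 increment_past// muleC; congr (_ * _)%E.
  by rewrite -increment_law.
Qed.

End Increment.

Lemma bm_brownian : brownian_motion lp filt bm.
Proof.
split.
- exact: bm_adapted.
- apply: aeW => w; apply/rowP => i; rewrite !mxE; apply: st_eq.
  under eq_fun do rewrite kidx0 /noise_path take0/= scaler0 mxE.
  exact: cvg_cst.
- have hae : {ae lp, forall w, Scontinuous h (fun n k => W k (w n)) /\ Sbounded h (fun n k => W k (w n))}.
    by apply: (@filterI _ _ (ae_filter_ringOfSetsType lp)); [exact: ae_Scontinuous|exact: ae_Sbounded].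
  by apply: (@filterS _ _ (ae_filter_ringOfSetsType lp)) hae => w [wc wb]; exact: spath_within.
- by move=> s t s0 st; exact: increment_indep.
- by move=> s t s0 st; exact: increment_gaussian.
Qed.

Section Solution.
Variables (pr : St -> E) (b c : R -> E -> E) (M K : R) (x : E).
Hypothesis mpr : measurable_fun setT pr.
Hypotheses (bl : locally_lipschitz_drift b) (cl : locally_lipschitz_drift c).
Hypotheses (bc : forall t z, 0 <= t -> enorm (b t z - c t z) <= M).
Hypotheses (K0 : 0 <= K) (mono : forall t u v, 0 <= t ->
  inner (u - v) (b t u - b t v) <= K * enorm (u - v) ^+ 2).
Hypothesis prstep : forall n i st a, pr (step n i st a) =
  pr st + h n *: cut_drift n%:R c (h n * i%:R) (pr st) + Num.sqrt (h n) *: eta n i st a.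
Hypothesis prx0 : pr x0 = x.
Hypothesis hC : forall n t y, 0 <= t -> h n * enorm (cut_drift n%:R c t y) ^+ 2 <= 1.

Definition euler_path n k (v : (N n).-tuple S) : E := pr (traj (step n) 0 x0 (take k v)).

Definition euler_limit (t : R) (w : loeb_space P) : E := spath h (fun n k => euler_path k (w n)) t.

Let euler0 n (v : (N n).-tuple S) : euler_path 0 v = x.
Proof. by rewrite /euler_path take0. Qed.

Let noise0 n (v : (N n).-tuple S) : W 0 v = 0.
Proof. by rewrite /noise_path take0 scaler0. Qed.

Let euler_rec n (v : (N n).-tuple S) k : (k < N n)%N ->
  euler_path k.+1 v = euler_path k v + h n *: cut_drift n%:R c (h n * k%:R) (euler_path k v)
    + (W k.+1 v - W k v).
Proof.
move=> kN; rewrite /euler_path /noise_path (take_nth point) ?size_tuple// -cats1.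
rewrite traj_cat nsum_cat /= add0n size_take size_tuple kN addr0.
rewrite prstep; congr (_ + _); rewrite -scalerBr; congr (_ *: _).
by apply/rowP => i; rewrite !mxE; ring.
Qed.

Lemma ae_euler_bounded : {ae lp, forall w, Sbounded h (fun n k => euler_path k (w n))}.
Proof.
have := ae_Sbounded; apply: (@filterS _ _ (ae_filter_ringOfSetsType lp)) => w wb.
exact: (Euler_bounded h0 bl bc K0 mono (fun n => euler0 (w n)) (fun n => noise0 (w n))
  (fun n => @euler_rec n (w n)) hN hC wb).
Qed.

Lemma euler_limit_adapted : adapted filt euler_limit.
Proof.
move=> t t0; apply: (@filt_row t (fun n v => euler_path (kidx (h n) t) v)).
- by move=> n; apply: (measurableT_comp mpr); exact: measurable_traj_cst.
- by move=> n v v' e; rewrite /euler_path e.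
Qed.

Theorem euler_limit_solution : sde_solution lp c x euler_limit.
Proof.
exists filt, bm.
have hae : {ae lp, forall w, Scontinuous h (fun n k => W k (w n)) /\ Sbounded h (fun n k => W k (w n))}.
  by apply: (@filterI _ _ (ae_filter_ringOfSetsType lp)); [exact: ae_Scontinuous|exact: ae_Sbounded].
split.
- exact: filtP.
- exact: bm_brownian.
- exact: euler_limit_adapted.
- apply: (@filterS _ _ (ae_filter_ringOfSetsType lp)) hae => w [wc wb].
  have Xb := Euler_bounded h0 bl bc K0 mono (fun n => euler0 (w n)) (fun n => noise0 (w n))
    (fun n => @euler_rec n (w n)) hN hC wb.
  have Xc := Euler_continuous h0 bl cl bc K0 mono (fun n => euler0 (w n)) (fun n => noise0 (w n))
    (fun n => @euler_rec n (w n)) hN hC wb wc.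
  exact: spath_within.
- apply: (@filterS _ _ (ae_filter_ringOfSetsType lp)) hae => w [wc wb] t t0 i.
  exact: (Euler_integral h0 hs bl cl bc K0 mono (fun n => euler0 (w n)) (fun n => noise0 (w n))
    (fun n => @euler_rec n (w n)) hN hC wb wc i t0).
Qed.

End Solution.

End Driven.

Lemma st_near_eq (R : realType) (u v : nat -> R) : nU [set n | u n = v n] -> st u = st v.
Proof.
move=> uv; rewrite /st; congr lim; apply/seteqP; split=> A /= h;
  by apply: filterS (filterI uv h) => n /= [e]; rewrite ?e -?e.
Qed.

Lemma nU_inv_le (R : realType) (G e : R) : 0 <= G -> 0 < e -> nU [set n | G / n.+1%:R <= e].
Proof.
move=> G0 e0; have hb := archi_boundP (divr_ge0 G0 (ltW e0)).
apply: filterS (nU_ge (Num.bound (G / e))) => n /= nn0.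
rewrite ler_pdivrMr// mulrC -ler_pdivrMr//; apply: le_trans (ltW hb) _.
by rewrite ler_nat; apply: leq_trans nn0 _.
Qed.

(** * The coupling *)

Section Decay.
Context {R : realType}.
Variables (s : nat -> R) (c eps r0 t : R) (F : nat -> R).
Local Notation h n := (s n ^+ 2).
Hypotheses (s0 : forall n, 0 < s n) (s1 : forall n, s n <= n.+1%:R^-1).
Hypotheses (c0 : 0 < c) (eps0 : 0 < eps) (r00 : 0 <= r0) (t0 : 0 < t).
Hypotheses (F01 : forall n, 0 <= F n <= 1).
Hypothesis FP : forall e, 0 < e -> nU [set n | h n * eps * (\sum_(j < kidx (h n) t) (1 - h n * c) ^+ j) * F n <=
  (1 - h n * c) ^+ kidx (h n) t * r0 + (kidx (h n) t)%:R * (h n * e)].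

Let h0 n : 0 < h n. Proof. by rewrite exprn_gt0. Qed.

Lemma h_le e : 0 < e -> nU [set n | h n <= e].
Proof.
move=> e0; apply: filterS (nU_inv_le ler01 e0) => n /=; rewrite mul1r; apply: le_trans.
apply: le_trans (s1 n); rewrite expr2 ger_pMr//; apply: le_trans (s1 n) _.
by rewrite invf_le1// ler1n.
Qed.

(** With a = 1 - hc, the geometric sum is h sum a^j = (1 - a^k)/c, and a^k is at most about v =
    e^{-ct}. The hypothesis becomes (eps/c)(1 - v) F <= v r0 up to errors, and v/(1 - v) = 1/(e^{ct}
    - 1). Errors multiplying F are absorbed by F <= 1. *)
Lemma decay_limit d : 0 < d -> nU [set n | F n <= eps^-1 * (c / (expR (c * t) - 1)) * r0 + d].
Proof.
move=> d0; pose v := expR (- (c * t)).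
have v0 : 0 < v by exact: expR_gt0.
have v1 : v < 1 by rewrite /v -expR0 ltr_expR ltrNl oppr0 mulr_gt0.
have v1' : 0 < 1 - v by rewrite subr_gt0.
have ec1 : 0 < expR (c * t) - 1 by rewrite subr_gt0 -expR0 ltr_expR mulr_gt0.
pose Q := eps / c; have Q0 : 0 < Q by rewrite divr_gt0.
(* [d1] is the tolerance before division by Q (1 - v): one half covers the rounding of t to the grid
   through [del], the other half the accumulated error t e. *)
pose d1 := d * (Q * (1 - v)); have d10 : 0 < d1 by exact: mulr_gt0 d0 (mulr_gt0 Q0 v1').
pose del := d1 / 2 / (r0 + Q); have rQ : 0 < r0 + Q by rewrite ltr_wpDl.
have del0 : 0 < del by rewrite !divr_gt0.
pose e := d1 / 2 / t; have e0 : 0 < e by rewrite !divr_gt0.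
(* For h <= eta the rounding error is controlled by e^{ch} <= 1 + del. *)
pose eta := ln (1 + del) / c.
have eta0 : 0 < eta by rewrite divr_gt0// ln_gt0// ltrDl.
have c1 : 0 < c^-1 by rewrite invr_gt0.
apply: filterS (filterI (filterI (h_le eta0) (h_le c1)) (FP e0)) => n /= [[heta hc] hF].
set a := 1 - h n * c in hF; set k := kidx (h n) t in hF.
have hn := h0 n.
have /andP[k1 k2] := kidxP hn (ltW t0); rewrite -/k in k1 k2.
have a0 : 0 <= a by rewrite subr_ge0 -ler_pdivlMr// mul1r.
have av : a ^+ k <= v * (1 + del).
  apply: (@le_trans _ _ (expR (- (h n * c)) ^+ k)).
    by rewrite lerXn2r ?nnegrE ?expR_ge0// expR_ge1Dx.
  rewrite -expRM_natl -[1 + del]lnK ?posrE ?addr_gt0// -expRD ler_expR.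
  have -> : ln (1 + del) = c * eta by rewrite /eta mulrCA divff ?mulr1// gt_eqF.
  have := ler_wpM2l (ltW c0) (ltW k2); have := ler_wpM2l (ltW c0) heta.
  rewrite mulrDr; lra.
have sumE : h n * (\sum_(j < k) a ^+ j) = (1 - a ^+ k) / c.
  have e1 := subrX1 a k; have e2 : a - 1 = - (h n * c) by rewrite /a addrAC subrr add0r.
  by rewrite -[1 - _]opprB e1 e2; field; rewrite gt_eqF.
have {}hF : Q * (1 - a ^+ k) * F n <= a ^+ k * r0 + t * e.
  apply: le_trans (_ : a ^+ k * r0 + k%:R * (h n * e) <= _); last first.
    by rewrite lerD2l mulrA ler_wpM2r ?(ltW e0)// mulrC.
  apply: le_trans hF; rewrite le_eqVlt; apply/orP; left; apply/eqP.
  transitivity (h n * (\sum_(j < k) a ^+ j) * eps * F n); last by rewrite (mulrAC (h n)).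
  by rewrite sumE /Q; field; rewrite gt_eqF.
have /andP[f0 f1] := F01 n.
have key : Q * (1 - v) * F n <= v * r0 + d1.
  have h1 : a ^+ k * (r0 + Q * F n) <= v * (1 + del) * (r0 + Q * F n).
    by rewrite ler_wpM2r// addr_ge0// mulr_ge0// ltW.
  have h2 : v * del * (r0 + Q * F n) <= del * (r0 + Q).
    apply: ler_pM.
    - by apply: mulr_ge0; exact: ltW.
    - by apply: addr_ge0 => //; apply: mulr_ge0 => //; exact: ltW.
    - by rewrite ger_pMl// ltW.
    - by rewrite lerD2l ger_pMr.
  have e1 : del * (r0 + Q) = d1 / 2 by rewrite /del divfK// gt_eqF.
  have e2 : t * e = d1 / 2 by rewrite /e mulrC divfK// gt_eqF.
  rewrite e1 in h2; rewrite e2 in hF; move: hF h1 h2; lra.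
have Qv : 0 < Q * (1 - v) by exact: mulr_gt0.
have -> : eps^-1 * (c / (expR (c * t) - 1)) * r0 + d = (v * r0 + d1) / (Q * (1 - v)).
  have ev : expR (c * t) = v^-1 by rewrite /v expRN invrK.
  by rewrite ev /d1 /Q; field; rewrite (gt_eqF eps0) (gt_eqF c0) (gt_eqF v0) (gt_eqF v1').
by rewrite ler_pdivlMr// mulrC.
Qed.

End Decay.

(** * The three-component scheme and its limit *)

Section Coupled_scheme.
Context {R : realType} {q : nat}.
Local Notation E := 'rV[R]_q.
Variables (b bt : R -> E -> E) (M : R) (kappa : R -> R) (Kl k Rk : R) (x y : E).
Hypotheses (bl : locally_lipschitz_drift b) (btl : locally_lipschitz_drift bt).
Hypotheses (M0 : 0 <= M) (bbt : forall t z, 0 <= t -> enorm (b t z - bt t z) <= M).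
Hypotheses (Kl0 : 0 <= Kl) (k0 : k < 0) (Rk0 : 0 <= Rk)
  (klip : forall a c, 0 <= a -> 0 <= c -> `|kappa a - kappa c| <= Kl * `|a - c|)
  (kk : forall r, Rk <= r -> kappa r = k).
Hypothesis mono : forall t u v, 0 <= t ->
  inner (u - v) (b t u - b t v) <= kappa (enorm (u - v)) * enorm (u - v) ^+ 2.
Local Notation K := (- k + 2 * Kl * Rk).
Variables (C beta s : nat -> R) (N : nat -> nat).
(** Bounds the distance of any two points whose coordinates are at most n in absolute value, so the
    cutoff in [rho] is inactive inside the box. *)
Local Notation D n := (2 * (q%:R * n%:R : R)).
Local Notation A n := (C n ^+ 2).
Local Notation h n := (s n ^+ 2).
Local Notation cb n := (cut_drift n%:R b).
Local Notation cbt n := (cut_drift n%:R bt).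
Hypotheses (C0 : forall n, 0 <= C n)
  (cbL : forall n t u v, 0 <= t -> enorm (cb n t u - cb n t v) <= C n * enorm (u - v))
  (cbtL : forall n t u v, 0 <= t -> enorm (cbt n t u - cbt n t v) <= C n * enorm (u - v))
  (cbB : forall n t u, 0 <= t -> enorm (cb n t u) <= C n)
  (cbtB : forall n t u, 0 <= t -> enorm (cbt n t u) <= C n).
Hypotheses (b1 : forall n, 1 <= beta n) (Db : forall n, D n <= beta n) (ADb : forall n, A n * D n <= beta n).
Hypotheses (s0 : forall n, 0 < s n) (s1 : forall n, s n <= n.+1%:R^-1) (sK : forall n, h n * K <= 1)
  (sb : forall n, s n * beta n ^+ 3 <= n.+1%:R^-1) (hA : forall n, h n * A n <= 1).
Hypothesis hN : forall n, n%:R <= h n * (N n)%:R.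

Let h0 n : 0 < h n. Proof. by rewrite exprn_gt0. Qed.
Let hs e : 0 < e -> nU [set n | h n <= e]. Proof. exact: (h_le s0 s1). Qed.
Let t0 n i : 0 <= h n * i%:R. Proof. by rewrite mulr_ge0// ltW. Qed.
Let D0 n : 0 <= D n. Proof. by rewrite !mulr_ge0. Qed.
Let A0 n : 0 <= A n. Proof. exact: sqr_ge0. Qed.
Let K0 : 0 <= K. Proof. exact: kr_lipC. Qed.
Let hE n : Num.sqrt (h n) = s n. Proof. by rewrite sqrtr_sqr gtr0_norm. Qed.
Let s1' n : s n <= 1. Proof. by apply: le_trans (s1 n) _; rewrite invf_le1// ler1n. Qed.

(* States are triples (x, (z, y)): the component z follows the drift [b] from the
   starting point of y, and both x and y are coupled to z by reflection. *)
Let St : Type := (E * (E * E))%type.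
Local Notation nz := (@noise R q).

Let px (w : St) : E := w.1.
Let pz (w : St) : E := w.2.1.
Let py (w : St) : E := w.2.2.
Let dx n i (w : St) : E := px w + h n *: cb n (h n * i%:R) (px w).
Let dz n i (w : St) : E := pz w + h n *: cb n (h n * i%:R) (pz w).
Let dy n i (w : St) : E := py w + h n *: cbt n (h n * i%:R) (py w).
Let ex n i (w : St) (a : nz) : E := rmap (- ((s n)^-1 *: (dx n i w - dz n i w))) a.1 a.2.1.
Let ey n i (w : St) (a : nz) : E := rmap (- ((s n)^-1 *: (dy n i w - dz n i w))) a.1 a.2.2.
Let ez (n i : nat) (w : St) (a : nz) : E := a.1.
Let step n i (w : St) (a : nz) : St :=
  (dx n i w + s n *: ex n i w a, (dz n i w + s n *: ez n i w a, dy n i w + s n *: ey n i w a)).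

Let mpx : measurable_fun [set: E * (E * E)] (px : E * (E * E) -> E). Proof. exact: measurable_fst. Qed.
Let mpz : measurable_fun [set: E * (E * E)] (pz : E * (E * E) -> E).
Proof. by apply: (measurableT_comp measurable_fst) measurable_snd. Qed.
Let mpy : measurable_fun [set: E * (E * E)] (py : E * (E * E) -> E).
Proof. by apply: (measurableT_comp measurable_snd) measurable_snd. Qed.

Let mdrift (c : nat -> R -> E -> E) (p : E * (E * E) -> E) n i :
  (forall n t u v, 0 <= t -> enorm (c n t u - c n t v) <= C n * enorm (u - v)) ->
  measurable_fun setT p -> measurable_fun setT (fun w => p w + h n *: c n (h n * i%:R) (p w)).
Proof.
move=> cL mp; apply: measurable_rVD => //; apply: measurable_rVZ => //.
by apply: (measurableT_comp _ mp); apply: measurable_lip => u v; exact: cL.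
Qed.

Let mdx n i : measurable_fun [set: E * (E * E)] (dx n i : E * (E * E) -> E).
Proof. exact: (@mdrift (fun n => cb n) px n i cbL mpx). Qed.
Let mdz n i : measurable_fun [set: E * (E * E)] (dz n i : E * (E * E) -> E).
Proof. exact: (@mdrift (fun n => cb n) pz n i cbL mpz). Qed.
Let mdy n i : measurable_fun [set: E * (E * E)] (dy n i : E * (E * E) -> E).
Proof. exact: (@mdrift (fun n => cbt n) py n i cbtL mpy). Qed.

Let mrm (d : E * (E * E) -> E) (u : nz -> R) n : measurable_fun setT d -> measurable_fun setT u ->
  measurable_fun setT (fun p : (E * (E * E)) * nz => rmap (- ((s n)^-1 *: d p.1)) p.2.1 (u p.2)).
Proof.
move=> md mu; apply: measurable_rmap.
- by apply: measurable_rVN; apply: measurable_rVZ => //; apply: (measurableT_comp md).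
- by apply: (measurableT_comp measurable_fst) measurable_snd.
- by apply: (measurableT_comp mu) measurable_snd.
Qed.

Let mu1 : measurable_fun [set: nz] (fun a : nz => a.2.1 : R).
Proof. by apply: (measurableT_comp measurable_fst) measurable_snd. Qed.
Let mu2 : measurable_fun [set: nz] (fun a : nz => a.2.2 : R).
Proof. by apply: (measurableT_comp measurable_snd) measurable_snd. Qed.

Let mex n i : measurable_fun setT (fun p : (E * (E * E)) * nz => ex n i p.1 p.2).
Proof. exact: (@mrm (fun w => dx n i w - dz n i w) _ n (measurable_rVB (mdx n i) (mdz n i)) mu1). Qed.
Let mey n i : measurable_fun setT (fun p : (E * (E * E)) * nz => ey n i p.1 p.2).
Proof. exact: (@mrm (fun w => dy n i w - dz n i w) _ n (measurable_rVB (mdy n i) (mdz n i)) mu2). Qed.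
Let mez n i : measurable_fun setT (fun p : (E * (E * E)) * nz => ez n i p.1 p.2).
Proof. by apply: (measurableT_comp measurable_fst) measurable_snd. Qed.

Let mstep n i : measurable_fun setT (fun p : (E * (E * E)) * nz => step n i p.1 p.2 : E * (E * E)).
Proof.
have m1 (d : E * (E * E) -> E) (e : (E * (E * E)) * nz -> E) : measurable_fun setT d -> measurable_fun setT e ->
    measurable_fun setT (fun p => d p.1 + s n *: e p).
  by move=> md me; apply: measurable_rVD; [apply: (measurableT_comp md)|apply: measurable_rVZ].
by apply/measurable_fun_pairP; split; [apply: m1|apply/measurable_fun_pairP; split; apply: m1].
Qed.

Let u1_law (f : E * R -> \bar R) : measurable_fun setT f -> (forall p, 0 <= f p)%E ->
  (\int[noise_law (q := q)]_a f (a.1, a.2.1) = \int[gauss q]_g \int[unif]_u f (g, u))%E.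
Proof. exact: noise_int1. Qed.
Let u2_law (f : E * R -> \bar R) : measurable_fun setT f -> (forall p, 0 <= f p)%E ->
  (\int[noise_law (q := q)]_a f (a.1, a.2.2) = \int[gauss q]_g \int[unif]_u f (g, u))%E.
Proof. exact: noise_int2. Qed.

Let rm_law (v : E) (u : nz -> R) (f : E -> \bar R) :
  (forall f : E * R -> \bar R, measurable_fun setT f -> (forall p, 0 <= f p)%E ->
    (\int[noise_law (q := q)]_a f (a.1, u a) = \int[gauss q]_g \int[unif]_u f (g, u))%E) ->
  measurable_fun setT f -> (forall g, 0 <= f g)%E ->
  (\int[noise_law (q := q)]_a f (rmap v a.1 (u a)) = \int[gauss q]_g f g)%E.
Proof.
move=> ul mf f0; rewrite -(rmap_law v mf f0).
apply: (ul (fun p => f (rmap v p.1 p.2))) => //.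
by apply: (measurableT_comp mf); apply: measurable_rmap.
Qed.

Let ex_law n i w (f : E -> \bar R) : measurable_fun setT f -> (forall g, 0 <= f g)%E ->
  (\int[noise_law (q := q)]_a f (ex n i w a) = \int[gauss q]_g f g)%E.
Proof. exact: rm_law u1_law. Qed.
Let ey_law n i w (f : E -> \bar R) : measurable_fun setT f -> (forall g, 0 <= f g)%E ->
  (\int[noise_law (q := q)]_a f (ey n i w a) = \int[gauss q]_g f g)%E.
Proof. exact: rm_law u2_law. Qed.
Let ez_law n i w (f : E -> \bar R) : measurable_fun setT f -> (forall g, 0 <= f g)%E ->
  (\int[noise_law (q := q)]_a f (ez n i w a) = \int[gauss q]_g f g)%E.
Proof.
move=> mf f0; have := @u1_law (fun p => f p.1); rewrite /= => -> //.
  by apply: eq_integral => g _; rewrite integral_prob_cst.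
by apply: (measurableT_comp mf); exact: measurable_fst.
Qed.

Let st0 : E * (E * E) := (x, (y, y)).
Local Notation P := (fun n => pw (noise_law (q := q)) (N n)).
Local Notation lp := (loeb P).

Let KM0 : 0 <= Kl * Rk. Proof. exact: mulr_ge0. Qed.

Let kappa_le r : 0 <= r -> kappa r <= Kl * Rk.
Proof.
move=> r0; have [rR|/ltW rR] := leP Rk r; first by rewrite kk// (le_trans (ltW k0)).
have := klip r0 Rk0; rewrite (kk (lexx Rk)) [`|r - Rk|]distrC (ger0_norm (x := Rk - r)) ?subr_ge0// ler_norml => /andP[_].
have : Kl * (Rk - r) <= Kl * Rk by rewrite ler_wpM2l// lerBlDr lerDl.
move: k0; lra.
Qed.

Let mono' t u v : 0 <= t -> inner (u - v) (b t u - b t v) <= Kl * Rk * enorm (u - v) ^+ 2.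
Proof.
move=> h1; apply: le_trans (mono _ _ h1) _.
by rewrite ler_wpM2r ?sqr_ge0// kappa_le// enorm_ge0.
Qed.

Let bb t z : 0 <= t -> enorm (b t z - b t z) <= 0.
Proof. by rewrite subrr enorm0. Qed.

Let hCb n t u : 0 <= t -> h n * enorm (cb n t u) ^+ 2 <= 1.
Proof.
move=> h1; apply: le_trans (hA n); rewrite ler_wpM2l ?sqr_ge0// lerXn2r ?nnegrE ?enorm_ge0//.
exact: cbB.
Qed.

Let hCbt n t u : 0 <= t -> h n * enorm (cbt n t u) ^+ 2 <= 1.
Proof.
move=> h1; apply: le_trans (hA n); rewrite ler_wpM2l ?sqr_ge0// lerXn2r ?nnegrE ?enorm_ge0//.
exact: cbtB.
Qed.

Let X := euler_limit (mu := noise_law (q := q)) (N := N) (fun n => h n) step st0 px.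
Let Y := euler_limit (mu := noise_law (q := q)) (N := N) (fun n => h n) step st0 py.

Let X_sol : sde_solution lp b x X.
Proof.
apply: (@euler_limit_solution R _ nz (noise_law (q := q)) _ (E * (E * E))%type q N (fun n => h n) step ex st0 mstep mex ex_law
  h0 hs hN px b b 0 (Kl * Rk) x mpx bl bl bb KM0 mono') => //.
by move=> n i w a; rewrite hE.
Qed.

Let Y_sol : sde_solution lp bt y Y.
Proof.
apply: (@euler_limit_solution R _ nz (noise_law (q := q)) _ (E * (E * E))%type q N (fun n => h n) step ey st0 mstep mey ey_law
  h0 hs hN py b bt M (Kl * Rk) y mpy bl btl bbt KM0 mono') => //.
by move=> n i w a; rewrite hE.
Qed.

Let path (p : E * (E * E) -> E) n k (v : (N n).-tuple nz) : E := p (traj (step n) 0 st0 (take k v)).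
Let bounded p := {ae lp, forall w, Sbounded (fun n => h n) (fun n k => path p k (w n))}.

Let X_bounded : bounded px.
Proof.
apply: (@ae_euler_bounded R _ nz (noise_law (q := q)) _ (E * (E * E))%type q N (fun n => h n) step ex st0 mstep mex ex_law
  h0 hN px b b 0 (Kl * Rk) x bl bb KM0 mono') => //.
by move=> n i w a; rewrite hE.
Qed.

Let Z_bounded : bounded pz.
Proof.
apply: (@ae_euler_bounded R _ nz (noise_law (q := q)) _ (E * (E * E))%type q N (fun n => h n) step ez st0 mstep mez ez_law
  h0 hN pz b b 0 (Kl * Rk) y bl bb KM0 mono') => //.
by move=> n i w a; rewrite hE.
Qed.

Let Y_bounded : bounded py.
Proof.
apply: (@ae_euler_bounded R _ nz (noise_law (q := q)) _ (E * (E * E))%type q N (fun n => h n) step ey st0 mstep mey ey_law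
  h0 hN py b bt M (Kl * Rk) y bl bbt KM0 mono') => //.
by move=> n i w a; rewrite hE.
Qed.

Let box n : set E := [set v | forall i, `|v ord0 i| <= n%:R].

Let mbox n : measurable (box n).
Proof.
have := @measurable_rVforall R q (fun=> `[- n%:R, n%:R]%classic) (fun _ => measurable_itv _).
by congr measurable; apply/seteqP; split=> v /= hv i; have := hv i; rewrite /= in_itv/= ler_norml.
Qed.

Let differ (p : E * (E * E) -> E) t n := [set v : (N n).-tuple nz |
  0 < enorm (path p (kidx (h n) t) v - path pz (kidx (h n) t) v)].

Let mpath (p : E * (E * E) -> E) n j : measurable_fun setT p -> measurable_fun setT (@path p n j).
Proof. by move=> mp; apply: (measurableT_comp mp); exact: measurable_traj_cst. Qed.

Let mdiffer p t n : measurable_fun setT p -> measurable (@differ p t n).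
Proof.
move=> mp; have m1 : measurable_fun setT (fun v : (N n).-tuple nz =>
    enorm (path p (kidx (h n) t) v - path pz (kidx (h n) t) v)).
  by apply: measurable_enorm; apply: measurable_rVB; exact: mpath.
have := m1 measurableT _ (measurable_itv `]0, +oo[); rewrite setTI.
by congr measurable; apply/seteqP; split=> w; rewrite /= in_itv/= andbT.
Qed.

Let kidx_le t : 0 <= t -> nU [set n | (kidx (h n) t <= N n)%N].
Proof.
move=> t0'; have [n0 hn0] : exists n0 : nat, t < n0%:R by exists (Num.bound t); exact: archi_boundP.
apply: filterS (nU_ge n0) => n /= nn0.
have /andP[t1 _] := kidxP (h0 n) t0'.
rewrite -(ler_nat R) -(ler_pM2l (h0 n)); apply: le_trans t1 _; apply: le_trans (hN n).
by apply: le_trans (ltW hn0) _; rewrite ler_nat.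
Qed.

(** Almost every path is bounded up to time t, hence stays in the box of side n for [nU]-almost
    every n; up to a null set the two components can then differ only on the event treated by
    [apart_le]. *)
Let differ_le p p' u g t c : 0 <= t -> measurable_fun setT p -> bounded p ->
  (forall f : E * R -> \bar R, measurable_fun setT f -> (forall p, 0 <= f p)%E ->
    (\int[noise_law (q := q)]_a f (a.1, u a) = \int[gauss q]_g \int[unif]_u f (g, u))%E) ->
  (forall n i w a, p (step n i w a) - pz (step n i w a) = (p' n i w - dz n i w)
    + s n *: (rmap (- ((s n)^-1 *: (p' n i w - dz n i w))) a.1 (u a) - a.1)) ->
  (forall a b, 0 <= a -> 0 <= b -> `|g a - g b| <= K * `|a - b|) -> 0 <= g 0 ->
  (forall n i w, box n (p w) -> box n (pz w) ->
    enorm (p' n i w - dz n i w) <= rho g (s n) (D n) (A n) (enorm (p w - pz w))) ->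
  nU [set n | surv g (s n) (D n) (A n) (kidx (h n) t) (enorm (p st0 - pz st0)) <= c] ->
  (lp (internal (P := P) (differ p t)) <= c%:E)%E.
Proof.
move=> t0' mp pb ul pstep gK g0 pdrift hc.
pose ap n : set ((N n).-tuple nz) := apart (n := N n) (step n) p pz (box n) (kidx (h n) t) 0 st0.
have map n : measurable (ap n) by exact: measurable_apart.
apply: (@le_trans _ _ (lp (internal (P := P) ap))).
  have hae : {ae lp, forall w : loeb_space P, internal (P := P) (differ p t) w -> internal (P := P) ap w}; last first.
    apply: ae_measure_le hae; last exact: measurable_internal.
    by apply: measurable_internal => n; exact: mdiffer.
  have hB : {ae lp, forall w, Sbounded (fun n => h n) (fun n k => path p k (w n)) /\
      Sbounded (fun n => h n) (fun n k => path pz k (w n))}.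
    by apply: (@filterI _ _ (ae_filter_ringOfSetsType lp)); [exact: pb|exact: Z_bounded].
  apply: (@filterS _ _ (ae_filter_ringOfSetsType lp)) hB => w [/(_ t)[B1 h1] /(_ t)[B2 h2]] hw.
  have hn : nU [set n | B1 <= n%:R /\ B2 <= n%:R].
    pose W := Num.max (Num.max B1 B2) 0.
    have W0 : 0 <= W by rewrite le_max lexx orbT.
    apply: filterS (nU_ge (Num.bound W)) => n /= Wn.
    have {}Wn : W <= n%:R by apply: le_trans (ltW (archi_boundP W0)) _; rewrite ler_nat.
    by split; apply: le_trans Wn; rewrite !le_max lexx ?orbT.
  apply: filterS (filterI hw (filterI (filterI h1 h2) hn)) => n /= [dn [[b1' b2'] [B1n B2n]]].
  split => // j jk; have jt : h n * j%:R <= t.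
    have /andP[kt _] := kidxP (h0 n) t0'; apply: le_trans kt.
    by rewrite ler_pM2l// ler_nat ltnW.
  split=> i; apply: le_trans (coord_le_enorm _ _) _.
    by apply: le_trans (b1' j jt) B1n.
  by apply: le_trans (b2' j jt) B2n.
apply: loeb_le => //; apply: filterS (filterI hc (kidx_le t0')) => n /= [hcn kN].
apply: le_trans (apart_le gK g0 (s0 n) (sK n) (D0 n) (A0 n) (Db n) (@mstep n) mp mpz ul (@pstep n) (@mbox n) (@pdrift n) _ _ kN) _.
by rewrite lee_fin.
Qed.

Let kapK r r' : 0 <= r -> 0 <= r' -> `|kappa r * r - kappa r' * r'| <= K * `|r - r'|.
Proof. by move=> r0 r0'; have := kr_lip Kl0 k0 Rk0 klip kk r0 r0'; rewrite !krE. Qed.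

Let drift_le (c : nat -> R -> E -> E) (Mc : R) n i (a z : E) : 0 <= Mc ->
  (forall t v, 0 <= t -> enorm (c n t v - cb n t v) <= Mc) -> box n a -> box n z ->
  enorm (a + h n *: c n (h n * i%:R) a - (z + h n *: cb n (h n * i%:R) z)) <=
  rho (fun r => Mc + kr kappa r) (s n) (D n) (A n) (enorm (a - z)).
Proof.
move=> Mc0 cM ba bz; set r := enorm (a - z); have r0 : 0 <= r by exact: enorm_ge0.
have rD : r <= D n.
  apply: le_trans (enorm_le_sum _) _; rewrite mulrCA.
  have -> : q%:R * (2 * n%:R) = \sum_(j < q) (2 * n%:R) :> R by rewrite sumr_const card_ord mulr_natl.
  apply: ler_sum => j _; rewrite !mxE; apply: le_trans (ler_normB _ _) _.
  by have := ba j; have := bz j; lra.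
have tn : 0 <= Num.min (h n * i%:R) n%:R by rewrite le_min t0//=.
have ca (v : E) : box n v -> cb n (h n * i%:R) v = b (Num.min (h n * i%:R) n%:R) v.
  by move=> bv; rewrite /cut_drift clamp_id.
have m1 : inner (a - z) (cb n (h n * i%:R) a - cb n (h n * i%:R) z) <= kappa r * r ^+ 2.
  by rewrite !ca//; exact: mono.
have := @drift_rho R q (cb n (h n * i%:R)) (c n (h n * i%:R)) kappa K (C n) (h n) Mc a z (ltW (h0 n)) Mc0 K0 (sK n)
  kapK m1 (@cbL n _ _ _ (t0 n i)) (cM _ _ (t0 n i)).
rewrite /rho pos_part_id// (min_idPl rD) krE// -exprM; exact.
Qed.

Local Notation g0x := (fun r => 0 + kr kappa r).
Local Notation gMx := (fun r => M + kr kappa r).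

Let g_lip m a c : 0 <= a -> 0 <= c -> `|(m + kr kappa a) - (m + kr kappa c)| <= K * `|a - c|.
Proof. by move=> a0 c0; rewrite opprD addrACA subrr add0r; exact: kr_lip. Qed.

Let kr0 : kr kappa 0 = 0.
Proof. by rewrite krE// mulr0. Qed.

Let g_bd m n r : 0 <= m -> 0 <= r -> r <= beta n -> `|m + kr kappa r| <= (m + K) * beta n.
Proof.
move=> m0 r0 rb; have := kr_lip Kl0 k0 Rk0 klip kk r0 (lexx 0); rewrite kr0 !subr0 (ger0_norm r0) => h1.
apply: le_trans (ler_normD _ _) _; rewrite (ger0_norm m0) mulrDl; apply: lerD.
  by rewrite ler_peMr.
by apply: le_trans h1 _; rewrite ler_wpM2l.
Qed.

(** X and Z have the same drift, so the chain has no push at 0 and [surv_decay] applies. The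
    supersolution and its constant [G] depend on the tolerance e, which is fixed before n grows; the
    half e/2 pays for [G] s beta^3. *)
Let xz_le t d : 0 < t -> 0 < d ->
  (lp (internal (P := P) (differ px t)) <=
   ((epst kappa)^-1 * (ct kappa / (expR (ct kappa * t) - 1)) * enorm (x - y) + d)%:E)%E.
Proof.
move=> t0' d0.
have [_ [_ [_ [_ [_ _ _ c0 e0]]]]] := decay_supersolution Kl0 k0 Rk0 klip kk ltr01.
have g00 : 0 <= g0x 0 by rewrite kr0 addr0.
have sP n := survP (@g_lip 0) g00 (s0 n) (sK n) (D0 n) (A0 n) (Db n) (kidx (h n) t).
apply: (@differ_le px dx _ g0x _ _ (ltW t0') mpx X_bounded u1_law _ (@g_lip 0) g00).
- by move=> n i w a; rewrite /step/px/pz/=/ex/ez; apply/rowP => j; rewrite !mxE; ring.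
- by move=> n i w bx bz; apply: (drift_le (c := fun n => cb n)) => // t' v _; rewrite subrr enorm0.
apply: (decay_limit s0 s1 c0 e0 (enorm_ge0 _) t0') d0 => [n|e e1]; first by case: (sP n).
have e2 : 0 < e / 2 by rewrite divr_gt0.
have [f [w [q' [L [S q0 fx _ _]]]]] := decay_supersolution Kl0 k0 Rk0 klip kk e2.
have B0 : 0 <= 0 + K by rewrite add0r.
have [G G0 hG] := supersolution_step S B0.
have c1 : 0 < (ct kappa)^-1 by rewrite invr_gt0.
apply: filterS (filterI (nU_inv_le G0 e2) (hs c1)) => n /= [hGn hcn].
have a0 : 0 <= 1 - h n * ct kappa by rewrite subr_ge0 -ler_pdivlMr// mul1r.
have a1 : 1 - h n * ct kappa <= 1 by rewrite lerBlDr lerDl mulr_ge0// ltW.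
have g0E : g0x 0 = 0 by rewrite kr0 addr0.
have := @surv_decay R g0x K (s n) (D n) (A n) (beta n) (@g_lip 0) g00 (s0 n) (sK n) (D0 n) (A0 n) (b1 n) (Db n) (ADb n)
  _ _ _ _ _ _ S (0 + K) G (fun r r0 rb => g_bd (lexx 0) r0 rb)
  (fun r e r0 rb e0 eb gb h => hG (s n) (beta n) r e (s0 n) (s1' n) (b1 n) r0 rb e0 eb gb h) a0 (ltW e2) G0
  (kidx (h n) t) (enorm (x - y)) (enorm_ge0 _) g0E a1.
rewrite q0 => hh; apply: le_trans hh _; apply: lerD.
  by rewrite ler_wpM2l ?exprn_ge0// fx// enorm_ge0.
rewrite ler_wpM2l// ler_wpM2l ?(ltW (h0 n))//.
rewrite [leRHS](splitr e); apply: lerD => //; apply: le_trans hGn.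
by rewrite ler_wpM2l.
Qed.

(** Z starts at y, so the dominating chain starts at 0 and [surv0_le] gives a bound that is uniform
    in time. *)
Let yz_le t d : 0 <= t -> 0 < d ->
  (lp (internal (P := P) (differ py t)) <= sticky_pi kappa M `]0%R, +oo[ + d%:E)%E.
Proof.
move=> t0' d0; have d2 : 0 < d / 2 by rewrite divr_gt0.
have [p [f [w [q' [L [p0 pp S q0]]]]]] := sticky_pi_supersolution Kl0 k0 Rk0 klip kk M0 d2.
have B0 : 0 <= M + K by rewrite addr_ge0.
have [G G0 hG] := supersolution_step S B0.
have gM0 : 0 <= gMx 0 by rewrite kr0 addr0.
apply: (@le_trans _ _ (p + d / 2)%:E); last first.
  by rewrite [in leRHS](splitr d) EFinD [X in (_ <= _ + X)%E]EFinD addeA leeD2r.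
apply: (@differ_le py dy _ gMx _ _ t0' mpy Y_bounded u2_law _ (@g_lip M) gM0).
- by move=> n i w' a; rewrite /step/py/pz/=/ey/ez; apply/rowP => j; rewrite !mxE; ring.
- move=> n i w' bx bz; apply: (drift_le (c := fun n => cbt n)) => // t' v t'0.
  by rewrite /cut_drift -enormN opprB; apply: bbt; rewrite le_min t'0/=.
apply: filterS (nU_inv_le G0 d2) => n /= hGn.
rewrite /py/pz/= subrr enorm0.
have a0 : 0 <= 1 - h n * 0 by rewrite mulr0 subr0.
apply: le_trans (@surv0_le R gMx K (s n) (D n) (A n) (beta n) (@g_lip M) gM0 (s0 n) (sK n) (D0 n) (A0 n) (b1 n) (Db n) (ADb n)
  _ _ _ _ _ _ S (M + K) G (fun r r0 rb => g_bd M0 r0 rb)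
  (fun r e r0 rb e0 eb gb h => hG (s n) (beta n) r e (s0 n) (s1' n) (b1 n) r0 rb e0 eb gb h) a0 p0 G0
  (kidx (h n) t) erefl q0) _.
rewrite lerD2l; apply: le_trans hGn; rewrite ler_wpM2l//.
Qed.

Let measurable_ne t : 0 <= t -> measurable [set w : loeb_space P | X t w != Y t w].
Proof.
move=> t0'; have [FX [BX [fX _ aX _ _]]] := X_sol; have [FY [BY [fY _ aY _ _]]] := Y_sol.
have mX F (Z : R -> loeb_space P -> E) : is_filtration F -> adapted F Z -> measurable_fun setT (Z t).
  move=> [/(_ t t0')[_ Fm] _] aZ; apply/measurable_rVP => i _ B mB; rewrite setTI.
  by apply: Fm; apply: (aZ t t0'); apply: sub_sigma_algebra; exists i => //; exists B => //; rewrite setTI.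
have m1 : measurable_fun setT (fun w : loeb_space P => enorm (X t w - Y t w)).
  by apply: measurable_enorm; apply: measurable_rVB; [exact: mX fX aX|exact: mX fY aY].
have := m1 measurableT _ (measurable_itv `]0, +oo[); rewrite setTI.
by congr measurable; apply/seteqP; split=> w; rewrite /= in_itv/= andbT lt_def enorm_ge0 andbT enorm_eq0 subr_eq0.
Qed.

(** If both components agree with Z at almost every index, they agree with each other there and have
    the same standard part. *)
Let ne_differ t : [set w : loeb_space P | X t w != Y t w] `<=`
  internal (P := P) (differ px t) `|` internal (P := P) (differ py t).
Proof.
move=> w /= XY; apply: contrapT => /not_orP[/nU_notin h1 /nU_notin h2].
move/eqP : XY; apply; apply/rowP => i; rewrite !mxE; apply: st_near_eq.
apply: filterS (filterI h1 h2) => n /= [/negP]; rewrite lt_def enorm_ge0 andbT negbK enorm_eq0 subr_eq0 => /eqP e1.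
move=> /negP; rewrite lt_def enorm_ge0 andbT negbK enorm_eq0 subr_eq0 => /eqP e2.
by move: e1; rewrite -e2 /path/euler_path => ->.
Qed.

Let sticky_pi_ge0 : (0 <= sticky_pi kappa M `]0%R, +oo[)%E.
Proof.
apply/lee_addgt0Pr => e e0.
have [p [f [w [q' [L [p0 pp _ _]]]]]] := sticky_pi_supersolution Kl0 k0 Rk0 klip kk M0 e0.
by apply: le_trans pp; rewrite lee_fin.
Qed.

Let coupling_le t : 0 <= t -> (lp [set w | X t w != Y t w] <= coupling_bound kappa M x y t)%E.
Proof.
move=> t0'; rewrite /coupling_bound; case: ifPn => [_|/nandP h]; first exact: leey.
(* At time 0 with x = y the schemes start at the same point, so the event is empty. *)
have [tE|t1] := eqVneq t 0.
  have /eqP xy : x == y by move: h; rewrite tE eqxx/= => -[//|]; rewrite negbK.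
  rewrite (_ : [set w | _] = set0) ?measure0.
    by rewrite tE -xy subrr enorm0 mulr0 add0e.
  apply/seteqP; split=> w //=; rewrite tE => /eqP; apply; apply/rowP => i; rewrite !mxE.
  by congr st; apply/funext => n; rewrite kidx0 /euler_path take0/= /px/py/= xy.
have {}t1 : 0 < t by rewrite lt_def t1.
have mI p : measurable_fun setT p -> measurable (internal (P := P) (differ p t) : set (loeb_space P)).
  by move=> mp; apply: measurable_internal => n; exact: mdiffer.
apply/lee_addgt0Pr => e e0; have e2 : 0 < e / 2 by rewrite divr_gt0.
apply: (@le_trans _ _ (lp (internal (P := P) (differ px t)) + lp (internal (P := P) (differ py t)))%E).
  apply: (@le_trans _ _ (lp (internal (P := P) (differ px t) `|` internal (P := P) (differ py t)))).
    2: exact: measureU2 (mI _ mpx) (mI _ mpy).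
  apply: le_measure; rewrite ?inE.
  - exact: measurable_ne.
  - by apply: measurableU; exact: mI.
  - exact: ne_differ.
apply: le_trans (leeD (xz_le t1 e2) (yz_le t0' e2)) _.
by rewrite EFinD addeACA -EFinD -splitr.
Qed.

Lemma coupled_solutions : exists (disp : measure_display) (Omega : measurableType disp)
  (P : probability Omega R) (X Y : R -> Omega -> 'rV[R]_q),
    [/\ sde_solution P b x X, sde_solution P bt y Y &
        forall t : R, 0 <= t -> (P [set w | X t w != Y t w] <= coupling_bound kappa M x y t)%E].
Proof. by exists _, (loeb_space P), lp, X, Y; split; [exact: X_sol|exact: Y_sol|exact: coupling_le]. Qed.

End Coupled_scheme.

Theorem theorem2 (R : realType) (d : nat) (b bt : R -> 'rV[R]_d -> 'rV[R]_d)
    (M : R) (kappa : R -> R) (x y : 'rV[R]_d) :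
  locally_lipschitz_drift b -> locally_lipschitz_drift bt ->
  0 <= M ->
  (forall (t : R) (z : 'rV[R]_d), 0 <= t -> enorm (b t z - bt t z) <= M) ->
  [lipschitz (kappa : R^o -> R^o) r | r in `[0, +oo[%classic] ->
  (exists2 k : R, k < 0 & \forall r \near +oo, kappa r = k) ->
  (forall (t : R) (u v : 'rV[R]_d), 0 <= t ->
     inner (u - v) (b t u - b t v) <= kappa (enorm (u - v)) * enorm (u - v) ^+ 2) ->
  exists (disp : measure_display) (Omega : measurableType disp)
         (P : probability Omega R) (X Y : R -> Omega -> 'rV[R]_d),
    [/\ sde_solution P b x X,
        sde_solution P bt y Y &
        forall t : R, 0 <= t ->
          (P [set w | X t w != Y t w] <= coupling_bound kappa M x y t)%E].
Proof.
move=> bl btl M0 bbt klip [k k0 kk] mono.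
have [Kl Kl0 {}klip] : exists2 Kl, 0 <= Kl & forall a c, 0 <= a -> 0 <= c -> `|kappa a - kappa c| <= Kl * `|a - c|.
  have [Kl [Kl0 hKl]] := pinfty_ex_gt0 klip; exists Kl; first exact: ltW.
  by move=> a c a0 c0; apply: (hKl (a, c)); rewrite /= !in_itv/= a0 c0.
have [Rk Rk0 {}kk] : exists2 Rk, 0 <= Rk & forall r, Rk <= r -> kappa r = k.
  (* Neighbourhoods of infinity are given by a strict inequality, hence the + 1. *)
  move: kk => [r0 [_ hr]]; exists (Num.max (r0 + 1) 0); first by rewrite le_max lexx orbT.
  by move=> r; rewrite ge_max => /andP[rr _]; apply: hr; apply: lt_le_trans rr; rewrite ltrDl.
have hC' (n : nat) : exists c : R, [/\ 0 <= c,
    forall t u v, 0 <= t -> enorm (cut_drift n%:R b t u - cut_drift n%:R b t v) <= c * enorm (u - v),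
    forall t u v, 0 <= t -> enorm (cut_drift n%:R bt t u - cut_drift n%:R bt t v) <= c * enorm (u - v),
    forall t u, 0 <= t -> enorm (cut_drift n%:R b t u) <= c &
    forall t u, 0 <= t -> enorm (cut_drift n%:R bt t u) <= c].
  have n0 : 0 <= n%:R :> R by [].
  have [L L0 [h1 h2]] := cut_driftP bl n0; have [L' L'0 [h3 h4]] := cut_driftP btl n0.
  exists (L + L'); split => [|t u v t0|t u v t0|t u t0|t u t0].
  - exact: addr_ge0.
  - by apply: le_trans (h1 _ _ _ t0) _; rewrite ler_wpM2r ?enorm_ge0// lerDl.
  - by apply: le_trans (h3 _ _ _ t0) _; rewrite ler_wpM2r ?enorm_ge0// lerDr.
  - by apply: le_trans (h2 _ _ t0) _; rewrite lerDl.
  - by apply: le_trans (h4 _ _ t0) _; rewrite lerDr.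
have [C hC] := choice hC'.
pose K := - k + 2 * Kl * Rk; have K0 : 0 <= K by exact: kr_lipC.
pose D n : R := 2 * (d%:R * n%:R); have D0 n : 0 <= D n by rewrite !mulr_ge0.
(* Dominates all quantities that grow with the truncation level n. *)
pose beta n : R := 1 + D n + C n ^+ 2 * D n + C n.
have C0 n : 0 <= C n by case: (hC n).
have AD0 n : 0 <= C n ^+ 2 * D n by apply: mulr_ge0 => //; exact: sqr_ge0.
have b1 n : 1 <= beta n by rewrite /beta -!addrA lerDl !addr_ge0.
have b0 n : 0 < beta n by apply: lt_le_trans (b1 n).
have bC n : C n <= beta n by rewrite /beta lerDr !addr_ge0.
have bD n : D n <= beta n by rewrite /beta -!addrA addrCA lerDl !addr_ge0.
have bAD n : C n ^+ 2 * D n <= beta n by rewrite /beta addrAC lerDr !addr_ge0.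
have K1 : 1 <= 1 + K by rewrite lerDl.
have K1' : 0 < 1 + K by exact: lt_le_trans K1.
(* All three factors are at least 1, so s is below the inverse of each: s beta^3 <= 1/(n+1) makes
   the accumulated error vanish, s <= 1/(1 + K) keeps [rho] monotone, and s <= 1/beta gives s^2 C^2
   <= 1. *)
pose s n : R := (n.+1%:R * (1 + K) * beta n ^+ 3)^-1.
have b3 n : 1 <= beta n ^+ 3 by exact: exprn_ege1.
have b30 n : 0 < beta n ^+ 3 by exact: exprn_gt0.
have s0 n : 0 < s n by rewrite invr_gt0; apply: mulr_gt0 => //; exact: mulr_gt0.
have sle n (u : R) : 0 < u -> u <= n.+1%:R * (1 + K) * beta n ^+ 3 -> s n <= u^-1.
  by move=> u0 ub; rewrite lef_pV2 ?posrE//; apply: mulr_gt0 => //; exact: mulr_gt0.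
have n1 n : 1 <= n.+1%:R :> R by rewrite ler1n.
have s1 n : s n <= n.+1%:R^-1.
  by apply: sle => //; rewrite -mulrA ler_peMr// mulr_ege1.
have sB n : s n <= (beta n)^-1.
  apply: sle => //; apply: (@le_trans _ _ (1 * beta n ^+ 3)).
    by rewrite mul1r -{1}[beta n]expr1 ler_weXn2l.
  by rewrite ler_wpM2r ?(ltW (b30 n))// mulr_ege1.
have sK n : s n <= (1 + K)^-1.
  apply: sle => //; rewrite mulrAC mulrC ler_peMr ?(ltW K1')// mulr_ege1//.
have s11 n : s n <= 1 by apply: le_trans (s1 n) _; rewrite invf_le1.
have s2 n : s n ^+ 2 <= s n by rewrite expr2 ger_pMr.
(* Enough steps of length s^2 to cover the time interval [0, n]. *)
pose N n := (Num.bound (n%:R / s n ^+ 2)).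
apply: (@coupled_solutions R d b bt M kappa Kl k Rk x y bl btl M0 bbt Kl0 k0 Rk0 klip kk mono C beta s N).
- exact: C0.
- by move=> n; case: (hC n).
- by move=> n; case: (hC n).
- by move=> n; case: (hC n).
- by move=> n; case: (hC n).
- exact: b1.
- exact: bD.
- exact: bAD.
- exact: s0.
- exact: s1.
- move=> n; rewrite -/K; apply: (@le_trans _ _ (s n * (1 + K))).
    by apply: ler_pM => //; [exact: sqr_ge0|rewrite lerDr].
  by rewrite -ler_pdivlMr// mul1r.
- move=> n; rewrite /s invfM mulrAC -mulrA mulrC divff ?mul1r ?gt_eqF//.
  by rewrite lef_pV2 ?posrE ?mulr_gt0// ler_peMr.
- move=> n; rewrite -exprMn exprn_ile1//; first by apply: mulr_ge0 => //; exact: ltW.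
  apply: (@le_trans _ _ (s n * beta n)); first by rewrite ler_wpM2l ?(ltW (s0 n)).
  by rewrite -ler_pdivlMr// mul1r.
- move=> n; rewrite mulrC -ler_pdivrMr ?exprn_gt0//; apply: ltW; apply: archi_boundP.
  by rewrite divr_ge0// exprn_ge0// ltW.
Qed.
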